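(* Let $\tau_1,\tau_2$ belong to regular families of meshes with mesh parameters $h_1,h_2$, and let $h=\max\{h_1,h_2\}$. Assume $\mathbf s_i\in[W^{1,\infty}(\Omega_i)]^d$ for $i=1,2$, and, if $n_s>0$, that the matrix $\tilde{\mathbb D}$ defined in the context is nonsingular. Then there exists a constant $C>0$ such that, if $\Delta t\,(h^{-2}+h^{-1})\le C$, the multirate DGiT problem consisting of the equations (S), (V), (T), (F) of the context admits a unique solution.
   Context: Spatial setting. Let $d\in\{2,3\}$, $\Gamma=(0,1)^{d-1}\times\{0\}\subset\mathbb R^d$, $\Omega_1=(0,1)^{d-1}\times(0,1)$, $\Omega_2=(0,1)^{d-1}\times(-1,0)$, $\Gamma_i=\partial\Omega_i\setminus\Gamma$, with unit outward normal $\mathbf n_i$ on $\partial\Omega_i$. For $i=1,2$: $\nu_i>0$ is constant, $\mathbf s_i:\overline{\Omega_i}\to\mathbb R^d$ is a steady advection field with $\mathbf n_i\cdot\mathbf s_i=0$ on $\partial\Omega_i$, $f_i$ is a given forcing on $\Omega_i\times(0,t_f]$, $g_i$ is a given forcing on $\Gamma\times(0,t_f]$ (such that the integrals below make sense), and $b_{i,j}$ are real constants. Let $\tau_i$ be a conforming regular mesh of $\Omega_i$ (triangles or quadrilaterals if $d=2$, tetrahedra or parallelepipeds if $d=3$); the two meshes coincide on $\Gamma$ and induce a partition $\tau_\Gamma$ of $\Gamma$. For a fixed integer $k\ge1$, $U_i$ is the space of continuous functions on $\overline{\Omega_i}$ that are in $\mathbb P_k$ on each cell (tensor-product polynomials on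 quadrilaterals/parallelepipeds) and vanish on $\Gamma_i$; $U_\Gamma$ is the analogous space on $\overline\Gamma$ with respect to $\tau_\Gamma$, vanishing on $\partial\Gamma$ (the trace space of $U_1$ and of $U_2$). Nodal bases are $\{\phi_{i,j}\}_{j=1}^{d_{\Omega_i}}$ and $\{\mu_j\}_{j=1}^{d_\Gamma}$. Write $(v,w)=\int_{\Omega_i}vw\,dx$, $(\mu,\lambda)_\Gamma=\int_\Gamma\mu\lambda\,d\Gamma$ (traces understood), and $L(v,w)=\int_{\Omega_i}\nu_i\nabla v\cdot\nabla w\,dx+\int_{\Omega_i}\nabla\cdot(\mathbf s_iv)\,w\,dx$. Standing assumption: there are positive constants $L_{i,1},L_{i,2}$ with $L_{i,1}\|v\|_{H^1(\Omega_i)}^2\le L(v,v)\le L_{i,2}\|v\|_{H^1(\Omega_i)}^2$ for all $v\in U_i$, $i=1,2$. Time setting. $N\in\mathbb N$, $\Delta t=t_f/N$, $t^{\tilde n}=\tilde n\Delta t$, $I^{\tilde n}=(t^{\tilde n-1},t^{\tilde n})$; $[t^{\tilde n-1},t^{\tilde n}]$ is coupling window $\tilde n$. For $i=1,2$, $M_i\in\mathbb N$, $\Delta t_i=\Delta t/M_i$; on window $\tilde n$, $t_i^n=t^{\tilde n-1}+n\Delta t_i$ and $I_i^n=(t_i^{n-1},t_i^n)$. $\mathcal U_i^n(q)$ is the space of functions $\sum_jv_j(t)\phi_{i,j}(x)$ with $v_j\in\mathbb P_q(I_i^n)$; $\mathcal V^{\tilde n}(r)$ is the space of functions $\sum_j\lambda_j(t)\mu_j(x)$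 with $\lambda_j\in\mathbb P_r(I^{\tilde n})$. Polynomials in time are extended to all of $\mathbb R$ when evaluated outside their interval. Multirate DGiT problem. Parameters: integers $q\ge0$, $0\le n_s\le q+1$, $k_s\ge0$, $r_1,r_2\ge0$, values $-\infty<\theta_1<\dots<\theta_{n_s}\le1$, and an $n_s\times(k_s+1)$ real matrix $\mathbb D$. On window $\tilde n$ the unknowns are $u_i^n\in\mathcal U_i^n(q)$ and side values $U_i^n\in U_i$ (approximating $u_i(t_i^n)$) for $1\le n\le M_i$, and $u_{\Gamma,i}^{\tilde n},F_i^{\tilde n}\in\mathcal V^{\tilde n}(r_i)$, $i=1,2$; $U_i^m$ with $m\le0$ is the side value at time $t_i^m$, known from earlier windows or initialization (in particular $U_i^0$ is the last side value of the previous window, or the given initial side value). All data are given on the initialization windows $1\le\tilde n<N_0$, with $N_0\geq 1$ large enough that every side value needed in (S) is available, and the following equations are to be solved on windows $N_0\le\tilde n\le N$, for $1\le n\le M_i$ and $i=1,2$: (S) $u_i^n(t_i^{n-1}+\theta_k\Delta t_i)=\sum_{l=1}^{k_s+1}(\mathbb D)_{k,l}U_i^{n+1-l}$, $1\le k\le n_s$ (no condition if $n_s=0$); (V) $(U_i^n,v(t_i^n))-\int_{I_i^n}(u_i^n,\dot v)\,dt=(U_i^{n-1},v(t_i^{n-1}))-\int_{I_i^n}\big[L(u_i^n,v)+(F_i^{\tilde n},v)_\Gamma-(f_i,v)\big]dt$ for all $v\in\mathcal U_i^n(q+1-n_s)$; (T) $\int_{I^{\tilde n}}(u_{\Gamma,i}^{\tilde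 n},\lambda)_\Gamma dt=\sum_{n=1}^{M_i}\int_{I_i^n}(u_i^n,\lambda)_\Gamma dt$ for all $\lambda\in\mathcal V^{\tilde n}(r_i)$; (F) $\int_{I^{\tilde n}}(F_i^{\tilde n},\lambda)_\Gamma dt=\int_{I^{\tilde n}}(b_{i,1}u_{\Gamma,1}^{\tilde n}+b_{i,2}u_{\Gamma,2}^{\tilde n}-g_i,\lambda)_\Gamma dt$ for all $\lambda\in\mathcal V^{\tilde n}(r_i)$. The matrix $\tilde{\mathbb D}$. Let $\{\psi_j\}_{j=0}^q$ be polynomials with $\psi_j\in\mathbb P_j(\mathbb R)$ whose restrictions to $[-1,1]$ form an $L^2$-orthogonal basis of $\mathbb P_q[-1,1]$. For $n_s\ge1$, $\tilde{\mathbb D}$ is the $n_s\times n_s$ matrix with entries $(\tilde{\mathbb D})_{j,k}=\psi_{m_k}(2\theta_j-1)$, $m_k=k+q-n_s$, $1\le j,k\le n_s$.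
   Formalization: ''Regular families of meshes'' is taken to mean shape-regular and quasi-uniform (every cell diameter comparable to the mesh parameter); for merely shape-regular meshes with h the largest diameter, no uniform C exists. *)

(* Defs.v *)
From HB Require Import structures.
From mathcomp Require Import all_boot all_order all_algebra.
From mathcomp Require Import all_classical all_reals all_analysis.

Set Implicit Arguments.
Unset Strict Implicit.
Unset Printing Implicit Defensive.

Import Order.TTheory GRing.Theory Num.Theory.
Import numFieldNormedType.Exports.

Local Open Scope classical_set_scope.
Local Open Scope ring_scope.

(** * Lebesgue measure on row vectors

    The library has Lebesgue measure on the line and products of two measures;
    the measure on ['rV[R]_n] is obtained from them by induction on [n]. *)

Definition rv_display : measure_display.
Proof. exact: default_measure_display. Qed.

Section measurable_rV.
Context {R : realType} (n : nat).

Let coords : 'I_n -> 'rV[R]_n -> R := fun j x => x ord0 j.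

Let rV_set0 : g_sigma_preimage coords set0.
Proof. exact: sigma_algebra0. Qed.

Let rV_setC A : g_sigma_preimage coords A -> g_sigma_preimage coords (~` A).
Proof. exact: sigma_algebraC. Qed.

Let rV_bigcup (F : _^nat) : (forall i, g_sigma_preimage coords (F i)) ->
  g_sigma_preimage coords (\bigcup_i (F i)).
Proof. exact: sigma_algebra_bigcup. Qed.

HB.instance Definition _ := @isMeasurable.Build rv_display 'rV[R]_n
  (g_sigma_preimage coords) rV_set0 rV_setC rV_bigcup.

Lemma measurable_coord (j : 'I_n) :
  measurable_fun [set: 'rV[R]_n] (fun x => x ord0 j).
Proof.
move=> _ Y mY; rewrite setTI; apply: sub_sigma_algebra => /=.
rewrite -bigcup_seq/=; exists j => /=; first by rewrite mem_index_enum.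
by exists Y => //; rewrite setTI.
Qed.

End measurable_rV.

Lemma measurable_fun_rV (R : realType) n d (T : measurableType d)
    (f : T -> 'rV[R]_n) :
  (forall j, measurable_fun [set: T] (fun x => f x ord0 j)) ->
  measurable_fun [set: T] f.
Proof.
move=> mf.
have H : g_sigma_preimage (fun (j : 'I_n) x => f x ord0 j) `<=` measurable.
  apply: smallest_sub; first exact: sigma_algebra_measurable.
  case: n f mf => [|m] f mf; first by rewrite big_ord0.
  rewrite -bigcup_mkord_ord; apply: bigcup_sub => i Ii.
  by move=> A [B mB <-]; exact: mf.
move=> _ A mA; rewrite setTI; apply: H.
rewrite (@g_sigma_preimage_comp _ _ n _ (fun j (x : 'rV[R]_n) => x ord0 j)).
by exists A => //; rewrite setTI.
Qed.


Section lebesgue_rV.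
Context {R : realType}.

Definition extend n (y : 'rV[R]_n) (z : R) : 'rV[R]_n.+1 :=
  \row_j (if unlift ord_max j is Some j' then y ord0 j' else z).

Lemma measurable_extend n :
  measurable_fun [set: 'rV[R]_n * R] (fun p => extend p.1 p.2).
Proof.
apply: measurable_fun_rV => j.
under eq_fun do rewrite mxE.
case: unliftP => [j' _|_]; last exact: measurable_snd.
by apply: (measurableT_comp (measurable_coord j')); exact: measurable_fst.
Qed.

Lemma measurable_drop_last n :
  measurable_fun [set: 'rV[R]_n.+1]
    (fun x : 'rV[R]_n.+1 => \row_j x ord0 (lift ord_max j) : 'rV[R]_n).
Proof.
apply: measurable_fun_rV => j.
under eq_fun do rewrite mxE.
exact: measurable_coord.
Qed.

Section step.
Context (n : nat) (mu : {sigma_finite_measure set 'rV[R]_n -> \bar R}).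

Definition leb_step : set 'rV[R]_n.+1 -> \bar R :=
  pushforward (mu \x (@lebesgue_measure R))%E (fun p => extend p.1 p.2).

Let leb_step_measure : {measure set 'rV[R]_n.+1 -> \bar R} :=
  measure_function_pushforward__canonical__measure_function_Measure
    (mu \x (@lebesgue_measure R))%E (@measurable_extend n).

HB.instance Definition _ := isMeasure.Build _ _ _ leb_step
  (measure0 leb_step_measure) (measure_ge0 leb_step_measure)
  (@measure_semi_sigma_additive _ _ _ leb_step_measure).

Let leb_step_sigma_finite : sigma_finite [set: 'rV[R]_n.+1] leb_step.
Proof.
have /sigma_finiteP[F [TF ndF Foo]] := sigma_finiteT mu.
have /sigma_finiteP[G [TG ndG Goo]] := sigma_finiteT (@lebesgue_measure R).
pose split_last (x : 'rV[R]_n.+1) : 'rV[R]_n * R :=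
  (\row_j x ord0 (lift ord_max j), x ord0 ord_max).
have msplit : measurable_fun [set: 'rV[R]_n.+1] split_last.
  apply/measurable_fun_pairP; split => /=.
    exact: measurable_drop_last.
  exact: measurable_coord.
have extendK : cancel (fun p => extend p.1 p.2) split_last.
  move=> [y z]; rewrite /split_last /=; congr pair.
    by apply/rowP => j; rewrite !mxE liftK.
  by rewrite mxE unlift_none.
exists (fun k => split_last @^-1` (F k `*` G k)).
  apply/esym; rewrite -subTset => x _.
  have [k1 _ F1] : (\bigcup_k F k) (split_last x).1 by rewrite -TF.
  have [k2 _ G2] : (\bigcup_k G k) (split_last x).2 by rewrite -TG.
  exists (maxn k1 k2) => //; split.
    by move: (split_last x).1 F1; exact/subsetPset/ndF/leq_maxl.
  by move: (split_last x).2 G2; exact/subsetPset/ndG/leq_maxr.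
move=> k; have [mF Fk] := Foo k; have [mG Gk] := Goo k; split.
  by rewrite -[X in measurable X]setTI; apply: msplit => //; exact: measurableX.
rewrite /leb_step /pushforward -comp_preimage.
have -> : split_last \o (fun p => extend p.1 p.2) = id.
  by apply/funext => p; exact: extendK.
rewrite preimage_id.
by rewrite product_measure1E// lte_mul_pinfty// ge0_fin_numE.
Qed.

HB.instance Definition _ := Measure_isSigmaFinite.Build _ _ _ leb_step
  leb_step_sigma_finite.

End step.

Fixpoint lebesgue_rV n : {sigma_finite_measure set 'rV[R]_n -> \bar R} :=
  match n with
  | 0 => \d_(0 : 'rV[R]_0)
  | m.+1 => leb_step (lebesgue_rV m)
  end.

End lebesgue_rV.

(** * Differential operators and Sobolev notions on subsets of [R^d] *)

Section sobolev.
Context {R : realType} (d : nat).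
Local Notation pt := 'rV[R]_d.
Implicit Types (A : set pt) (f g v w phi : pt -> R).

Definition dot (x y : pt) : R := \sum_j x ord0 j * y ord0 j.

(* The norm [`|x|] of the library is the sup norm. *)
Definition enorm (x : pt) : R := Num.sqrt (dot x x).

Definition pd (j : 'I_d) f : pt -> R := fun x => 'D_(delta_mx ord0 j) f x.

Definition inner A f g : R := \int[lebesgue_rV d]_(x in A) (f x * g x).

Definition test_function A phi :=
  (forall (s : seq 'I_d) x, differentiable (foldr pd phi s) x) /\
  exists K : set pt, [/\ compact K, K `<=` A & forall x, ~ K x -> phi x = 0].

Definition Linf A f := measurable_fun A f /\
  exists B : R, {ae lebesgue_rV d, forall x, A x -> `|f x| <= B}.

Definition weak_partial A (j : 'I_d) f g :=
  forall phi, test_function A phi -> inner A f (pd j phi) = - inner A g phi.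

Definition W1inf A f := Linf A f /\
  forall j, exists g, Linf A g /\ weak_partial A j f g.

(* The weak derivative of [f] in [W^{1,oo}(A)], determined up to a null set;
   here a representative is selected. *)
Definition wpd A (j : 'I_d) f : pt -> R :=
  xget (fun=> 0) [set g | Linf A g /\ weak_partial A j f g].

(* [grad v . grad w], [div (s v)] and the H^1 norm are only used for finite
   element functions [v], [w]; these are continuous and piecewise smooth, so
   that their pointwise partial derivatives exist off the cell boundaries (a
   null set) and are their weak derivatives. *)
Definition grad_dot v w : pt -> R := fun x => \sum_j pd j v x * pd j w x.

(* [div (s v)] for [s] in [W^{1,oo}(A)^d]: the weak derivative of the product
   of [s j] with a continuous piecewise smooth [v], by the Leibniz rule. *)
Definition div_mul A (s : pt -> pt) v : pt -> R := fun x =>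
  \sum_j (wpd A j (fun y => s y ord0 j) x * v x + s x ord0 j * pd j v x).

Definition H1normsq A v : R :=
  inner A v v + \int[lebesgue_rV d]_(x in A) grad_dot v v x.

(* The bilinear form L of the advection-diffusion operator. *)
Definition Lform (nu : R) A (s : pt -> pt) v w : R :=
  nu * \int[lebesgue_rV d]_(x in A) grad_dot v w x + inner A (div_mul A s v) w.

(* [e] is the unit outward normal of [A] at the (smooth) boundary point [x]:
   near [x] the closure of a polyhedral [A] is a half space. *)
Definition outward_normal A (x e : pt) :=
  enorm e = 1 /\
  \forall y \near x, closure A y <-> dot e (y - x) <= 0.

Definition bdry A : set pt := closure A `\` interior A.

Definition diam A : R :=
  sup [set r | exists x y, [/\ A x, A y & r = enorm (x - y)]].

(* The diameter of the largest ball contained in [A]. *)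
Definition inball_diam A : R :=
  sup [set r | 0 <= r /\ exists c, [set x | enorm (x - c) <= r / 2] `<=` A].

Definition is_convex A := forall x y (t : R),
  A x -> A y -> 0 <= t -> t <= 1 -> A (t *: x + (1 - t) *: y).

(* Faces of a convex set: vertices, edges, ..., the set itself, and the empty
   set. *)
Definition is_face A (F : set pt) := [/\ F `<=` A, is_convex F &
  forall x y (t : R), A x -> A y -> 0 < t -> t < 1 ->
    F (t *: x + (1 - t) *: y) -> F x /\ F y].

End sobolev.

(** * Meshes and finite element spaces *)

Section meshes.
Context {R : realType} (m : nat).
Local Notation pt := 'rV[R]_m.

(* A cell is given by its vertices, the vertices of a [Cube] being indexed by
   those of the unit cube. A well-formed [Cube] is a segment if m = 1, a convex
   quadrilateral if m = 2 and a parallelepiped if m >= 3. *)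
Inductive cell :=
| Simplex of ('I_m.+1 -> pt)
| Cube of ({ffun 'I_m -> bool} -> pt).

Definition is_simplex (K : cell) : bool := if K is Simplex _ then true else false.

Definition ref_cell (K : cell) : set pt :=
  match K with
  | Simplex _ => [set x | (forall j, 0 <= x ord0 j) /\ \sum_j x ord0 j <= 1]
  | Cube _ => [set x | forall j, 0 <= x ord0 j <= 1]
  end.

(* The affine, respectively multilinear, map from the reference cell. *)
Definition cell_map (K : cell) (x : pt) : pt :=
  match K with
  | Simplex v => v ord0 + \sum_j x ord0 j *: (v (lift ord0 j) - v ord0)
  | Cube v => \sum_(a : {ffun 'I_m -> bool})
      (\prod_j (if a j then x ord0 j else 1 - x ord0 j)) *: v a
  end.

Definition carrier (K : cell) : set pt := cell_map K @` ref_cell K.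

Definition is_parallelepiped (v : {ffun 'I_m -> bool} -> pt) :=
  let v0 := v [ffun=> false] in
  forall a, v a = v0 + \sum_(j | a j) (v [ffun l => l == j] - v0).

Definition cell_wf (K : cell) : Prop :=
  [/\ {in ref_cell K &, injective (cell_map K)},
      is_convex (carrier K) &
      if K is Cube v then (2 < m)%N -> is_parallelepiped v else True].

(* Polynomials on the reference cell: total degree at most [k] on a simplex,
   degree at most [k] in each variable on a cube. *)
Definition ref_poly (k : nat) (K : cell) (p : pt -> R) :=
  exists c : {ffun 'I_m -> 'I_k.+1} -> R, forall x, p x =
    \sum_(al : {ffun 'I_m -> 'I_k.+1} | is_simplex K ==> (\sum_j al j <= k)%N)
      c al * \prod_j x ord0 j ^+ al j.

Record mesh := Mesh { ncells : nat; cell_of :> 'I_ncells -> cell }.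

Definition conforming_mesh (D : set pt) (tau : mesh) := [/\
  forall K, cell_wf (tau K),
  (forall K, is_simplex (tau K)) \/ (forall K, ~~ is_simplex (tau K)),
  D = \bigcup_K carrier (tau K) &
  forall K K', K != K' -> [/\
    interior (carrier (tau K)) `&` interior (carrier (tau K')) = set0,
    is_face (carrier (tau K)) (carrier (tau K) `&` carrier (tau K')) &
    is_face (carrier (tau K')) (carrier (tau K) `&` carrier (tau K'))]].

Definition meshsize (tau : mesh) : R :=
  \big[Num.max/0]_K diam (carrier (tau K)).

(* The simplex spanned by the vertex [a] of a cube and its [m] neighbours. *)
Definition corner (v : {ffun 'I_m -> bool} -> pt) (a : {ffun 'I_m -> bool}) :=
  Simplex (fun i => if unlift ord0 i is Some j
    then v [ffun l => if l == j then ~~ a l else a l] else v a).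

(* Shape regularity; for quadrilaterals the inscribed balls are those of the
   four triangles spanned by vertices, which also keeps the angles away from
   [pi]. *)
Definition shape_regular (sigma : R) (K : cell) : Prop :=
  match K with
  | Simplex _ => diam (carrier K) <= sigma * inball_diam (carrier K)
  | Cube v => forall a,
      diam (carrier K) <= sigma * inball_diam (carrier (corner v a))
  end.

(* The regular family of meshes with constant [sigma]: shape regular, and with
   all cells of a size comparable to the mesh parameter, so that inverse
   inequalities hold with powers of the mesh parameter. *)
Definition regular_mesh (sigma : R) (tau : mesh) := forall K,
  shape_regular sigma (tau K) /\
  meshsize tau <= sigma * diam (carrier (tau K)).

(* Continuous functions on [D], the union of the cells, that are (mapped)
   polynomials on each cell and vanish on [Z]. A function on [D] is encoded as
   a function on the whole space that vanishes off [D]. *)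
Definition fe_space (k : nat) (tau : mesh) (Z : set pt) : set (pt -> R) :=
  let D := \bigcup_K carrier (tau K) in
  [set v | [/\ {within D, continuous v},
    forall K, exists p, ref_poly k (tau K) p /\
      forall x, ref_cell (tau K) x -> v (cell_map (tau K) x) = p x,
    forall x, Z x -> v x = 0 &
    forall x, ~ D x -> v x = 0]].

(* Polynomials in time of degree at most [q] with coefficients in [S], on the
   whole time axis. *)
Definition time_poly (q : nat) (S : set (pt -> R)) : set (R -> pt -> R) :=
  [set u | exists N (p : 'I_N -> {poly R}) (phi : 'I_N -> pt -> R),
    (forall l, (size (p l) <= q.+1)%N /\ S (phi l)) /\
    u = fun t x => \sum_l (p l).[t] * phi l x].

End meshes.

(** * The spatial setting *)

Section domains.
Context {R : realType} (n : nat).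

(* The dimension d is [n.+1]; side [ord0 : 'I_2] is Omega_1 (above Gamma) and
   the other one is Omega_2 (below Gamma). *)
Definition Omega (i : 'I_2) : set 'rV[R]_n.+1 :=
  [set x | (forall j, j != ord_max -> 0 < x ord0 j < 1) /\
    if i == ord0 then 0 < x ord0 ord_max < 1 else -1 < x ord0 ord_max < 0].

(* Gamma as a subset of [R^(d-1)]. *)
Definition Gam : set 'rV[R]_n := [set y | forall j, 0 < y ord0 j < 1].

Definition on_interface (y : 'rV[R]_n) : 'rV[R]_n.+1 := extend y 0.

Definition outer_boundary (i : 'I_2) : set 'rV[R]_n.+1 :=
  bdry (Omega i) `\` (on_interface @` Gam).

Definition trace (v : 'rV[R]_n.+1 -> R) : 'rV[R]_n -> R := v \o on_interface.

(* The cells of [tauG] are the facets on Gamma of the cells of [tau]. *)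
Definition induces (tau : mesh n.+1) (tauG : @mesh R n) :=
  forall A : set 'rV[R]_n,
    (exists K, A = carrier (tauG K)) <->
    (exists K, A = on_interface @^-1` carrier (tau K) /\ interior A !=set0).

Definition U_space k (tau : mesh n.+1) (i : 'I_2) :=
  fe_space k tau (outer_boundary i).

Definition UG_space k (tauG : mesh n) := fe_space k tauG (bdry Gam).

End domains.
Arguments Omega {R n} i.
Arguments Gam {R n}.

(* The integrals of [(f(t), v)_A] against polynomials in t over subintervals of
   (0, tf] make sense for all [v] in [S]. *)
Definition admissible_data {R : realType} d (A : set 'rV[R]_d) (tf : R)
    (S : set ('rV[R]_d -> R)) (f : R -> 'rV[R]_d -> R) :=
  forall v, S v ->
    {ae @lebesgue_measure R, forall t, 0 < t <= tf ->
      (lebesgue_rV d).-integrable A (fun x => (f t x * v x)%:E)} /\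
    (@lebesgue_measure R).-integrable `]0, tf]
      (fun t => (inner A (f t) v)%:E).

(** * The multirate problem *)

(* [psi 0, ..., psi q] form an L^2(-1,1)-orthogonal basis of P_q, and
   [psi j] has degree at most j. *)
Definition orthogonal_basis {R : realType} (q : nat) (psi : nat -> {poly R}) :=
  [/\ forall j, (j <= q)%N -> (size (psi j) <= j.+1)%N,
      forall j l, (j <= q)%N -> (l <= q)%N -> j != l ->
        \int[@lebesgue_measure R]_(x in `[-1, 1]) ((psi j).[x] * (psi l).[x]) = 0
    & forall p : {poly R}, (size p <= q.+1)%N ->
        exists! c : 'rV[R]_q.+1, p = \sum_j c ord0 j *: psi j].

(* Rows and columns are numbered from 0, so that column k has m_k = (k+1)+q-ns,
   which is nonnegative for ns <= q+1. *)
Definition Dtilde {R : realType} (q ns : nat) (psi : nat -> {poly R})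
    (theta : 'I_ns -> R) : 'M[R]_ns :=
  \matrix_(j, k) (psi (k + q.+1 - ns)%N).[2 * theta j - 1].

(* The coefficients of the problem that do not depend on the meshes or on the
   time windows. *)
Record dgit_params (R : realType) (n : nat) := DGiTParams {
  nu : 'I_2 -> R;
  adv : 'I_2 -> 'rV[R]_n.+1 -> 'rV[R]_n.+1;
  bcoef : 'I_2 -> 'I_2 -> R;
  kdeg : nat;
  qdeg : nat;
  ns : nat;
  ks : nat;
  rdeg : 'I_2 -> nat;
  theta : 'I_ns -> R;
  Dmat : 'M[R]_(ns, ks.+1);
  Msub : 'I_2 -> nat
}.
Arguments theta {R n} d : rename.
Arguments Dmat {R n} d : rename.

(* Component functions of a (candidate) solution. Windows [w] and steps [l]
   within a window are numbered from 1; side values are numbered globally, the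
   side value number [j] of side [i] being that at time j * dt / M_i. *)
Record dgit_fun (R : realType) (n : nat) := DGiTFun {
  sol_u : 'I_2 -> nat -> nat -> R -> 'rV[R]_n.+1 -> R;
  sol_U : 'I_2 -> nat -> 'rV[R]_n.+1 -> R;
  sol_uG : 'I_2 -> nat -> R -> 'rV[R]_n -> R;
  sol_F : 'I_2 -> nat -> R -> 'rV[R]_n -> R
}.

Section problem.
Context {R : realType} {n : nat} (P : dgit_params R n).
Context (tau : 'I_2 -> @mesh R n.+1) (tauG : @mesh R n).
Context (dt : R) (N0 N : nat).
Context (f : 'I_2 -> R -> 'rV[R]_n.+1 -> R) (g : 'I_2 -> R -> 'rV[R]_n -> R).
(* The given side values, used for the numbers 0, ..., (N0 - 1) * M_i. *)
Context (Uinit : 'I_2 -> nat -> 'rV[R]_n.+1 -> R).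

Local Notation leb := (@lebesgue_measure R).

Definition wtime (w : nat) : R := w%:R * dt.
Definition dti (i : 'I_2) : R := dt / (Msub P i)%:R.
Definition stime (i : 'I_2) (w l : nat) : R := wtime w.-1 + l%:R * dti i.
Definition gidx (i : 'I_2) (w l : nat) : nat := (w.-1 * Msub P i + l)%N.

Definition Iwin (w : nat) : set R := `]wtime w.-1, wtime w[%classic.
Definition Isub (i : 'I_2) (w l : nat) : set R :=
  `]stime i w l.-1, stime i w l[%classic.

Definition eq_S (z : dgit_fun R n) (i : 'I_2) (w l : nat) :=
  forall k : 'I_(ns P), forall x,
    sol_u z i w l (stime i w l.-1 + theta P k * dti i) x =
    \sum_(c < (ks P).+1) Dmat P k c * sol_U z i (gidx i w l - c) x.

Definition eq_V (z : dgit_fun R n) (i : 'I_2) (w l : nat) :=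
  forall v, time_poly ((qdeg P).+1 - ns P) (U_space (kdeg P) (tau i) i) v ->
    inner (Omega i) (sol_U z i (gidx i w l)) (v (stime i w l))
    - \int[leb]_(t in Isub i w l)
        inner (Omega i) (sol_u z i w l t) (fun x => derive1 (v ^~ x) t)
    = inner (Omega i) (sol_U z i (gidx i w l.-1)) (v (stime i w l.-1))
    - \int[leb]_(t in Isub i w l)
        (Lform (nu P i) (Omega i) (adv P i) (sol_u z i w l t) (v t)
         + inner Gam (sol_F z i w t) (trace (v t))
         - inner (Omega i) (f i t) (v t)).

Definition eq_T (z : dgit_fun R n) (i : 'I_2) (w : nat) :=
  forall lam, time_poly (rdeg P i) (UG_space (kdeg P) tauG) lam ->
    \int[leb]_(t in Iwin w) inner Gam (sol_uG z i w t) (lam t)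
    = \sum_(1 <= l < (Msub P i).+1)
        \int[leb]_(t in Isub i w l) inner Gam (trace (sol_u z i w l t)) (lam t).

Definition eq_F (z : dgit_fun R n) (i : 'I_2) (w : nat) :=
  forall lam, time_poly (rdeg P i) (UG_space (kdeg P) tauG) lam ->
    \int[leb]_(t in Iwin w) inner Gam (sol_F z i w t) (lam t)
    = \int[leb]_(t in Iwin w)
        inner Gam (fun y => \sum_j bcoef P i j * sol_uG z j w t y - g i t y)
          (lam t).

Definition dgit_solution (z : dgit_fun R n) :=
  (forall i j, (j <= N0.-1 * Msub P i)%N -> sol_U z i j = Uinit i j) /\
  forall w i, (N0 <= w <= N)%N ->
    [/\ time_poly (rdeg P i) (UG_space (kdeg P) tauG) (sol_uG z i w),
        time_poly (rdeg P i) (UG_space (kdeg P) tauG) (sol_F z i w),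
        eq_T z i w, eq_F z i w &
        forall l, (1 <= l <= Msub P i)%N ->
          [/\ time_poly (qdeg P) (U_space (kdeg P) (tau i) i) (sol_u z i w l),
              U_space (kdeg P) (tau i) i (sol_U z i (gidx i w l)),
              eq_S z i w l & eq_V z i w l]].

(* Equality of the unknowns of the windows N0, ..., N. *)
Definition same_solution (z z' : dgit_fun R n) :=
  forall w i, (N0 <= w <= N)%N ->
    [/\ sol_uG z i w = sol_uG z' i w, sol_F z i w = sol_F z' i w &
        forall l, (1 <= l <= Msub P i)%N ->
          sol_u z i w l = sol_u z' i w l /\
          sol_U z i (gidx i w l) = sol_U z' i (gidx i w l)].

Definition uniquely_solvable :=
  exists z, dgit_solution z /\
    forall z', dgit_solution z' -> same_solution z z'.

End problem.

(* Main.v *)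
Require Import Defs.
From HB Require Import structures.
From mathcomp Require Import all_boot all_order all_algebra.
From mathcomp Require Import all_classical all_reals all_analysis.
From mathcomp Require Import measurable_realfun ring lra.

Set Implicit Arguments.
Unset Strict Implicit.
Unset Printing Implicit Defensive.

Import Order.TTheory GRing.Theory Num.Theory.
Import numFieldNormedType.Exports.

Local Open Scope classical_set_scope.
Local Open Scope ring_scope.

(* In bases of the discrete spaces that are orthonormal in L^2, the equations of
   one coupling window are a square linear system, so that it suffices to show
   that the homogeneous system with vanishing initial side values has only the
   zero solution. On a substep, (V) differs from the pure time discretization by
   terms of size [dt * ||L||] and by the interface flux. A polynomial in time of
   degree [q] is determined by its moments up to degree [q - n_s] together with
   its values at the [theta_k]: the polynomials orthogonal to [P_(q - n_s)] are
   spanned by the last [n_s] basis polynomials, on which evaluation at the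
   [theta_k] is the matrix [Dtilde]. Inverse estimates give
   [||L|| <= C h^-2] and [||trace||^2 <= C h^-1], and the trace enters once
   through (T) and once through (V); so the perturbation is of size
   [dt (h^-2 + h^-1)].

   The inverse estimates are local: on each cell [v] is the image of a
   polynomial on the reference cell, which its values at finitely many nodes
   bound together with its derivatives, and the cell map expands distances at
   least by a multiple of the mesh parameter. For quadrilaterals this holds
   because the Jacobian determinant is affine and, by injectivity, does not
   change sign, so that the corner triangles bound it from below. The mesh
   parameters of the two sides are comparable since both meshes share the
   partition of the interface. *)

(** * Linear algebra *)

Section linear_algebra.

(** The constant must not depend on the meshes or on [dt]. Time is measured relative to each
    substep, so the inverse of the moment and point-value problem depends only on [q], [ns] and the
    [theta_k], and the matrix of the time derivative has no factor [dt] at all. The interface flux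
    contributes [sqrt (dt Ct)] in each of (T) and (V), with [Ct] of order [h^-1]; only the product
    of these two factors enters. The lower-order terms of [L] are absorbed into [h^-2], because a
    mesh parameter is bounded by the size of the subdomains. An obstacle of a different kind is that
    gradients and weak derivatives are pointwise expressions with no guarantee at cell boundaries or
    on null sets. Off a null set they are replaced by bounded measurable functions, on which all
    forms are bilinear. This requires that cell boundaries be null and that finite element functions
    be differentiable inside the cells; both are proved from the secants of the cell maps. *)

Lemma injective_linear_surjective (R : fieldType) (K : finType)
    (G : (K -> R) -> K -> R) :
  (forall a c c' k, G (fun j => a * c j + c' j) k = a * G c k + G c' k) ->
  (forall c, (forall k, G c k = 0) -> forall k, c k = 0) ->
  forall y, exists c, forall k, G c k = y k.
Proof.
move=> Glin Ginj.
pose vec (r : 'rV[R]_#|K|) : K -> R := fun k => r ord0 (enum_rank k).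
(* The matrix of [G] in the basis of indicators, acting on row vectors. It is square, so a trivial
   kernel makes it row free and hence row full. *)
pose A : 'M[R]_#|K| :=
  \matrix_(i, j) G (fun k => (enum_rank k == i)%:R) (enum_val j).
have G0 k : G (fun=> 0) k = 0.
  have := Glin (-1) (fun=> 0) (fun=> 0) k.
  rewrite (_ : (fun _ : K => -1 * 0 + 0) = (fun=> 0)); last first.
    by apply/funext => j; rewrite mulr0 addr0.
  by rewrite mulN1r addNr.
have Gsum (s : seq 'I_#|K|) (a : 'I_#|K| -> R) (f : 'I_#|K| -> K -> R) k :
    G (fun j => \sum_(i <- s) a i * f i j) k = \sum_(i <- s) a i * G (f i) k.
  elim: s => [|i s IH].
    by rewrite big_nil -[RHS](G0 k); congr G; apply/funext => j; rewrite big_nil.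
  rewrite big_cons -IH -Glin; congr G; apply/funext => j.
  by rewrite big_cons.
have GA r k : G (vec r) k = (r *m A) ord0 (enum_rank k).
  have -> : vec r = fun j => \sum_i r ord0 i * (enum_rank j == i)%:R.
    apply/funext => j; rewrite (bigD1 (enum_rank j))//= eqxx mulr1 big1 ?addr0//.
    by move=> i /negPf ni; rewrite eq_sym ni mulr0.
  rewrite Gsum mxE; apply: eq_bigr => i _; rewrite mxE enum_rankK.
  by congr (_ * G _ k); apply/funext => j.
have Afree : row_free A.
  rewrite -kermx_eq0; apply/eqP/row_matrixP => i; rewrite row0.
  have kA : row i (kermx A) *m A = 0 by apply/sub_kermxP; exact: row_sub.
  have H := Ginj (vec (row i (kermx A))).
  apply/rowP => j; rewrite [RHS]mxE.
  rewrite -(enum_valK j); apply: H => k.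
  by rewrite GA kA mxE.
move=> y; pose r : 'rV[R]_#|K| := \row_j y (enum_val j).
have /submxP[s rs] : (r <= A)%MS by apply: submx_full; rewrite row_full_unit -row_free_unit.
exists (vec s) => k; rewrite GA -rs mxE enum_rankK//.
Qed.

Context {R : realType}.

Definition dotf (I : finType) (x y : I -> R) : R := \sum_i x i * y i.
Definition nrm (I : finType) (x : I -> R) : R := Num.sqrt (dotf x x).

Lemma dotf_ge0 (I : finType) (x : I -> R) : 0 <= dotf x x.
Proof. by apply: sumr_ge0 => i _; rewrite -expr2 sqr_ge0. Qed.

Lemma nrm_ge0 (I : finType) (x : I -> R) : 0 <= nrm x.
Proof. exact: sqrtr_ge0. Qed.

Lemma sqr_nrm (I : finType) (x : I -> R) : nrm x ^+ 2 = dotf x x.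
Proof. by rewrite sqr_sqrtr// dotf_ge0. Qed.

Lemma nrm_eq0 (I : finType) (x : I -> R) : nrm x = 0 -> forall i, x i = 0.
Proof.
move=> x0 i; have : dotf x x = 0 by rewrite -sqr_nrm x0 expr0n.
move/eqP; rewrite psumr_eq0 => [/allP/(_ i)|j _]; last by rewrite -expr2 sqr_ge0.
by rewrite mem_index_enum => /(_ isT); rewrite -expr2 sqrf_eq0 => /eqP.
Qed.

(** The last step whenever an unknown is bounded by testing its own equation with itself; the case
    of norm 0 needs no division. *)
Lemma ler_dual (I : finType) (x : I -> R) (c : R) : 0 <= c ->
  (dotf x x <= c * nrm x) -> nrm x <= c.
Proof.
move=> c0; rewrite -sqr_nrm expr2.
have := nrm_ge0 x; rewrite le_eqVlt => /predU1P[<-//|x0].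
by rewrite ler_pM2r.
Qed.

(** Semidefinite and bilinear on [S] only: it serves L^2 products of functions rather than of
    classes, and their integrals in time. *)
Lemma psd_cauchy_schwarz (V : lmodType R) (S : set V) (B : V -> V -> R) :
  (forall a u v, S u -> S v -> S (a *: u + v)) ->
  (forall a u v w, S u -> S v -> S w -> B (a *: u + v) w = a * B u w + B v w) ->
  (forall u v, S u -> S v -> B u v = B v u) ->
  (forall u, S u -> 0 <= B u u) ->
  forall u v, S u -> S v -> B u v ^+ 2 <= B u u * B v v.
Proof.
move=> hS hlin hsym hpos u v Su Sv.
have H t : 0 <= t ^+ 2 * B u u + 2 * t * B u v + B v v.
  have Stuv : S (t *: u + v) by exact: hS.
  have := hpos _ Stuv; rewrite hlin// [B u _]hsym// hlin// [B v (_ + _)]hsym//.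
  rewrite hlin// [B v u]hsym// => /le_trans; apply.
  by rewrite le_eqVlt; apply/orP; left; apply/eqP; ring.
have := hpos _ Su; rewrite le_eqVlt => /predU1P[u0|u0].
  rewrite -u0 mul0r; have := H (- (B v v + 1) / 2 * (B u v)).
  have := H 0; rewrite -u0; move=> h0 h1.
  have [->|b0] := eqVneq (B u v) 0; first by rewrite expr0n.
  (* With [B u u = 0] the quadratic is affine in [t], and at this [t] it equals -1. *)
  have := H (- (B v v + 1) / (2 * B u v)); rewrite -u0 mulr0 add0r.
  rewrite (_ : 2 * _ * _ = - (B v v + 1)); last by field.
  lra.
have := H (- B u v / B u u).
rewrite (_ : _ + _ = B v v - B u v ^+ 2 / B u u); last by field; rewrite gt_eqF.
by rewrite subr_ge0 ler_pdivrMr// mulrC.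
Qed.

Lemma dotf_cauchy_schwarz (I : finType) (x y : I -> R) :
  `|dotf x y| <= nrm x * nrm y.
Proof.
rewrite -(@ler_pXn2r _ 2)// ?nnegrE ?mulr_ge0 ?nrm_ge0//.
rewrite real_normK ?num_real// exprMn !sqr_nrm.
apply: (@psd_cauchy_schwarz (I -> R) setT (@dotf I)) => //.
- move=> a u v w _ _ _; rewrite /dotf mulr_sumr -big_split/=.
  by apply: eq_bigr => i _; rewrite mulrDl mulrA.
- by move=> u v _ _; apply: eq_bigr => i _; rewrite mulrC.
- by move=> u _; exact: dotf_ge0.
Qed.

Lemma nrmD (I : finType) (x y : I -> R) : nrm (fun i => x i + y i) <= nrm x + nrm y.
Proof.
rewrite -(@ler_pXn2r _ 2)// ?nnegrE ?addr_ge0 ?nrm_ge0//.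
rewrite sqr_nrm sqrrD !sqr_nrm.
have -> : dotf (fun i => x i + y i) (fun i => x i + y i) =
    dotf x x + (dotf x y *+ 2) + dotf y y.
  rewrite /dotf -sumrMnl -!big_split/=; apply: eq_bigr => i _.
  by ring.
rewrite lerD2r lerD2l lerMn2r; apply/orP; right.
exact: le_trans (ler_norm _) (dotf_cauchy_schwarz _ _).
Qed.

Lemma nrmZ (I : finType) (a : R) (x : I -> R) : nrm (fun i => a * x i) = `|a| * nrm x.
Proof.
rewrite /nrm (_ : dotf _ _ = a ^+ 2 * dotf x x); last first.
  by rewrite /dotf mulr_sumr; apply: eq_bigr => i _; ring.
by rewrite sqrtrM ?sqr_ge0// sqrtr_sqr.
Qed.

Lemma nrm0 (I : finType) : nrm (fun _ : I => 0) = 0.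
Proof. by rewrite /nrm /dotf big1 ?sqrtr0// => i _; rewrite mulr0. Qed.

Lemma nrm_sum (I : finType) (J : Type) (s : seq J) (x : J -> I -> R) :
  nrm (fun i => \sum_(j <- s) x j i) <= \sum_(j <- s) nrm (x j).
Proof.
elim: s => [|j s IH].
  rewrite big_nil (_ : (fun i => _) = fun=> 0) ?nrm0//.
  by apply/funext => i; rewrite big_nil.
rewrite big_cons (_ : (fun i => _) = fun i => x j i + \sum_(j <- s) x j i).
  exact: le_trans (nrmD _ _) (lerD (lexx _) IH).
by apply/funext => i; rewrite big_cons.
Qed.

(* An orthonormal family of maximal length is a basis; the length is bounded
   because [ev] maps the family to independent rows. *)
Lemma orthonormal_basis (V : lmodType R) (S : set V) (B : V -> V -> R)
    (N : nat) (ev : V -> 'I_N -> R) :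
  S 0 ->
  (forall a u v, S u -> S v -> S (a *: u + v)) ->
  (forall a u v w, S u -> S v -> S w -> B (a *: u + v) w = a * B u w + B v w) ->
  (forall u v, S u -> S v -> B u v = B v u) ->
  (forall u, S u -> u != 0 -> 0 < B u u) ->
  (forall a u v k, S u -> S v -> ev (a *: u + v) k = a * ev u k + ev v k) ->
  (forall u, S u -> (forall k, ev u k = 0) -> u = 0) ->
  exists D (e : 'I_D -> V), [/\ forall m, S (e m),
    forall m m', B (e m) (e m') = (m == m')%:R &
    forall v, S v -> v = \sum_m B v (e m) *: e m].
Proof.
move=> S0 hS hlin hsym hpos evlin evinj.
have Ssum n (c : 'I_n -> R) (e : 'I_n -> V) : (forall m, S (e m)) ->
    S (\sum_m c m *: e m).
  move=> Se; elim/big_ind : _ => //; last first.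
    by move=> m _; rewrite -[_ *: _]addr0; apply: hS.
  by move=> x y Sx Sy; rewrite -[x]scale1r; exact: hS.
have B0 w : S w -> B 0 w = 0.
  move=> Sw; have := hlin (-1) 0 0 w S0 S0 Sw.
  by rewrite scaler0 add0r mulN1r addNr.
have Bsum n (c : 'I_n -> R) (e : 'I_n -> V) w : (forall m, S (e m)) -> S w ->
    B (\sum_m c m *: e m) w = \sum_m c m * B (e m) w.
  elim: n c e => [|n IH] c e Se Sw; first by rewrite !big_ord0 B0.
  by rewrite !big_ord_recl hlin ?IH//; apply: Ssum.
pose ortho D := exists e : 'I_D -> V, (forall m, S (e m)) /\
  forall m m', B (e m) (e m') = (m == m')%:R.
have ortho_le D : ortho D -> (D <= N)%N.
  move=> [e [Se oe]].
  pose A : 'M[R]_(D, N) := \matrix_(m, k) ev (e m) k.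
  suff : row_free A by move=> /eqP <-; exact: rank_leq_col.
  rewrite -kermx_eq0; apply/eqP/row_matrixP => i; rewrite row0.
  have kA : row i (kermx A) *m A = 0 by apply/sub_kermxP; exact: row_sub.
  (* A relation [r] between the rows makes all evaluations of [v] vanish, so [v = 0], and pairing
     with [e m] gives [r m = 0]. *)
  set r := row i _ in kA *; pose v := \sum_m r ord0 m *: e m.
  have evsum n (c : 'I_n -> R) (e' : 'I_n -> V) k : (forall m, S (e' m)) ->
      ev (\sum_m c m *: e' m) k = \sum_m c m * ev (e' m) k.
    elim: n c e' => [|n IH] c e' Se'.
      rewrite !big_ord0; have := evlin (-1) 0 0 k S0 S0.
      by rewrite scaler0 add0r mulN1r addNr.
    by rewrite !big_ord_recl evlin ?IH//; apply: Ssum.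
  have v0 : v = 0.
    apply: evinj => [|k]; first exact: Ssum.
    rewrite evsum//; have := congr1 (fun M : 'rV_N => M ord0 k) kA.
    by rewrite mxE [RHS]mxE => H; rewrite -[RHS]H; apply: eq_bigr => m _; rewrite [A _ _]mxE.
  apply/rowP => m; have := Bsum _ (r ord0) e (e m) Se (Se m).
  rewrite -/v v0 B0// (bigD1 m)//= oe eqxx mulr1 big1 => [|m' /negPf m'm]; last by rewrite oe m'm mulr0.
  by rewrite addr0 => /esym ->; rewrite [RHS]mxE.
have : exists D, `[< ortho D >].
  by exists 0%N; apply/asboolP; exists (fun=> 0); split; case.
move=> exD; have ubD D : `[< ortho D >] -> (D <= N)%N by move=> /asboolP/ortho_le.
have [D /asboolP[e [Se oe]] Dmax] := ex_maxnP exD ubD.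
exists D, e; split => // v Sv; apply/eqP; rewrite eq_sym -subr_eq0; apply/eqP.
(* The expansion error up to sign. It is orthogonal to the family, so if nonzero its normalization
   would lengthen the family. *)
set w := _ - v.
have Sw : S w.
  rewrite /w addrC -scaleN1r; apply: hS => //; exact: Ssum.
apply: contrapT => /eqP w0.
have wo m : B w (e m) = 0.
  rewrite /w addrC -scaleN1r hlin//; last exact: Ssum.
  rewrite Bsum// (bigD1 m)//= oe eqxx big1 => [|m' /negPf m'm]; last by rewrite oe m'm mulr0.
  by rewrite addr0 mulr1 mulN1r addNr.
have Bw := hpos _ Sw w0.
pose s := (Num.sqrt (B w w))^-1.
pose e' (m : 'I_D.+1) := if unlift ord_max m is Some m' then e m' else s *: w.
have Ssw : S (s *: w) by rewrite -[_ *: _]addr0; exact: hS.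
have hZ a x y : S x -> S y -> B (a *: x) y = a * B x y.
  by move=> Sx Sy; rewrite -[_ *: _]addr0 hlin// B0// addr0.
suff : ortho D.+1 by move=> oS; have := Dmax D.+1 (asboolT oS); rewrite ltnn.
have sw : s * s * B w w = 1.
  rewrite -expr2 exprVn sqr_sqrtr ?ltW// mulVf//; exact: lt0r_neq0.
have eW m : B (e m) w = 0 by rewrite hsym.
exists e'; split => [m|m m'].
  by rewrite /e'; case: unliftP.
rewrite /e'; case: unliftP => [j|] ->; case: unliftP => [j'|] ->.
- by rewrite oe (inj_eq lift_inj).
- by rewrite hsym// hZ// wo mulr0 eq_sym (negPf (neq_lift _ _)).
- by rewrite hZ// wo mulr0 (negPf (neq_lift _ _)).
- by rewrite hZ// hsym// hZ// mulrA sw eqxx.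
Qed.

End linear_algebra.

(** * The equations of one window in coordinates *)

Section window.
Context {R : realType}.
Context (D Gd M : 'I_2 -> nat) (q nv ns ks : nat) (g0 : 'I_2 -> nat).
Context (th : nat -> R) (Dm : nat -> nat -> R) (dtl : 'I_2 -> R).
Context (A : forall i, 'I_(D i) -> 'I_(D i) -> R).
Context (tau : forall i, nat -> nat -> 'I_(D i) -> 'I_(Gd i) -> R).
Context (b : 'I_2 -> 'I_2 -> R).
Context (kap : forall i j, 'I_(Gd j) -> 'I_(Gd i) -> R).

Section residuals.
Context (u : forall i, nat -> nat -> 'I_(D i) -> R).
Context (U : forall i, nat -> 'I_(D i) -> R) (p f : forall i, 'I_(Gd i) -> R).

(* [u i l j m] is the coefficient of [s^j phi_m] on substep [l] (numbered from
   0), with [s] in (0,1) the relative time; [U], [p] and [f] are the coordinates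
   of the side values, of [u_Gamma] and of [F] in orthonormal bases. [Vres] is
   (V) tested with [s^r phi_m]. *)
Definition Vres i l r m : R :=
  U (g0 i + l).+1 m - \sum_(j < q.+1) r%:R / (j + r)%:R * u l j m
  - (r == 0%N)%:R * U (g0 i + l) m
  + (dtl i * \sum_(j < q.+1) \sum_m' (j + r).+1%:R^-1 * A m' m * @u i l j m'
     + \sum_g tau l r m g * f g).

Definition Sres i l k m : R :=
  \sum_(j < q.+1) th k ^+ j * @u i l j m
  - \sum_(c < ks.+1) Dm k c * @U i ((g0 i + l).+1 - c) m.

Definition Tres i g : R :=
  p g - \sum_(l < M i) \sum_(j < q.+1) \sum_m tau l j m g * @u i l j m.

Definition Fres i g : R :=
  f g - \sum_j b i j * \sum_g' @kap i j g' g * @p j g'.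

Definition window_eqs (fd : forall i, nat -> nat -> 'I_(D i) -> R)
    (gd : forall i, 'I_(Gd i) -> R) := forall i, [/\
  forall l r m, (l < M i)%N -> (r <= nv)%N -> @Vres i l r m = fd i l r m,
  forall l k m, (l < M i)%N -> (k < ns)%N -> @Sres i l k m = 0,
  forall g, @Tres i g = 0 &
  forall g, @Fres i g = gd i g].

End residuals.

Context (W W' : nat -> nat -> R) (Lam del : R).
Context (HW : forall (a : nat -> R) j, (j <= q)%N ->
  a j = \sum_(r < nv) W j r * (\sum_(j' < q.+1) (j' + r).+1%:R^-1 * a j')
      + \sum_(k < ns) W' j k * (\sum_(j' < q.+1) th k ^+ j' * a j')).
Context (HA : forall i (x y : 'I_(D i) -> R),
  `|\sum_m \sum_m' A m' m * x m' * y m| <= Lam * nrm x * nrm y).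
Context (Htau : forall i l r (x : 'I_(D i) -> R) (y : 'I_(Gd i) -> R),
  (l < M i)%N -> (r <= q.+1)%N ->
  `|\sum_g \sum_m tau l r m g * x m * y g| <= del * nrm x * nrm y).
Context (Hkap : forall i j (x : 'I_(Gd j) -> R) (y : 'I_(Gd i) -> R),
  `|\sum_g \sum_g' @kap i j g' g * x g' * y g| <= nrm x * nrm y).
Context (Hnv : (nv <= q.+1)%N).
Context (Hdtl : forall i, 0 <= dtl i).
Context (HLam : 0 <= Lam).
Context (Hdel : 0 <= del).

Let Mx : R := (\sum_i M i)%N%:R.
Let Bb : R := \sum_i \sum_j `|b i j|.
Let Db : R := \sum_(k < ns) \sum_(c < ks.+1) `|Dm k c|.
Let Wb : R := \sum_(j < q.+1) \sum_(r < nv) `|W j r|.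
Let Wb' : R := \sum_(j < q.+1) \sum_(k < ns) `|W' j k|.

(** There are [(q + 1) Mx] coefficient vectors. Each is recovered by [W] from moments, of size [Mx]
    (side value) plus 1 (residual), and by [W'] from point values, of size [Db Mx]. The factor
    [1 + Bb] covers stiffness and flux; the leading 1 leaves the margin used to conclude. *)
Definition window_const : R := 1 +
  (q.+1)%:R * Mx * (Wb * (Mx + 1) + Wb' * Db * Mx) * (1 + Bb).

Context (Hsmall : forall i, window_const * (dtl i * Lam + del ^+ 2) < 1).

Section homogeneous.
Context (u : forall i, nat -> nat -> 'I_(D i) -> R).
Context (U : forall i, nat -> 'I_(D i) -> R) (p f : forall i, 'I_(Gd i) -> R).
Context (Hsol : window_eqs u U p f (fun _ _ _ _ => 0) (fun _ _ => 0)).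
Context (HU0 : forall i j m, (j <= g0 i)%N -> @U i j m = 0).

Let N : R := \sum_i \sum_(l < M i) \sum_(j < q.+1) nrm (@u i l j).

Let N0 : 0 <= N.
Proof. by do 3 apply: sumr_ge0 => ? _; exact: nrm_ge0. Qed.

Let Nl i l : (l < M i)%N -> \sum_(j < q.+1) nrm (@u i l j) <= N.
Proof.
move=> lM; rewrite /N (bigD1 i)//= (bigD1 (Ordinal lM))//= -addrA lerDl.
by apply: addr_ge0; repeat (apply: sumr_ge0 => ? _); exact: nrm_ge0.
Qed.

Let Ni i : \sum_(l < M i) \sum_(j < q.+1) nrm (@u i l j) <= N.
Proof.
rewrite /N [leRHS](bigD1 i)//= lerDl.
by repeat (apply: sumr_ge0 => ? _); exact: nrm_ge0.
Qed.

(** (T) tested with [p] itself; [Htau] costs the first of the two factors [del]. *)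
Let p_le i : nrm (@p i) <= del * N.
Proof.
apply: ler_dual; first exact: mulr_ge0.
have [_ _ HT _] := Hsol i.
have pE g : @p i g = \sum_(l < M i) \sum_(j < q.+1) \sum_m tau l j m g * @u i l j m.
  by apply/eqP; rewrite -subr_eq0; apply/eqP; exact: HT.
have -> : dotf (@p i) (@p i) = \sum_(l < M i) \sum_(j < q.+1)
    \sum_g \sum_m tau l j m g * @u i l j m * @p i g.
  rewrite /dotf (eq_bigr (fun g => \sum_(l < M i) \sum_(j < q.+1)
     \sum_m tau l j m g * @u i l j m * @p i g)); last first.
    move=> g _; rewrite {1}pE mulr_suml; apply: eq_bigr => l _.
    by rewrite mulr_suml; apply: eq_bigr => j _; rewrite mulr_suml.
  rewrite exchange_big; apply: eq_bigr => l _.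
  by rewrite exchange_big.
apply: (@le_trans _ _ (\sum_(l < M i) \sum_(j < q.+1) del * nrm (@u i l j) * nrm (@p i))).
  apply: ler_sum => l _; apply: ler_sum => j _.
  apply: le_trans (ler_norm _) _; apply: Htau => //.
  exact: ltnW.
rewrite (eq_bigr (fun l : 'I_(M i) => del * (\sum_(j < q.+1) nrm (@u i l j)) * nrm (@p i))).
  rewrite -mulr_suml -mulr_sumr; apply: ler_wpM2r; first exact: nrm_ge0.
  by apply: ler_wpM2l => //; exact: Ni.
by move=> l _; rewrite mulr_sumr mulr_suml.
Qed.

Let f_le i : nrm (@f i) <= Bb * del * N.
Proof.
have Bb0 : 0 <= Bb by do 2 (apply: sumr_ge0 => ? _).
apply: ler_dual; first by do 2 apply: mulr_ge0 => //.
have [_ _ _ HF] := Hsol i.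
have fE g : @f i g = \sum_j b i j * \sum_g' @kap i j g' g * @p j g'.
  by apply/eqP; rewrite -subr_eq0; apply/eqP; exact: HF.
have -> : dotf (@f i) (@f i) =
    \sum_j b i j * \sum_g \sum_g' @kap i j g' g * @p j g' * @f i g.
  rewrite /dotf (eq_bigr (fun g => \sum_j b i j *
     \sum_g' @kap i j g' g * @p j g' * @f i g)); last first.
    move=> g _; rewrite {1}fE mulr_suml; apply: eq_bigr => j _.
    by rewrite -mulrA; congr (_ * _); rewrite mulr_suml.
  by rewrite exchange_big; apply: eq_bigr => j _; rewrite mulr_sumr.
apply: (@le_trans _ _ (\sum_j `|b i j| * (del * N * nrm (@f i)))).
  apply: ler_sum => j _; apply: le_trans (ler_norm _) _.
  rewrite normrM ler_wpM2l//; apply: le_trans (Hkap _ _) _.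
  by apply: ler_wpM2r => //; exact: nrm_ge0.
rewrite -mulr_suml -!mulrA; apply: ler_wpM2r; first by rewrite !mulr_ge0 ?nrm_ge0.
by rewrite /Bb [leRHS](bigD1 i)//= lerDl; do 2 (apply: sumr_ge0 => ? _).
Qed.

Let ep i := (1 + Bb) * (dtl i * Lam + del ^+ 2).

Let Bb0 : 0 <= Bb. Proof. by do 2 (apply: sumr_ge0 => ? _). Qed.

Let ep0 i : 0 <= ep i.
Proof. by rewrite mulr_ge0// addr_ge0// ?mulr_ge0// exprn_ge0. Qed.

Let epN i : 0 <= ep i * N. Proof. exact: mulr_ge0. Qed.

Let MepN i : 0 <= Mx * ep i * N.
Proof. by rewrite -mulrA; apply: mulr_ge0 => //; exact: ler0n. Qed.

(** The pure time discretization in (V); by the homogeneous equation it equals minus the stiffness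
    and flux terms. *)
Let X i l r m := @U i (g0 i + l).+1 m
  - \sum_(j < q.+1) r%:R / (j + r)%:R * @u i l j m
  - (r == 0%N)%:R * @U i (g0 i + l) m.

(** [X] is tested with itself: the stiffness costs [dtl Lam], and the flux costs the second factor
    [del] on top of the one in [f_le]. *)
Let X_le i l r : (l < M i)%N -> (r <= nv)%N -> nrm (@X i l r) <= ep i * N.
Proof.
move=> lM rv; apply: ler_dual; first exact: mulr_ge0.
have [HV _ _ _] := Hsol i.
have XE m : X l r m = - (dtl i * \sum_(j < q.+1) \sum_m' (j + r).+1%:R^-1 * A m' m * @u i l j m'
     + \sum_g tau l r m g * @f i g).
  by apply/eqP; rewrite -subr_eq0 opprK; apply/eqP; exact: HV.
have -> : dotf (@X i l r) (@X i l r) =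
   - (dtl i * \sum_(j < q.+1) (j + r).+1%:R^-1 * (\sum_m \sum_m' A m' m * @u i l j m' * X l r m)
     + \sum_g \sum_m tau l r m g * X l r m * @f i g).
  rewrite /dotf (eq_bigr (fun m => - (dtl i * \sum_(j < q.+1) (j + r).+1%:R^-1 *
      (\sum_m' A m' m * @u i l j m' * X l r m)) - \sum_g tau l r m g * X l r m * @f i g)).
    rewrite big_split/= !sumrN opprD; congr (- _ - _); last by rewrite exchange_big.
    rewrite -mulr_sumr exchange_big/=; congr (_ * _); apply: eq_bigr => j _.
    by rewrite mulr_sumr.
  move=> m _; rewrite {1}XE mulNr -opprD; congr (- _).
  rewrite mulrDl -mulrA mulr_suml; congr (_ * _ + _).
    apply: eq_bigr => j _; rewrite mulr_suml mulr_sumr.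
    by apply: eq_bigr => m' _; rewrite !mulrA.
  rewrite mulr_suml; apply: eq_bigr => g _; ring.
apply: le_trans (ler_norm _) _; rewrite normrN.
apply: le_trans (ler_normD _ _) _.
apply: (@le_trans _ _ (dtl i * (Lam * N * nrm (@X i l r)) + del * nrm (@X i l r) * (Bb * del * N))).
  apply: lerD; last first.
    apply: le_trans (Htau _ _ lM _) _; first exact: leq_trans rv Hnv.
    apply: ler_wpM2l; last exact: f_le.
    by apply: mulr_ge0 => //; exact: nrm_ge0.
  rewrite normrM ger0_norm// ler_wpM2l//.
  apply: le_trans (ler_norm_sum _ _ _) _.
  apply: (@le_trans _ _ (\sum_(j < q.+1) Lam * nrm (@u i l j) * nrm (@X i l r))).
    apply: ler_sum => j _; rewrite normrM.
    apply: le_trans (HA _ _); apply: ler_piMl => //.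
    by rewrite ger0_norm ?invr_ge0// invf_le1 ?ltr0n// ler1n.
  rewrite -mulr_suml -mulr_sumr ler_wpM2r ?nrm_ge0// ler_wpM2l//; exact: Nl.
rewrite (_ : _ + _ = (dtl i * Lam + Bb * del ^+ 2) * N * nrm (@X i l r)); last by ring.
rewrite ler_wpM2r ?nrm_ge0// ler_wpM2r// /ep mulrDl mul1r mulrDr addrA lerD2r.
rewrite -addrA lerDl addr_ge0 ?exprn_ge0//.
by rewrite !mulr_ge0.
Qed.

(** For [r = 0] the derivative of the test function vanishes and [X] is the increment of the side
    value; the increments add up over at most [Mx] substeps, starting from 0. *)
Let U_le i l : (l <= M i)%N -> nrm (@U i (g0 i + l)) <= Mx * ep i * N.
Proof.
move=> lM; apply: (@le_trans _ _ (l%:R * ep i * N)); last first.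
  rewrite !ler_wpM2r// ler_nat (bigD1 i)//=.
  exact: leq_trans lM (leq_addr _ _).
elim: l lM => [|l IH] lM.
  rewrite addn0 !mul0r (_ : U _ = fun=> 0) ?nrm0//.
  by apply/funext => m; rewrite HU0.
have := X_le lM (leq0n _).
have -> : @U i (g0 i + l.+1) = fun m => X l 0 m + U (g0 i + l) m.
  apply/funext => m; rewrite /X eqxx big1; last by move=> j _; rewrite !mul0r.
  by rewrite addnS mul1r subr0 subrK.
move=> XX; apply: le_trans (nrmD _ _) _.
apply: le_trans (lerD XX (IH (ltnW lM))) _.
by rewrite -natr1 !mulrDl mul1r addrC.
Qed.

Let U_le' i j : (j <= g0 i + M i)%N -> nrm (@U i j) <= Mx * ep i * N.
Proof.
move=> jM; have [jg|gj] := leqP j (g0 i).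
  rewrite (_ : @U i j = fun=> 0) ?nrm0 ?MepN//.
  by apply/funext => m; rewrite HU0.
by rewrite -(subnKC (ltnW gj)) U_le// leq_subLR.
Qed.

(** Testing with [s^(r+1)]: its derivative produces the moment of order [r], and it vanishes at the
    start of the substep, so that only the new side value remains. *)
Let mom_le i l r : (l < M i)%N -> (r < nv)%N ->
  nrm (fun m => \sum_(j < q.+1) (j + r).+1%:R^-1 * @u i l j m) <= (Mx + 1) * ep i * N.
Proof.
move=> lM rv.
have -> : (fun m => \sum_(j < q.+1) (j + r).+1%:R^-1 * @u i l j m) =
  fun m => r.+1%:R^-1 * (U (g0 i + l).+1 m + (-1) * X l r.+1 m).
  apply/funext => m; rewrite /X/= mul0r subr0 mulN1r opprB addrC subrK.
  rewrite mulr_sumr; apply: eq_bigr => j _; rewrite addnS.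
  by rewrite !mulrA mulVf ?mul1r// pnatr_eq0.
rewrite nrmZ; apply: (@le_trans _ _ (nrm (fun m => @U i (g0 i + l).+1 m + -1 * X l r.+1 m))).
  apply: ler_piMl; first exact: nrm_ge0.
  by rewrite ger0_norm ?invr_ge0// invf_le1 ?ltr0n// ler1n.
apply: le_trans (nrmD _ _) _; rewrite nrmZ normrN1 mul1r.
rewrite !mulrDl mul1r lerD//; last exact: X_le.
by rewrite -addnS; exact: U_le.
Qed.

Let val_le i l k : (l < M i)%N -> (k < ns)%N ->
  nrm (fun m => \sum_(j < q.+1) th k ^+ j * @u i l j m) <= Db * Mx * ep i * N.
Proof.
move=> lM kn; have [_ HS _ _] := Hsol i.
have -> : (fun m => \sum_(j < q.+1) th k ^+ j * @u i l j m) =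
    fun m => \sum_(c < ks.+1) Dm k c * @U i ((g0 i + l).+1 - c) m.
  by apply/funext => m; apply/eqP; rewrite -subr_eq0; apply/eqP; exact: HS.
apply: le_trans (nrm_sum _ _) _.
apply: (@le_trans _ _ (\sum_(c < ks.+1) `|Dm k c| * (Mx * ep i * N))).
  apply: ler_sum => c _; rewrite nrmZ ler_wpM2l// U_le'//.
  by rewrite (leq_trans (leq_subr _ _))// -addnS leq_add2l.
rewrite -mulr_suml (_ : Db * _ * _ * _ = Db * (Mx * ep i * N)); last by ring.
apply: ler_wpM2r; first exact: MepN.
by rewrite /Db [leRHS](bigD1 (Ordinal kn))//= lerDl; do 2 (apply: sumr_ge0 => ? _).
Qed.

Let u_le i l j : (l < M i)%N -> (j < q.+1)%N ->
  nrm (@u i l j) <= (Wb * (Mx + 1) + Wb' * Db * Mx) * ep i * N.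
Proof.
move=> lM jq.
have -> : @u i l j = fun m =>
    (\sum_(r < nv) W j r * (\sum_(j' < q.+1) (j' + r).+1%:R^-1 * @u i l j' m))
    + \sum_(k < ns) W' j k * (\sum_(j' < q.+1) th k ^+ j' * @u i l j' m).
  by apply/funext => m; rewrite {1}(HW (fun j => @u i l j m)).
apply: le_trans (nrmD _ _) _; rewrite !mulrDl; apply: lerD.
  apply: le_trans (nrm_sum _ _) _.
  apply: (@le_trans _ _ (\sum_(r < nv) `|W j r| * ((Mx + 1) * ep i * N))).
    by apply: ler_sum => r _; rewrite nrmZ ler_wpM2l// mom_le.
  rewrite -mulr_suml (_ : Wb * _ * _ * _ = Wb * ((Mx + 1) * ep i * N)); last by ring.
  apply: ler_wpM2r.
    by rewrite -mulrA; apply: mulr_ge0 => //; apply: addr_ge0 => //; exact: ler0n.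
  by rewrite /Wb [leRHS](bigD1 (Ordinal jq))//= lerDl; do 2 (apply: sumr_ge0 => ? _).
apply: le_trans (nrm_sum _ _) _.
apply: (@le_trans _ _ (\sum_(k < ns) `|W' j k| * (Db * Mx * ep i * N))).
  by apply: ler_sum => r _; rewrite nrmZ ler_wpM2l// val_le.
rewrite -mulr_suml (_ : Wb' * _ * _ * _ * _ = Wb' * (Db * Mx * ep i * N)); last by ring.
apply: ler_wpM2r.
  rewrite (_ : Db * _ * _ * _ = Db * (Mx * ep i * N)); last by ring.
  by apply: mulr_ge0; [do 2 (apply: sumr_ge0 => ? _)|exact: MepN].
by rewrite /Wb' [leRHS](bigD1 (Ordinal jq))//= lerDl; do 2 (apply: sumr_ge0 => ? _).
Qed.

Let N_eq0 : N = 0.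
Proof.
pose e := Num.max (dtl ord0 * Lam + del ^+ 2) (dtl (lift ord0 ord0) * Lam + del ^+ 2).
have ee i : dtl i * Lam + del ^+ 2 <= e.
  rewrite /e le_max; case: (unliftP ord0 i) => [j|] ->; last by rewrite lexx.
  by rewrite (ord1 j) lexx orbT.
have W0 : 0 <= Wb * (Mx + 1) + Wb' * Db * Mx.
  by rewrite addr_ge0// !mulr_ge0// ?addr_ge0//; do 2 (apply: sumr_ge0 => ? _).
have se : window_const * e < 1.
  by rewrite /e; have [_|_] := leP (dtl ord0 * Lam + del ^+ 2) _; exact: Hsmall.
have e0 : 0 <= e by apply: le_trans (ee ord0); rewrite addr_ge0 ?exprn_ge0 ?mulr_ge0.
(* The sum of [u_le] over all coefficient vectors yields exactly [window_const] without its leading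
   1. *)
have : N <= (window_const - 1) * e * N.
  apply: (@le_trans _ _ (\sum_i \sum_(l < M i) \sum_(j < q.+1)
      ((Wb * (Mx + 1) + Wb' * Db * Mx) * ((1 + Bb) * e) * N))).
    apply: ler_sum => i _; apply: ler_sum => l _; apply: ler_sum => j _.
    apply: le_trans (u_le _ _) _ => //.
    by rewrite ler_wpM2r// ler_wpM2l// ler_wpM2l ?addr_ge0.
  under eq_bigr do under eq_bigr do rewrite sumr_const card_ord -mulr_natl.
  under eq_bigr do rewrite sumr_const card_ord -[X in X *+ _]mul1r -mulrnAl.
  rewrite -mulr_suml -natr_sum /window_const addrAC subrr add0r.
  by rewrite le_eqVlt; apply/orP; left; apply/eqP; rewrite /Mx; ring.
move: N0; rewrite le_eqVlt => /predU1P[<-//|Npos].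
rewrite ler_pMl// => h1; exfalso.
have : (window_const - 1) * e <= window_const * e by rewrite ler_wpM2r// gerBl.
by move=> h2; have := le_lt_trans (le_trans h1 h2) se; rewrite ltxx.
Qed.

(* With [N] the norm of all the coefficients of [u], (T) and (F) bound the flux
   by [del N], so that (V) makes the side values, then the moments of [u], and
   by (S) its values at the [theta_k], of size [(dtl Lam + del^2) N]. By [HW]
   they control [u], whence [N <= window_const (dtl Lam + del^2) N]. *)
Lemma window_homogeneous :
  [/\ forall i l j m, (l < M i)%N -> (j <= q)%N -> @u i l j m = 0,
      forall i j m, (j <= g0 i + M i)%N -> @U i j m = 0,
      forall i g, @p i g = 0 & forall i g, @f i g = 0].
Proof.
have z (I : finType) (x : I -> R) c : nrm x <= c * N -> forall i, x i = 0.
  by rewrite N_eq0 mulr0 => x0; apply: nrm_eq0; apply/le_anti; rewrite x0 nrm_ge0.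
split.
- by move=> i l j m lM jq; apply: z (u_le lM _) m.
- by move=> i j m jM; apply: z (U_le' jM) m.
- by move=> i g; apply: z (p_le i) g.
- by move=> i g; apply: z (f_le i) g.
Qed.

End homogeneous.

Definition linear_fun (T : Type) (F : (T -> R) -> R) :=
  forall a c c', F (fun k => a * c k + c' k) = a * F c + F c'.

Lemma linear_fun_sum (T : Type) (I : Type) (s : seq I) (F : I -> (T -> R) -> R) :
  (forall i, linear_fun (F i)) -> linear_fun (fun c => \sum_(i <- s) F i c).
Proof.
move=> lF a c c'; rewrite mulr_sumr -big_split/=.
by apply: eq_bigr => i _; exact: lF.
Qed.

Lemma linear_fun_mull (T : Type) (x : R) (F : (T -> R) -> R) :
  linear_fun F -> linear_fun (fun c => x * F c).
Proof. by move=> lF a c c'; rewrite lF; ring. Qed.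

Lemma linear_fun_add (T : Type) (F G : (T -> R) -> R) :
  linear_fun F -> linear_fun G -> linear_fun (fun c => F c + G c).
Proof. by move=> lF lG a c c'; rewrite lF lG; ring. Qed.

Lemma linear_fun_sub (T : Type) (F G : (T -> R) -> R) :
  linear_fun F -> linear_fun G -> linear_fun (fun c => F c - G c).
Proof. by move=> lF lG a c c'; rewrite lF lG; ring. Qed.

Section existence.

(** One index set for unknowns and equations. As an unknown, 0 in ['I_q.+2] is the side value and
    [j + 1] the coefficient of [s^j]; as an equation, [e <= nv] is (V) tested with [s^e] and the
    rest is (S). The system is square because [(nv + 1) + ns = q + 2]. *)
Let K1 (i : 'I_2) : finType := ('I_(M i) * 'I_q.+2 * 'I_(D i))%type.
Let K2 (i : 'I_2) : finType := 'I_(Gd i).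
Let K : finType := ({i : 'I_2 & K1 i} + {i : 'I_2 & K2 i} + {i : 'I_2 & K2 i})%type.

Let cu (c : K -> R) i (l j : nat) (m : 'I_(D i)) : R :=
  if insub l is Some l' then
    c (inl (inl (existT K1 i (l', inord j.+1, m))))
  else 0.
Let cU (c : K -> R) i (j : nat) (m : 'I_(D i)) : R :=
  if (j <= g0 i)%N then 0 else
  if insub (j - (g0 i).+1)%N is Some l' then
    c (inl (inl (existT K1 i (l', ord0, m))))
  else 0.
Let cp (c : K -> R) i g : R := c (inl (inr (existT K2 i g))).
Let cf (c : K -> R) i g : R := c (inr (existT K2 i g)).

Let G (c : K -> R) (k : K) : R :=
  match k with
  | inl (inl (existT i (l, e, m))) =>
    if (e <= nv)%N then Vres (cu c) (cU c) (cf c) l e m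
    else Sres (cu c) (cU c) l (e - nv.+1) m
  | inl (inr (existT i g)) => Tres (cu c) (cp c) g
  | inr (existT i g) => Fres (cp c) (cf c) g
  end.

Let cu_lin i l j m : linear_fun (fun c => @cu c i l j m).
Proof. by move=> a c c'; rewrite /cu; case: insubP => //; rewrite mulr0 addr0. Qed.

Let cU_lin i j m : linear_fun (fun c => @cU c i j m).
Proof.
move=> a c c'; rewrite /cU; case: ifP => _; first by rewrite mulr0 addr0.
by case: insubP => //; rewrite mulr0 addr0.
Qed.

Let cp_lin i g : linear_fun (fun c => @cp c i g). Proof. by []. Qed.
Let cf_lin i g : linear_fun (fun c => @cf c i g). Proof. by []. Qed.

Let G_lin k : linear_fun (G ^~ k).
Proof.
case: k => [[[i [[l e] m]]|[i g]]|[i g]] /=.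
- case: (e <= nv)%N.
    apply: linear_fun_add; first apply: linear_fun_sub; first apply: linear_fun_sub => //.
    + by apply: linear_fun_sum => j; exact: linear_fun_mull.
    + exact: linear_fun_mull.
    + apply: linear_fun_add.
        apply: linear_fun_mull; apply: linear_fun_sum => j.
        by apply: linear_fun_sum => m'; exact: linear_fun_mull.
      by apply: linear_fun_sum => g; exact: linear_fun_mull.
  apply: linear_fun_sub; apply: linear_fun_sum => j; exact: linear_fun_mull.
- apply: linear_fun_sub => //; do 3 (apply: linear_fun_sum => ?).
  exact: linear_fun_mull.
- apply: linear_fun_sub => //; apply: linear_fun_sum => j; apply: linear_fun_mull.
  by apply: linear_fun_sum => g'; exact: linear_fun_mull.
Qed.

Context (Hns : (nv + ns = q.+1)%N).

Let G_eqs c (fd : forall i, nat -> nat -> 'I_(D i) -> R) (gd : forall i, 'I_(Gd i) -> R) (sd : forall i, nat -> nat -> 'I_(D i) -> R) :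
  (forall k, G c k = match k with
    | inl (inl (existT i (l, e, m))) =>
      if (e <= nv)%N then fd i l e m else sd i l (e - nv.+1)%N m
    | inl (inr (existT i g)) => 0
    | inr (existT i g) => gd i g end) ->
  forall i, [/\
    forall l r (m : 'I_(D i)), (l < M i)%N -> (r <= nv)%N ->
      Vres (cu c) (cU c) (cf c) l r m = fd i l r m,
    forall l k (m : 'I_(D i)), (l < M i)%N -> (k < ns)%N ->
      Sres (cu c) (cU c) l k m = sd i l k m,
    forall g : 'I_(Gd i), Tres (cu c) (cp c) g = 0 &
    forall g : 'I_(Gd i), Fres (cp c) (cf c) g = gd i g].
Proof.
move=> HG i; split.
- move=> l r m lM rv; have rq : (r < q.+2)%N.
    by apply: leq_ltn_trans rv _; rewrite ltnS -Hns leq_addr.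
  have := HG (inl (inl (existT K1 i (Ordinal lM, Ordinal rq, m)))).
  by rewrite /G /= rv.
- move=> l k m lM kn; have rq : (k + nv.+1 < q.+2)%N.
    by rewrite addnS ltnS -Hns addnC ltn_add2l.
  have := HG (inl (inl (existT K1 i (Ordinal lM, Ordinal rq, m)))).
  by rewrite /G /= -addSnnS leqNgt ltnS leq_addl/= addSnnS addnK.
- by move=> g; exact: (HG (inl (inr (existT K2 i g)))).
- by move=> g; exact: (HG (inr (existT K2 i g))).
Qed.

(** Injectivity is [window_homogeneous], so the square system is solvable for every right-hand side.
    The known side values, extended by zero, are moved to the right as the residuals they produce
    alone. *)
Theorem window_exists (H : forall i, nat -> 'I_(D i) -> R) fd gd :
  exists u U p f, window_eqs u U p f fd gd /\
    forall i j m, (j <= g0 i)%N -> U i j m = H i j m.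
Proof.
pose H0 i j m := if (j <= g0 i)%N then H i j m else 0.
have Ginj c : (forall k, G c k = 0) -> forall k, c k = 0.
  move=> Gc.
  have : window_eqs (cu c) (cU c) (cp c) (cf c) (fun _ _ _ _ => 0) (fun _ _ => 0).
    apply: (@G_eqs c (fun _ _ _ _ => 0) (fun _ _ => 0) (fun _ _ _ _ => 0)).
    by move=> k; rewrite Gc; case: k => [[[i [[l e] m]]|[i g]]|[i g]] //; case: ifP.
  move/window_homogeneous => []; first by move=> i j m ji; rewrite /cU ji.
  move=> hu hU hp hf [[[i [[l e] m]]|[i g]]|[i g]].
  - have := ltn_ord e; rewrite ltnS => eq1.
    have [e0|e0] := posnP e.
      have := @hU i (g0 i + l.+1)%N m; rewrite leq_add2l ltn_ord => /(_ isT).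
      rewrite /cU leqNgt addnS ltnS leq_addr/= -addSn addKn valK.
      by move=> <-; congr (c (inl (inl (existT _ _ (_, _, _))))); apply: val_inj.
    have := @hu i l e.-1 m (ltn_ord l); rewrite -ltnS prednK// => /(_ eq1).
    rewrite /cu valK => <-; congr (c (inl (inl (existT _ _ (_, _, _))))).
    by apply: val_inj; rewrite /= prednK// inordK.
  - exact: hp.
  - exact: hf.
pose Z i (l j : nat) (m : 'I_(D i)) : R := 0.
pose Zg i (g : 'I_(Gd i)) : R := 0.
pose y (k : K) : R := match k with
    | inl (inl (existT i (l, e, m))) =>
      if (e <= nv)%N then fd i l e m - Vres Z H0 Zg l e m
      else - Sres Z H0 l (e - nv.+1) m
    | inl (inr (existT i g)) => 0
    | inr (existT i g) => gd i g end.
have [c Gc] := injective_linear_surjective (fun a c c' k => G_lin k a c c') Ginj y.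
have := @G_eqs c (fun i l e m => fd i l e m - Vres Z H0 Zg l e m) gd
   (fun i l k m => - Sres Z H0 l k m) Gc.
move=> HG.
exists (cu c), (fun i j m => cU c j m + H0 i j m), (cp c), (cf c); split; last first.
  by move=> i j m ji; rewrite /cU /H0 ji add0r.
move=> i; have [hV hS hT hF] := HG i; split => //.
- move=> l r m lM rv; have := hV l r m lM rv.
  have -> : Vres (cu c) (fun i j m => cU c j m + H0 i j m) (cf c) l r m =
      Vres (cu c) (cU c) (cf c) l r m + Vres Z H0 Zg l r m.
    rewrite /Vres.
    have -> : \sum_(j < q.+1) r%:R / (j + r)%:R * Z i l j m = 0.
      by rewrite big1// => j _; rewrite mulr0.
    have -> : \sum_(j < q.+1) \sum_m' (j + r).+1%:R^-1 * A m' m * Z i l j m' = 0.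
      by rewrite big1// => j _; rewrite big1// => m' _; rewrite mulr0.
    have -> : \sum_g tau l r m g * Zg i g = 0.
      by rewrite big1// => j _; rewrite mulr0.
    by ring.
  by move=> ->; rewrite subrK.
- move=> l k m lM kn; have := hS l k m lM kn.
  have -> : Sres (cu c) (fun i j m => cU c j m + H0 i j m) l k m =
      Sres (cu c) (cU c) l k m + Sres Z H0 l k m.
    rewrite /Sres.
    have -> : \sum_(j < q.+1) th k ^+ j * Z i l j m = 0.
      by rewrite big1// => j _; rewrite mulr0.
    rewrite sub0r -addrA -opprD; congr (_ - _); rewrite -big_split/=.
    by apply: eq_bigr => j _; rewrite mulrDr.
  by move=> ->; rewrite addNr.
Qed.

End existence.

End window.

Lemma window_eqs_sub (R : realType) (D Gd M : 'I_2 -> nat) (q nv ns ks : nat)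
    (g0 : 'I_2 -> nat) (th : nat -> R) (Dm : nat -> nat -> R) (dtl : 'I_2 -> R)
    (A : forall i, 'I_(D i) -> 'I_(D i) -> R)
    (tau : forall i, nat -> nat -> 'I_(D i) -> 'I_(Gd i) -> R)
    (b : 'I_2 -> 'I_2 -> R) (kap : forall i j, 'I_(Gd j) -> 'I_(Gd i) -> R)
    (u u' : forall i, nat -> nat -> 'I_(D i) -> R) (U U' : forall i, nat -> 'I_(D i) -> R)
    (p p' f f' : forall i, 'I_(Gd i) -> R) fd gd :
  window_eqs M q nv ns ks g0 th Dm dtl A tau b kap u U p f fd gd ->
  window_eqs M q nv ns ks g0 th Dm dtl A tau b kap u' U' p' f' fd gd ->
  window_eqs M q nv ns ks g0 th Dm dtl A tau b kap
    (fun i l j m => @u i l j m - @u' i l j m) (fun i j m => @U i j m - @U' i j m)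
    (fun i g => @p i g - @p' i g) (fun i g => @f i g - @f' i g)
    (fun _ _ _ _ => 0) (fun _ _ => 0).
Proof.
have sumB (I : finType) (c x y : I -> R) :
    \sum_i c i * (x i - y i) = \sum_i c i * x i - \sum_i c i * y i.
  by rewrite -sumrB; apply: eq_bigr => i _; rewrite mulrBr.
have sumB2 (I J : finType) (c x y : I -> J -> R) :
    \sum_i \sum_j c i j * (x i j - y i j) =
    \sum_i \sum_j c i j * x i j - \sum_i \sum_j c i j * y i j.
  by rewrite -sumrB; apply: eq_bigr => i _; exact: sumB.
move=> H H' i; have [hV hS hT hF] := H i; have [hV' hS' hT' hF'] := H' i; split.
- move=> l r m lM rv; have := congr2 (fun x y => x - y) (hV l r m lM rv) (hV' l r m lM rv).
  rewrite subrr => <-; rewrite /Vres.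
  rewrite (sumB _ (fun j : 'I_q.+1 => r%:R / (j + r)%:R) (fun j => u i l j m) (fun j => u' i l j m)).
  rewrite (sumB2 _ _ (fun (j : 'I_q.+1) m' => (j + r).+1%:R^-1 * A i m' m)
    (fun j m' => u i l j m') (fun j m' => u' i l j m')).
  rewrite sumB; ring.
- move=> l k m lM kn; have := congr2 (fun x y => x - y) (hS l k m lM kn) (hS' l k m lM kn).
  rewrite subrr => <-; rewrite /Sres.
  rewrite (sumB _ (fun j : 'I_q.+1 => th k ^+ j) (fun j => u i l j m) (fun j => u' i l j m)).
  rewrite (sumB _ (fun c : 'I_ks.+1 => Dm k c) (fun c => U i ((g0 i + l).+1 - c)%N m)
    (fun c => U' i ((g0 i + l).+1 - c)%N m)).
  ring.
- move=> g; have := congr2 (fun x y => x - y) (hT g) (hT' g).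
  rewrite subrr => <-; rewrite /Tres.
  under eq_bigr => l _ do rewrite (sumB2 _ _ (fun (j : 'I_q.+1) m => tau i l j m g)
    (fun j m => u i l j m) (fun j m => u' i l j m)).
  rewrite sumrB; ring.
- move=> g; have := congr2 (fun x y => x - y) (hF g) (hF' g).
  rewrite subrr => <-; rewrite /Fres.
  under eq_bigr => j _ do rewrite sumB mulrBr.
  rewrite sumrB; ring.
Qed.

(** * Polynomials in time *)

Section polynomial_integrals.
Context {R : realType}.
Local Notation leb := (@lebesgue_measure R).
Implicit Types (p Q : {poly R}) (a b : R).

Lemma continuous_horner p : continuous (horner p).
Proof.
move=> x; apply: differentiable_continuous; apply/derivable1_diffP.
by have [] := is_derive_poly p x.
Qed.

Lemma integrable_horner p a b :
  leb.-integrable `[a, b] (EFin \o horner p).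
Proof.
apply: continuous_compact_integrable; first exact: segment_compact.
exact/continuous_subspaceT/continuous_horner.
Qed.

Lemma integrable_horner_oo p a b :
  leb.-integrable `]a, b[ (EFin \o horner p).
Proof.
by apply: integrableS (integrable_horner p a b) => //; exact: subset_itv_oo_cc.
Qed.

Lemma Rintegral_deriv_poly Q a b : a < b ->
  \int[leb]_(x in `[a, b]) (Q^`()).[x] = Q.[b] - Q.[a].
Proof.
move=> ab; rewrite /Rintegral (@continuous_FTC2 _ _ (horner Q))//.
- exact/continuous_subspaceT/continuous_horner.
- split.
  + by move=> x _; have [] := is_derive_poly Q x.
  + by apply: cvg_at_right_filter; exact: continuous_horner.
  + by apply: cvg_at_left_filter; exact: continuous_horner.
- by move=> x _; rewrite derive1E; have [_ ->] := is_derive_poly Q x.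
Qed.

Lemma Rintegral_deriv_poly_oo Q a b : a < b ->
  \int[leb]_(x in `]a, b[) (Q^`()).[x] = Q.[b] - Q.[a].
Proof.
move=> ab; rewrite -Rintegral_deriv_poly//.
rewrite Rintegral_itv_bndo_bndc; last first.
  by apply: integrableS (integrable_horner _ a b) => //; exact: subset_itv_oo_cc.
rewrite Rintegral_itv_obnd_cbnd//.
by apply: integrableS (integrable_horner _ a b) => //; exact: subset_itv_oc_cc.
Qed.

Definition primitive p : {poly R} := \poly_(i < (size p).+1) (p`_i.-1 / i%:R).

Lemma deriv_primitive p : (primitive p)^`() = p.
Proof.
apply/polyP => i; rewrite coef_deriv coef_poly ltnS.
case: ltnP => [ip|pi] /=; last by rewrite mul0rn nth_default.
by rewrite -[_ *+ _]mulr_natr -mulrA mulVf ?mulr1// pnatr_eq0.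
Qed.

Lemma Rintegral_poly p a b : a < b ->
  \int[leb]_(x in `]a, b[) p.[x] = (primitive p).[b] - (primitive p).[a].
Proof. by move=> ab; rewrite -Rintegral_deriv_poly_oo// deriv_primitive. Qed.

Lemma Rintegral_affine p t c : 0 < c ->
  \int[leb]_(x in `]t, t + c[) p.[(x - t) / c] = c * \int[leb]_(s in `]0, 1[) p.[s].
Proof.
move=> c0; rewrite Rintegral_poly//.
pose L : {poly R} := c^-1 *: ('X - t%:P).
have LE x : L.[x] = (x - t) / c by rewrite !hornerE mulrC.
have dL : L^`() = c^-1%:P.
  by rewrite derivZ derivB derivX derivC subr0 -mul_polyC mulr1.
pose Q := c *: (primitive p \Po L).
have QE x : (Q^`()).[x] = p.[(x - t) / c].
  rewrite /Q derivZ deriv_comp deriv_primitive dL !hornerE horner_comp LE.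
  by rewrite /= mulrAC mulfV ?mul1r// gt_eqF.
under eq_Rintegral do rewrite -QE.
rewrite Rintegral_deriv_poly_oo ?ltrDl// /Q !hornerE !horner_comp !LE.
by rewrite subrr mul0r addrAC subrr add0r mulfV ?gt_eqF// mulrBr.
Qed.

Lemma poly_eq0_on_itv p a b : a < b ->
  (forall x, a < x < b -> p.[x] = 0) -> p = 0.
Proof.
move=> ab p0.
(* [size p] distinct roots strictly inside the interval; the denominators start at 2 to avoid the
   end point [b]. *)
pose rs := [seq a + (b - a) / k.+2%:R | k <- iota 0 (size p)].
apply: (@roots_geq_poly_eq0 _ _ rs); last by rewrite size_map size_iota.
  apply/allP => _ /mapP[k _ ->]; apply/rootP/p0.
  have ba : 0 < b - a by rewrite subr_gt0.
  by rewrite ltrDl divr_gt0//= -ltrBrDl ltr_pdivrMr// ltr_pMr// ltr1n.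
rewrite map_inj_uniq ?iota_uniq// => k l /addrI/mulfI.
by rewrite subr_eq0 gt_eqF// => /(_ isT)/invr_inj/eqP; rewrite eqr_nat !eqSS => /eqP.
Qed.

(** A primitive is nondecreasing with equal values at both ends, hence constant on the interval and
    therefore as a polynomial. *)
Lemma poly_int_eq0 p a b : a < b -> (forall x, a < x < b -> 0 <= p.[x]) ->
  \int[leb]_(x in `]a, b[) p.[x] = 0 -> p = 0.
Proof.
move=> ab p0; rewrite Rintegral_poly// => /eqP; rewrite subr_eq0 => /eqP Qab.
set Q := primitive p in Qab.
have dQ x : (horner Q)^`()%classic x = p.[x].
  by rewrite derive1E; have [_ ->] := is_derive_poly Q x; rewrite deriv_primitive.
have incr : {in `[a, b] &, {homo (horner Q) : x y / x <= y}}.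
  apply: ger0_derive1_le_cc.
  - by move=> x _; have [] := is_derive_poly Q x.
  - by move=> x; rewrite in_itv/= dQ => /p0.
  - exact/continuous_subspaceT/continuous_horner.
have : Q - Q.[a]%:P = 0.
  apply: (poly_eq0_on_itv ab) => x /andP[ax xb]; rewrite !hornerE.
  apply/eqP; rewrite subr_eq0 eq_le; apply/andP; split.
    rewrite -Qab; apply: incr; rewrite ?in_itv/= ?lexx ?(ltW ax) ?(ltW xb) ?(ltW ab)//.
  apply: incr; rewrite ?in_itv/= ?lexx ?(ltW ax) ?(ltW xb) ?(ltW ab)//.
move/eqP; rewrite subr_eq0 => /eqP QE.
by rewrite -(deriv_primitive p) -/Q QE derivC.
Qed.

Lemma Rintegral_sum d (T : measurableType d) (mu : {measure set T -> \bar R})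
    (D : set T) (I : Type) (s : seq I) (f : I -> T -> R) : measurable D ->
  (forall i, mu.-integrable D (EFin \o f i)) ->
  \int[mu]_(x in D) (\sum_(i <- s) f i x) =
  \sum_(i <- s) \int[mu]_(x in D) f i x.
Proof.
move=> mD intf; elim: s => [|i s IH].
  rewrite big_nil; under eq_Rintegral do rewrite big_nil.
  by rewrite Rintegral_cst// mul0r.
rewrite big_cons -IH -RintegralD//.
  by apply: eq_Rintegral => x _; rewrite big_cons.
rewrite (_ : _ \o _ = (fun x => \sum_(i <- s) (f i x)%:E)%E).
  by apply: integrable_sum => // j _; exact: intf.
by apply/funext => x /=; rewrite sumEFin.
Qed.

Lemma Rintegral_Xn n : \int[leb]_(s in `]0, 1[) s ^+ n = n.+1%:R^-1.
Proof.
have -> : \int[leb]_(s in `]0, 1[) s ^+ n = \int[leb]_(s in `]0, 1[) ('X^n : {poly R}).[s].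
  by apply: eq_Rintegral => s _; rewrite hornerXn.
pose Q : {poly R} := n.+1%:R^-1 *: 'X^(n.+1).
rewrite (_ : 'X^n = Q^`()).
  rewrite Rintegral_deriv_poly_oo// !hornerE.
  by rewrite ?hornerXn !expr1n ?expr0n/= ?mulr0 ?subr0 ?mulr1.
by rewrite derivZ derivXn/= -scalerMnr scalerMnl -mulr_natr mulVf ?scale1r// pnatr_eq0.
Qed.

End polynomial_integrals.

(** * Moments and point values of polynomials in time *)

Section time_matrix.
Context {R : realType}.
Local Notation leb := (@lebesgue_measure R).

(* A polynomial of degree at most [q] that is orthogonal to P_(q-ns) on (0,1)
   is a combination of the last [ns] basis polynomials, whose coefficients
   solve a system with matrix [Dtilde]. *)
Lemma time_unisolvence (q ns : nat) (psi : nat -> {poly R}) (theta : 'I_ns -> R)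
    (a : nat -> R) :
  (ns <= q.+1)%N -> orthogonal_basis q psi ->
  ((0 < ns)%N -> Dtilde q psi theta \in unitmx) ->
  (forall r, (r < q.+1 - ns)%N ->
     \sum_(j < q.+1) (j + r).+1%:R^-1 * a j = 0) ->
  (forall k, \sum_(j < q.+1) theta k ^+ j * a j = 0) ->
  forall j, (j <= q)%N -> a j = 0.
Proof.
move=> nsq [psz port pbas] Dunit mom0 val0.
pose P : {poly R} := \poly_(j < q.+1) a j.
have PE x : P.[x] = \sum_(j < q.+1) a j * x ^+ j by rewrite horner_poly.
suff P0 : P = 0.
  by move=> j jq; have := coef_poly q.+1 a j; rewrite ltnS jq -/P P0 coef0.
have Pmom (S : {poly R}) : (size S <= q.+1 - ns)%N ->
    \int[leb]_(x in `]0, 1[) (P * S).[x] = 0.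
  move=> sS.
  transitivity (\int[leb]_(x in `]0, 1[)
      \sum_(r < q.+1 - ns) \sum_(j < q.+1) (a j * S`_r) * x ^+ (j + r)).
    apply: eq_Rintegral => x _; rewrite hornerM PE.
    rewrite (horner_coef_wide _ sS) mulr_sumr; apply: eq_bigr => r _.
    rewrite mulr_suml; apply: eq_bigr => j _.
    by rewrite exprD; ring.
  have intX c n : leb.-integrable `]0, 1[ (EFin \o (fun x : R => c * x ^+ n)).
    have := @integrable_horner_oo R (c *: 'X^n) 0 1.
    by congr (_.-integrable _ _); apply/funext => x /=; rewrite hornerZ hornerXn.
  rewrite Rintegral_sum//; last first.
    move=> r; rewrite (_ : _ \o _ = (fun x => \sum_(j < q.+1) (a j * S`_r * x ^+ (j + r))%:E)%E).
      by apply: integrable_sum => // j _; exact: intX.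
    by apply/funext => x /=; rewrite sumEFin.
  rewrite big1// => r _; rewrite Rintegral_sum//.
  rewrite (eq_bigr (fun j : 'I_q.+1 => S`_r * ((j + r).+1%:R^-1 * a j))).
    by rewrite -mulr_sumr mom0 ?mulr0.
  move=> j _; rewrite RintegralZl//; last first.
    by have := intX 1 (j + r)%N; congr (_.-integrable _ _); apply/funext => x /=; rewrite mul1r.
  by rewrite Rintegral_Xn; ring.
(* [L] maps [-1, 1] onto [0, 1], with inverse [L']: the [psi j] are orthogonal on the former, the
   moments are taken over the latter. *)
pose L : {poly R} := 2^-1 *: ('X + 1).
pose L' : {poly R} := 2 *: 'X - 1.
pose Pt := P \Po L.
have sPt : (size Pt <= q.+1)%N.
  apply: leq_trans (size_poly q.+1 a).
  rewrite size_comp_poly2 ?leqnn//.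
  rewrite size_scale ?invr_eq0 ?pnatr_eq0//.
  by rewrite (_ : 'X + 1 = 'X + 1%:P)// size_XaddC.
have [c [Pc _]] := pbas _ sPt.
have ct j : (j < q.+1 - ns)%N -> forall jq : (j < q.+1)%N, c ord0 (Ordinal jq) = 0.
  move=> jr jq.
  have jq' : (j <= q)%N by rewrite -ltnS.
  have int0 : \int[leb]_(y in `[-1, 1]) (Pt * psi j).[y] = 0.
    rewrite -(deriv_primitive (Pt * psi j)) Rintegral_deriv_poly; last by lra.
    set Q := primitive _.
    have := Pmom (psi j \Po L') _.
    rewrite -(deriv_primitive (P * _)).
    have QE : (2^-1 *: (Q \Po L'))^`() = P * (psi j \Po L').
      rewrite derivZ deriv_comp deriv_primitive rmorphM/= /Pt -comp_polyA.
      have -> : L \Po L' = 'X.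
        rewrite /L /L' linearZ/= linearD/= comp_polyX comp_polyC.
        rewrite subrK scalerA mulVf ?scale1r// pnatr_eq0//.
      rewrite comp_polyXr /L' derivB derivZ derivX derivC subr0.
      by rewrite -[X in _ * X]mul_polyC mulr1 mulrC mul_polyC scalerA mulVf ?scale1r ?pnatr_eq0.
    rewrite deriv_primitive -QE Rintegral_deriv_poly_oo// => H.
    have {}H : (2^-1 *: (Q \Po L')).[1] - (2^-1 *: (Q \Po L')).[0] = 0.
      apply: H; apply: leq_trans jr; apply: leq_trans (psz _ jq').
      rewrite size_comp_poly2 ?leqnn// /L'.
      rewrite (_ : 2 *: 'X - 1 = 2 *: ('X + (- 2^-1)%:P)).
        by rewrite size_scale ?pnatr_eq0// size_XaddC.
      by rewrite scalerDr -[2 *: (_)%:P]mul_polyC -polyCM mulrN mulfV ?pnatr_eq0// polyCN.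
    move: H; rewrite !hornerZ !horner_comp /L' !hornerE.
    rewrite -mulrBr => /eqP; rewrite mulf_eq0 invr_eq0 pnatr_eq0/=.
    by rewrite (_ : 2 - 1 = 1 :> R); [move/eqP|ring].
  move: int0; rewrite Pc.
  have -> : \int[leb]_(y in `[-1, 1]) ((\sum_j c ord0 j *: psi j) * psi j).[y] =
     \sum_(l < q.+1) c ord0 l * \int[leb]_(y in `[-1, 1]) ((psi l).[y] * (psi j).[y]).
    transitivity (\int[leb]_(y in `[-1, 1]) \sum_(l < q.+1) (c ord0 l *: (psi l * psi j)).[y]).
      apply: eq_Rintegral => y _; rewrite hornerM horner_sum mulr_suml.
      by apply: eq_bigr => l _; rewrite !hornerZ hornerM mulrA.
    rewrite Rintegral_sum//; last by move=> l; exact: integrable_horner.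
    apply: eq_bigr => l _; rewrite -RintegralZl//.
      by apply: eq_Rintegral => y _; rewrite hornerZ hornerM.
    have := integrable_horner (psi l * psi j) (-1 : R) 1.
    by congr (_.-integrable _ _); apply/funext => y /=; rewrite hornerM.
  rewrite (bigD1 (Ordinal jq))//= big1 ?addr0; last first.
    move=> l lj; rewrite port ?mulr0//; by rewrite -ltnS.
  move/eqP; rewrite mulf_eq0 => /predU1P[//|/eqP psi2].
  have : psi j * psi j = 0.
    apply: (@poly_int_eq0 _ _ (-1) 1); first by lra.
      by move=> x _; rewrite hornerM -expr2 sqr_ge0.
    rewrite Rintegral_poly; last by lra.
    rewrite -[RHS]psi2 -Rintegral_deriv_poly; last by lra.
    by apply: eq_Rintegral => x _; rewrite deriv_primitive hornerM.
  move/eqP; rewrite mulf_eq0 orbb => /eqP psi0.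
  (* If [psi j] were 0, the zero polynomial would have two different expansions. *)
  have [c0 [_ c0u]] := pbas 0 (leq_trans (eq_leq (size_poly0 _)) (leq0n _)).
  have e1 : c0 = 0.
    by apply: c0u; rewrite big1// => l _; rewrite mxE scale0r.
  have e2 : c0 = delta_mx ord0 (Ordinal jq).
    apply: c0u; rewrite (bigD1 (Ordinal jq))//= psi0 scaler0 add0r big1//.
    by move=> l lj; rewrite mxE (negPf lj) andbF scale0r.
  move: e1; rewrite e2 => /rowP/(_ (Ordinal jq)); rewrite !mxE !eqxx/=.
  by move=> /eqP; rewrite oner_eq0.
pose cn l : R := c ord0 (inord l).
have PtE y : Pt.[y] = \sum_(k < ns) cn (k + q.+1 - ns)%N * (psi (k + q.+1 - ns)%N).[y].
  rewrite Pc horner_sum.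
  rewrite (eq_bigr (fun l : 'I_q.+1 => cn l * (psi l).[y])); last first.
    by move=> l _; rewrite /cn inord_val hornerZ.
  rewrite -(big_mkord xpredT (fun l => cn l * (psi l).[y])).
  rewrite (@big_cat_nat _ _ _ (q.+1 - ns)%N)//= ?leq_subr//.
  rewrite big_nat_cond big1 ?add0r; last first.
    move=> l /andP[/andP[_ lr] _]; have lq := leq_trans lr (leq_subr _ _).
    rewrite /cn (_ : inord l = Ordinal lq) ?ct ?mul0r//.
    by apply: val_inj; rewrite /= inordK.
  rewrite -{1}[(q.+1 - ns)%N]add0n big_addn subKn// big_mkord.
  by apply: eq_bigr => k _; rewrite addnBA.
(* [2 theta - 1] is the image of [theta] under [L'], so [Pt] takes there the value of [P] at
   [theta], which is 0; these are the equations with matrix [Dtilde]. *)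
have cn0 k : (k < ns)%N -> cn (k + q.+1 - ns)%N = 0.
  move=> kn; have Du := Dunit (leq_ltn_trans (leq0n _) kn).
  pose v : 'cV[R]_ns := \col_k cn (k + q.+1 - ns)%N.
  have : Dtilde q psi theta *m v = 0.
    apply/colP => j; rewrite !mxE.
    transitivity (Pt.[2 * theta j - 1]).
      by rewrite PtE; apply: eq_bigr => l _; rewrite !mxE mulrC.
    rewrite /Pt horner_comp PE -[RHS](val0 j) /L !hornerE subrK mulrA mulVf ?pnatr_eq0// mul1r.
    by apply: eq_bigr => l _; rewrite mulrC.
  move/(congr1 (mulmx (invmx (Dtilde q psi theta)))); rewrite mulKmx// mulmx0.
  by move/colP/(_ (Ordinal kn)); rewrite !mxE.
have Pt0 : Pt = 0.
  apply: (@poly_eq0_on_itv R _ 0 1) => // x _.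
  by rewrite PtE big1// => k _; rewrite cn0// mul0r.
apply: (@poly_eq0_on_itv R _ 0 1) => // x _.
have := congr1 (horner^~ (2 * x - 1)) Pt0; rewrite /Pt horner_comp horner0.
by rewrite /L !hornerE subrK mulrA mulVf ?pnatr_eq0// mul1r.
Qed.

(** Unisolvence makes the stacked matrix of moments and point values injective; [W] and [W'] are the
    two column blocks of a left inverse. *)
Lemma time_inverse (q ns : nat) (psi : nat -> {poly R}) (theta : 'I_ns -> R) :
  (ns <= q.+1)%N -> orthogonal_basis q psi ->
  ((0 < ns)%N -> Dtilde q psi theta \in unitmx) ->
  let th (k : nat) : R := if insub k is Some k' then theta k' else 0 in
  exists W W' : nat -> nat -> R, forall (a : nat -> R) j, (j <= q)%N ->
    a j = \sum_(r < q.+1 - ns) W j r * (\sum_(j' < q.+1) (j' + r).+1%:R^-1 * a j')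
      + \sum_(k < ns) W' j k * (\sum_(j' < q.+1) th k ^+ j' * a j').
Proof.
move=> nsq ob Du th.
pose T : 'M[R]_(q.+1 - ns + ns, q.+1) := col_mx
  (\matrix_(r < q.+1 - ns, j < q.+1) (j + r).+1%:R^-1)
  (\matrix_(k < ns, j < q.+1) theta k ^+ j).
have Tcol (a : 'cV[R]_q.+1) : T *m a = 0 -> a = 0.
  rewrite mul_col_mx -col_mx0 => /eq_col_mx[/colP h1 /colP h2].
  pose an (j : nat) := a (inord j) ord0.
  have aE (j : 'I_q.+1) : a j ord0 = an j by rewrite /an inord_val.
  apply/colP => j; rewrite aE mxE.
  apply: (@time_unisolvence q ns psi theta an nsq ob Du); last by rewrite -ltnS.
    move=> r rq; have := h1 (Ordinal rq); rewrite mxE [RHS]mxE => H; rewrite -[RHS]H.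
    by apply: eq_bigr => l _; rewrite !mxE aE.
  move=> k; have := h2 k; rewrite mxE [RHS]mxE => H; rewrite -[RHS]H.
  by apply: eq_bigr => l _; rewrite !mxE aE.
have : row_full T.
  rewrite /row_full -mxrank_tr -/(row_free T^T) -kermx_eq0.
  apply/eqP/row_matrixP => i; rewrite row0.
  have kA : row i (kermx T^T) *m T^T = 0 by apply/sub_kermxP; exact: row_sub.
  apply: trmx_inj; rewrite trmx0; apply: Tcol.
  by rewrite -[LHS]trmxK trmx_mul trmxK kA trmx0.
move=> /row_fullP[B BT].
exists (fun j r => if insub r is Some r' then B (inord j) (lshift ns r') else 0).
exists (fun j k => if insub k is Some k' then B (inord j) (rshift (q.+1 - ns) k') else 0).
move=> a j jq; pose v : 'cV[R]_q.+1 := \col_j a j.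
have := congr1 (fun M : 'M[R]_(q.+1) => (M *m v) (inord j) ord0) BT.
rewrite mul1mx [RHS]mxE inordK// => <-.
rewrite -mulmxA mxE big_split_ord/=; congr (_ + _); apply: eq_bigr => r _.
  rewrite valK; congr (_ * _); rewrite mul_col_mx col_mxEu mxE.
  by apply: eq_bigr => l _; rewrite !mxE.
rewrite valK; congr (_ * _); rewrite mul_col_mx col_mxEd mxE.
by apply: eq_bigr => l _; rewrite !mxE /th valK.
Qed.

End time_matrix.

(** * Integrals and null sets *)

Import HBNNSimple.

Section ae_integral.
Context d (T : measurableType d) (R : realType) (mu : {measure set T -> \bar R}).

(* No measurability: outside a measurable null set every simple function below
   [f] can be cut off without changing its integral. *)
Lemma ge0_integralT_null_le (f g : T -> \bar R) (N : set T) :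
  measurable N -> mu N = 0 -> (forall x, 0 <= f x)%E -> (forall x, 0 <= g x)%E ->
  (forall x, ~ N x -> f x = g x) -> (\int[mu]_x f x <= \int[mu]_x g x)%E.
Proof.
move=> mN N0 f0 g0 fg; rewrite !ge0_integralTE//.
apply: ub_ereal_sup => _ [h hf <-].
pose h' := proj_nnsfun h (measurableC mN).
have -> : sintegral mu h = sintegral mu h'.
  rewrite -!integralT_nnsfun; apply: ae_eq_integral => //.
  - exact/measurable_EFinP.
  - exact/measurable_EFinP.
  exists N; split => // x /= /not_implyP[_ hx].
  apply: contrapT => Nx; apply: hx.
  by rewrite mindicE mem_set//= mulr1.
apply: ereal_sup_ubound; exists h' => // x.
rewrite /h' /= mindicE; have [Nx|Nx] := pselect (N x).
  by rewrite memNset ?mulr0//; exact.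
by rewrite mem_set// mulr1 -fg.
Qed.

(** Neither function is assumed measurable, so that pointwise derivatives and data, controlled only
    off a null set, can be replaced by measurable functions under the integral. *)
Lemma integral_null (f g : T -> \bar R) (D N : set T) :
  measurable N -> mu N = 0 -> (forall x, D x -> ~ N x -> f x = g x) ->
  (\int[mu]_(x in D) f x = \int[mu]_(x in D) g x)%E.
Proof.
move=> mN N0 fg; rewrite integral_mkcond [RHS]integral_mkcond.
have fgD x : ~ N x -> (f \_ D) x = (g \_ D) x.
  move=> Nx; rewrite /patch; case: ifPn => // /set_mem Dx; exact: fg.
rewrite integralE [RHS]integralE; congr (_ - _)%E; apply/le_anti/andP; split;
  apply: (ge0_integralT_null_le mN N0) => // x Nx; by rewrite ?funeposE ?funenegE fgD.
Qed.

Lemma Rintegral_null (f g : T -> R) (D N : set T) :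
  measurable N -> mu N = 0 -> (forall x, D x -> ~ N x -> f x = g x) ->
  \int[mu]_(x in D) f x = \int[mu]_(x in D) g x.
Proof.
move=> mN N0 fg; rewrite /Rintegral; congr fine.
by apply: (integral_null mN N0) => x Dx Nx; rewrite fg.
Qed.

(** Closed under products, and integrable on sets of finite measure: the ambient space on which
    every spatial form is bilinear. *)
Definition bounded_meas (A : set T) (f : T -> R) :=
  measurable_fun A f /\ exists B, forall x, A x -> `|f x| <= B.

Context (A : set T) (mA : measurable A) (Aoo : (mu A < +oo)%E).
Implicit Types f g : T -> R.

Lemma bounded_meas_cst c : bounded_meas A (fun=> c).
Proof. by split; [exact: measurable_cst|exists `|c|]. Qed.

Lemma bounded_measD f g : bounded_meas A f -> bounded_meas A g ->
  bounded_meas A (fun x => f x + g x).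
Proof.
move=> [mf [B fB]] [mg [B' gB]]; split; first exact: measurable_funD.
exists (B + B') => x Ax; apply: le_trans (ler_normD _ _) _.
by apply: lerD; [exact: fB|exact: gB].
Qed.

Lemma bounded_measM f g : bounded_meas A f -> bounded_meas A g ->
  bounded_meas A (fun x => f x * g x).
Proof.
move=> [mf [B fB]] [mg [B' gB]]; split; first exact: measurable_funM.
by exists (B * B') => x Ax; rewrite normrM ler_pM// ?fB ?gB.
Qed.

Lemma bounded_meas_sum (I : Type) (s : seq I) (f : I -> T -> R) :
  (forall i, bounded_meas A (f i)) -> bounded_meas A (fun x => \sum_(i <- s) f i x).
Proof.
move=> bf; elim: s => [|i s IH].
  under eq_fun do rewrite big_nil; exact: bounded_meas_cst.
by under eq_fun do rewrite big_cons; exact: bounded_measD.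
Qed.

Lemma bounded_meas_integrable f : bounded_meas A f ->
  mu.-integrable A (EFin \o f).
Proof.
move=> [mf [B fB]]; apply: measurable_bounded_integrable => //.
exists B; split; first exact: num_real.
by move=> M BM x Ax; exact: le_trans (fB _ Ax) (ltW BM).
Qed.

Definition ip (f g : T -> R) : R := \int[mu]_(x in A) (f x * g x).

Lemma ip_sym f g : ip f g = ip g f.
Proof. by apply: eq_Rintegral => x _; rewrite mulrC. Qed.

Lemma ip_lin a f g h : bounded_meas A f -> bounded_meas A g ->
  bounded_meas A h -> ip (a *: f + g) h = a * ip f h + ip g h.
Proof.
move=> bf bg bh; rewrite /ip -RintegralZl//; last exact/bounded_meas_integrable/bounded_measM.
rewrite -RintegralD//; last 2 first.
- apply: bounded_meas_integrable; apply: bounded_measM; first exact: bounded_meas_cst.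
  exact: bounded_measM.
- exact/bounded_meas_integrable/bounded_measM.
apply: eq_Rintegral => x _.
by rewrite !fctE mulrDl mulrA.
Qed.

Lemma ip_ge0 f : 0 <= ip f f.
Proof. by apply: Rintegral_ge0 => x _; rewrite -expr2 sqr_ge0. Qed.

Lemma bounded_meas_lin a f g : bounded_meas A f -> bounded_meas A g ->
  bounded_meas A (a *: f + g).
Proof.
move=> bf bg; apply: bounded_measD => //.
by apply: bounded_measM => //; exact: bounded_meas_cst.
Qed.

Lemma ip_cauchy_schwarz f g : bounded_meas A f -> bounded_meas A g ->
  `|ip f g| <= Num.sqrt (ip f f) * Num.sqrt (ip g g).
Proof.
move=> bf bg; rewrite -sqrtrM ?ip_ge0// -(@ler_pXn2r _ 2)// ?nnegrE ?sqrtr_ge0//.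
rewrite sqr_sqrtr ?mulr_ge0 ?ip_ge0// real_normK ?num_real//.
apply: (@psd_cauchy_schwarz _ (T -> R) (bounded_meas A) ip) => //.
- by move=> a u v bu bv; exact: bounded_meas_lin.
- by move=> a u v w bu bv bw; exact: ip_lin.
- by move=> u v _ _; exact: ip_sym.
- by move=> u _; exact: ip_ge0.
Qed.

Lemma bounded_meas_le_Rintegral f g : bounded_meas A f -> bounded_meas A g ->
  (forall x, A x -> f x <= g x) ->
  \int[mu]_(x in A) f x <= \int[mu]_(x in A) g x.
Proof.
by move=> bf bg fg; apply: le_Rintegral => //; exact: bounded_meas_integrable.
Qed.

Lemma ip_le f g : bounded_meas A f -> bounded_meas A g ->
  (forall x, A x -> `|f x| <= `|g x|) -> ip f f <= ip g g.
Proof.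
move=> bf bg fg; apply: bounded_meas_le_Rintegral; try exact: bounded_measM.
move=> x Ax; rewrite -!expr2 -[leLHS]real_normK ?num_real// -[leRHS]real_normK ?num_real//.
by rewrite ler_pXn2r// ?nnegrE// fg.
Qed.

End ae_integral.

Section sup_norm.
Context {R : realType}.

Lemma coord_le_norm n (x : 'rV[R]_n) j : `|x ord0 j| <= `|x|.
Proof.
have -> : `|x| = mx_norm x by []. rewrite mx_normrE.
by have := le_bigmax 0 (fun ij : 'I_1 * 'I_n => `|x ij.1 ij.2|) (ord0, j).
Qed.

Lemma norm_le_coord n (x : 'rV[R]_n) c : 0 <= c ->
  (forall j, `|x ord0 j| <= c) -> `|x| <= c.
Proof.
move=> c0 xc; have -> : `|x| = mx_norm x by []. rewrite mx_normrE.
by apply: bigmax_le => // -[i j] _ /=; rewrite ord1.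
Qed.

Lemma norm_lt_coord n (x : 'rV[R]_n) c : 0 < c ->
  (forall j, `|x ord0 j| < c) -> `|x| < c.
Proof.
move=> c0 xc; have -> : `|x| = mx_norm x by []. rewrite mx_normrE.
by apply: bigmax_lt => // -[i j] _ /=; rewrite ord1.
Qed.

Lemma ballE n (x : 'rV[R]_n) r : 0 < r ->
  ball x r = [set y | forall j, `|x ord0 j - y ord0 j| < r].
Proof.
move=> r0; apply/seteqP; split => y /=.
  rewrite -ball_normE/= => xy j; have := coord_le_norm (x - y) j.
  by rewrite !mxE => /le_lt_trans; apply.
move=> xy; rewrite -ball_normE/=; apply: norm_lt_coord => // j.
by rewrite !mxE.
Qed.

End sup_norm.

(** * Cubes, Borel sets and Lipschitz images for Lebesgue measure on row vectors *)

Section rV_measure.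
Context {R : realType}.

Lemma measurable_ball_rV n (x : 'rV[R]_n) r : measurable (ball x r : set 'rV[R]_n).
Proof.
have [r0|r0] := ltP 0 r; last first.
  rewrite (_ : ball x r = set0)//; apply/seteqP; split => // y.
  rewrite -ball_normE/= => /lt_le_trans/(_ r0).
  by rewrite normr_lt0.
rewrite ballE//.
suff : measurable (\big[setI/setT]_(j < n) [set y : 'rV[R]_n | `|x ord0 j - y ord0 j| < r]).
  rewrite -bigcap_seq; congr (measurable _); apply/seteqP; split => y /= H j.
    by apply: H; rewrite /= mem_index_enum.
  by move=> _; exact: H.
apply: bigsetI_measurable => j _.
have := @measurable_coord R n j measurableT _ (measurable_ball (x ord0 j) r).
by rewrite setTI; congr (measurable _); apply/seteqP; split.
Qed.

(** Balls of the sup norm are cubes, so the product measure splits off the last side. *)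
Lemma lebesgue_rV_ball n (x : 'rV[R]_n) r : 0 < r ->
  @lebesgue_rV R n (ball x r) = ((2 * r) ^+ n)%:E.
Proof.
move=> r0; rewrite ballE//; elim: n x => [|n IH] x.
  rewrite /= diracE mem_set ?expr0//; by case.
rewrite /= /leb_step /pushforward.
transitivity ((lebesgue_rV n \x lebesgue_measure)%E
   ([set y : 'rV[R]_n | forall j, `|x ord0 (lift ord_max j) - y ord0 j| < r] `*`
   ball (x ord0 ord_max) r)).
  apply: congr1; apply/seteqP; split => -[y z] /=.
    move=> H; split => [j|].
      by have := H (lift ord_max j); rewrite mxE liftK.
    by have := H ord_max; rewrite mxE unlift_none.
  by move=> [H1 H2] j; rewrite mxE; case: unliftP => [j'|] ->.
have -> : [set y : 'rV[R]_n | forall j, `|x ord0 (lift ord_max j) - y ord0 j| < r] =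
   ball (\row_j x ord0 (lift ord_max j)) r.
  by rewrite ballE//; apply/seteqP; split => y /= H j; have := H j; rewrite !mxE.
rewrite product_measure1E//; last 2 first.
- exact: measurable_ball_rV.
- exact: measurable_ball.
have IHx := IH (\row_j x ord0 (lift ord_max j)); rewrite -ballE// in IHx.
transitivity (((2 * r) ^+ n)%:E * (2 * r)%:E)%E; last by rewrite -EFinM exprSr.
congr (_ * _)%E; first exact: IHx.
transitivity ((r *+ 2)%:E); last by rewrite mulr_natl.
exact/lebesgue_measure_ball/ltW.
Qed.

(** The sigma-algebra is generated by the coordinates, so an open set is written as a countable
    union of balls, those with rational centre and radius that it contains. *)
Lemma open_measurable_rV n (U : set 'rV[R]_n) : open U -> measurable U.
Proof.
move=> oU.
pose B (i : 'rV[rat]_n * rat) := ball (map_mx ratr i.1 : 'rV[R]_n) (ratr i.2).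
have -> : U = \bigcup_(i in [set i | B i `<=` U]) B i.
  apply/seteqP; split => [x Ux|x [i /= BU /BU//]].
  have := open_nbhs_nbhs (conj oU Ux); rewrite -nbhs_ballE => -[e /= e0 xeU].
  have [r /andP[r0 re]] : exists r : rat, 0 < (ratr r : R) < e / 2.
    have [r] := @rat_in_itvoo R 0 (e / 2) (divr_gt0 e0 (ltr0Sn _ 1)).
    by rewrite in_itv/= => ?; exists r.
  have H j : exists q : rat, `|(ratr q : R) - x ord0 j| < ratr r.
    have [|q] := @rat_in_itvoo R (x ord0 j - ratr r) (x ord0 j + ratr r).
      by rewrite ltrBlDr -addrA ltrDl addr_gt0.
    rewrite in_itv/= => /andP[h1 h2]; exists q.
    by rewrite ltr_norml; apply/andP; split; lra.
  pose q := \row_j projT1 (cid (H j)).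
  have qx : `|(map_mx ratr q : 'rV[R]_n) - x| < ratr r.
    apply: norm_lt_coord => // j; rewrite !mxE.
    exact: (projT2 (cid (H j))).
  exists (q, r) => /=.
    move=> y; rewrite /B -ball_normE/= => qy; apply: xeU.
    rewrite -ball_normE/=.
    rewrite (_ : x - y = (x - map_mx ratr q) + (map_mx ratr q - y)); last by rewrite addrA subrK.
    apply: le_lt_trans (ler_normD _ _) _.
    rewrite distrC; have := ltrD (lt_trans qx re) (lt_trans qy re).
    by rewrite -splitr.
  by rewrite /B -ball_normE/=.
have -> : \bigcup_(i in [set i | B i `<=` U]) B i =
   \bigcup_i (if `[< B i `<=` U >] then B i else set0).
  apply/seteqP; split => x [i Bi].
    by move=> ?; exists i => //; rewrite asboolT.
  by case: asboolP => // BU ?; exists i.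
apply: countable_bigcupT_measurable => [|i]; first exact: countableP.
by case: ifP => // _; exact: measurable_ball_rV.
Qed.

Lemma closed_measurable_rV n (U : set 'rV[R]_n) : closed U -> measurable U.
Proof.
by move=> cU; rewrite -[U]setCK; apply: measurableC; apply: open_measurable_rV; exact: closed_openC.
Qed.

Lemma measurable_shift n (v : 'rV[R]_n) :
  measurable_fun [set: 'rV[R]_n] (fun x => x + v).
Proof.
apply: measurable_fun_rV => j; under eq_fun do rewrite mxE.
by apply: measurable_funD; [exact: measurable_coord|exact: measurable_cst].
Qed.

Lemma measurable_within_closed n (D : set 'rV[R]_n) (v : 'rV[R]_n -> R) :
  closed D -> {within D, continuous v} -> (forall x, ~ D x -> v x = 0) ->
  measurable_fun [set: 'rV[R]_n] v.
Proof.
move=> cD vc v0.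
have mD := closed_measurable_rV cD.
have vD : measurable_fun D v.
  apply: (measurability _ (RGenOpens.measurableE R)) => _ [_ [a [b ->] <-]].
  have /continuousP/(_ _ (@interval_open R (BRight a) (BLeft b) isT isT)) := vc.
  move=> /open_subspaceP[V oV VE].
  rewrite setIC -VE setIC; apply: measurableI => //; exact: open_measurable_rV.
rewrite -(setUv D); apply/measurable_funU => //; first exact: measurableC.
split => //.
have : measurable_fun (~` D) (cst (0 : R)) by exact: measurable_cst.
by apply: eq_measurable_fun => x; rewrite inE/= => Dx; rewrite v0.
Qed.

Lemma measure_bigsetU_le d (T : measurableType d) (mu : {measure set T -> \bar R})
    (I : Type) (s : seq I) (F : I -> set T) : (forall i, measurable (F i)) ->
  (mu (\big[setU/set0]_(i <- s) F i) <= \sum_(i <- s) mu (F i))%E.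
Proof.
move=> mF; elim: s => [|i s IH]; first by rewrite !big_nil measure0.
rewrite !big_cons; apply: le_trans (measureU2 _ _ _) _ => //.
  exact: bigsetU_measurable.
exact: leeD.
Qed.

(** A grid of spacing [1/(k+1)] has at most [(2 (k+1))^n] points, and the balls of radius
    [2 L/(k+1)] around their images have measure [(4 L/(k+1))^(n+1)]. The extra dimension makes the
    total of order [1/(k+1)]; [N] is the intersection over [k]. *)
Lemma lipschitz_face_null (n : nat) (G : 'rV[R]_n -> 'rV[R]_n.+1) (L : R) :
  (forall x y : 'rV[R]_n, (forall j, 0 <= x ord0 j <= 1) -> (forall j, 0 <= y ord0 j <= 1) ->
     `|G x - G y| <= L * `|x - y|) ->
  exists N, [/\ measurable N, lebesgue_rV n.+1 N = 0%E &
    forall x : 'rV[R]_n, (forall j, 0 <= x ord0 j <= 1) -> N (G x)].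
Proof.
wlog L0 : L / 0 < L.
  move=> + GL => /(_ (Num.max L 1)); apply.
    by rewrite lt_max ltr01 orbT.
  move=> x y x1 y1; apply: le_trans (GL _ _ x1 y1) _.
  by rewrite ler_wpM2r// le_max lexx.
move=> GL.
pose cent (k : nat) (f : {ffun 'I_n -> 'I_k.+2}) : 'rV[R]_n := \row_j ((f j)%:R / k.+1%:R).
pose C k := \big[setU/set0]_(f : {ffun 'I_n -> 'I_k.+2}) ball (G (cent k f)) (2 * L / k.+1%:R).
have mC k : measurable (C k).
  by apply: bigsetU_measurable => f _; exact: measurable_ball_rV.
have muC k : (lebesgue_rV n.+1 (C k) <= ((2 ^+ n * (4 * L) ^+ n.+1) / k.+1%:R)%:E)%E.
  have r0 : 0 < 2 * L / k.+1%:R by rewrite divr_gt0 ?mulr_gt0.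
  apply: le_trans (measure_bigsetU_le _ _ _) _ => [f|]; first exact: measurable_ball_rV.
  rewrite (eq_bigr (fun=> ((2 * (2 * L / k.+1%:R)) ^+ n.+1)%:E)); last first.
    by move=> f _; exact: lebesgue_rV_ball.
  rewrite sumEFin lee_fin sumr_const card_ffun !card_ord.
  rewrite -[leLHS]mulr_natl natrX (_ : 2 * (2 * L / k.+1%:R) = (4 * L) / k.+1%:R); last by ring.
  rewrite expr_div_n [k.+1%:R ^+ n.+1]exprSr invfM !mulrA ler_pM2r ?invr_gt0//.
  rewrite mulrAC ler_pM2r ?exprn_gt0 ?mulr_gt0// ler_pdivrMr ?exprn_gt0//.
  rewrite -exprMn lerXn2r ?nnegrE ?mulr_ge0// -natrM ler_nat mul2n -addnn.
  by rewrite addSn ltnS addnS ltnS leq_addl.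
exists (\bigcap_k C k); split.
- exact: bigcapT_measurable.
- apply/eqP; rewrite eq_le measure_ge0 andbT; apply/lee_addgt0Pr => e e0.
  rewrite add0e.
  set c := 2 ^+ n * (4 * L) ^+ n.+1 in muC.
  have c0 : 0 < c by rewrite mulr_gt0 ?exprn_gt0 ?mulr_gt0.
  pose k := Num.trunc (c / e).
  apply: le_trans (_ : (_ <= lebesgue_rV n.+1 (C k))%E) _.
    apply: le_measure; rewrite ?inE//; first exact: bigcapT_measurable.
    exact: bigcap_inf.
  apply: le_trans (muC _) _; rewrite lee_fin ler_pdivrMr//.
  by rewrite mulrC -ler_pdivrMr// ltW// truncnS_gt.
move=> x x01 k _.
have tk j : (Num.trunc (k.+1%:R * x ord0 j) < k.+2)%N.
  rewrite ltnS truncn_le_nat (@le_lt_trans _ _ k.+1%:R) ?ltr_nat//.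
  by have /andP[_ ?] := x01 j; rewrite ler_piMr.
pose f := [ffun j => Ordinal (tk j)].
rewrite /C (bigD1 f)//=; left; rewrite -ball_normE/=.
have xj j : (f j)%:R <= k.+1%:R * x ord0 j < (f j).+1%:R.
  by rewrite ffunE /= truncn_itv// mulr_ge0//; have /andP[] := x01 j.
have cent01 j : 0 <= cent k f ord0 j <= 1.
  rewrite mxE divr_ge0//= ler_pdivrMr// mul1r ler_nat -ltnS.
  exact: ltn_ord.
apply: le_lt_trans (GL _ _ cent01 x01) _.
rewrite -mulrA mulrCA ltr_pM2l//; apply: norm_lt_coord; first by rewrite mulr_gt0 ?invr_gt0.
move=> j; rewrite !mxE; have /andP[h1 h2] := xj j.
have K0 : 0 < k.+1%:R :> R by rewrite ltr0n.
rewrite (_ : _ - _ = ((f j)%:R - k.+1%:R * x ord0 j) / k.+1%:R); last first.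
  by rewrite mulrBl mulrAC mulfV ?gt_eqF// mul1r.
rewrite normrM normfV (gtr0_norm K0) ltr_pM2r ?invr_gt0//.
by rewrite ltr_norml; apply/andP; split; move: h2; rewrite -natr1; lra.
Qed.

End rV_measure.

(** * Polynomials on the reference cells *)

Section reference_polynomials.
Context {R : realType} (m : nat).
Local Notation pt := 'rV[R]_m.

Lemma prod_lipschitz (I : finType) (a b : I -> R) :
  (forall i, 0 <= a i <= 1) -> (forall i, 0 <= b i <= 1) ->
  `|\prod_i a i - \prod_i b i| <= \sum_i `|a i - b i|.
Proof.
move=> a01 b01.
suff : (`|\prod_i a i| <= 1) /\ (`|\prod_i b i| <= 1) /\
    `|\prod_i a i - \prod_i b i| <= \sum_i `|a i - b i| by move=> [_ []].
elim/big_rec3 : _ => [|i s y x _ [x1 [y1 xy]]].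
  by rewrite subrr normr0 normr1; do 2 split => //.
have /andP[a0 a1] := a01 i; have /andP[b0 b1] := b01 i.
have na : `|a i| <= 1 by rewrite ger0_norm.
have nb : `|b i| <= 1 by rewrite ger0_norm.
split; first by rewrite normrM mulr_ile1.
split; first by rewrite normrM mulr_ile1.
rewrite (_ : _ - _ = (a i - b i) * x + b i * (x - y)); last by ring.
apply: le_trans (ler_normD _ _) _; rewrite !normrM; apply: lerD.
  exact: ler_piMr.
by apply: le_trans xy; apply: ler_piMl.
Qed.

Lemma exp_lipschitz (a b : R) n : 0 <= a <= 1 -> 0 <= b <= 1 ->
  `|a ^+ n - b ^+ n| <= n%:R * `|a - b|.
Proof.
move=> a01 b01; have := @prod_lipschitz 'I_n (fun=> a) (fun=> b) (fun=> a01) (fun=> b01).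
by rewrite !prodr_const sumr_const !card_ord mulr_natl.
Qed.

Context (k : nat).
Local Notation idx := {ffun 'I_m -> 'I_k.+1}.

Definition monomial (al : idx) (x : pt) : R := \prod_j x ord0 j ^+ al j.

(** The denominator keeps the sum of the [m] coordinates of a node below 1, so that the same nodes
    serve the reference simplex and the reference cube. *)
Definition abscissa (a : nat) : R := a%:R / (k * m).+1%:R.

Definition node (g : idx) : pt := \row_j abscissa (g j).

Lemma abscissa_ge0 a : 0 <= abscissa a.
Proof. by rewrite divr_ge0. Qed.

Lemma node_sum (g : idx) : \sum_j node g ord0 j <= 1.
Proof.
under eq_bigr do rewrite mxE; rewrite -mulr_suml ler_pdivrMr// mul1r -natr_sum ler_nat.
apply: leq_trans (leqnSn _); apply: (@leq_trans (\sum_(j < m) k)%N).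
  by apply: leq_sum => j _; rewrite -ltnS.
by rewrite sum_nat_const card_ord mulnC.
Qed.

Lemma node_ref (K : @cell R m) (g : idx) : ref_cell K (node g).
Proof.
have g0 j : 0 <= node g ord0 j by rewrite mxE abscissa_ge0.
have gs := node_sum g.
case: K => v /=; first by split.
move=> j; rewrite g0/=; apply: le_trans gs.
by rewrite [leRHS](bigD1 j)//= lerDl; apply: sumr_ge0.
Qed.

Definition nodal_inv : 'M[R]_k.+1 :=
  invmx (\matrix_(a < k.+1, b < k.+1) abscissa a ^+ b).

Lemma nodal_invP (b c : 'I_k.+1) :
  \sum_(a < k.+1) nodal_inv b a * abscissa a ^+ c = (b == c)%:R.
Proof.
set T := \matrix_(a < k.+1, b < k.+1) abscissa a ^+ b.
have uT : T \in unitmx.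
  have -> : T = (Vandermonde k.+1 (\row_(a < k.+1) abscissa a))^T.
    by apply/matrixP => a d; rewrite !mxE.
  rewrite unitmx_tr unitmxE det_Vandermonde unitfE.
  apply/prodf_neq0 => i _; apply/prodf_neq0 => j ij.
  rewrite !mxE subr_eq0; apply: contraTneq ij => /mulIf.
  rewrite invr_eq0 pnatr_eq0 => /(_ isT) /eqP; rewrite eqr_nat => /eqP ->.
  by rewrite ltnn.
have := mulVmx uT => /matrixP/(_ b c); rewrite !mxE => <-.
by apply: eq_bigr => a _; rewrite !mxE.
Qed.

(** Evaluation of tensor-product polynomials on the grid is a tensor power of a Vandermonde matrix,
    inverted by the tensor power of [nodal_inv]. Polynomials on a simplex are included as those with
    some coefficients 0. *)
Lemma coef_from_nodes (c : idx -> R) (al : idx) :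
  c al = \sum_(g : idx) (\prod_j nodal_inv (al j) (g j)) *
                        (\sum_be c be * monomial be (node g)).
Proof.
under eq_bigr do rewrite mulr_sumr.
rewrite exchange_big/=.
rewrite (eq_bigr (fun be => c be * (\prod_j \sum_(a < k.+1)
   nodal_inv (al j) a * abscissa a ^+ be j))); last first.
  move=> be _; rewrite bigA_distr_bigA mulr_sumr; apply: eq_bigr => g _.
  rewrite mulrCA -big_split/=; congr (_ * _); apply: eq_bigr => j _.
  by rewrite mxE.
rewrite (bigD1 al)//= [X in _ + X]big1.
  rewrite big1 ?mulr1 ?addr0// => j _; by rewrite nodal_invP eqxx.
move=> be bal; have [j bj] : exists j, al j != be j.
  apply/existsP; apply: contraNT bal; rewrite negb_exists => /forallP h.
  by apply/eqP/ffunP => j; apply/esym/eqP; rewrite -[_ == _]negbK.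
by rewrite (bigD1 j)//= nodal_invP (negPf bj) mul0r mulr0.
Qed.

(** With [S] the double sum, node values at most [M] force coefficients of total size at most [S M];
    on the unit cube a monomial is at most 1 and has Lipschitz constant [k m]. The summand 1 keeps
    the constant at least 1. *)
Definition markov_const : R := 1 + (k * m)%:R *
  \sum_(al : idx) \sum_(g : idx) `|\prod_j nodal_inv (al j) (g j)|
  + \sum_(al : idx) \sum_(g : idx) `|\prod_j nodal_inv (al j) (g j)|.

Lemma markov_const_gt0 : 0 < markov_const.
Proof.
rewrite /markov_const -addrA ltr_wpDr//.
have S0 : 0 <= \sum_(al : idx) \sum_(g : idx) `|\prod_j nodal_inv (al j) (g j)|.
  by do 2 (apply: sumr_ge0 => ? _).
by rewrite addr_ge0// mulr_ge0.
Qed.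

Lemma ref_poly_monomials (K : @cell R m) (p : pt -> R) : ref_poly k K p ->
  exists c : idx -> R, forall x, p x = \sum_al c al * monomial al x.
Proof.
move=> [c pE]; exists (fun al : idx => if is_simplex K ==> (\sum_j al j <= k)%N then c al else 0).
move=> x; rewrite pE big_mkcond/=; apply: eq_bigr => al _.
by case: ifP => _; rewrite ?mul0r.
Qed.

Definition unit_cube : set pt := [set x | forall j, 0 <= x ord0 j <= 1].

Lemma ref_cell_cube (K : @cell R m) x : ref_cell K x -> unit_cube x.
Proof.
case: K => v //= -[x0 xs] j; rewrite x0/=; apply: le_trans xs.
by rewrite [leRHS](bigD1 j)//= lerDl; apply: sumr_ge0.
Qed.

Lemma markov (K : @cell R m) (p : pt -> R) M : ref_poly k K p ->
  (forall g : idx, `|p (node g)| <= M) ->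
  (forall x, unit_cube x -> `|p x| <= markov_const * M) /\
  (forall x y, unit_cube x -> unit_cube y ->
     `|p x - p y| <= markov_const * M * `|x - y|).
Proof.
move=> /ref_poly_monomials[c pE] pM.
have M0 : 0 <= M by apply: le_trans (pM [ffun=> ord0]).
pose S := \sum_(al : idx) \sum_(g : idx) `|\prod_j nodal_inv (al j) (g j)|.
have S0 : 0 <= S by do 2 (apply: sumr_ge0 => ? _).
have cS : \sum_al `|c al| <= S * M.
  rewrite /S mulr_suml; apply: ler_sum => al _.
  rewrite {1}coef_from_nodes mulr_suml; apply: le_trans (ler_norm_sum _ _ _) _.
  by apply: ler_sum => g _; rewrite normrM ler_wpM2l// -pE.
split => [x x01|x y x01 y01].
  rewrite pE; apply: le_trans (ler_norm_sum _ _ _) _.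
  apply: (@le_trans _ _ (\sum_al `|c al|)).
    apply: ler_sum => al _; rewrite normrM ler_piMr// normr_prod.
    apply: prodr_ile1 => j _; rewrite normr_ge0/= normrX exprn_ile1//.
    by have /andP[? ?] := x01 j; rewrite ger0_norm.
  apply: le_trans cS _; rewrite ler_wpM2r// /markov_const -/S addrC lerDl.
  by rewrite addr_ge0// mulr_ge0.
rewrite !pE -sumrB; apply: le_trans (ler_norm_sum _ _ _) _.
apply: (@le_trans _ _ (\sum_al `|c al| * ((k * m)%:R * `|x - y|))).
  apply: ler_sum => al _; rewrite -mulrBr normrM ler_wpM2l//.
  apply: le_trans (prod_lipschitz _ _) _.
  - by move=> j; have /andP[h1 h2] := x01 j; rewrite exprn_ge0//= exprn_ile1.
  - by move=> j; have /andP[h1 h2] := y01 j; rewrite exprn_ge0//= exprn_ile1.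
  apply: (@le_trans _ _ (\sum_(j < m) k%:R * `|x - y|)).
    apply: ler_sum => j _; apply: le_trans (exp_lipschitz _ (x01 j) (y01 j)) _.
    apply: ler_pM => //; first by rewrite ler_nat -ltnS.
    by have := coord_le_norm (x - y) j; rewrite !mxE.
  by rewrite sumr_const card_ord natrM -mulrnAl -[k%:R *+ _]mulr_natr.
rewrite -mulr_suml mulrA; apply: ler_wpM2r => //.
apply: (@le_trans _ _ (S * M * (k * m)%:R)); first by rewrite ler_wpM2r.
rewrite mulrAC; apply: ler_wpM2r => //; rewrite /markov_const -/S mulrC.
by rewrite -addrA addrCA lerDl addr_ge0.
Qed.

Lemma ref_cell_convex (K : @cell R m) (x y : pt) t : ref_cell K x -> ref_cell K y ->
  0 <= t -> t <= 1 -> ref_cell K (t *: x + (1 - t) *: y).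
Proof.
move=> Kx Ky t0 t1; have t1' : 0 <= 1 - t by rewrite subr_ge0.
case: K Kx Ky => v /=.
  move=> [x0 xs] [y0 ys]; split => [j|]; first by rewrite !mxE addr_ge0// mulr_ge0.
  under eq_bigr do rewrite !mxE; rewrite big_split/= -!mulr_sumr.
  apply: (@le_trans _ _ (t * 1 + (1 - t) * 1)); last by rewrite !mulr1 addrC subrK.
  by rewrite lerD// ler_wpM2l.
move=> x01 y01 j; have /andP[h1 h2] := x01 j; have /andP[h3 h4] := y01 j.
rewrite !mxE addr_ge0 ?mulr_ge0//=.
apply: (@le_trans _ _ (t * 1 + (1 - t) * 1)); last by rewrite !mulr1 addrC subrK.
by rewrite lerD// ler_wpM2l.
Qed.

(* The closed ball around a convex combination with the barycentric point. *)
Lemma ref_cell_ball (K : @cell R m) (x : pt) (e : R) : (0 < m)%N -> ref_cell K x ->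
  0 <= e -> e <= 1 ->
  exists c : pt, forall y, `|y - c| <= e / (2 * m%:R) ->
    ref_cell K y /\ `|y - x| <= 2 * e.
Proof.
move=> m0 Kx e0 e1; have mR : 0 < m%:R :> R by rewrite ltr0n.
(* A perturbation of size [e b] around [(1 - e) x + e b] leaves each coordinate nonnegative and adds
   at most [2 e b m = e] to the coordinate sum [1 - e]. *)
pose b : R := (2 * m%:R)^-1.
have b0 : 0 < b by rewrite invr_gt0 mulr_gt0.
have b1 : b <= 2^-1.
  rewrite lef_pV2 ?posrE ?mulr_gt0//.
  by rewrite ler_peMr// ler1n.
have e1' : 0 <= 1 - e by rewrite subr_ge0.
exists ((1 - e) *: x + e *: const_mx b) => y; rewrite -/b => yc.
have yj j : `|y ord0 j - ((1 - e) * x ord0 j + e * b)| <= e * b.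
  by have := le_trans (coord_le_norm _ j) yc; rewrite !mxE.
have eb0 : 0 <= e * b by rewrite mulr_ge0// ltW.
have x01 := ref_cell_cube Kx.
split; last first.
  apply: norm_le_coord => [|j]; first by rewrite mulr_ge0.
  have := yj j; rewrite !mxE ler_norml => /andP[h1 h2].
  have /andP[h3 h4] := x01 j.
  have h5 : e * b <= e * 2^-1 by rewrite ler_wpM2l.
  have h6 : 0 <= e * x ord0 j by rewrite mulr_ge0.
  have h7 : e * x ord0 j <= e by rewrite ler_piMr.
  by rewrite ler_norml; apply/andP; split; lra.
case: K Kx => v /=.
  move=> [x0 xs]; split => [j|].
    have := yj j; rewrite ler_norml => /andP[h1 h2].
    have h6 : 0 <= (1 - e) * x ord0 j by rewrite mulr_ge0.
    lra.
  apply: (@le_trans _ _ (\sum_j ((1 - e) * x ord0 j + 2 * (e * b)))).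
    apply: ler_sum => j _; have := yj j; rewrite ler_norml => /andP[h1 h2].
    lra.
  rewrite big_split/= -mulr_sumr sumr_const card_ord -[_ *+ m]mulr_natr.
  have -> : 2 * (e * b) * m%:R = e.
    by rewrite /b; field; rewrite gt_eqF.
  have : (1 - e) * \sum_i x ord0 i <= 1 - e by rewrite ler_piMr.
  lra.
move=> _ j; have := yj j; rewrite ler_norml => /andP[h1 h2].
have /andP[h3 h4] := x01 j.
have h5 : e * b <= e * 2^-1 by rewrite ler_wpM2l.
have h6 : 0 <= (1 - e) * x ord0 j by rewrite mulr_ge0.
have h7 : (1 - e) * x ord0 j <= 1 - e by rewrite ler_piMr.
by apply/andP; split; lra.
Qed.

End reference_polynomials.

(** * Cell maps *)

Section secant_maps.
Context {R : realType} {m : nat}.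
Local Notation pt := 'rV[R]_m.

Definition mxbound (A : 'M[R]_m) : R := \sum_i \sum_j `|A i j|.

Lemma mxbound_ge0 A : 0 <= mxbound A.
Proof. by do 2 (apply: sumr_ge0 => ? _). Qed.

Lemma norm_mulmx_le (w : pt) (A : 'M[R]_m) : `|w *m A| <= mxbound A * `|w|.
Proof.
apply: norm_le_coord => [|j]; first by rewrite mulr_ge0 ?mxbound_ge0.
rewrite mxE; apply: le_trans (ler_norm_sum _ _ _) _.
rewrite /mxbound mulr_suml; apply: ler_sum => i _.
rewrite normrM mulrC; apply: ler_pM => //; last exact: coord_le_norm.
by rewrite (bigD1 j)//= lerDl; apply: sumr_ge0.
Qed.

Lemma expanding_unitmx (A : 'M[R]_m) (kap : R) : 0 < kap ->
  (forall w : pt, kap * `|w| <= `|w *m A|) -> A \in unitmx.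
Proof.
move=> k0 Ak; rewrite -row_free_unit -kermx_eq0.
apply/eqP/row_matrixP => i; rewrite row0.
have kA : row i (kermx A) *m A = 0 by apply/sub_kermxP; exact: row_sub.
have := Ak (row i (kermx A)); rewrite kA normr0 pmulr_rle0// => H.
by apply/eqP; rewrite -normr_le0.
Qed.

(* [J] gives the secants of [F]: for an affine map it is constant, and for a
   quadratic map it is the Jacobian matrix, evaluated at the midpoint. *)
Definition secant (F : pt -> pt) (J : pt -> 'M[R]_m) (C0 : R) :=
  (forall x y, F x - F y = (x - y) *m J (2^-1 *: (x + y))) /\
  (forall z s w : pt, `|w *m J (z + s) - w *m J z| <= C0 * `|s| * `|w|).

Context (F : pt -> pt) (J : pt -> 'M[R]_m) (C0 : R) (FJ : secant F J C0).

Lemma secant_local_lipschitz x y :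
  `|F y - F x| <= (mxbound (J x) + `|C0| * `|y - x|) * `|y - x|.
Proof.
have [FE JL] := FJ.
rewrite FE (_ : 2^-1 *: (y + x) = x + 2^-1 *: (y - x)); last first.
  by apply/rowP => j; rewrite !mxE; field.
rewrite -[_ *m _](subrK ((y - x) *m J x)) mulrDl addrC.
apply: le_trans (ler_normD _ _) _; apply: lerD; first exact: norm_mulmx_le.
apply: le_trans (JL _ _ _) _; apply: ler_wpM2r => //.
rewrite normrZ ger0_norm ?invr_ge0//.
apply: le_trans (ler_norm _) _; rewrite !normrM normr_id.
apply: ler_wpM2l => //; rewrite ger0_norm ?invr_ge0//.
by rewrite ler_piMl// invf_le1// ler1n.
Qed.

Lemma secant_continuous : continuous F.
Proof.
move=> x; apply/(@cvgrPdist_lt _ _ _ _ (nbhs_filter x)) => e e0.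
pose b := mxbound (J x) + `|C0| + 1.
have b0 : 0 < b by rewrite ltr_wpDl// addr_ge0 ?mxbound_ge0.
near=> y.
have yx1 : `|x - y| < 1 by near: y; exact: cvgr_dist_lt.
have yx : `|x - y| < e / b by near: y; apply: cvgr_dist_lt => //; exact: divr_gt0.
rewrite distrC; apply: le_lt_trans (secant_local_lipschitz _ _) _.
rewrite distrC; rewrite ltr_pdivlMr// in yx; apply: le_lt_trans yx.
rewrite mulrC; apply: ler_wpM2l => //; rewrite /b -addrA lerD2l.
have : `|C0| * `|x - y| <= `|C0| by rewrite ler_piMr// ltW.
lra.
Unshelve. all: by end_near. Qed.

Context (S : set pt) (kap : R) (kap0 : 0 < kap).
Context (Smid : forall x y, S x -> S y -> S (2^-1 *: (x + y))).
Context (Jlow : forall z, S z -> forall w : pt, kap * `|w| <= `|w *m J z|).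

(** The secant matrix is [J] at the midpoint, which stays in [S]; no inverse of [F] is involved. *)
Lemma secant_lower x y : S x -> S y -> kap * `|x - y| <= `|F x - F y|.
Proof. by move=> Sx Sy; have [-> _] := FJ; apply: Jlow; exact: Smid. Qed.

(* A minimizer of the distance from [y] to the image of the closed ball is
   interior and hence critical; it attains [y] since [J] is invertible. *)
Lemma secant_ball_image (c : pt) (r : R) : 0 < r ->
  (forall z, `|z - c| <= r -> S z) ->
  forall y, `|y - F c| < kap * r / 2 -> exists z, `|z - c| <= r /\ F z = y.
Proof.
move=> r0 Sball y yc; have [FE JL] := FJ.
pose K := [set z : pt | forall j, z ord0 j \in `[c ord0 j - r, c ord0 j + r]].
have KE z : K z <-> `|z - c| <= r.
  split=> [Kz|zr j].
    apply: norm_le_coord => [|j]; first exact: ltW.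
    by have := Kz j; rewrite !mxE in_itv/= ler_norml => /andP[h1 h2]; apply/andP; split; lra.
  have := le_trans (coord_le_norm _ j) zr; rewrite !mxE in_itv/= ler_norml.
  by move=> /andP[h1 h2]; apply/andP; split; lra.
have cK : compact K.
  by apply: (@rV_compact _ _ (fun j => `[c ord0 j - r, c ord0 j + r]%classic)) => j; exact: segment_compact.
have [z /set_mem/KE zr zmin] : exists2 z, z \in K & forall t, t \in K -> `|F z - y| <= `|F t - y|.
  apply: EVT_min_rV => //.
    by exists c; apply/KE; rewrite subrr normr0 ltW.
  apply: continuous_subspaceT => x.
  apply/(@cvgrPdist_lt _ _ _ _ (nbhs_filter x)) => e e0.
  have /(@cvgrPdist_lt _ _ _ _ (nbhs_filter x))/(_ e e0) := @secant_continuous x.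
  apply: filterS => w; apply: le_lt_trans; apply: le_trans (ler_dist_dist _ _) _.
  by rewrite opprB addrA subrK.
have Fzy : `|F z - y| < kap * r / 2.
  apply: le_lt_trans yc; rewrite [leRHS]distrC; apply: zmin.
  by apply/mem_set/KE; rewrite subrr normr0 ltW.
(* [F z] and [F c] are both within [kap r / 2] of [y], so the lower bound on secants keeps the
   minimizer off the boundary of the ball. *)
have zr' : `|z - c| < r.
  rewrite -(ltr_pM2l kap0); apply: le_lt_trans (secant_lower _ _) _.
  - exact: Sball.
  - by apply: Sball; rewrite subrr normr0 ltW.
  rewrite (_ : F z - F c = (F z - y) + (y - F c)); last by rewrite addrA subrK.
  apply: le_lt_trans (ler_normD _ _) _.
  by have := ltrD Fzy yc; rewrite -splitr.
exists z; split => //; apply/eqP; rewrite -subr_eq0 -normr_le0.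
set d := F z - y in zmin Fzy *; rewrite leNgt; apply/negP => d0.
have uJ : J z \in unitmx by apply: (expanding_unitmx kap0); apply: Jlow; exact: Sball.
(* The Newton direction at [z]: a step [t w] turns the defect [d] into [(1 - t) d] up to order
   [t^2]. *)
pose w := - (d *m invmx (J z)).
have wJ : w *m J z = - d by rewrite /w mulNmx mulmxKV.
pose b := `|C0| * `|w| * `|w| + 1.
have b0 : 0 < b by rewrite ltr_wpDl// !mulr_ge0.
(* The three bounds keep [1 - t] nonnegative, keep the step in the ball, and make the quadratic
   error at most half of the gain [t |d|]. *)
pose t := Num.min 1 (Num.min ((r - `|z - c|) / (`|w| + 1)) (`|d| / b)).
have t0 : 0 < t.
  by rewrite !lt_min ltr01 !divr_gt0// ?subr_gt0// ltr_wpDl.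
have t1 : t <= 1 by rewrite ge_min lexx.
have tr : t * `|w| <= r - `|z - c|.
  have : t <= (r - `|z - c|) / (`|w| + 1) by rewrite !ge_min lexx orbT.
  rewrite ler_pdivlMr; last by rewrite ltr_wpDl.
  by apply: le_trans; rewrite ler_wpM2l ?lerDl// ltW.
have td : t * b <= `|d|.
  have : t <= `|d| / b by rewrite !ge_min lexx !orbT.
  by rewrite ler_pdivlMr.
have Kt : z + t *: w \in K.
  apply/mem_set/KE; rewrite addrAC; apply: le_trans (ler_normD _ _) _.
  by rewrite normrZ gtr0_norm// -lerBrDl.
have := zmin _ Kt; apply/negP; rewrite -ltNge.
have -> : F (z + t *: w) - y = (1 - t) *: d + t *: (w *m J (z + (t / 2) *: w) - w *m J z).
  rewrite -[F (z + _)](subrK (F z)) -addrA -/d FE.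
  rewrite [_ + _ - z]addrAC subrr add0r -scalemxAl.
  rewrite (_ : 2^-1 *: _ = z + (t / 2) *: w); last first.
    by apply/rowP => j; rewrite !mxE; field.
  rewrite wJ opprK; move: (w *m J (z + _)) (d) => q d'.
  by apply/rowP => j; rewrite !mxE; ring.
apply: le_lt_trans (ler_normD _ _) _; rewrite !normrZ (gtr0_norm t0) ger0_norm ?subr_ge0//.
have h : `|w *m J (z + (t / 2) *: w) - w *m J z| <= t / 2 * b.
  apply: le_trans (JL _ _ _) _; rewrite normrZ gtr0_norm ?divr_gt0//.
  apply: (@le_trans _ _ (t / 2 * (`|C0| * `|w| * `|w|))).
    rewrite (_ : C0 * _ * _ = C0 * (t / 2 * `|w| * `|w|)); last by ring.
    rewrite (_ : t / 2 * (`|C0| * _ * _) = `|C0| * (t / 2 * `|w| * `|w|)); last by ring.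
    by rewrite ler_wpM2r ?ler_norm// !mulr_ge0// ltW.
  by rewrite ler_wpM2l ?lerDl// ltW// divr_gt0.
have : t * `|w *m J (z + (t / 2) *: w) - w *m J z| <= t * (`|d| / 2).
  apply: ler_wpM2l; first exact: ltW.
  by apply: le_trans h _; rewrite mulrAC ler_wpM2r// invr_ge0.
have : 0 < t * `|d| by rewrite mulr_gt0.
move=> h1 h2; lra.
Qed.

Definition inner_points : set pt := [set x | exists2 r, 0 < r & forall y, `|y - x| <= r -> S y].

Lemma derivable_big_sum (V : normedModType R) (I : Type) (s : seq I)
    (f : I -> V -> R) (x v : V) :
  (forall i, derivable (f i) x v) ->
  derivable (fun t => \sum_(i <- s) f i t) x v.
Proof.
move=> df; elim: s => [|i s IH].
  by under eq_fun do rewrite big_nil; exact: derivable_cst.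
under eq_fun do rewrite big_cons.
exact: (@derivableD _ _ _ (f i) (fun t => \sum_(i <- s) f i t)).
Qed.

Lemma derivable_big_prod (V : normedModType R) (I : Type) (s : seq I)
    (f : I -> V -> R) (x v : V) :
  (forall i, derivable (f i) x v) ->
  derivable (fun t => \prod_(i <- s) f i t) x v.
Proof.
move=> df; elim: s => [|i s IH].
  by under eq_fun do rewrite big_nil; exact: derivable_cst.
under eq_fun do rewrite big_cons.
exact: (@derivableM _ _ (f i) (fun t => \prod_(i <- s) f i t)).
Qed.

Lemma derivable_quadratic (g : R -> R) (l C d : R) : 0 < d ->
  (forall t, `|t| < d -> `|g t - g 0 - t * l| <= C * t ^+ 2) ->
  derivable g (0 : R) 1.
Proof.
move=> d0 gC; rewrite /derivable; apply/cvg_ex; exists l.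
apply/cvgrPdist_lt => e e0; near=> t.
have t0 : t != 0 by near: t; exact: nbhs_dnbhs_neq.
have td : `|t| < d by near: t; exact: dnbhs0_lt.
have te : `|t| < e / (`|C| + 1).
  by near: t; apply: dnbhs0_lt; rewrite divr_gt0// ltr_wpDl.
rewrite /= /GRing.scale/= mulr1 addr0 distrC.
rewrite (_ : _ - l = (g t - g 0 - t * l) / t); last by rewrite [RHS]mulrBl mulrAC mulfV// mul1r mulrC.
rewrite normrM normfV ltr_pdivrMr ?normr_gt0//.
apply: le_lt_trans (gC t td) _.
rewrite -[t ^+ 2]real_normK ?num_real// expr2 mulrA ltr_pM2r ?normr_gt0//.
apply: le_lt_trans (_ : (`|C| + 1) * `|t| < e); last first.
  by rewrite mulrC -ltr_pdivlMr// ltr_wpDl.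
by apply: ler_wpM2r => //; apply: le_trans (ler_norm _) _; rewrite lerDl.
Unshelve. all: by end_near. Qed.


(* [c] expresses [v \o F] as a polynomial; the preimage of the segment
   [x + t e] under [F] is a curve with a derivative at [t = 0]. *)
Lemma secant_derivable (k : nat) (v : pt -> R) (c : {ffun 'I_m -> 'I_k.+1} -> R) :
  (forall z, S z -> v (F z) = \sum_al c al * monomial al z) ->
  forall x e, inner_points x -> derivable v (F x) e.
Proof.
move=> vF x e xin; have [r r0 Sr] := xin; have [FE JL] := FJ.
have Sx : S x by apply: Sr; rewrite subrr normr0 ltW.
have uJ : J x \in unitmx by apply: (expanding_unitmx kap0); exact: Jlow.
pose d := (kap * r / 2) / (`|e| + 1).
have e1 : 0 < `|e| + 1 by rewrite ltr_wpDl.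
have d0 : 0 < d by rewrite !divr_gt0// mulr_gt0.
(* [d] keeps [F x + t e] in the ball covered by [secant_ball_image]; for larger [t] the point is a
   dummy. *)
have pre t : exists z, `|t| < d -> S z /\ F z = F x + t *: e.
  have [td|td] := ltP `|t| d; last by exists x.
  have [z [zr Fz]] : exists z, `|z - x| <= r /\ F z = F x + t *: e.
    apply: (secant_ball_image r0 Sr); rewrite addrAC subrr add0r normrZ.
    rewrite ltr_pdivlMr// in td; apply: le_lt_trans td.
    by rewrite ler_wpM2l// lerDl.
  by exists z => _; split => //; exact: Sr.
pose ga t := projT1 (cid (pre t)).
have gaP t : `|t| < d -> S (ga t) /\ F (ga t) = F x + t *: e := projT2 (cid (pre t)).
have ga_le t : `|t| < d -> kap * `|ga t - x| <= `|t| * `|e|.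
  move=> /gaP[Sg Fg]; apply: le_trans (secant_lower Sg Sx) _.
  by rewrite Fg addrAC subrr add0r normrZ.
have ga0 : ga 0 = x.
  have := ga_le 0; rewrite normr0 mul0r => /(_ d0).
  by rewrite pmulr_rle0// normr_le0 subr_eq0 => /eqP.
(* The velocity of the preimage curve at 0, from differentiating [F (ga t) = F x + t e]; [C] bounds
   the quadratic remainder. *)
pose l := e *m invmx (J x).
pose C := mxbound (invmx (J x)) * (`|C0| * (`|e| / kap) ^+ 2).
have gaC t : `|t| < d -> `|ga t - x - t *: l| <= C * t ^+ 2.
  move=> td; have [Sg Fg] := gaP t td; have gl := ga_le t td.
  have {}gl : `|ga t - x| <= `|t| * (`|e| / kap).
    by rewrite mulrA ler_pdivlMr// mulrC.
  set h := ga t - x in gl *.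
  have hE : h *m J (x + 2^-1 *: h) = t *: e.
    have := FE (ga t) x; rewrite Fg addrAC subrr add0r => ->.
    by congr (_ *m J _); apply/rowP => j; rewrite !mxE; field.
  have -> : h - t *: l = - ((h *m J (x + 2^-1 *: h) - h *m J x) *m invmx (J x)).
    by rewrite mulmxBl mulmxK// hE -scalemxAl -/l opprB.
  rewrite normrN; apply: le_trans (norm_mulmx_le _ _) _.
  rewrite /C -mulrA; apply: ler_wpM2l; first exact: mxbound_ge0.
  apply: le_trans (JL _ _ _) _; rewrite normrZ gtr0_norm ?invr_gt0//.
  apply: (@le_trans _ _ (`|C0| * (`|h| * `|h|))).
    rewrite -mulrA; apply: (@le_trans _ _ (`|C0| * (2^-1 * `|h| * `|h|))).
      by rewrite ler_wpM2r ?ler_norm// !mulr_ge0.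
    rewrite ler_wpM2l// -mulrA ler_piMl ?mulr_ge0// invf_le1// ler1n//.
  rewrite -mulrA ler_wpM2l// -[t ^+ 2]real_normK ?num_real// -exprMn -expr2.
  by rewrite lerXn2r ?nnegrE// 1?mulrC// mulr_ge0// divr_ge0// ltW.
have dg j : derivable (fun t => ga t ord0 j) (0 : R) 1.
  apply: (@derivable_quadratic _ (l ord0 j) C d) => // t td.
  have := le_trans (coord_le_norm _ j) (gaC t td).
  by rewrite !mxE ga0.
pose g t := \sum_al c al * monomial al (ga t).
have dgg : derivable g (0 : R) 1.
  apply: derivable_big_sum => al.
  apply: (@derivableM _ _ (fun=> c al) (fun t => monomial al (ga t))).
    exact: derivable_cst.
  apply: derivable_big_prod => j.
  have -> : (fun t => ga t ord0 j ^+ al j) = (fun t => \prod_(i < al j) ga t ord0 j).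
    by apply/funext => t; rewrite prodr_const card_ord.
  by apply: derivable_big_prod => _; exact: dg.
move: dgg; rewrite /derivable => /cvg_ex[L gL]; apply/cvg_ex; exists L.
apply: cvg_trans gL; apply: near_eq_cvg; near=> t.
have td : `|t| < d by near: t; exact: dnbhs0_lt.
have [Sg Fg] := gaP t td.
rewrite /= /g [t *: 1]mulr1 addr0 -!vF ?ga0//.
by rewrite Fg [F x + _]addrC.
Unshelve. all: by end_near. Qed.

End secant_maps.

(** * Cell boundaries are null sets *)

Section null_boundary.
Context {R : realType} {n : nat}.
Local Notation pt := 'rV[R]_n.+1.

Lemma secant_face_null (F : pt -> pt) (J : pt -> 'M[R]_n.+1) (C0 : R)
    (T : 'rV[R]_n -> pt) (L B : R) : secant F J C0 -> 0 <= L ->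
  (forall x y, `|T x - T y| <= L * `|x - y|) ->
  (forall x, unit_cube x -> `|T x| <= B) ->
  exists N, [/\ measurable N, lebesgue_rV n.+1 N = 0%E &
    forall x, unit_cube x -> N (F (T x))].
Proof.
move=> [FE JL] L0 TL TB.
apply: (@lipschitz_face_null R n (F \o T) ((mxbound (J 0) + `|C0| * B) * L)) => x y x1 y1.
have B0 : 0 <= B by apply: le_trans (TB _ x1).
rewrite /= FE -[_ *m _](subrK ((T x - T y) *m J 0)) -mulrA mulrDl addrC.
have b0 := mxbound_ge0 (J 0).
apply: le_trans (ler_normD _ _) _; apply: lerD.
  by apply: le_trans (norm_mulmx_le _ _) _; rewrite ler_wpM2l.
have := JL 0 (2^-1 *: (T x + T y)) (T x - T y); rewrite add0r => /le_trans; apply.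
have mid : `|2^-1 *: (T x + T y)| <= B.
  rewrite normrZ gtr0_norm ?invr_gt0//.
  have := le_trans (ler_normD (T x) (T y)) (lerD (TB _ x1) (TB _ y1)).
  lra.
apply: (@le_trans _ _ (`|C0| * `|2^-1 *: (T x + T y)| * `|T x - T y|)).
  by rewrite !ler_wpM2r ?ler_norm.
by apply: ler_pM => //; rewrite ?mulr_ge0 ?ler_wpM2l.
Qed.

Definition insert_coord (j : 'I_n.+1) (c : R) (y : 'rV[R]_n) : pt :=
  \row_k (if unlift j k is Some k' then y ord0 k' else c).

(** The slanted face of the reference simplex as a graph over its first coordinates; [insert_coord]
    parametrizes the other faces of the simplex and those of the cube. *)
Definition complete_sum (y : 'rV[R]_n) : pt :=
  \row_k (if unlift ord_max k is Some k' then y ord0 k' else 1 - \sum_l y ord0 l).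

Lemma unit_cube_norm (y : 'rV[R]_n) : unit_cube y -> `|y| <= 1.
Proof.
move=> y01; apply: norm_le_coord => // j.
by have /andP[h1 h2] := y01 j; rewrite ger0_norm.
Qed.

Lemma sum_coord_le (y : 'rV[R]_n) : `|\sum_l y ord0 l| <= n%:R * `|y|.
Proof.
apply: le_trans (ler_norm_sum _ _ _) _.
apply: (@le_trans _ _ (\sum_(l < n) `|y|)).
  by apply: ler_sum => l _; exact: coord_le_norm.
by rewrite sumr_const card_ord mulr_natl.
Qed.

Lemma not_inner_ref (K : @cell R n.+1) (x : pt) :
  ref_cell K x -> ~ inner_points (ref_cell K) x ->
  (exists j, x ord0 j = 0 \/ x ord0 j = 1) \/ \sum_j x ord0 j = 1.
Proof.
move=> Kx; apply: contra_notP => /not_orP[/forallNP h hs].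
have x01 := ref_cell_cube Kx.
have x0 j : 0 < x ord0 j.
  have /andP[+ _] := x01 j; rewrite le_eqVlt => /predU1P[x0|//].
  by exfalso; apply: (h j); left.
have x1 j : x ord0 j < 1.
  have /andP[_ +] := x01 j; rewrite le_eqVlt => /predU1P[x0'|//].
  by exfalso; apply: (h j); right.
pose r := \big[Num.min/1]_j Num.min (x ord0 j) (1 - x ord0 j).
have r0 : 0 < r.
  rewrite /r; elim/big_ind : _ => //.
    by move=> a b a0 b0; rewrite lt_min a0.
  by move=> j _; rewrite lt_min x0 subr_gt0 x1.
have rj j : r <= Num.min (x ord0 j) (1 - x ord0 j) by exact: bigmin_le_cond.
have near_cube y : `|y - x| <= r -> unit_cube y.
  move=> yr j; have := le_trans (coord_le_norm _ j) yr.
  have := rj j; rewrite !mxE le_min ler_norml => /andP[h1 h2] /andP[h3 h4].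
  by apply/andP; split; lra.
case: K Kx {x01} => v /=; last by move=> _; exists r.
move=> [_ xs].
have xs' : \sum_j x ord0 j < 1 by rewrite lt_neqAle xs andbT; apply/eqP.
pose r' := Num.min r ((1 - \sum_j x ord0 j) / n.+1%:R).
exists r'; first by rewrite lt_min r0 divr_gt0// subr_gt0.
move=> y; rewrite le_min => /andP[yr ys]; split.
  by move=> j; have /andP[] := near_cube y yr j.
rewrite (_ : \sum_j y ord0 j = \sum_j x ord0 j + \sum_j (y - x) ord0 j); last first.
  by rewrite -big_split/=; apply: eq_bigr => j _; rewrite !mxE addrC subrK.
rewrite -lerBrDl; apply: (@le_trans _ _ (\sum_(j < n.+1) `|y - x|)).
  by apply: ler_sum => j _; apply: le_trans (ler_norm _) (coord_le_norm _ _).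
rewrite sumr_const card_ord -mulr_natr.
by rewrite ler_pdivlMr// in ys.
Qed.

(** Every point of the reference cell that is not inner lies on a coordinate face or on the slanted
    face, and the image of each under the cell map is part of a Lipschitz image of a cube of one
    dimension less. *)
Lemma cell_boundary_null (K : @cell R n.+1) (J : pt -> 'M[R]_n.+1) (C0 : R) :
  secant (cell_map K) J C0 ->
  exists N, [/\ measurable N, lebesgue_rV n.+1 N = 0%E &
    forall x, ref_cell K x -> ~ inner_points (ref_cell K) x -> N (cell_map K x)].
Proof.
move=> sJ.
have H1 (jb : 'I_n.+1 * bool) : exists N, [/\ measurable N, lebesgue_rV n.+1 N = 0%E &
    forall x, unit_cube x -> N (cell_map K (insert_coord jb.1 jb.2%:R x))].
  apply: (@secant_face_null _ _ _ _ 1 1 sJ) => // [x y|x x01].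
    rewrite mul1r; apply: norm_le_coord => // k; rewrite !mxE.
    case: (unlift jb.1 k) => [k'|]; last by rewrite subrr normr0.
    by have := coord_le_norm (x - y) k'; rewrite !mxE.
  apply: norm_le_coord => // k; rewrite !mxE.
  case: (unlift jb.1 k) => [k'|].
    by apply: le_trans (coord_le_norm _ _) (unit_cube_norm x01).
  by case: jb.2; rewrite ?normr1 ?normr0.
have [N2 [mN2 N20 H2]] : exists N, [/\ measurable N, lebesgue_rV n.+1 N = 0%E &
    forall x, unit_cube x -> N (cell_map K (complete_sum x))].
  apply: (@secant_face_null _ _ _ _ (1 + n%:R) (1 + n%:R) sJ) => //.
    move=> x y; apply: norm_le_coord => [|k]; first by rewrite mulr_ge0.
    rewrite !mxE; case: (unlift ord_max k) => [k'|].
      apply: (@le_trans _ _ `|x - y|); first by have := coord_le_norm (x - y) k'; rewrite !mxE.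
      by rewrite ler_peMl// lerDl.
    rewrite opprB addrC addrA subrK -sumrB.
    have := sum_coord_le (y - x); rewrite distrC => h.
    apply: le_trans (_ : n%:R * `|x - y| <= _); last by rewrite ler_wpM2r// lerDr.
    by apply: le_trans h; rewrite le_eqVlt; apply/orP; left; apply/eqP; congr `|_|; apply: eq_bigr => l _; rewrite !mxE.
  move=> x x01; apply: norm_le_coord => [|k]; first by rewrite addr_ge0.
  rewrite !mxE; case: (unlift ord_max k) => [k'|].
    apply: le_trans (coord_le_norm _ _) _; apply: le_trans (unit_cube_norm x01) _.
    by rewrite lerDl.
  apply: le_trans (ler_normB _ _) _; rewrite normr1 lerD2l.
  apply: le_trans (sum_coord_le _) _; rewrite ler_piMr//; exact: unit_cube_norm.
have [N1 N1P] := choice H1.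
exists (N2 `|` \big[setU/set0]_jb N1 jb); split.
- apply: measurableU => //; apply: bigsetU_measurable => jb _.
  by have [] := N1P jb.
- apply/eqP; rewrite eq_le measure_ge0 andbT.
  apply: le_trans (measureU2 _ mN2 _) _.
    by apply: bigsetU_measurable => jb _; have [] := N1P jb.
  rewrite [X in (X + _)%E](_ : _ = 0%E)// add0e.
  apply: le_trans (measure_bigsetU_le _ _ _) _; first by move=> jb; have [] := N1P jb.
  by rewrite big1// => jb _; have [_ + _] := N1P jb.
move=> x Kx /(not_inner_ref Kx) [[j xj]|xs].
  right; rewrite -bigcup_seq.
  pose bb := x ord0 j == 1.
  have xb : x ord0 j = bb%:R.
    by rewrite /bb; case: xj => ->; rewrite ?eqxx// eq_sym oner_eq0.
  exists (j, bb); first by rewrite /= mem_index_enum.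
  have [_ _ /(_ (\row_k x ord0 (lift j k)))] := N1P (j, bb).
  rewrite (_ : insert_coord _ _ _ = x).
    apply => k; rewrite mxE; exact: (ref_cell_cube Kx).
  apply/rowP => k; rewrite mxE /=; case: unliftP => [k'|] ->; first by rewrite mxE.
  by rewrite xb.
left; have := H2 (\row_k x ord0 (lift ord_max k)).
rewrite (_ : complete_sum _ = x).
  by apply => k; rewrite mxE; exact: (ref_cell_cube Kx).
apply/rowP => k; rewrite mxE /=; case: unliftP => [k'|] ->; first by rewrite mxE.
rewrite -xs big_ord_recr/= addrC -addrA [X in _ + X](_ : _ = 0) ?addr0//.
apply/eqP; rewrite subr_eq0; apply/eqP; apply: eq_bigr => l _; rewrite mxE.
by congr (x ord0 _); apply: val_inj; rewrite /= /bump leqNgt ltn_ord.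
Qed.

End null_boundary.

(** * Diameters, inscribed balls and the expansion of affine maps *)

Section cell_size.
Context {R : realType} {m : nat}.
Local Notation pt := 'rV[R]_m.
Implicit Types (x y : pt) (A : set pt) (K : @cell R m).

Lemma norm_le_enorm x : `|x| <= enorm x.
Proof.
apply: norm_le_coord => [|j]; first exact: sqrtr_ge0.
rewrite -[leLHS]sqrtr_sqr /enorm /dot ler_sqrt ?sumr_ge0//.
  by rewrite (bigD1 j)//= -expr2 lerDl sumr_ge0// => i _; rewrite -expr2 sqr_ge0.
by move=> i _; rewrite -expr2 sqr_ge0.
Qed.

Lemma enorm_le_norm x : enorm x <= m%:R * `|x|.
Proof.
rewrite -[leRHS]ger0_norm ?mulr_ge0// -sqrtr_sqr /enorm ler_sqrt ?sqr_ge0// /dot.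
apply: (@le_trans _ _ (\sum_(j < m) `|x| ^+ 2)).
  apply: ler_sum => j _; rewrite -expr2 -[leLHS]real_normK ?num_real//.
  by rewrite lerXn2r ?nnegrE// coord_le_norm.
rewrite sumr_const card_ord exprMn -[_ *+ m]mulr_natl ler_wpM2r ?sqr_ge0//.
by rewrite -natrX ler_nat; rewrite -mulnn; case: (m) => // k; rewrite leq_pmulr.
Qed.

Lemma carrier_bounded K : exists B, forall x, carrier K x -> `|x| <= B.
Proof.
case: K => v.
  exists (`|v ord0| + \sum_j `|v (lift ord0 j) - v ord0|) => _ [z Kz <-].
  apply: le_trans (ler_normD _ _) _; rewrite lerD2l.
  apply: le_trans (ler_norm_sum _ _ _) _; apply: ler_sum => j _.
  have /andP[h1 h2] := ref_cell_cube Kz j.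
  by rewrite normrZ ger0_norm// ler_piMl.
exists (\sum_a `|v a|) => _ [z Kz <-].
apply: le_trans (ler_norm_sum _ _ _) _; apply: ler_sum => a _.
rewrite normrZ ler_piMl// normr_prod; apply: prodr_ile1 => j _.
rewrite normr_ge0/=; have /andP[h1 h2] := Kz j.
by case: (a j); rewrite ger0_norm ?subr_ge0// gerBl.
Qed.

Lemma diam_ub K x y : carrier K x -> carrier K y -> enorm (x - y) <= diam (carrier K).
Proof.
move=> Kx Ky; apply: ub_le_sup; last by exists x, y.
have [B KB] := carrier_bounded K.
exists (m%:R * (B + B)) => _ [a [b [Ka Kb ->]]].
apply: le_trans (enorm_le_norm _) _; rewrite ler_wpM2l//.
by apply: le_trans (ler_normB _ _) _; rewrite lerD ?KB.
Qed.

Lemma diam_le A c : A !=set0 -> (forall x y, A x -> A y -> enorm (x - y) <= c) ->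
  diam A <= c.
Proof.
move=> [a Aa] Ac; apply: ge_sup; first by exists (enorm (a - a)), a, a.
by move=> _ [x [y [Ax Ay ->]]]; exact: Ac.
Qed.

(** The supremum need not be attained, so half of the diameter is given up; diameter [r / 2] is
    radius [r / 4]. *)
Lemma inball_exists A r : 0 < r -> r <= inball_diam A ->
  exists c, forall x, enorm (x - c) <= r / 4 -> A x.
Proof.
move=> r0 rA.
have rA' : r / 2 < inball_diam A.
  by apply: lt_le_trans rA; rewrite ltr_pdivrMr// ltr_pMr// ltr1n.
have [|s [s0 [c sc]] rs] := sup_gt _ rA'.
  apply: contrapT => /nonemptyPn H; move: rA; rewrite /inball_diam H sup0.
  by rewrite leNgt r0.
exists c => x xc; apply: sc; rewrite /=; apply: le_trans xc _; lra.
Qed.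

(* The differences of the points of a ball in the simplex are the images of
   vectors of norm at most 1, so that [B] is invertible with small inverse. *)
Lemma simplex_expanding (v : 'I_m.+1 -> pt) (c : pt) (r : R) : (0 < m)%N -> 0 < r ->
  (forall x, enorm (x - c) <= r -> carrier (Simplex v) x) ->
  forall w : pt, r / m%:R * `|w| <= `|w *m (\matrix_(j < m) (v (lift ord0 j) - v ord0))|.
Proof.
move=> m0 r0 ball; set B := \matrix_(j < m) _.
have mR : 0 < m%:R :> R by rewrite ltr0n.
have FB x : cell_map (Simplex v) x = v ord0 + x *m B.
  congr (_ + _); rewrite mulmx_sum_row; apply: eq_bigr => j _.
  by rewrite rowK.
have surj (e : pt) : `|e| <= r / m%:R -> exists2 z : pt, `|z| <= 1 & z *m B = e.
  move=> er.
  have [x Kx Fx] : carrier (Simplex v) (c + e).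
    apply: ball; rewrite addrAC subrr add0r; apply: le_trans (enorm_le_norm _) _.
    by rewrite mulrC -ler_pdivlMr.
  have [y Ky Fy] : carrier (Simplex v) c.
    apply: ball; rewrite subrr; apply: le_trans (enorm_le_norm _) _.
    by rewrite normr0 mulr0 ltW.
  exists (x - y).
    apply: norm_le_coord => // j; rewrite !mxE.
    have /andP[h1 h2] := ref_cell_cube Kx j; have /andP[h3 h4] := ref_cell_cube Ky j.
    by rewrite ler_norml; apply/andP; split; lra.
  rewrite mulmxBl; move: Fx Fy; rewrite !FB => Fx Fy.
  have : c + e - c = (v ord0 + x *m B) - (v ord0 + y *m B) by rewrite Fx Fy.
  by rewrite addrAC subrr add0r opprD addrACA subrr add0r.
have rm : 0 < r / m%:R by rewrite divr_gt0.
have full : row_full B.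
  rewrite -sub1mx; apply/row_subP => i; rewrite rowE mulmx1.
  have [|z _ zB] := surj ((r / m%:R) *: delta_mx ord0 i).
    rewrite normrZ gtr0_norm//; apply: ler_piMr; first exact: ltW.
    apply: norm_le_coord => // j; rewrite mxE.
    by case: (_ && _); rewrite ?normr1 ?normr0.
  apply/submxP; exists ((r / m%:R)^-1 *: z).
  by rewrite -scalemxAl zB scalerA mulVf ?scale1r// gt_eqF.
have uB : B \in unitmx by rewrite -row_full_unit.
move=> w; have [->|w0] := eqVneq w 0; first by rewrite normr0 mulr0.
set u := w *m B.
have u0 : 0 < `|u|.
  rewrite normr_gt0; apply: contra_neq w0 => u0.
  by rewrite -[w](mulmxK uB) -/u u0 mul0mx.
have [|z z1 zB] := surj ((r / m%:R / `|u|) *: u).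
  by rewrite normrZ gtr0_norm; [rewrite mulfVK// gt_eqF|exact: divr_gt0].
have zw : z = (r / m%:R / `|u|) *: w.
  by rewrite -[z](mulmxK uB) zB -scalemxAl mulmxK.
move: z1; rewrite zw normrZ gtr0_norm ?divr_gt0//.
by rewrite mulrAC ler_pdivrMr// mul1r.
Qed.

End cell_size.

(** * Simplices and parallelepipeds *)

Section affine_cells.
Context {R : realType} {m : nat}.
Local Notation pt := 'rV[R]_m.

Definition edge_mx (v0 : pt) (d : 'I_m -> pt) : 'M[R]_m := \matrix_(j < m) (d j - v0).

Lemma affine_secant (v0 : pt) (B : 'M[R]_m) (F : pt -> pt) :
  (forall x, F x = v0 + x *m B) -> secant F (fun=> B) 0.
Proof.
move=> FE; split => [x y|z s w].
  by rewrite !FE opprD addrACA subrr add0r mulmxBl.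
by rewrite subrr normr0 !mul0r.
Qed.

Lemma simplex_affine (v : 'I_m.+1 -> pt) (x : pt) :
  cell_map (Simplex v) x = v ord0 + x *m edge_mx (v ord0) (v \o lift ord0).
Proof.
by congr (_ + _); rewrite mulmx_sum_row; apply: eq_bigr => j _; rewrite rowK.
Qed.

Definition cube_weight (x : pt) (a : {ffun 'I_m -> bool}) : R :=
  \prod_j (if a j then x ord0 j else 1 - x ord0 j).

Lemma cube_weight_ge0 x a : unit_cube x -> 0 <= cube_weight x a.
Proof.
move=> x01; apply: prodr_ge0 => j _; have /andP[h1 h2] := x01 j.
by case: (a j) => //; rewrite subr_ge0.
Qed.

Lemma sum_cube_weight x : \sum_a cube_weight x a = 1.
Proof.
rewrite -(bigA_distr_bigA (fun j (b : bool) => if b then x ord0 j else 1 - x ord0 j)).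
by rewrite big1// => j _; rewrite big_bool/= addrC subrK.
Qed.

Lemma sum_cube_weight_coord x j :
  \sum_(a : {ffun 'I_m -> bool} | a j) cube_weight x a = x ord0 j.
Proof.
rewrite big_mkcond/=.
rewrite (eq_bigr (fun a : {ffun 'I_m -> bool} => \prod_l (if a l then x ord0 l
   else if l == j then 0 else 1 - x ord0 l))); last first.
  move=> a _; case: ifPn => aj.
    apply: eq_bigr => l _; case: ifP => // al.
    by case: eqP => // lj; move: al; rewrite lj aj.
  by rewrite (bigD1 j)//= (negPf aj) eqxx mul0r.
rewrite -(bigA_distr_bigA (fun l (b : bool) => if b then x ord0 l else if l == j then 0 else 1 - x ord0 l)).
rewrite (bigD1 j)//= big_bool/= eqxx addr0 big1 ?mulr1// => l lj.
by rewrite big_bool/= (negPf lj) addrC subrK.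
Qed.

(** The multilinear map is a weighted mean of the vertices. Each vertex is the origin vertex plus
    its edges, and the vertices using edge [j] have total weight [x_j]. *)
Lemma parallelepiped_affine (v : {ffun 'I_m -> bool} -> pt) (x : pt) :
  is_parallelepiped v -> cell_map (Cube v) x =
  v [ffun=> false] + x *m edge_mx (v [ffun=> false]) (fun j => v [ffun l => l == j]).
Proof.
move=> par; rewrite /cell_map -/(cube_weight x _).
transitivity (\sum_a cube_weight x a *: (v [ffun=> false] +
    \sum_(j | a j) (v [ffun l => l == j] - v [ffun=> false]))).
  by apply: eq_bigr => a _; rewrite -par.
under eq_bigr do rewrite scalerDr; rewrite big_split/= -scaler_suml sum_cube_weight scale1r.
congr (_ + _); rewrite mulmx_sum_row.
transitivity (\sum_(a : {ffun 'I_m -> bool}) \sum_j (if a j then cube_weight x a *: row j (edge_mx (v [ffun=> false]) (fun j => v [ffun l => l == j])) else 0)).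
  apply: eq_bigr => a _; rewrite scaler_sumr big_mkcond/=; apply: eq_bigr => j _.
  by rewrite rowK.
rewrite exchange_big; apply: eq_bigr => j _.
by rewrite -big_mkcond/= -scaler_suml sum_cube_weight_coord.
Qed.

Lemma ref_corner (a : {ffun 'I_m -> bool}) (v : {ffun 'I_m -> bool} -> pt) :
  ref_cell (Cube v) (\row_j (a j)%:R).
Proof. by move=> j; rewrite mxE; case: (a j); rewrite ?lexx ?ler01. Qed.

Lemma cell_map_vertex (a : {ffun 'I_m -> bool}) (v : {ffun 'I_m -> bool} -> pt) :
  cell_map (Cube v) (\row_j (a j)%:R) = v a.
Proof.
rewrite /= (bigD1 a)//= [X in X *: _]big1 => [|j _]; last first.
  by rewrite mxE; case: (a j); rewrite ?subr0.
rewrite scale1r big1 ?addr0// => b ba.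
have [j bj] : exists j, b j != a j.
  apply/existsP; apply: contraNT ba; rewrite negb_exists => /forallP h.
  by apply/eqP/ffunP => j; apply/eqP; rewrite -[_ == _]negbK.
rewrite (bigD1 j)//= mxE; move: bj; case: (a j); case: (b j) => //= _.
  by rewrite subrr mul0r scale0r.
by rewrite mul0r scale0r.
Qed.

End affine_cells.

(** * Bilinear maps onto quadrilaterals *)

Section quadrilaterals.
Context {R : realType}.
Local Notation pt := 'rV[R]_2.
Local Notation i0 := (ord0 : 'I_2).
Local Notation i1 := (lift ord0 ord0 : 'I_2).

Lemma big_I2 (V : nmodType) (F : 'I_2 -> V) : \sum_j F j = F i0 + F i1.
Proof. by rewrite big_ord_recl big_ord_recl big_ord0 addr0. Qed.

Lemma norm_I2 (w : pt) c : 0 <= c -> `|w ord0 i0| <= c -> `|w ord0 i1| <= c -> `|w| <= c.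
Proof.
move=> c0 w0 w1; apply: norm_le_coord => // j.
by case: (unliftP i0 j) => [j'|] ->; rewrite ?(ord1 j').
Qed.

Definition pair_ffun (b0 b1 : bool) : {ffun 'I_2 -> bool} :=
  [ffun l => if l == i0 then b0 else b1].

Lemma pair_ffun0 b0 b1 : pair_ffun b0 b1 i0 = b0. Proof. by rewrite ffunE. Qed.
Lemma pair_ffun1 b0 b1 : pair_ffun b0 b1 i1 = b1. Proof. by rewrite ffunE. Qed.

Lemma big_pair_ffun (V : nmodType) (G : {ffun 'I_2 -> bool} -> V) :
  \sum_a G a = G (pair_ffun true true) + G (pair_ffun true false)
             + (G (pair_ffun false true) + G (pair_ffun false false)).
Proof.
rewrite (reindex (fun b : bool * bool => pair_ffun b.1 b.2)); last first.
  exists (fun a : {ffun 'I_2 -> bool} => (a i0, a i1)) => [[b0 b1] _|a _]; first by rewrite pair_ffun0 pair_ffun1.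
  apply/ffunP => l; case: (unliftP i0 l) => [j|] ->; last by rewrite pair_ffun0.
  by rewrite (ord1 j) pair_ffun1.
rewrite -(pair_big xpredT xpredT (fun b0 b1 => G (pair_ffun b0 b1)))/=.
by rewrite big_bool/= !big_bool.
Qed.

Context (v : {ffun 'I_2 -> bool} -> pt).
Local Notation V b0 b1 := (v (pair_ffun b0 b1)).

Lemma quad_mapE (x : pt) k : cell_map (Cube v) x ord0 k =
  x ord0 i0 * x ord0 i1 * V true true ord0 k
  + x ord0 i0 * (1 - x ord0 i1) * V true false ord0 k
  + (1 - x ord0 i0) * x ord0 i1 * V false true ord0 k
  + (1 - x ord0 i0) * (1 - x ord0 i1) * V false false ord0 k.
Proof.
rewrite /= big_pair_ffun !mxE !big_ord_recl !big_ord0 !ffunE/=.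
by rewrite !mulr1; ring.
Qed.

Definition quad_jac (z : pt) : 'M[R]_2 := \matrix_(i, k)
  if i == i0 then (1 - z ord0 i1) * (V true false ord0 k - V false false ord0 k)
                + z ord0 i1 * (V true true ord0 k - V false true ord0 k)
  else (1 - z ord0 i0) * (V false true ord0 k - V false false ord0 k)
                + z ord0 i0 * (V true true ord0 k - V true false ord0 k).

Lemma quad_jacE z (w : pt) k : (w *m quad_jac z) ord0 k =
  w ord0 i0 * ((1 - z ord0 i1) * (V true false ord0 k - V false false ord0 k)
                + z ord0 i1 * (V true true ord0 k - V false true ord0 k))
  + w ord0 i1 * ((1 - z ord0 i0) * (V false true ord0 k - V false false ord0 k)
                + z ord0 i0 * (V true true ord0 k - V true false ord0 k)).
Proof. by rewrite mxE big_I2 !mxE. Qed.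

Lemma quad_secant : exists C0, secant (cell_map (Cube v)) quad_jac C0.
Proof.
(* The coefficient of [x0 x1] in the cell map, through which alone the Jacobian matrix varies. *)
pose D := V true true - V true false - V false true + V false false.
exists (2 * `|D|); split => [x y|z s w].
  apply/rowP => k; rewrite quad_jacE [LHS]mxE [X in _ + X]mxE !quad_mapE !mxE.
  by field.
have H k : `|(w *m quad_jac (z + s) - w *m quad_jac z) ord0 k| <= 2 * `|D| * `|s| * `|w|.
  rewrite mxE [X in _ + X]mxE !quad_jacE.
  rewrite (_ : _ - _ = (w ord0 i0 * s ord0 i1 + w ord0 i1 * s ord0 i0) * D ord0 k); last first.
    by rewrite !mxE; ring.
  rewrite normrM (_ : 2 * _ * _ * _ = (`|w| * `|s| + `|w| * `|s|) * `|D|); last by ring.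
  apply: ler_pM => //; last exact: coord_le_norm.
  apply: le_trans (ler_normD _ _) _; rewrite !normrM.
  by apply: lerD; apply: ler_pM => //; exact: coord_le_norm.
by apply: norm_le_coord => [|k]; rewrite ?H// !mulr_ge0.
Qed.

Definition quad_det (z : pt) : R :=
  quad_jac z i0 i0 * quad_jac z i1 i1 - quad_jac z i0 i1 * quad_jac z i1 i0.

Definition vertex (b0 b1 : bool) : pt := \row_j (pair_ffun b0 b1 j)%:R.

Lemma quad_det_weights z : quad_det z =
  (1 - z ord0 i0) * (1 - z ord0 i1) * quad_det (vertex false false)
  + (1 - z ord0 i0) * z ord0 i1 * quad_det (vertex false true)
  + z ord0 i0 * (1 - z ord0 i1) * quad_det (vertex true false)
  + z ord0 i0 * z ord0 i1 * quad_det (vertex true true).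
Proof. by rewrite /quad_det !mxE !ffunE/=; ring. Qed.

(** The rows of [quad_jac] have the form [a + z1 D] and [b + z0 D] with the same vector [D], so the
    quadratic term of the determinant vanishes. *)
Lemma quad_det_affine (z z' : pt) t :
  quad_det (t *: z + (1 - t) *: z') = t * quad_det z + (1 - t) * quad_det z'.
Proof. by rewrite /quad_det !mxE /=; ring. Qed.

(** Cramer's rule, with the entries of the adjugate bounded by [mxbound A]. *)
Lemma jac_det_inverse (A : 'M[R]_2) (w : pt) :
  `|A i0 i0 * A i1 i1 - A i0 i1 * A i1 i0| * `|w| <= 2 * mxbound A * `|w *m A|.
Proof.
set d := A i0 i0 * _ - _; set u := w *m A.
have uE k : u ord0 k = w ord0 i0 * A i0 k + w ord0 i1 * A i1 k by rewrite mxE big_I2.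
have Ab i j : `|A i j| <= mxbound A.
  rewrite /mxbound (bigD1 i)//= (bigD1 j)//= -addrA lerDl addr_ge0 ?sumr_ge0//.
  by move=> i' _; rewrite sumr_ge0.
have b0 := mxbound_ge0 A.
have [->|dn0] := eqVneq d 0; first by rewrite normr0 mul0r !mulr_ge0.
have dp : 0 < `|d| by rewrite normr_gt0.
rewrite mulrC -ler_pdivlMr//.
have H a a' k k' (x : R) : d * x = u ord0 k * a + u ord0 k' * a' ->
    `|a| <= mxbound A -> `|a'| <= mxbound A -> `|x| <= 2 * mxbound A * `|u| / `|d|.
  move=> dx ha ha'; rewrite ler_pdivlMr// mulrC -normrM dx.
  apply: le_trans (ler_normD _ _) _; rewrite !normrM.
  rewrite (_ : 2 * _ * _ = `|u| * mxbound A + `|u| * mxbound A); last by ring.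
  by apply: lerD; apply: ler_pM => //; exact: coord_le_norm.
apply: norm_I2; first by rewrite !mulr_ge0// invr_ge0.
- by apply: (H (A i1 i1) (- A i1 i0) i0 i1); rewrite ?normrN// !uE /d; ring.
- by apply: (H (- A i0 i1) (A i0 i0) i0 i1); rewrite ?normrN// !uE /d; ring.
Qed.

(** The rows of the adjugate are mapped to [d] times unit vectors, so [kap] times an entry of [A] is
    at most [|d|]; and the first row of [A], as the image of a unit vector, has norm at least
    [kap]. *)
Lemma expanding_det (A : 'M[R]_2) (kap : R) : 0 <= kap ->
  (forall w : pt, kap * `|w| <= `|w *m A|) ->
  kap ^+ 2 <= `|A i0 i0 * A i1 i1 - A i0 i1 * A i1 i0|.
Proof.
move=> k0 Ak; set d := A i0 i0 * _ - _.
pose mk (a b : R) : pt := \row_j (if j == i0 then a else b).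
have mkE a b k : (mk a b *m A) ord0 k = a * A i0 k + b * A i1 k.
  by rewrite mxE big_I2 !mxE.
have H a b i j : (mk a b *m A) ord0 i0 = (i == i0)%:R * d ->
   (mk a b *m A) ord0 i1 = (i != i0)%:R * d -> mk a b ord0 j = mk a b ord0 j ->
   kap * `|mk a b ord0 j| <= `|d|.
  move=> h0 h1 _; apply: le_trans (_ : kap * `|mk a b| <= _).
    by rewrite ler_wpM2l// coord_le_norm.
  apply: le_trans (Ak _) _; apply: norm_I2 => //.
    by rewrite h0; case: (_ == _); rewrite ?mul1r ?mul0r ?normr0.
  by rewrite h1; case: (_ == _); rewrite ?mul1r ?mul0r ?normr0.
have a11 : kap * `|A i1 i1| <= `|d|.
  have := H (A i1 i1) (- A i0 i1) i0 i0; rewrite !mkE !mxE/=; apply => //; rewrite /d; ring.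
have a01 : kap * `|A i0 i1| <= `|d|.
  have := H (A i1 i1) (- A i0 i1) i0 i1; rewrite !mkE !mxE/= normrN; apply => //; rewrite /d; ring.
have k1 : kap <= `|(mk 1 0 *m A)|.
  have := Ak (mk 1 0); suff -> : `|mk 1 0| = 1 by rewrite mulr1.
  apply/le_anti/andP; split.
    by apply: norm_I2 => //; rewrite !mxE/= ?normr1 ?normr0.
  by have := coord_le_norm (mk 1 0) i0; rewrite !mxE/= normr1.
have a00 : kap * `|A i0 i0| <= `|d|.
  have := H (- A i1 i0) (A i0 i0) i1 i1; rewrite !mkE !mxE/=; apply => //; rewrite /d; ring.
rewrite expr2; apply: le_trans (_ : kap * `|mk 1 0 *m A| <= _).
  by rewrite ler_wpM2l.
have [->|kn0] := eqVneq kap 0; first by rewrite mul0r.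
have kp : 0 < kap by rewrite lt_neqAle eq_sym kn0.
rewrite mulrC -ler_pdivlMr//; apply: norm_I2; first by rewrite divr_ge0.
  by rewrite mkE mul1r mul0r addr0 ler_pdivlMr// mulrC.
by rewrite mkE mul1r mul0r addr0 ler_pdivlMr// mulrC.
Qed.

Context (inj : {in ref_cell (Cube v) &, injective (cell_map (Cube v))}).

(* Where the Jacobian is singular, two points symmetric to each other have the
   same image. *)
Lemma quad_det_neq0 (z : pt) : (forall j, 0 < z ord0 j < 1) -> quad_det z != 0.
Proof.
move=> z01; apply/negP => /eqP dz.
have [C0 [FE _]] := quad_secant.
have [w w0 wJ] : exists2 w : pt, w != 0 & w *m quad_jac z = 0.
  pose mk (a b : R) : pt := \row_j (if j == i0 then a else b).
  set A := quad_jac z in dz *; rewrite /quad_det -/A in dz.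
  have mkE a b : a * A i0 i0 + b * A i1 i0 = 0 -> a * A i0 i1 + b * A i1 i1 = 0 ->
      mk a b *m A = 0.
    move=> h0 h1; apply/rowP => k; rewrite mxE big_I2 [mk _ _ _ _]mxE [mk _ _ _ _]mxE [RHS]mxE/=.
    by case: (unliftP i0 k) => [k'|] ->; rewrite ?(ord1 k').
  have mk0 a b : mk a b = 0 -> a = 0 /\ b = 0.
    by move=> /rowP h; have := h i0; have := h i1; rewrite !mxE.
  (* For a singular [A] the rows of the adjugate are in the kernel; if both vanish, then [A = 0] and
     any vector will do. *)
  have [w1|w1] := eqVneq (mk (A i1 i1) (- A i0 i1)) 0; last first.
    by exists (mk (A i1 i1) (- A i0 i1)) => //; apply: mkE; [rewrite -dz; ring|ring].
  have [w2|w2] := eqVneq (mk (- A i1 i0) (A i0 i0)) 0; last first.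
    by exists (mk (- A i1 i0) (A i0 i0)) => //; apply: mkE; [ring|rewrite -dz; ring].
  have [a11 /eqP a01] := mk0 _ _ w1; have [/eqP a10 a00] := mk0 _ _ w2.
  rewrite !oppr_eq0 in a01 a10.
  exists (mk 1 0); last by apply: mkE; rewrite ?a00 ?(eqP a01) mulr0 mul0r addr0.
  by apply/eqP => /mk0[/eqP]; rewrite oner_eq0.
pose r := Num.min (Num.min (z ord0 i0) (1 - z ord0 i0)) (Num.min (z ord0 i1) (1 - z ord0 i1)).
have r0 : 0 < r.
  have /andP[h1 h2] := z01 i0; have /andP[h3 h4] := z01 i1.
  by rewrite !lt_min h1 h3 !subr_gt0 h2 h4.
have wp : 0 < `|w| by rewrite normr_gt0.
pose t := r / `|w|.
have t0 : 0 < t by rewrite divr_gt0.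
have tw j : `|t * w ord0 j| <= r.
  rewrite normrM gtr0_norm// /t mulrAC ler_pdivrMr//.
  by apply: ler_wpM2l; [exact: ltW|exact: coord_le_norm].
have inref (s : R) : `|s| = 1 -> ref_cell (Cube v) (z + (s * t) *: w).
  move=> s1 j; rewrite !mxE.
  have : `|s * t * w ord0 j| <= Num.min (z ord0 j) (1 - z ord0 j).
    rewrite -mulrA normrM s1 mul1r; apply: le_trans (tw j) _.
    by case: (unliftP i0 j) => [j'|] ->; rewrite ?(ord1 j') /r ge_min lexx ?orbT.
  by rewrite le_min !ler_norml => /andP[/andP[h1 h2] /andP[h3 h4]]; apply/andP; split; lra.
have h1 := inref 1 (normr1 _); have h2 := inref (-1) (normrN1 _).
have : cell_map (Cube v) (z + (1 * t) *: w) - cell_map (Cube v) (z + (-1 * t) *: w) = 0.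
  rewrite FE (_ : 2^-1 *: _ = z); last by apply/rowP => j; rewrite !mxE; field.
  rewrite (_ : _ - _ = (2 * t) *: w); last by apply/rowP => j; rewrite !mxE; ring.
  by rewrite -scalemxAl wJ scaler0.
move/eqP; rewrite subr_eq0 => /eqP /(inj (mem_set h1) (mem_set h2)).
move/eqP; rewrite -subr_eq0 (_ : _ - _ = (2 * t) *: w); last by apply/rowP => j; rewrite !mxE; ring.
by rewrite scaler_eq0 mulf_eq0 pnatr_eq0/= (gt_eqF t0)/= (negPf w0).
Qed.

(** [quad_det_neq0] concerns interior points only. Opposite signs at two corners would persist after
    moving both slightly towards the centre, and on the segment between the new points the affine
    determinant would have an interior zero. *)
Lemma quad_det_same_sign b0 b1 c0 c1 :
  0 <= quad_det (vertex b0 b1) * quad_det (vertex c0 c1).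
Proof.
rewrite leNgt; apply/negP => neg.
wlog bp : b0 b1 c0 c1 neg / 0 < quad_det (vertex b0 b1).
  move=> H; have [b|] := ltP 0 (quad_det (vertex b0 b1)); first exact: (H b0 b1 c0 c1).
  rewrite le_eqVlt => /predU1P[b|b]; first by move: neg; rewrite b mul0r ltxx.
  apply: (H c0 c1 b0 b1); first by rewrite mulrC.
  by rewrite -(nmulr_rlt0 _ b).
have cn : quad_det (vertex c0 c1) < 0 by rewrite -(pmulr_rlt0 _ bp).
pose ce : pt := const_mx 2^-1.
have near (x y : R) : 0 < x -> exists2 e, 0 < e < 1 & 0 < (1 - e) * x + e * y.
  move=> x0; pose e := x / (2 * (x + `|y|)).
  have xy : 0 < x + `|y| by rewrite ltr_wpDr.
  have ee : e * (x + `|y|) = x / 2 by rewrite /e; field; rewrite gt_eqF.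
  have e0 : 0 < e by rewrite divr_gt0// mulr_gt0.
  exists e.
    rewrite e0/= /e ltr_pdivrMr ?mulr_gt0// mul1r.
    have := normr_ge0 y; lra.
  have : - (e * `|y|) <= e * y 
    by rewrite -mulrN; apply: ler_wpM2l; [exact: ltW|rewrite lerNl -normrN ler_norm].
  lra.
have [e /andP[e0 e1] pe] := near _ (quad_det ce) bp.
have cn' : 0 < - quad_det (vertex c0 c1) by rewrite oppr_gt0.
have [e' /andP[e0' e1'] pe'] := near _ (- quad_det ce) cn'.
pose P := (1 - e) *: vertex b0 b1 + (1 - (1 - e)) *: ce.
pose Q := (1 - e') *: vertex c0 c1 + (1 - (1 - e')) *: ce.
have dP : 0 < quad_det P by rewrite quad_det_affine (_ : 1 - (1 - e) = e)//; ring.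
have dQ : quad_det Q < 0.
  by rewrite quad_det_affine (_ : 1 - (1 - e') = e'); [lra|ring].
have inner d0 d1 s : 0 < s -> s < 1 ->
    forall j, 0 < ((1 - s) *: vertex d0 d1 + (1 - (1 - s)) *: ce) ord0 j < 1.
  move=> s0 s1 j; rewrite !mxE.
  by case: (pair_ffun d0 d1 j) => /=; apply/andP; split; lra.
have Pin := inner b0 b1 _ e0 e1; have Qin := inner c0 c1 _ e0' e1'.
pose s := - quad_det Q / (quad_det P - quad_det Q).
have den : 0 < quad_det P - quad_det Q by lra.
have s0 : 0 < s by rewrite divr_gt0// oppr_gt0.
have s1 : s < 1 by rewrite ltr_pdivrMr// mul1r; lra.
have : quad_det (s *: P + (1 - s) *: Q) = 0.
  by rewrite quad_det_affine /s; field; rewrite gt_eqF.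
apply/eqP/quad_det_neq0 => j; rewrite mxE [X in X + _]mxE [X in _ + X]mxE.
have /andP[h1 h2] := Pin j; have /andP[h3 h4] := Qin j.
rewrite -/P in h1 h2; rewrite -/Q in h3 h4.
have s1' : 0 < 1 - s by rewrite subr_gt0.
apply/andP; split; first by rewrite addr_gt0// mulr_gt0.
apply: lt_le_trans (_ : s * 1 + (1 - s) * 1 <= _); last by rewrite !mulr1 addrC subrK.
by rewrite ltrD// ltr_pM2l.
Qed.

(** At a corner the rows of the Jacobian matrix are, up to sign, the two edges leaving it, which
    ties the determinant to the corner triangle of the shape regularity condition. *)
Lemma quad_corner_jac (b0 b1 : bool) : exists s0 s1 : R, [/\ `|s0| = 1, `|s1| = 1 &
  forall w : pt, w *m quad_jac (vertex b0 b1) =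
   (\row_j ((if j == i0 then s0 else s1) * w ord0 j)) *m
   edge_mx (v (pair_ffun b0 b1)) (fun j => v [ffun l => if l == j then ~~ pair_ffun b0 b1 l else pair_ffun b0 b1 l])].
Proof.
have flip0 : [ffun l => if l == i0 then ~~ pair_ffun b0 b1 l else pair_ffun b0 b1 l] = pair_ffun (~~ b0) b1.
  by apply/ffunP => l; rewrite !ffunE; case: (l == i0).
have flip1 : [ffun l => if l == i1 then ~~ pair_ffun b0 b1 l else pair_ffun b0 b1 l] = pair_ffun b0 (~~ b1).
  apply/ffunP => l; rewrite !ffunE.
  by case: (unliftP i0 l) => [l'|] ->; rewrite ?(ord1 l').
exists (if b0 then -1 else 1), (if b1 then -1 else 1); split.
- by case: b0 {flip0 flip1}; rewrite ?normrN1 ?normr1.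
- by case: b1 {flip0 flip1}; rewrite ?normrN1 ?normr1.
move=> w; apply/rowP => k; rewrite quad_jacE [RHS]mxE big_I2 !mxE/= flip0 flip1 !ffunE/=.
by case: b0 {flip0 flip1}; case: b1; rewrite /=; ring.
Qed.

(** The corner determinants have one sign and modulus at least [kap^2], and so do their convex
    combinations. The four entries of the matrix are at most [h], so Cramer's rule loses
    [2 * 4 h = 8 h]. *)
Lemma quad_expanding (kap h : R) : 0 < kap -> 0 < h ->
  (forall b0 b1 (w : pt), kap * `|w| <= `|w *m edge_mx (v (pair_ffun b0 b1))
     (fun j => v [ffun l => if l == j then ~~ pair_ffun b0 b1 l else pair_ffun b0 b1 l])|) ->
  (forall a b, `|v a - v b| <= h) ->
  forall z, unit_cube z -> forall w : pt,
    kap ^+ 2 / (8 * h) * `|w| <= `|w *m quad_jac z|.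
Proof.
move=> k0 h0 Hk Hh z z01 w.
have corner b0 b1 : kap ^+ 2 <= `|quad_det (vertex b0 b1)|.
  apply: expanding_det; first exact: ltW.
  have [s0 [s1 [s01 s11 sE]]] := quad_corner_jac b0 b1.
  move=> u; rewrite sE; apply: le_trans (Hk _ _ _).
  apply: ler_wpM2l; first exact: ltW.
  apply: norm_le_coord => // j; have := coord_le_norm (\row_j ((if j == i0 then s0 else s1) * u ord0 j)) j.
  by rewrite mxE normrM; case: (j == i0); rewrite ?s01 ?s11 mul1r.
have det_z : kap ^+ 2 <= `|quad_det z|.
  have kp : 0 < kap ^+ 2 by rewrite exprn_gt0.
  have /andP[h1 h2] := z01 i0; have /andP[h3 h4] := z01 i1.
  have h2' : 0 <= 1 - z ord0 i0 by rewrite subr_ge0.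
  have h4' : 0 <= 1 - z ord0 i1 by rewrite subr_ge0.
  have q0 := corner false false.
  have [q|q] := ltP 0 (quad_det (vertex false false)).
    have pos b0 b1 : kap ^+ 2 <= quad_det (vertex b0 b1).
      have := quad_det_same_sign false false b0 b1; rewrite pmulr_rge0// => qq.
      by have := corner b0 b1; rewrite ger0_norm.
    apply: le_trans (ler_norm _); rewrite quad_det_weights.
    have := ler_wpM2l (mulr_ge0 h2' h4') (pos false false).
    have := ler_wpM2l (mulr_ge0 h2' h3) (pos false true).
    have := ler_wpM2l (mulr_ge0 h1 h4') (pos true false).
    have := ler_wpM2l (mulr_ge0 h1 h3) (pos true true).
    by move: (kap ^+ 2) => kk; lra.
  have q' : quad_det (vertex false false) < 0.
    rewrite lt_neqAle q andbT; apply/eqP => q00; move: q0; rewrite q00 normr0.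
    by rewrite leNgt kp.
  have pos b0 b1 : kap ^+ 2 <= - quad_det (vertex b0 b1).
    have := quad_det_same_sign false false b0 b1; rewrite nmulr_rge0// => qq.
    by have := corner b0 b1; rewrite ler0_norm.
  rewrite -normrN; apply: le_trans (ler_norm _); rewrite quad_det_weights.
  have := ler_wpM2l (mulr_ge0 h2' h4') (pos false false).
  have := ler_wpM2l (mulr_ge0 h2' h3) (pos false true).
  have := ler_wpM2l (mulr_ge0 h1 h4') (pos true false).
  have := ler_wpM2l (mulr_ge0 h1 h3) (pos true true).
  by move: (kap ^+ 2) => kk; lra.
have Jb : mxbound (quad_jac z) <= 4 * h.
  have Je i j : `|quad_jac z i j| <= h.
    have comb t (x y : R) : 0 <= t <= 1 -> `|x| <= h -> `|y| <= h -> `|(1 - t) * x + t * y| <= h.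
      move=> /andP[t0 t1] hx hy; apply: le_trans (ler_normD _ _) _.
      rewrite !normrM (ger0_norm t0) (@ger0_norm _ (1 - t)) ?subr_ge0//.
      have := ler_wpM2l t0 hy; have t1' : 0 <= 1 - t by rewrite subr_ge0.
      by have := ler_wpM2l t1' hx; lra.
    have dv a b k : `|v a ord0 k - v b ord0 k| <= h.
      by have := le_trans (coord_le_norm _ k) (Hh a b); rewrite !mxE.
    by rewrite mxE; case: (i == i0); apply: comb.
  rewrite /mxbound !big_I2.
  have := Je i0 i0; have := Je i0 i1; have := Je i1 i0; have := Je i1 i1; lra.
have := jac_det_inverse (quad_jac z) w; rewrite -/(quad_det z) => H.
rewrite mulrAC ler_pdivrMr ?mulr_gt0//.
apply: le_trans (ler_wpM2r (normr_ge0 _) det_z) _; apply: le_trans H _.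
rewrite mulrC; apply: ler_wpM2l => //.
by rewrite (_ : 8 * h = 2 * (4 * h)) ?ler_wpM2l//; ring.
Qed.

End quadrilaterals.

(** * Uniform expansion of shape-regular cells *)

Section cell_expansion.
Context {R : realType} {m : nat}.
Local Notation pt := 'rV[R]_m.

Lemma diam_gt0 (K : @cell R m) : (0 < m)%N -> cell_wf K -> 0 < diam (carrier K).
Proof.
move=> m0 [inj _ _].
pose x : pt := 0; pose y : pt := delta_mx ord0 (Ordinal m0).
have Kx : ref_cell K x.
  case: K {inj} => v /=; last by move=> j; rewrite mxE lexx ler01.
  split=> [j|]; first by rewrite mxE.
  by rewrite big1// => j _; rewrite mxE.
have Ky : ref_cell K y.
  case: K {inj Kx} => v /=; last first.
    by move=> j; rewrite /y mxE eqxx; case: (j == _); rewrite /= ?ler01 ?lexx ?ler01.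
  split=> [j|]; first by rewrite mxE; case: (_ && _).
  rewrite (bigD1 (Ordinal m0))//= mxE !eqxx big1 ?addr0// => j jm.
  by rewrite mxE (negPf jm) andbF.
have xy : cell_map K x != cell_map K y.
  apply/eqP => /(inj _ _ (mem_set Kx) (mem_set Ky))/rowP/(_ (Ordinal m0)).
  by rewrite !mxE !eqxx => /eqP; rewrite eq_sym oner_eq0.
apply: lt_le_trans (diam_ub _ _); [|by exists x|by exists y].
apply: lt_le_trans (norm_le_enorm _).
by rewrite normr_gt0 subr_eq0.
Qed.

(** The first term is for affine cells: [simplex_expanding] with radius [diam / (4 sigma)], with a
    factor 2 to spare. With [c] this term, the second is [kap^2 / (8 h)] of [quad_expanding] for
    [kap = c diam] and [h = diam], divided by [diam]. *)
Definition expansion_const (sigma : R) : R := Num.min (8 * sigma * m%:R)^-1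
  ((8 * sigma * m%:R)^-1 ^+ 2 / 8).

End cell_expansion.

(** In dimensions 2 and 3 a well-formed cell is affine or a quadrilateral. That [sigma] is positive
    follows from shape regularity, as diameters are positive. *)
Lemma cell_secant (R : realType) (m : nat) (sigma : R) (K : @cell R m) :
  (m == 2) || (m == 3) ->
  cell_wf K -> shape_regular sigma K -> 0 < sigma /\
  exists J C0, secant (cell_map K) J C0 /\
    forall z, ref_cell K z -> forall w : 'rV[R]_m,
      @expansion_const R m sigma * diam (carrier K) * `|w| <= `|w *m J z|.
Proof.
move=> m23 wf reg; have m0 : (0 < m)%N by case: (m) m23.
have dK := diam_gt0 m0 wf.
have mR : 0 < m%:R :> R by rewrite ltr0n.
have sig (A : set 'rV[R]_m) : diam (carrier K) <= sigma * inball_diam A -> 0 < sigma.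
  move=> dA; rewrite ltNge; apply/negP => s0.
  have i0 : 0 <= inball_diam A.
    rewrite /inball_diam; set S := [set r | _].
    have [hs|/sup_out ->//] := pselect (has_sup S).
    have [[r Sr] _] := hs; apply: le_trans (sup_upper_bound hs Sr).
    by have [] := Sr.
  by have := lt_le_trans dK dA; rewrite ltNge mulr_le0_ge0.
have H v (Bm : 'M[R]_m) : diam (carrier K) <= sigma * inball_diam (carrier (Simplex v)) ->
    Bm = edge_mx (v ord0) (v \o lift ord0) ->
    forall w : 'rV[R]_m, (8 * sigma * m%:R)^-1 * diam (carrier K) * `|w| <= `|w *m Bm|.
  move=> dA -> w; have s0 := sig _ dA.
  have r0 : 0 < diam (carrier K) / sigma by rewrite divr_gt0.
  have [|c ball] := @inball_exists _ _ (carrier (Simplex v)) _ r0.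
    by rewrite ler_pdivrMr// mulrC.
  have r40 : 0 < diam (carrier K) / sigma / 4 by rewrite divr_gt0.
  apply: le_trans (simplex_expanding m0 r40 ball w).
  apply: ler_wpM2r => //; rewrite (_ : _ / m%:R = 2 * ((8 * sigma * m%:R)^-1 * diam (carrier K))).
    rewrite ler_peMl ?ler1n// mulr_ge0 ?invr_ge0 ?mulr_ge0// ltW//.
  by field; rewrite !gt_eqF.
have minl (w : 'rV[R]_m) (X : R) : (8 * sigma * m%:R)^-1 * diam (carrier K) * `|w| <= X ->
    @expansion_const R m sigma * diam (carrier K) * `|w| <= X.
  apply: le_trans; apply: ler_wpM2r => //; apply: ler_wpM2r; first exact: ltW.
  by rewrite ge_min lexx.
case: K wf reg dK sig H minl => v wf reg dK sig H minl.
  split; first exact: sig reg.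
  exists (fun=> edge_mx (v ord0) (v \o lift ord0)), 0; split.
    apply: affine_secant => x; exact: simplex_affine.
  by move=> z _ w; apply: minl; apply: H reg _ _.
have s0 : 0 < sigma by exact: sig (reg [ffun=> false]).
split => //.
have Hc a (w : 'rV[R]_m) : (8 * sigma * m%:R)^-1 * diam (carrier (Cube v)) * `|w| <=
    `|w *m edge_mx (v a) (fun j => v [ffun l => if l == j then ~~ a l else a l])|.
  apply: H (reg a) _ w; rewrite /= unlift_none.
  by apply/row_matrixP => j; rewrite !rowK /= liftK.
have [inj _ par] := wf.
have [m3|m2] : (2 < m)%N \/ m = 2%N.
    by case/orP: m23 => /eqP ->; [right|left].
  have {}par := par m3.
  exists (fun=> edge_mx (v [ffun=> false]) (fun j => v [ffun l => l == j])), 0; split.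
    apply: affine_secant => x; exact: parallelepiped_affine.
  move=> z _ w; apply: minl; have := Hc [ffun=> false] w.
  congr (_ <= `|_ *m _|); apply/row_matrixP => j; rewrite !rowK.
  by congr (v _ - _); apply/ffunP => l; rewrite !ffunE; case: eqP.
subst m.
have [C0 sec] := quad_secant v.
exists (quad_jac v), C0; split => // z Kz w.
have k0 : 0 < (8 * sigma * 2%:R)^-1 * diam (carrier (Cube v)).
  by rewrite mulr_gt0// invr_gt0 !mulr_gt0.
apply: le_trans (quad_expanding inj k0 dK (fun b0 b1 => Hc (pair_ffun b0 b1)) _ Kz w).
  apply: ler_wpM2r => //.
  rewrite (_ : _ / (8 * diam _) = (8 * sigma * 2%:R)^-1 ^+ 2 / 8 * diam (carrier (Cube v))).
    apply: ler_wpM2r; first exact: ltW.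
    by rewrite ge_min lexx orbT.
  by field; rewrite !gt_eqF.
move=> a b; apply: le_trans (norm_le_enorm _) _.
by apply: diam_ub; [exists (\row_j (a j)%:R)|exists (\row_j (b j)%:R)];
  rewrite ?cell_map_vertex//; exact: ref_corner.
Qed.

Lemma expansion_const_gt0 (R : realType) (m : nat) (sigma : R) :
  (0 < m)%N -> 0 < sigma -> 0 < @expansion_const R m sigma.
Proof.
move=> m0 s0; have mR : 0 < m%:R :> R by rewrite ltr0n.
by rewrite lt_min divr_gt0 ?exprn_gt0 ?invr_gt0 ?mulr_gt0.
Qed.

(** * Inverse estimates *)

Lemma Rintegral_indic d (T : measurableType d) (R : realType)
    (mu : {measure set T -> \bar R}) (A B : set T) (c : R) :
  measurable A -> measurable B -> (mu A < +oo)%E ->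
  \int[mu]_(x in A) (c * \1_B x) = c * fine (mu (B `&` A)).
Proof.
move=> mA mB Aoo; rewrite RintegralZl//; last first.
  apply: (bounded_meas_integrable mA Aoo); split; first exact: measurable_indic.
  by exists 1 => x _; rewrite indicE; case: (_ \in _); rewrite ?normr1 ?normr0.
by rewrite /Rintegral integral_indic.
Qed.

Lemma bounded_meas_indic d (T : measurableType d) (R : realType) (A B : set T) (c : R) :
  measurable A -> measurable B -> bounded_meas A (fun x => c * \1_B x).
Proof.
move=> mA mB; apply: bounded_measM; first exact: bounded_meas_cst.
split; first exact: measurable_indic.
by exists 1 => x _; rewrite indicE; case: (_ \in _); rewrite ?normr1 ?normr0.
Qed.

(** The balls stand for cells and may overlap: the square is dominated by the sum of all [b K ^+ 2]
    over the balls containing the point. Used for derivatives in the volume and for traces on the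
    interface. *)
Lemma sq_integral_upper (R : realType) m N (A : set 'rV[R]_m) (w : 'rV[R]_m -> R)
    (c : 'I_N -> 'rV[R]_m) (r : R) (b : 'I_N -> R) :
  measurable A -> (@lebesgue_rV R m A < +oo)%E -> bounded_meas A w -> 0 < r ->
  (forall x, A x -> w x != 0 -> exists K, ball (c K) r x /\ `|w x| <= b K) ->
  \int[@lebesgue_rV R m]_(x in A) (w x * w x) <= (2 * r) ^+ m * \sum_K b K ^+ 2.
Proof.
move=> mA Aoo bw r0 wP.
have mB K : measurable (ball (c K) r : set 'rV[R]_m) by exact: measurable_ball_rV.
apply: (@le_trans _ _ (\int[@lebesgue_rV R m]_(x in A)
    \sum_K b K ^+ 2 * \1_(ball (c K) r : set 'rV[R]_m) x)).
  apply: bounded_meas_le_Rintegral => //; first exact: bounded_measM.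
    by apply: bounded_meas_sum => K; exact: bounded_meas_indic.
  move=> x Ax; have s0 K : 0 <= b K ^+ 2 * \1_(ball (c K) r : set 'rV[R]_m) x.
    by rewrite mulr_ge0 ?sqr_ge0// indicE ler0n.
  have [->|/wP[//|K [xK wK]]] := eqVneq (w x) 0; first by rewrite mul0r sumr_ge0.
  rewrite (bigD1 K)//= indicE mem_set// mulr1.
  apply: (@le_trans _ _ (b K ^+ 2)); last by rewrite lerDl sumr_ge0.
  rewrite -expr2 -[leLHS]real_normK ?num_real//; apply: lerXn2r => //.
  by rewrite nnegrE; exact: le_trans wK.
rewrite Rintegral_sum//; last first.
  by move=> K; apply: bounded_meas_integrable => //; exact: bounded_meas_indic.
rewrite mulr_sumr; apply: ler_sum => K _; rewrite Rintegral_indic// mulrC.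
apply: ler_wpM2r; first exact: sqr_ge0.
have -> : (2 * r) ^+ m = fine (@lebesgue_rV R m (ball (c K) r)).
  by rewrite lebesgue_rV_ball.
have BA : (lebesgue_rV m (ball (c K) r `&` A) <= lebesgue_rV m (ball (c K) r))%E.
  by apply: le_measure; rewrite ?inE//; exact: measurableI.
have Boo : (lebesgue_rV m (ball (c K) r : set 'rV[R]_m) < +oo)%E.
  by rewrite lebesgue_rV_ball// ltry.
by apply: fine_le => //; rewrite ge0_fin_numE//; exact: le_lt_trans BA Boo.
Qed.

Section fe_space.
Context {R : realType} {m : nat}.
Local Notation pt := 'rV[R]_m.
Context (k : nat) (tau : @mesh R m) (Z : set pt).
Local Notation idx := {ffun 'I_m -> 'I_k.+1}.
Local Notation D := (\bigcup_K carrier (tau K)).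

Lemma fe_space0 : fe_space k tau Z 0.
Proof.
split => //; first by move=> x; exact: cst_continuous.
move=> K; exists (fun=> 0); split => //.
exists (fun=> 0) => x; rewrite big1// => al _; by rewrite mul0r.
Qed.

Lemma fe_space_lin a u v : fe_space k tau Z u -> fe_space k tau Z v ->
  fe_space k tau Z (a *: u + v).
Proof.
move=> [uc up uZ uD] [vc vp vZ vD]; split.
- move=> x; apply: (@cvgD _ _ _ _ _ (fun x => a * u x) v).
    by apply: cvgM; [exact: cvg_cst|exact: uc].
  exact: vc.
- move=> K; have [p [[c pE] up']] := up K; have [r [[d rE] vr]] := vp K.
  exists (fun x => a * p x + r x); split; last first.
    by move=> x Kx; rewrite !fctE up'// vr.
  exists (fun al => a * c al + d al) => x; rewrite pE rE mulr_sumr -big_split/=.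
  by apply: eq_bigr => al _; rewrite mulrDl mulrA.
- by move=> x Zx; rewrite !fctE uZ// vZ// scaler0 addr0.
- by move=> x Dx; rewrite !fctE uD// vD// scaler0 addr0.
Qed.

(** Only the nodes are inspected; by [markov] this controls [v] on the whole cell up to a
    constant. *)
Definition cell_max (v : pt -> R) K : R :=
  \big[Num.max/0]_(g : idx) `|v (cell_map (tau K) (node g))|.

Lemma cell_max_ge0 v K : 0 <= cell_max v K.
Proof. exact: bigmax_ge_id. Qed.

Lemma cell_max_node v K (g : idx) : `|v (cell_map (tau K) (node g))| <= cell_max v K.
Proof. exact: (le_bigmax 0 (fun g : idx => `|v (cell_map (tau K) (node g))|)). Qed.

Lemma cell_max_attained v K :
  exists g : idx, cell_max v K = `|v (cell_map (tau K) (node g))|.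
Proof.
have [g _ gE] := @eq_bigmax _ _ _ 0 [ffun=> ord0] xpredT
  (fun g : idx => `|v (cell_map (tau K) (node g))|) isT (fun _ _ => normr_ge0 _).
by exists g.
Qed.

Local Notation Cm := (@markov_const R m k).

Lemma fe_cell v K : fe_space k tau Z v ->
  exists p : pt -> R, [/\ ref_poly k (tau K) p,
    forall x, ref_cell (tau K) x -> v (cell_map (tau K) x) = p x,
    forall x, unit_cube x -> `|p x| <= Cm * cell_max v K &
    forall x y, unit_cube x -> unit_cube y -> `|p x - p y| <= Cm * cell_max v K * `|x - y|].
Proof.
move=> [_ vp _ _]; have [p [rp pE]] := vp K; exists p.
have [|h1 h2] := @markov R m k (tau K) p (cell_max v K) rp; last by split.
by move=> g; rewrite -pE; [exact: cell_max_node|exact: node_ref].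
Qed.

Lemma fe_cell_bound v K x : fe_space k tau Z v -> carrier (tau K) x ->
  `|v x| <= Cm * cell_max v K.
Proof.
move=> /(fe_cell K)[p [_ pE pb _]] [z Kz <-].
by rewrite pE//; apply: pb; exact: ref_cell_cube Kz.
Qed.

Lemma fe_eq0 v : fe_space k tau Z v ->
  (forall K, cell_max v K = 0) -> v = 0.
Proof.
move=> fv M0; apply/funext => x; have [Dx|Dx] := pselect (D x); last first.
  by have [_ _ _ ->] := fv.
have [K _ Kx] := Dx; apply/eqP; rewrite -normr_le0.
by have := fe_cell_bound fv Kx; rewrite M0 mulr0.
Qed.

Lemma fe_nodes_eq0 v : fe_space k tau Z v ->
  (forall K (g : idx), v (cell_map (tau K) (node g)) = 0) -> v = 0.
Proof.
move=> fv v0; apply: fe_eq0 => // K.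
by have [g ->] := cell_max_attained v K; rewrite v0 normr0.
Qed.

Lemma fe_bounded v : fe_space k tau Z v -> exists B, forall x, `|v x| <= B.
Proof.
move=> fv; exists (\sum_K Cm * cell_max v K) => x.
have c0 K : 0 <= Cm * cell_max v K.
  by rewrite mulr_ge0 ?cell_max_ge0// ltW// markov_const_gt0.
have [Dx|Dx] := pselect (D x); last first.
  by have [_ _ _ ->] := fv => //; rewrite normr0 sumr_ge0.
have [K _ Kx] := Dx; apply: le_trans (fe_cell_bound fv Kx) _.
by rewrite [leRHS](bigD1 K)//= lerDl sumr_ge0.
Qed.

Lemma fe_measurable v : closed D -> fe_space k tau Z v ->
  measurable_fun [set: pt] v.
Proof. by move=> cD [vc _ _ vD]; exact: measurable_within_closed vc vD. Qed.

Lemma fe_bounded_meas v (A : set pt) : closed D -> fe_space k tau Z v ->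
  bounded_meas A v.
Proof.
move=> cD fv; split; last by have [B vB] := fe_bounded fv; exists B.
by apply: measurable_funTS; exact: fe_measurable.
Qed.

(** The finitely many functionals that [orthonormal_basis] asks for. *)
Definition node_values (v : pt -> R) (i : 'I_#|{: 'I_(ncells tau) * idx}|) : R :=
  v (cell_map (tau (enum_val i).1) (node (enum_val i).2)).

Lemma node_values_eq0 v : fe_space k tau Z v -> (forall i, node_values v i = 0) -> v = 0.
Proof.
move=> fv v0; apply: fe_nodes_eq0 => // K g.
by have := v0 (enum_rank (K, g)); rewrite /node_values enum_rankK.
Qed.

End fe_space.

(** * Inverse inequalities on a regular mesh *)

Section fe_estimates.
Context {R : realType} {n : nat} (hd : (n.+1 == 2) || (n.+1 == 3)).
Local Notation pt := 'rV[R]_n.+1.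
Context (k : nat) (tau : @mesh R n.+1) (Z : set pt) (sigma : R) (O : set pt).
Local Notation D := (\bigcup_K carrier (tau K)).
Local Notation mu := (@lebesgue_rV R n.+1).
Local Notation idx := {ffun 'I_n.+1 -> 'I_k.+1}.
Context (conf : conforming_mesh D tau) (reg : regular_mesh sigma tau).
Context (cD : closed D) (Kn : exists K : 'I_(ncells tau), True).
Context (mO : measurable O) (Ofin : (mu O < +oo)%E) (OD : O `<=` D).
Context (Oball : forall x r, 0 < r -> ball x r `<=` D -> ball x r `<=` O).
Local Notation h := (meshsize tau).
Local Notation Cm := (@markov_const R n.+1 k).

Lemma diam_le_meshsize K : diam (carrier (tau K)) <= h.
Proof. exact: (le_bigmax 0 (fun K => diam (carrier (tau K)))). Qed.

Lemma cells_wf K : cell_wf (tau K). Proof. by have [] := conf. Qed.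

Lemma meshsize_gt0 : 0 < h.
Proof.
have [K _] := Kn; apply: lt_le_trans (diam_le_meshsize K).
exact/diam_gt0/cells_wf.
Qed.

Lemma sigma_gt0 : 0 < sigma.
Proof.
have [K _] := Kn; have [sr _] := reg K.
by have [] := cell_secant hd (cells_wf K) sr.
Qed.

(** Dividing by [sigma] replaces the diameter of the cell by the mesh parameter. *)
Definition expansion : R := @expansion_const R n.+1 sigma / sigma.

Lemma expansion_gt0 : 0 < expansion.
Proof. by rewrite divr_gt0 ?expansion_const_gt0 ?sigma_gt0. Qed.

Local Notation kap := (expansion * h).

Lemma kap_gt0 : 0 < kap. Proof. by rewrite mulr_gt0 ?expansion_gt0 ?meshsize_gt0. Qed.

Lemma mesh_secant K : exists J C0, secant (cell_map (tau K)) J C0 /\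
  forall z, ref_cell (tau K) z -> forall w : pt, kap * `|w| <= `|w *m J z|.
Proof.
have [sr hK] := reg K.
have [_ [J [C0 [sec low]]]] := cell_secant hd (cells_wf K) sr.
exists J, C0; split => // z Kz w; apply: le_trans (low z Kz w).
apply: ler_wpM2r => //; rewrite /expansion -mulrA; apply: ler_wpM2l.
  by rewrite ltW// expansion_const_gt0// sigma_gt0.
by rewrite ler_pdivrMl ?sigma_gt0.
Qed.

Lemma ref_midpoint K (x y : pt) : ref_cell (tau K) x -> ref_cell (tau K) y ->
  ref_cell (tau K) (2^-1 *: (x + y)).
Proof.
move=> Kx Ky; rewrite scalerDr.
have := ref_cell_convex Kx Ky (ltW (_ : 0 < 2^-1)) _.
rewrite (_ : 1 - 2^-1 = 2^-1 :> R); last by field.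
by apply; rewrite ?invr_gt0// invf_le1// ler1n.
Qed.

Lemma mesh_lower K (x y : pt) : ref_cell (tau K) x -> ref_cell (tau K) y ->
  kap * `|x - y| <= `|cell_map (tau K) x - cell_map (tau K) y|.
Proof.
move=> Kx Ky; have [J [C0 [sec low]]] := mesh_secant K.
exact: (secant_lower sec (@ref_midpoint K) low Kx Ky).
Qed.

Lemma fe_lipschitz v K (x y : pt) : fe_space k tau Z v ->
  carrier (tau K) x -> carrier (tau K) y ->
  `|v x - v y| <= Cm * cell_max k v K / kap * `|x - y|.
Proof.
move=> /(fe_cell K)[p [_ pE _ pL]] [a Ka <-] [b Kb <-]; rewrite !pE//.
have Cm0 : 0 <= Cm * cell_max k v K.
  by rewrite mulr_ge0 ?cell_max_ge0// ltW// markov_const_gt0.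
apply: le_trans (pL _ _ (ref_cell_cube Ka) (ref_cell_cube Kb)) _.
rewrite -[leRHS]mulrA; apply: ler_wpM2l => //.
by rewrite ler_pdivlMl ?kap_gt0//; exact: mesh_lower.
Qed.

(** [ref_cell_ball] with [e = 1 / (4 Cm)] gives the reference radius [e / (2 (n+1))], and
    [secant_ball_image] multiplies it by [kap / 2]. *)
Definition core_radius : R := kap / (16 * Cm * n.+1%:R).

Lemma core_radius_gt0 : 0 < core_radius.
Proof. by rewrite divr_gt0 ?kap_gt0// !mulr_gt0// ?markov_const_gt0// ltr0n. Qed.

(** All points of the reference ball are within [2 e = 1 / (2 Cm)] of a node where the maximum is
    attained, so the Lipschitz bound of [markov] loses at most half of it. The ball avoids the node
    itself because the node may lie on the boundary of the cell. *)
Lemma fe_core v K : fe_space k tau Z v -> exists c : pt,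
  ball c core_radius `<=` carrier (tau K) /\
  forall x, ball c core_radius x -> cell_max k v K / 2 <= `|v x|.
Proof.
move=> fv; have [p [_ pE _ pL]] := fe_cell K fv.
have [g gM] := @cell_max_attained R n.+1 k tau v K.
have C0 := @markov_const_gt0 R n.+1 k.
have C1 : 1 <= Cm.
  rewrite /markov_const -addrA lerDl; apply: addr_ge0.
    by apply: mulr_ge0 => //; do 2 (apply: sumr_ge0 => ? _).
  by do 2 (apply: sumr_ge0 => ? _).
pose e := (4 * Cm)^-1.
have e0 : 0 < e by rewrite invr_gt0 mulr_gt0.
have e1 : e <= 1.
  rewrite invf_le1 ?mulr_gt0//; apply: le_trans C1 _.
  by have := C0; lra.
have Kg := @node_ref R n.+1 k (tau K) g.
have [c cP] := @ref_cell_ball R n.+1 (tau K) (node g) e isT Kg (ltW e0) e1.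
have r0 : 0 < e / (2 * n.+1%:R) by rewrite divr_gt0// mulr_gt0// ltr0n.
have [J [C0' [sec low]]] := mesh_secant K.
have img := secant_ball_image sec kap_gt0 (@ref_midpoint K) low r0 (fun z hz => (cP z hz).1).
have rE : core_radius = kap * (e / (2 * n.+1%:R)) / 2.
  rewrite /core_radius /e; field.
  by rewrite (gt_eqF C0) nat1r pnatr_eq0.
exists (cell_map (tau K) c); split => x; rewrite -ball_normE/= distrC rE => /img[z [zr <-]].
  by exists z => //; have [] := cP z zr.
have [Kz zg] := cP z zr; rewrite pE//.
have := pL _ _ (ref_cell_cube Kz) (ref_cell_cube Kg); rewrite -(pE _ Kg).
have := ler_normB (p z) (p z - v (cell_map (tau K) (node g))).
rewrite subKr -gM.
have : Cm * cell_max k v K * `|z - node g| <= Cm * cell_max k v K * (2 * e).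
  by apply: ler_wpM2l => //; rewrite mulr_ge0 ?cell_max_ge0// ltW.
have -> : Cm * cell_max k v K * (2 * e) = cell_max k v K / 2.
  by rewrite /e; field; rewrite gt_eqF.
lra.
Qed.

Lemma sum_indic_disjoint (B : 'I_(ncells tau) -> set pt) (a : 'I_(ncells tau) -> R) (x : pt) (b : R) :
  (forall K K', K != K' -> B K `&` B K' = set0) -> 0 <= b ->
  (forall K, B K x -> a K <= b) -> \sum_K a K * \1_(B K) x <= b.
Proof.
move=> Bd b0 ab; have [[K BK]|nB] := pselect (exists K, B K x).
  rewrite (bigD1 K)//= indicE mem_set// mulr1 big1 ?addr0; first exact: ab.
  move=> K' K'K; rewrite indicE memNset ?mulr0// => BK'.
  by have : (B K' `&` B K) x by []; rewrite Bd.
rewrite big1// => K _; rewrite indicE memNset ?mulr0// => BK.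
by apply: nB; exists K.
Qed.

(** The balls of [fe_core] lie in the interiors of different cells, hence are disjoint, and by
    [Oball] they lie in [O]. *)
Lemma fe_mass_lower v : fe_space k tau Z v ->
  (2 * core_radius) ^+ n.+1 / 4 * (\sum_K (@cell_max R n.+1 k tau v K) ^+ 2) <=
  \int[mu]_(x in O) (v x * v x).
Proof.
move=> fv.
have [c cP] := choice (fun K => @fe_core v K fv).
pose B K : set pt := ball (c K) core_radius.
have mB K : measurable (B K) by exact: measurable_ball_rV.
have BO K : B K `<=` O.
  apply: Oball; first exact: core_radius_gt0.
  by have [h1 _] := cP K; move=> x /h1 Kx; exists K.
have oB K x : B K x -> interior (carrier (tau K)) x.
  move=> Bx; have [h1 _] := cP K; apply: filterS h1 _.
  by apply: open_nbhs_nbhs; split => //; apply: ball_open; exact: core_radius_gt0.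
have Bd K K' : K != K' -> B K `&` B K' = set0.
  move=> KK'; have [_ _ _ /(_ K K' KK')[dis _ _]] := conf.
  by apply/seteqP; split => // x [/oB Bx /oB Bx']; rewrite -dis.
have bv : bounded_meas O v := fe_bounded_meas O cD fv.
pose M := @cell_max R n.+1 k tau v.
have -> : (2 * core_radius) ^+ n.+1 / 4 * (\sum_K M K ^+ 2) =
  \int[mu]_(x in O) (\sum_K (M K ^+ 2 / 4) * \1_(B K) x).
  rewrite Rintegral_sum//; last first.
    by move=> K; apply: bounded_meas_integrable => //; exact: bounded_meas_indic.
  rewrite mulr_sumr; apply: eq_bigr => K _; rewrite Rintegral_indic//.
  have -> : B K `&` O = B K by exact: setIidl (BO K).
  transitivity (M K ^+ 2 / 4 * fine ((2 * core_radius) ^+ n.+1)%:E); first by rewrite /=; ring.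
  by congr (_ * fine _); apply/esym; exact: lebesgue_rV_ball core_radius_gt0.
apply: bounded_meas_le_Rintegral => //.
- by apply: bounded_meas_sum => K; exact: bounded_meas_indic.
- exact: bounded_measM.
move=> x Ox; apply: sum_indic_disjoint => //; first by rewrite -expr2 sqr_ge0.
move=> K Bx; have [_ /(_ x Bx)] := cP K; rewrite -/(M K) => Mv.
rewrite -expr2 -[leRHS]real_normK ?num_real//.
have -> : M K ^+ 2 / 4 = (M K / 2) ^+ 2 by rewrite expr_div_n -natrX.
by apply: lerXn2r => //; rewrite nnegrE// divr_ge0// cell_max_ge0.
Qed.

(** Images of inner reference points rather than interiors of the cells: both differentiability and
    the null boundary are obtained in reference coordinates. *)
Definition mesh_interior : set pt :=
  \bigcup_K cell_map (tau K) @` inner_points (ref_cell (tau K)).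
Local Notation G := mesh_interior.

Lemma mesh_interior_ball K z : inner_points (ref_cell (tau K)) z ->
  exists2 e, 0 < e & ball (cell_map (tau K) z) e `<=`
    cell_map (tau K) @` inner_points (ref_cell (tau K)).
Proof.
move=> [r r0 rP]; have [J [C0 [sec low]]] := mesh_secant K.
have r2 : 0 < r / 2 by rewrite divr_gt0.
have zr y : `|y - z| <= r / 2 -> ref_cell (tau K) y.
  by move=> yz; apply: rP; apply: le_trans yz _; lra.
exists (kap * (r / 2) / 2); first by rewrite divr_gt0// mulr_gt0// kap_gt0.
move=> y; rewrite -ball_normE/= distrC.
move=> /(secant_ball_image sec kap_gt0 (@ref_midpoint K) low r2 zr)[w [wz <-]].
exists w => //; exists (r / 2) => // y' yw; apply: rP.
have -> : y' - z = (y' - w) + (w - z) by rewrite addrA subrK.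
by apply: le_trans (ler_normD _ _) _; lra.
Qed.

Lemma measurable_mesh_interior : measurable G.
Proof.
apply: open_measurable_rV; rewrite openE => x [K _ [z Kz <-]].
have [e e0 eG] := mesh_interior_ball Kz.
by apply/nbhs_ballP; exists e => //= y /eG Gy; exists K.
Qed.

Lemma mesh_interior_ae : exists N, [/\ measurable N, mu N = 0%E &
  forall x, D x -> ~ N x -> G x].
Proof.
have NP K : exists N, [/\ measurable N, mu N = 0%E &
    forall x, ref_cell (tau K) x -> ~ inner_points (ref_cell (tau K)) x ->
    N (cell_map (tau K) x)].
  have [J [C0 [sec low]]] := mesh_secant K; exact: cell_boundary_null sec.
have [N NK] := choice NP.
have mN K : measurable (N K) by case: (NK K).
exists (\big[setU/set0]_K N K); split.
- by apply: bigsetU_measurable => K _.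
- apply/le_anti; rewrite measure_ge0 andbT.
  apply: le_trans (measure_bigsetU_le _ _ _) _ => //.
  by rewrite big1// => K _; case: (NK K).
move=> x [K _ [z Kz <-]] nN; exists K => //; exists z => //.
apply: contrapT => nz; apply: nN; rewrite -bigcup_seq; exists K => /=.
  by rewrite mem_index_enum.
by have [_ _] := NK K; apply.
Qed.

Lemma fe_derivable v x e : fe_space k tau Z v -> G x -> derivable v x e.
Proof.
move=> fv [K _ [z Kz <-]]; have [p [/ref_poly_monomials[c pE] vE _ _]] := fe_cell K fv.
have [J [C0 [sec low]]] := mesh_secant K.
by apply: (secant_derivable sec kap_gt0 (@ref_midpoint K) low (c := c)) Kz => y Ky; rewrite vE.
Qed.

(* The partial derivatives, cut off at the cell boundaries where they need not
   exist. *)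
Definition cell_pd j v : pt -> R := fun x => \1_G x * pd j v x.

Lemma cell_pdE j v x : G x -> cell_pd j v x = pd j v x.
Proof. by move=> Gx; rewrite /cell_pd indicE mem_set// mul1r. Qed.

Lemma cell_pd0 j v x : ~ G x -> cell_pd j v x = 0.
Proof. by move=> Gx; rewrite /cell_pd indicE memNset// mul0r. Qed.

Lemma cell_pd_lin j a u v : fe_space k tau Z u -> fe_space k tau Z v ->
  cell_pd j (a *: u + v) = a *: cell_pd j u + cell_pd j v.
Proof.
move=> fu fv; apply/funext => x; rewrite !fctE.
have [Gx|Gx] := pselect (G x); last by rewrite !cell_pd0// scaler0 addr0.
rewrite !cell_pdE// /pd deriveD ?deriveZ//; try exact: fe_derivable.
by apply: derivableZ; exact: fe_derivable.
Qed.

(** A pointwise limit of measurable difference quotients, with the steps [1/(a+1)]. *)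
Lemma measurable_cell_pd j v : fe_space k tau Z v -> measurable_fun [set: pt] (cell_pd j v).
Proof.
move=> fv; pose e : pt := delta_mx ord0 j.
pose q (h : R) : pt -> R := fun x => h^-1 * (v (x + h *: e) - v x).
apply: (measurable_fun_cvg (h := fun a x => \1_G x * q (harmonic a) x)).
  move=> a; apply: measurable_funM; first by apply: measurable_indic; exact: measurable_mesh_interior.
  have mv := fe_measurable cD fv.
  apply: measurable_funM; first exact: measurable_cst.
  apply: measurable_funB => //.
  by apply: (measurableT_comp mv); exact: measurable_shift.
move=> x _; have [Gx|Gx] := pselect (G x); last first.
  rewrite cell_pd0// indicE memNset//.
  by under eq_fun do rewrite mul0r; exact: cvg_cst.
rewrite cell_pdE// indicE mem_set//.
under eq_fun do rewrite mul1r.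
have dv : q h x @[h --> 0^'] --> pd j v x.
  have := @fe_derivable v x e fv Gx; rewrite /derivable /pd /derive -/e.
  suff -> : (fun h => h^-1 *: ((v \o shift x) (h *: e) - v x)) = (fun h => q h x) by [].
  by apply/funext => h /=; rewrite /q [x + _]addrC.
have [/(_ dv) dq _] := @cvgr_dnbhsP R (fun h => q h x) 0 (pd j v x).
apply: dq; split; last exact: cvg_harmonic.
by move=> a; rewrite /= invr_eq0 pnatr_eq0.
Qed.

(** A neighbourhood of the point lies in one cell, so its difference quotients obey the Lipschitz
    bound of that cell. *)
Lemma cell_pd_bound j v x : fe_space k tau Z v -> cell_pd j v x != 0 ->
  exists K, carrier (tau K) x /\
    `|cell_pd j v x| <= Cm / kap * @cell_max R n.+1 k tau v K.
Proof.
move=> fv; have [Gx _|Gx] := pselect (G x); last by rewrite cell_pd0 ?eqxx.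
rewrite cell_pdE//; have [K _ [z Kz zx]] := Gx; exists K.
have [e e0 eG] := mesh_interior_ball Kz; rewrite zx in eG.
have eK y : ball x e y -> carrier (tau K) y.
  by move=> /eG[w [r r0 rw] <-]; exists w => //; apply: rw; rewrite subrr normr0 ltW.
have Kx : carrier (tau K) x by apply: eK; exact: ballxx.
split => //; pose d : pt := delta_mx ord0 j.
have d1 : `|d| <= 1.
  apply: norm_le_coord => // l; rewrite mxE eqxx/=.
  by case: eqP => _; rewrite ?normr1 ?normr0.
have := @fe_derivable v x d fv Gx; rewrite /derivable /pd /derive -/d => cv.
rewrite -(cvg_lim _ (cvg_norm cv))//; apply: limr_le; first exact: cvgP (cvg_norm cv).
near=> t; rewrite /=.
have t0 : t != 0 by near: t; exact: nbhs_dnbhs_neq.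
have te : `|t| < e.
  by near: t; apply: dnbhs0_lt.
have tdx : `|t *: d| <= `|t| by rewrite normrZ ler_piMr.
rewrite normrZ normfV mulrC ler_pdivrMr ?normr_gt0//.
have xt : ball x e (t *: d + x).
  rewrite -ball_normE/= opprD addrCA subrr addr0 normrN; exact: le_lt_trans tdx te.
have := fe_lipschitz fv (eK _ xt) Kx; rewrite addrK => /le_trans; apply.
rewrite [Cm / _ * _]mulrAC; apply: ler_wpM2l => //.
by rewrite divr_ge0 ?(ltW kap_gt0)// mulr_ge0 ?cell_max_ge0// ltW// markov_const_gt0.
Unshelve. all: by end_near.
Qed.

Lemma cell_pd_bounded_meas j v : fe_space k tau Z v -> bounded_meas O (cell_pd j v).
Proof.
move=> fv; split; first by apply: measurable_funTS; exact: measurable_cell_pd.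
exists (\sum_K Cm / kap * @cell_max R n.+1 k tau v K) => x _.
have s0 K : 0 <= Cm / kap * @cell_max R n.+1 k tau v K.
  by rewrite mulr_ge0 ?cell_max_ge0// divr_ge0 ?(ltW kap_gt0)// ltW// markov_const_gt0.
have [->|/(cell_pd_bound fv)[K [_ xK]]] := eqVneq (cell_pd j v x) 0.
  by rewrite normr0 sumr_ge0.
by apply: le_trans xK _; rewrite [leRHS](bigD1 K)//= lerDl sumr_ge0.
Qed.

Lemma carrier_sub_ball K : exists z : pt, forall x, carrier (tau K) x -> ball z (2 * h) x.
Proof.
have Kg := @node_ref R n.+1 k (tau K) [ffun=> ord0].
exists (cell_map (tau K) (node [ffun=> ord0 : 'I_k.+1])) => x Kx; rewrite -ball_normE/=.
apply: le_lt_trans (norm_le_enorm _) _.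
apply: le_lt_trans (diam_ub _ Kx) _; first by exists (node [ffun=> ord0 : 'I_k.+1]).
apply: le_lt_trans (diam_le_meshsize K) _.
by have := meshsize_gt0; lra.
Qed.

(** The factor in [fe_mass_lower] without its power [h^(n+1)]. *)
Definition mass_const : R := (2 * (expansion / (16 * Cm * n.+1%:R))) ^+ n.+1 / 4.

Lemma mass_const_gt0 : 0 < mass_const.
Proof.
rewrite divr_gt0// exprn_gt0// mulr_gt0// divr_gt0 ?expansion_gt0//.
by rewrite !mulr_gt0// ?markov_const_gt0// ltr0n.
Qed.

Lemma sum_cell_max_sq v : fe_space k tau Z v ->
  \sum_K (@cell_max R n.+1 k tau v K) ^+ 2 <= mass_const^-1 * h ^- n.+1 * ip mu O v v.
Proof.
move=> fv; rewrite -mulrA ler_pdivlMl ?mass_const_gt0//.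
rewrite ler_pdivlMl ?exprn_gt0 ?meshsize_gt0//.
apply: le_trans (fe_mass_lower fv); rewrite mulrA; apply: ler_wpM2r.
  by apply: sumr_ge0 => K _; exact: sqr_ge0.
rewrite /core_radius /mass_const.
by rewrite (_ : 2 * (kap / _) = h * (2 * (expansion / (16 * Cm * n.+1%:R)))) ?exprMn ?mulrA//; ring.
Qed.

(** A ball of radius [2 h] containing a cell has measure [(4 h)^(n+1)], the squared derivative costs
    [(Cm / (expansion h))^2], and returning to the L^2 norm costs [h^-(n+1) / mass_const]:
    altogether [h^-2]. *)
Definition grad_const : R := 4 ^+ n.+1 * (Cm / expansion) ^+ 2 / mass_const.

Lemma cell_pd_inverse j v : fe_space k tau Z v ->
  ip mu O (cell_pd j v) (cell_pd j v) <= grad_const * h ^- 2 * ip mu O v v.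
Proof.
move=> fv; have [z zP] := choice carrier_sub_ball.
have h0 := meshsize_gt0.
have : ip mu O (cell_pd j v) (cell_pd j v) <= (2 * (2 * h)) ^+ n.+1 *
    \sum_K (Cm / kap * @cell_max R n.+1 k tau v K) ^+ 2.
  apply: (sq_integral_upper (c := z)) => //; first exact: cell_pd_bounded_meas.
    by rewrite mulr_gt0.
  by move=> x _ /(cell_pd_bound fv)[K [Kx vK]]; exists K; split => //; exact: zP.
move=> /le_trans; apply.
under eq_bigr do rewrite exprMn.
rewrite -mulr_sumr.
apply: (@le_trans _ _ ((2 * (2 * h)) ^+ n.+1 * ((Cm / kap) ^+ 2 *
   (mass_const^-1 * h ^- n.+1 * ip mu O v v)))).
  apply: ler_wpM2l; first by rewrite exprn_ge0// !mulr_ge0// ltW.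
  apply: ler_wpM2l; first exact: sqr_ge0.
  exact: sum_cell_max_sq.
rewrite le_eqVlt; apply/orP; left; apply/eqP.
rewrite /grad_const (_ : 2 * (2 * h) = 4 * h); last by ring.
rewrite exprMn; have hn : h ^+ n.+1 != 0 by rewrite expf_eq0 (gt_eqF h0) andbF.
move: (h ^+ n.+1) (4 ^+ n.+1) hn => H F H0; field.
by rewrite H0 (gt_eqF h0) (gt_eqF mass_const_gt0) (gt_eqF expansion_gt0).
Qed.

(** No derivative is taken, but the balls are now in dimension [n]: [h^n h^-(n+1) = h^-1]. *)
Definition trace_const : R := 4 ^+ n * Cm ^+ 2 / mass_const.

Lemma trace_inverse (A : set 'rV[R]_n) v : measurable A ->
  (@lebesgue_rV R n A < +oo)%E ->
  bounded_meas A (trace v) -> fe_space k tau Z v ->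
  ip (@lebesgue_rV R n) A (trace v) (trace v) <= trace_const * h ^- 1 * ip mu O v v.
Proof.
move=> mA Aoo bt fv; have [z zP] := choice carrier_sub_ball.
have h0 := meshsize_gt0.
pose c K : 'rV[R]_n := \row_j z K ord0 (lift ord_max j).
have : ip (@lebesgue_rV R n) A (trace v) (trace v) <= (2 * (2 * h)) ^+ n *
    \sum_K (Cm * @cell_max R n.+1 k tau v K) ^+ 2.
  apply: (sq_integral_upper (c := c)) => //; first by rewrite mulr_gt0.
  move=> y _ ty0.
  have [[K _ Ky]|nD] := pselect (D (on_interface y)); last first.
    by move: ty0; have [_ _ _ v0] := fv; rewrite /trace/= v0 ?eqxx.
  exists K; split; last exact: fe_cell_bound fv Ky.
  have := zP K _ Ky; rewrite !ballE ?mulr_gt0// => + j => /(_ (lift ord_max j)).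
  by rewrite !mxE liftK.
move=> /le_trans; apply.
under eq_bigr do rewrite exprMn.
rewrite -mulr_sumr.
apply: (@le_trans _ _ ((2 * (2 * h)) ^+ n * (Cm ^+ 2 *
   (mass_const^-1 * h ^- n.+1 * ip mu O v v)))).
  apply: ler_wpM2l; first by rewrite exprn_ge0// !mulr_ge0// ltW.
  apply: ler_wpM2l; first exact: sqr_ge0.
  exact: sum_cell_max_sq.
rewrite le_eqVlt; apply/orP; left; apply/eqP.
rewrite /trace_const (_ : 2 * (2 * h) = 4 * h); last by ring.
rewrite exprMn [h ^+ n.+1]exprS [h ^+ 1]expr1; have hn : h ^+ n != 0 by rewrite expf_eq0 (gt_eqF h0) andbF.
move: (h ^+ n) (4 ^+ n) hn => H F H0; field.
by rewrite H0 (gt_eqF h0) (gt_eqF mass_const_gt0).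
Qed.

Lemma ip_eq0 v : fe_space k tau Z v -> ip mu O v v = 0 -> v = 0.
Proof.
move=> fv v0; have := sum_cell_max_sq fv; rewrite v0 mulr0 => s0.
apply: (fe_eq0 fv) => K; apply/eqP; rewrite -sqrf_eq0 -[_ == _]/(_ == _).
have s K' : 0 <= (@cell_max R n.+1 k tau v K') ^+ 2 by exact: sqr_ge0.
rewrite eq_le s andbT; apply: le_trans s0.
by rewrite (bigD1 K)//= lerDl sumr_ge0.
Qed.

End fe_estimates.

(** * The subdomains and their interface *)

Section domain_geometry.
Context {R : realType} {n : nat}.

Definition Omega_center (i : 'I_2) : 'rV[R]_n.+1 :=
  \row_j (if (j == ord_max) && (i != ord0) then - 2^-1 else 2^-1).

(** In the sup norm the box is a ball, which reduces its measurability, volume and closure to those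
    of balls. *)
Lemma Omega_ball i : @Omega R n i = ball (Omega_center i) 2^-1.
Proof.
rewrite ballE ?invr_gt0//; apply/seteqP; split => x /=.
  move=> [x1 x2] j; rewrite mxE; have [->|jm] := eqVneq j ord_max => /=.
    by rewrite ltr_distl; move: x2; case: (i == ord0) => /= /andP[]; lra.
  by rewrite ltr_distl; have /andP[] := x1 j jm; lra.
move=> H; split.
  move=> j jm; have := H j; rewrite mxE (negbTE jm)/= ltr_distl => /andP[]; lra.
have := H ord_max; rewrite mxE eqxx/= ltr_distl.
by case: (i == ord0) => /= /andP[]; lra.
Qed.

Lemma Gam_ball : @Gam R n = ball (const_mx 2^-1 : 'rV[R]_n) 2^-1.
Proof.
rewrite ballE ?invr_gt0//; apply/seteqP; split => x /= H j.
  by rewrite mxE ltr_distl; have /andP[] := H j; lra.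
by have := H j; rewrite mxE ltr_distl => /andP[]; lra.
Qed.

Lemma measurable_Omega i : measurable (@Omega R n i).
Proof. by rewrite Omega_ball; exact: measurable_ball_rV. Qed.

Lemma measurable_Gam : measurable (@Gam R n).
Proof. by rewrite Gam_ball; exact: measurable_ball_rV. Qed.

Lemma Omega_finite i : (@lebesgue_rV R n.+1 (Omega i) < +oo)%E.
Proof. by rewrite Omega_ball lebesgue_rV_ball ?invr_gt0// ltry. Qed.

Lemma Gam_finite : (@lebesgue_rV R n Gam < +oo)%E.
Proof. by rewrite Gam_ball lebesgue_rV_ball ?invr_gt0// ltry. Qed.

Lemma closure_Omega i : closure (@Omega R n i) = closed_ball (Omega_center i) 2^-1.
Proof. by rewrite Omega_ball. Qed.

Lemma ball_sub_closure_Omega i (x : 'rV[R]_n.+1) (r : R) : 0 < r ->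
  ball x r `<=` closure (Omega i) -> ball x r `<=` Omega i.
Proof.
move=> r0; rewrite closure_Omega => xr; rewrite Omega_ball => y xy.
have h2 : 0 < 2^-1 :> R by rewrite invr_gt0.
rewrite -(interior_closed_ballE _ h2); apply: filterS xr _.
by apply: open_nbhs_nbhs; split => //; exact: ball_open.
Qed.

Lemma closure_Omega_dist i (x y : 'rV[R]_n.+1) :
  closure (Omega i) x -> closure (Omega i) y -> `|x - y| <= 1.
Proof.
rewrite closure_Omega closed_ballE ?invr_gt0// /closed_ball_/= => hx hy.
have -> : x - y = (Omega_center i - y) - (Omega_center i - x).
  by apply/rowP => j; rewrite !mxE; lra.
by apply: le_trans (ler_normB _ _) _; lra.
Qed.

Lemma closure_Omega_height i (x : 'rV[R]_n.+1) : closure (Omega i) x ->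
  0 <= (if i == ord0 then 1 else -1) * x ord0 ord_max.
Proof.
rewrite closure_Omega closed_ballE ?invr_gt0// /closed_ball_/= => hx.
have := le_trans (coord_le_norm _ ord_max) hx; rewrite !mxE eqxx/=.
by rewrite ler_distl; case: (i == ord0) => /= /andP[]; lra.
Qed.

Lemma bdry_Gam (x : 'rV[R]_n) : closure Gam x -> ~ Gam x -> bdry Gam x.
Proof.
move=> cx nx; split => // ix; apply: nx; exact: interior_subset ix.
Qed.

Lemma measurable_trace v : measurable_fun [set: 'rV[R]_n.+1] v ->
  measurable_fun [set: 'rV[R]_n] (trace v).
Proof.
move=> mv; apply: (measurableT_comp mv); apply: measurable_fun_rV => j.
under eq_fun do rewrite mxE.
by case: unliftP => [j' _|_]; [exact: measurable_coord|exact: measurable_cst].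
Qed.

(** The interface mesh carries no regularity assumption, so definiteness comes from continuity: a
    nonzero value can only occur in the open set [Gam], and it persists at half its size on a small
    ball there. *)
Lemma UG_ip_eq0 k (tauG : @mesh R n) v :
  closure Gam = \bigcup_K carrier (tauG K) -> UG_space k tauG v ->
  ip (@lebesgue_rV R n) Gam v v = 0 -> v = 0.
Proof.
move=> GE fv v0; apply: contrapT => vn.
have [x vx] : exists x, v x != 0.
  apply: contrapT => h; apply: vn; apply/funext => x.
  by apply: contrapT => /eqP vx; apply: h; exists x.
have cD : closed (\bigcup_K carrier (tauG K)) by rewrite -GE; exact: closed_closure.
have [vc _ vZ vD] := fv.
have Gx : Gam x.
  apply: contrapT => nx; move: vx; have [cx|cx] := pselect (closure Gam x).
    by rewrite vZ ?eqxx//; exact: bdry_Gam.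
  by rewrite vD ?eqxx// -GE.
have oG : open (@Gam R n) by rewrite Gam_ball; exact: ball_open.
have vcx : {for x, continuous v}.
  have : {within Gam, continuous v}.
    by apply: continuous_subspaceW vc; rewrite -GE; exact: subset_closure.
  by rewrite continuous_open_subspace// => /(_ x); apply; rewrite inE.
have vx2 : 0 < `|v x| / 2 by rewrite divr_gt0// normr_gt0.
have : \forall y \near x, Gam y /\ `|v x - v y| < `|v x| / 2.
  by near=> y; split; near: y; [exact: open_nbhs_nbhs|apply: (@cvgr_dist_lt _ _ _ _ _ _ _ vcx)].
move=> /nbhs_ballP[r /= r0 rP].
have bv : bounded_meas Gam v := fe_bounded_meas Gam cD fv.
have : (`|v x| / 2) ^+ 2 * fine (@lebesgue_rV R n (ball x r)) <= ip (@lebesgue_rV R n) Gam v v.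
  have -> : fine (@lebesgue_rV R n (ball x r)) =
      fine (@lebesgue_rV R n ((ball x r : set 'rV[R]_n) `&` Gam)).
    by rewrite setIidl// => y /rP[].
  rewrite -Rintegral_indic//; [|exact: measurable_Gam|exact: measurable_ball_rV|exact: Gam_finite].
  have mB := @measurable_ball_rV R n x r.
  apply: bounded_meas_le_Rintegral; [exact: measurable_Gam|exact: Gam_finite|..].
  - by apply: bounded_meas_indic => //; exact: measurable_Gam.
  - exact: bounded_measM.
  move=> y Gy; rewrite indicE; have [yr|yr] := boolP (y \in _); last first.
    by rewrite mulr0 -expr2 sqr_ge0.
  rewrite mulr1 -expr2 -[leRHS]real_normK ?num_real//.
  have [_ vy] := rP y (set_mem yr).
  have := ler_normD (v x - v y) (v y); rewrite subrK => vy'.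
  by apply: lerXn2r; rewrite ?nnegrE ?(ltW vx2)//; lra.
by rewrite v0 lebesgue_rV_ball//= leNgt mulr_gt0// exprn_gt0// mulr_gt0.
Unshelve. all: by end_near.
Qed.

End domain_geometry.

(** * Vertices and barycentric weights *)

Section cell_vertices.
Context {R : realType} {m : nat}.
Local Notation pt := 'rV[R]_m.

Lemma dist_ref_vertices (x y : pt) j : `|x ord0 j - y ord0 j| = 1 -> 1 <= `|x - y|.
Proof. by move=> <-; have := coord_le_norm (x - y) j; rewrite !mxE. Qed.

(** A common description of both kinds of cells: [V] are the vertices, [P] their reference points,
    [W] the weights by which the cell map averages the vertices. *)
Lemma cell_vertices (K : @cell R m) : exists (T : finType) (V P : T -> pt) (W : pt -> T -> R),
  [/\ forall z, ref_cell K z -> (forall a, 0 <= W z a) /\ \sum_a W z a = 1,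
      forall z, cell_map K z = \sum_a W z a *: V a,
      forall a, ref_cell K (P a) /\ cell_map K (P a) = V a &
      forall a b, a != b -> 1 <= `|P a - P b|].
Proof.
case: K => v.
  pose W (z : pt) (a : 'I_m.+1) := if unlift ord0 a is Some j then z ord0 j else 1 - \sum_j z ord0 j.
  pose P (a : 'I_m.+1) : pt := if unlift ord0 a is Some j then delta_mx ord0 j else 0.
  have W0 z : W z ord0 = 1 - \sum_j z ord0 j by rewrite /W unlift_none.
  have WS z j : W z (lift ord0 j) = z ord0 j by rewrite /W liftK.
  have Wmap z : cell_map (Simplex v) z = \sum_a W z a *: v a.
    rewrite big_ord_recl W0 scalerBl scale1r scaler_suml -addrA; congr (_ + _).
    rewrite addrC -sumrB; apply: eq_bigr => j _.
    by rewrite WS scalerBr.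
  have P0 : P ord0 = 0 by rewrite /P unlift_none.
  have PS j : P (lift ord0 j) = delta_mx ord0 j by rewrite /P liftK.
  exists 'I_m.+1, v, P, W; split => //.
  - move=> z [z0 z1]; split; last first.
      by rewrite big_ord_recl W0 (eq_bigr _ (fun j _ => WS z j)) subrK.
    move=> a; case: (unliftP ord0 a) => [j ->|->]; first by rewrite WS.
    by rewrite W0 subr_ge0.
  - move=> a; case: (unliftP ord0 a) => [j ->|->].
      rewrite PS; split; first split.
      + by move=> l; rewrite mxE ler0n.
      + by rewrite (bigD1 j)//= big1 ?addr0 ?mxE ?eqxx// => l lj; rewrite mxE (negbTE lj) andbF.
      rewrite /= (bigD1 j)//= big1 ?addr0.
        by rewrite mxE !eqxx scale1r addrC subrK.
      by move=> l lj; rewrite mxE (negbTE lj) andbF scale0r.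
    rewrite P0; split; first by split => [l|]; rewrite ?big1 ?mxE// => l _; rewrite mxE.
    by rewrite /= big1 ?addr0// => l _; rewrite mxE scale0r.
  - move=> a b; case: (unliftP ord0 a) => [j ->|->]; case: (unliftP ord0 b) => [l ->|->].
    + rewrite !PS => jl; apply: (@dist_ref_vertices _ _ j); rewrite !mxE eqxx/= eqxx.
      by rewrite (_ : j == l = false) ?subr0 ?normr1//; apply: contraNF jl => /eqP->.
    + by rewrite PS P0 => _; apply: (@dist_ref_vertices _ _ j); rewrite !mxE !eqxx subr0 normr1.
    + by rewrite PS P0 => _; apply: (@dist_ref_vertices _ _ l); rewrite !mxE !eqxx sub0r normrN normr1.
    + by rewrite eqxx.
exists {ffun 'I_m -> bool}, v, (fun a : {ffun 'I_m -> bool} => \row_j (a j)%:R), cube_weight; split => //.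
- move=> z Kz; split; last exact: sum_cube_weight.
  by move=> a; exact: cube_weight_ge0.
- by move=> a; split; [exact: ref_corner|exact: cell_map_vertex].
move=> a b ab; have [j jab] : exists j, a j != b j.
  apply: contrapT => h; move/negP: ab; apply; apply/eqP/ffunP => j.
  by apply: contrapT => /eqP abj; apply: h; exists j.
apply: (@dist_ref_vertices _ _ j); rewrite !mxE.
by move: jab; case: (a j); case: (b j) => //= _; rewrite ?subr0 ?sub0r ?normrN normr1.
Qed.

End cell_vertices.

(** * The two meshes at their common interface *)

Section interface_meshes.
Context {R : realType} {n : nat} (hd : (n.+1 == 2) || (n.+1 == 3)).
Context (tau : 'I_2 -> @mesh R n.+1) (tauG : @mesh R n) (sigma : R).
Context (conf : forall i, conforming_mesh (closure (Omega i)) (tau i))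
  (confG : conforming_mesh (closure Gam) tauG)
  (ind : forall i, induces (tau i) tauG) (reg : forall i, regular_mesh sigma (tau i)).

Lemma cover_Omega i : closure (Omega i) = \bigcup_K carrier (tau i K).
Proof. by have [] := conf i. Qed.

Lemma cover_Gam : closure (@Gam R n) = \bigcup_K carrier (tauG K).
Proof. by have [] := confG. Qed.

Lemma conf_cover i : conforming_mesh (\bigcup_K carrier (tau i K)) (tau i).
Proof. by rewrite -cover_Omega. Qed.

Lemma closed_cover i : closed (\bigcup_K carrier (tau i K)).
Proof. by rewrite -cover_Omega; exact: closed_closure. Qed.

Lemma closed_cover_Gam : closed (\bigcup_K carrier (tauG K)).
Proof. by rewrite -cover_Gam; exact: closed_closure. Qed.

Lemma cell_exists i : exists K : 'I_(ncells (tau i)), True.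
Proof.
have : (\bigcup_K carrier (tau i K)) (Omega_center i).
  by rewrite -cover_Omega; apply: subset_closure; rewrite Omega_ball; apply: ballxx; rewrite invr_gt0.
by move=> [K _ _]; exists K.
Qed.

Lemma Gam_cell_exists : exists K : 'I_(ncells tauG), True.
Proof.
have : (\bigcup_K carrier (tauG K)) (const_mx 2^-1).
  by rewrite -cover_Gam; apply: subset_closure; rewrite Gam_ball; apply: ballxx; rewrite invr_gt0.
by move=> [K _ _]; exists K.
Qed.

Lemma ball_sub_cover i (x : 'rV[R]_n.+1) (r : R) : 0 < r ->
  ball x r `<=` \bigcup_K carrier (tau i K) -> ball x r `<=` Omega i.
Proof. by move=> r0; rewrite -cover_Omega; exact: ball_sub_closure_Omega. Qed.

(** The a priori bound by which lower powers of [h^-1] are absorbed into [h^-2]. *)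
Lemma meshsize_le i : meshsize (tau i) <= n.+1%:R.
Proof.
apply: bigmax_le => // K _; apply: diam_le.
  have [z Kz] : exists z, ref_cell (tau i K) z by exists (node [ffun=> ord0 : 'I_1]); exact: node_ref.
  by exists (cell_map (tau i K) z), z.
move=> x y Kx Ky; apply: le_trans (enorm_le_norm _) _.
by rewrite ler_piMr//; apply: (@closure_Omega_dist _ _ i); rewrite cover_Omega; exists K.
Qed.

(* A facet on the interface has an edge, which is an edge of the cells on both
   sides; its length is comparable with both mesh parameters. *)
Lemma meshsize_comparable i j :
  @expansion R n sigma * meshsize (tau i) <= meshsize (tau j).
Proof.
have [K0 _] := Gam_cell_exists; pose A := carrier (tauG K0).
have [/(_ (ex_intro _ K0 erefl))[K [AE Ai]] _] := ind i A.
have [/(_ (ex_intro _ K0 erefl))[L [AE' _]] _] := ind j A.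
suff [x [y [Ax Ay xy]]] : exists x y, [/\ A x, A y &
    @expansion R n sigma * meshsize (tau i) <= `|on_interface x - on_interface y|].
  apply: le_trans xy _; apply: le_trans (norm_le_enorm _) _.
  apply: le_trans (diam_le_meshsize L); apply: diam_ub.
    by move: Ax; rewrite AE'.
  by move: Ay; rewrite AE'.
have [T [V [P [W [W1 WF PV Pd]]]]] := cell_vertices (tau i K).
pose s : R := if i == ord0 then 1 else -1.
have Vs a : 0 <= s * V a ord0 ord_max.
  by apply: closure_Omega_height; rewrite cover_Omega; exists K => //; have [h1 <-] := PV a; exists (P a).
have VA a : V a ord0 ord_max = 0 -> exists x, A x /\ on_interface x = V a.
  move=> Va0; exists (\row_j V a ord0 (lift ord_max j)).
  have e : on_interface (\row_j V a ord0 (lift ord_max j)) = V a.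
    apply/rowP => j'; rewrite mxE; case: unliftP => [l ->|->]; first by rewrite mxE.
    by rewrite Va0.
  by split => //; rewrite AE/= e; have [h1 <-] := PV a; exists (P a).
suff [a [b [ab Va Vb]]] : exists a b, [/\ a != b, V a ord0 ord_max = 0 & V b ord0 ord_max = 0].
  have [x [Ax xE]] := VA a Va; have [y [Ay yE]] := VA b Vb.
  exists x, y; split => //; rewrite xE yE.
  have [Ra <-] := PV a; have [Rb <-] := PV b.
  have ml := mesh_lower hd (conf_cover i) (@reg i) (@cell_exists i) Ra Rb.
  apply: (le_trans _ ml).
  by rewrite ler_peMr ?Pd// ltW//; exact: (kap_gt0 hd (conf_cover i) (@reg i) (@cell_exists i)).
have s0 : s != 0 by rewrite /s; case: ifP; rewrite ?oppr_eq0 oner_eq0.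
(* The vertices lie on one side of the interface, so a mean of them at height 0 gives no weight to
   those off the interface. *)
have Asum x : A x -> exists2 w : T -> R, (forall a, V a ord0 ord_max != 0 -> w a = 0) &
    \sum_a w a = 1 /\ on_interface x = \sum_a w a *: V a.
  rewrite AE => -[z Kz zx]; have [W0 Ws] := W1 z Kz.
  exists (W z); last by rewrite -WF zx.
  move=> a Va.
  have : \sum_a W z a * (s * V a ord0 ord_max) = 0.
    have : on_interface x ord0 ord_max = 0 by rewrite mxE unlift_none.
    rewrite -zx WF summxE => z0.
    transitivity (s * \sum_a (W z a *: V a) ord0 ord_max); last by rewrite z0 mulr0.
    by rewrite mulr_sumr; apply: eq_bigr => b _; rewrite mxE mulrCA.
  move=> /eqP; rewrite psumr_eq0; last by move=> b _; rewrite mulr_ge0.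
  move=> /allP/(_ a (mem_index_enum _))/=; rewrite mulf_eq0 => /orP[/eqP//|].
  by rewrite mulf_eq0 (negbTE s0) (negbTE Va).
have [x [y [Ax Ay xy]]] : exists x y, [/\ A x, A y & x != y].
  have [x /nbhs_ballP[r /= r0 rA]] := Ai.
  exists x, (x + const_mx (r / 2)); split.
  - by apply: rA; exact: ballxx.
  - apply: rA; rewrite -ball_normE/= opprD addrA subrr sub0r normrN.
    by apply: norm_lt_coord => // l; rewrite mxE ger0_norm; [|exact/ltW/divr_gt0]; lra.
  rewrite -subr_eq0 opprD addrA subrr sub0r oppr_eq0.
  have nl : (0 < n)%N by move: hd; case: (n).
  apply: contraTneq (divr_gt0 r0 (ltr0Sn R 1)) => /rowP/(_ (Ordinal nl)).
  by rewrite !mxE => ->; rewrite ltxx.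
have [w wV [w1 wx]] := Asum x Ax; have [w' wV' [w1' wy]] := Asum y Ay.
have [a [wa Va]] : exists a, w a != 0 /\ V a ord0 ord_max = 0.
  apply: contrapT => h; have : \sum_a w a = 0.
    rewrite big1// => a _; apply: contrapT => /eqP wa; apply: h; exists a; split => //.
    by apply: contrapT => /eqP /wV /eqP; rewrite (negbTE wa).
  by rewrite w1 => /eqP; rewrite oner_eq0.
(* If [a] were the only vertex on the interface, the facet would be a single point, although it
   contains [x] and [y]. *)
exists a; apply: contrapT => h.
have Vb b : b != a -> V b ord0 ord_max != 0.
  by move=> ba; apply/eqP => Vb; apply: h; exists b; rewrite eq_sym.
have xa (u : T -> R) : (forall b, V b ord0 ord_max != 0 -> u b = 0) -> \sum_b u b = 1 ->
    \sum_b u b *: V b = V a.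
  move=> uV u1; rewrite (bigD1 a)//= big1 => [|b ba]; last by rewrite uV ?scale0r// Vb.
  move: u1; rewrite (bigD1 a)//= big1 => [|b ba]; last by rewrite uV// Vb.
  by rewrite !addr0 => ->; rewrite scale1r.
move/negP: xy; apply; apply/eqP/rowP => l.
have : on_interface x = on_interface y by rewrite wx wy !xa.
by move=> /rowP/(_ (lift ord_max l)); rewrite !mxE liftK.
Qed.

End interface_meshes.

(** * Space-time bilinear forms *)

Section linear_closed.
Context {R : realType} {V : lmodType R}.
Implicit Types (S : set V) (F : V -> R).

(** Subspaces are kept as sets of functions, since the integral forms are linear only on such a set
    and not on the whole function type. *)
Definition lin_closed S := S 0 /\ forall a u v, S u -> S v -> S (a *: u + v).

Definition lin_on S F := forall a u v, S u -> S v -> F (a *: u + v) = a * F u + F v.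

Lemma lin_closed_sum S (I : Type) (s : seq I) (c : I -> R) (e : I -> V) :
  lin_closed S -> (forall i, S (e i)) -> S (\sum_(i <- s) c i *: e i).
Proof.
move=> [S0 Sl] Se; elim: s => [|i s IH]; first by rewrite big_nil.
by rewrite big_cons; exact: Sl.
Qed.

Lemma lin_on0 S F : lin_closed S -> lin_on S F -> F 0 = 0.
Proof.
move=> [S0 _] Fl; have := Fl 1 0 0 S0 S0; rewrite scaler0 addr0 mul1r => /eqP.
by rewrite -[X in X == _]addr0 (inj_eq (addrI _)) eq_sym => /eqP.
Qed.

Lemma lin_on_sum S F (I : Type) (s : seq I) (c : I -> R) (e : I -> V) :
  lin_closed S -> lin_on S F -> (forall i, S (e i)) ->
  F (\sum_(i <- s) c i *: e i) = \sum_(i <- s) c i * F (e i).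
Proof.
move=> Sl Fl Se; elim: s => [|i s IH]; first by rewrite !big_nil; exact: lin_on0 Sl Fl.
by rewrite !big_cons Fl// ?IH//; exact: lin_closed_sum.
Qed.

Lemma lin_on_sub S S' F : S `<=` S' -> lin_on S' F -> lin_on S F.
Proof. by move=> SS Fl a u v /SS Su /SS Sv; exact: Fl. Qed.

Lemma lin_onD S F G : lin_on S F -> lin_on S G -> lin_on S (fun u => F u + G u).
Proof. by move=> hF hG a u v Su Sv; rewrite hF// hG//; ring. Qed.

Lemma lin_onB S F G : lin_on S F -> lin_on S G -> lin_on S (fun u => F u - G u).
Proof. by move=> hF hG a u v Su Sv; rewrite hF// hG//; ring. Qed.

Lemma lin_onZ S F c : lin_on S F -> lin_on S (fun u => c * F u).
Proof. by move=> hF a u v Su Sv; rewrite hF//; ring. Qed.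

Lemma lin_on_bigsum S (I : Type) (s : seq I) (F : I -> V -> R) :
  (forall i, lin_on S (F i)) -> lin_on S (fun u => \sum_(i <- s) F i u).
Proof.
move=> hF a u v Su Sv; rewrite mulr_sumr -big_split/=.
by apply: eq_bigr => i _; rewrite hF.
Qed.

End linear_closed.

Definition bilin_on (R : realType) (V V' : lmodType R) (S : set V) (S' : set V')
    (b : V -> V' -> R) :=
  (forall v, S' v -> lin_on S (b ^~ v)) /\ (forall u, S u -> lin_on S' (b u)).

Lemma bilin_on_sum (R : realType) (V V' : lmodType R) (S : set V) (S' : set V')
    (b : V -> V' -> R) (I J : Type) (s : seq I) (r : seq J) (c : I -> R) (d : J -> R)
    (e : I -> V) (f : J -> V') : lin_closed S -> lin_closed S' -> bilin_on S S' b ->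
  (forall i, S (e i)) -> (forall i, S' (f i)) ->
  b (\sum_(i <- s) c i *: e i) (\sum_(j <- r) d j *: f j) =
  \sum_(i <- s) \sum_(j <- r) c i * d j * b (e i) (f j).
Proof.
move=> Sl Sl' [b1 b2] Se Sf.
rewrite (lin_on_sum s c Sl (b1 _ (lin_closed_sum r d Sl' Sf)) Se).
apply: eq_bigr => i _; rewrite (lin_on_sum r d Sl' (b2 _ (Se i)) Sf) mulr_sumr.
by apply: eq_bigr => j _; rewrite mulrA.
Qed.

Section time_poly.
Context {R : realType}.
Local Notation leb := (@lebesgue_measure R).

Section one_space.
Context {d : nat}.
Local Notation pt := 'rV[R]_d.
Implicit Types (S : set (pt -> R)) (u v : R -> pt -> R) (q : nat).

Lemma time_polyE q S u : time_poly q S u <-> exists N (p : 'I_N -> {poly R}) (phi : 'I_N -> pt -> R),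
  (forall l, (size (p l) <= q.+1)%N /\ S (phi l)) /\
  forall t, u t = \sum_l (p l).[t] *: phi l.
Proof.
split=> -[N [p [phi [h uE]]]]; exists N, p, phi; split => //.
  by move=> t; rewrite uE fct_sumE.
by apply/funext => t; rewrite uE fct_sumE.
Qed.

Lemma time_poly_closed q S : lin_closed S -> lin_closed (time_poly q S).
Proof.
move=> [S0 Sl]; split.
  apply/time_polyE; exists 0%N, (fun=> 0), (fun=> 0); split => [|t]; first by case.
  by rewrite big_ord0.
move=> a u v /time_polyE[N [p [phi [h uE]]]] /time_polyE[N' [p' [phi' [h' vE]]]].
apply/time_polyE; exists (N + N')%N.
exists (fun l => match fintype.split l with inl l => a *: p l | inr l => p' l end).
exists (fun l => match fintype.split l with inl l => phi l | inr l => phi' l end).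
split.
  move=> l; case: (fintype.split l) => l' //; have [h1 h2] := h l'; split => //.
  exact: leq_trans (size_scale_leq _ _) h1.
move=> t; rewrite (_ : (a *: u + v) t = a *: u t + v t)// uE vE scaler_sumr big_split_ord/=; congr (_ + _).
  apply: eq_bigr => l _; case: splitP => l' ll'.
    by rewrite (_ : l' = l) ?hornerZ ?scalerA//; exact/val_inj/esym.
  by move: ll' => /= ll'; have := ltn_ord l; rewrite ll' ltnNge leq_addr.
apply: eq_bigr => l _; case: splitP => l' ll'.
  by have := ltn_ord l'; rewrite -ll' ltnNge leq_addr.
by move/eqP: ll'; rewrite eqn_add2l => /eqP/ord_inj ->.
Qed.

Lemma time_poly_mono q q' S S' u : (q <= q')%N -> S `<=` S' ->
  time_poly q S u -> time_poly q' S' u.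
Proof.
move=> qq SS [N [p [phi [h ->]]]]; exists N, p, phi; split => // l.
have [h1 h2] := h l; split; [exact: leq_trans h1 _|exact: SS].
Qed.

Lemma time_poly_eval q S u t : lin_closed S -> time_poly q S u -> S (u t).
Proof.
move=> Sl /time_polyE[N [p [phi [h ->]]]].
by apply: lin_closed_sum => // l; have [] := h l.
Qed.

Lemma time_poly_monomial q S (p : {poly R}) phi : (size p <= q.+1)%N -> S phi ->
  time_poly q S (fun t => p.[t] *: phi).
Proof.
move=> sp Sphi; apply/time_polyE; exists 1%N, (fun=> p), (fun=> phi); split => // t.
by rewrite big_ord1.
Qed.

Definition time_deriv v : R -> pt -> R := fun t x => derive1 (v ^~ x) t.

Lemma time_deriv_sum N (p : 'I_N -> {poly R}) (phi : 'I_N -> pt -> R) v :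
  (forall t, v t = \sum_l (p l).[t] *: phi l) ->
  forall t, time_deriv v t = \sum_l ((p l)^`()).[t] *: phi l.
Proof.
move=> vE t; apply/funext => x; rewrite /time_deriv.
have -> : v ^~ x = horner (\sum_l phi l x *: p l).
  apply/funext => s; rewrite vE fct_sumE horner_sum; apply: eq_bigr => l _.
  by rewrite hornerZ mulrC.
rewrite derive1E; have [_ ->] := is_derive_poly (\sum_l phi l x *: p l) t.
rewrite (raddf_sum (@deriv R)) horner_sum fct_sumE; apply: eq_bigr => l _.
transitivity ((phi l x *: (p l)^`()).[t]); last by rewrite hornerZ mulrC.
by congr (_.[t]); exact: derivZ.
Qed.

Lemma time_poly_deriv q S v : time_poly q S v -> time_poly q S (time_deriv v).
Proof.
move=> /time_polyE[N [p [phi [h vE]]]]; apply/time_polyE.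
exists N, (fun l => (p l)^`()), phi; split; last exact: time_deriv_sum.
move=> l; have [h1 h2] := h l; split => //.
exact: leq_trans (leq_trans (size_poly _ _) (leq_pred _)) h1.
Qed.

Lemma time_deriv_lin q S a u v : time_poly q S u -> time_poly q S v ->
  time_deriv (a *: u + v) = a *: time_deriv u + time_deriv v.
Proof.
move=> /time_polyE[N [p [phi [h uE]]]] /time_polyE[N' [p' [phi' [h' vE]]]].
have du (w : R -> pt -> R) M (r : 'I_M -> {poly R}) (psi : 'I_M -> pt -> R) :
    (forall t, w t = \sum_l (r l).[t] *: psi l) ->
    forall x, w ^~ x = horner (\sum_l psi l x *: r l).
  move=> wE x; apply/funext => s; rewrite wE fct_sumE horner_sum; apply: eq_bigr => l _.
  by rewrite hornerZ mulrC.
apply/funext => t; apply/funext => x; rewrite /time_deriv !fctE.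
rewrite -!/(u ^~ x) -!/(v ^~ x).
have -> : (fun t0 => (a *: u + v) t0 x) = horner (a *: (\sum_l phi l x *: p l) + \sum_l phi' l x *: p' l).
  apply/funext => s; rewrite hornerD hornerZ -(du _ _ _ _ uE) -(du _ _ _ _ vE).
  by rewrite !fctE.
rewrite (du _ _ _ _ uE) (du _ _ _ _ vE) !derive1E.
by rewrite !(derive_val (is_derive := is_derive_poly _ t)) derivD derivZ hornerD hornerZ.
Qed.

End one_space.

Section forms.
Context {d d' : nat} (S : set ('rV[R]_d -> R)) (S' : set ('rV[R]_d' -> R)).
Context (b : ('rV[R]_d -> R) -> ('rV[R]_d' -> R) -> R).
Context (Sl : lin_closed S) (Sl' : lin_closed S') (bb : bilin_on S S' b).
Context (q q' : nat).

(** The source of integrability in time, and of definiteness: a nonnegative polynomial with zero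
    integral vanishes identically. *)
Lemma time_bilinear_poly u v : time_poly q S u -> time_poly q' S' v ->
  exists P : {poly R}, forall t, b (u t) (v t) = P.[t].
Proof.
move=> /time_polyE[N [p [phi [h uE]]]] /time_polyE[N' [p' [phi' [h' vE]]]].
exists (\sum_l \sum_l' b (phi l) (phi' l') *: (p l * p' l')) => t.
rewrite uE vE (bilin_on_sum _ _ _ _ Sl Sl' bb); [|by move=> l; have [] := h l|by move=> l; have [] := h' l].
rewrite horner_sum; apply: eq_bigr => l _; rewrite horner_sum; apply: eq_bigr => l' _.
by rewrite hornerZ hornerM mulrC.
Qed.

Context (t1 t2 : R).
Local Notation I := `]t1, t2[%classic.

Definition time_form (u : R -> 'rV[R]_d -> R) (v : R -> 'rV[R]_d' -> R) : R :=
  \int[leb]_(t in I) b (u t) (v t).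

Lemma integrable_time_form u v : time_poly q S u -> time_poly q' S' v ->
  leb.-integrable I (EFin \o (fun t => b (u t) (v t))).
Proof.
move=> hu hv; have [P PE] := time_bilinear_poly hu hv.
rewrite (_ : (fun t => _) = horner P); last exact/funext.
exact: integrable_horner_oo.
Qed.

Lemma time_form_bilin : bilin_on (time_poly q S) (time_poly q' S') time_form.
Proof.
have [b1 b2] := bb; have mI : measurable I by exact: measurable_itv.
split => [v hv a u w hu hw|u hu a v w hv hw]; rewrite /time_form.
  rewrite -RintegralZl//; last exact: integrable_time_form.
  rewrite -RintegralD//; last exact: integrable_time_form.
    by apply: eq_Rintegral => t _; rewrite (b1 _ (time_poly_eval t Sl' hv))//;
      [exact: time_poly_eval hu|exact: time_poly_eval hw].
  have := integrable_time_form ((time_poly_closed q Sl).2 a _ _ hu (time_poly_closed q Sl).1) hv.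
  apply: eq_integrable => // t _ /=; rewrite addr0.
  congr EFin; have := b1 _ (time_poly_eval t Sl' hv) a (u t) 0 (time_poly_eval t Sl hu) Sl.1.
  by rewrite addr0 (lin_on0 Sl (b1 _ (time_poly_eval t Sl' hv))) addr0.
rewrite -RintegralZl//; last exact: integrable_time_form.
rewrite -RintegralD//; last exact: integrable_time_form.
  by apply: eq_Rintegral => t _; rewrite (b2 _ (time_poly_eval t Sl hu))//;
    [exact: time_poly_eval hv|exact: time_poly_eval hw].
have := integrable_time_form hu ((time_poly_closed q' Sl').2 a _ _ hv (time_poly_closed q' Sl').1).
apply: eq_integrable => // t _ /=; rewrite addr0.
congr EFin; have := b2 _ (time_poly_eval t Sl hu) a (v t) 0 (time_poly_eval t Sl' hv) Sl'.1.
by rewrite addr0 (lin_on0 Sl' (b2 _ (time_poly_eval t Sl hu))) addr0.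
Qed.

End forms.

Section psd_forms.
Context {d : nat} (S : set ('rV[R]_d -> R)).
Context (b : ('rV[R]_d -> R) -> ('rV[R]_d -> R) -> R).
Context (Sl : lin_closed S) (bb : bilin_on S S b) (b0 : forall u, S u -> 0 <= b u u).
Context (bs : forall u v, S u -> S v -> b u v = b v u).
Context (q : nat) (t1 t2 : R).
Local Notation I := `]t1, t2[%classic.

Lemma time_form_sym u v : time_poly q S u -> time_poly q S v ->
  time_form b t1 t2 u v = time_form b t1 t2 v u.
Proof.
by move=> hu hv; apply: eq_Rintegral => t _; rewrite bs//;
  [exact: time_poly_eval hu|exact: time_poly_eval hv].
Qed.

Lemma time_form_ge0 u : time_poly q S u -> 0 <= time_form b t1 t2 u u.
Proof. by move=> hu; apply: Rintegral_ge0 => t _; apply: b0; exact: time_poly_eval hu. Qed.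

Lemma time_form_cauchy_schwarz u v : time_poly q S u -> time_poly q S v ->
  `|time_form b t1 t2 u v| <= Num.sqrt (time_form b t1 t2 u u) * Num.sqrt (time_form b t1 t2 v v).
Proof.
move=> hu hv; rewrite -sqrtrM ?time_form_ge0// -(@ler_pXn2r _ 2)// ?nnegrE ?sqrtr_ge0//.
rewrite sqr_sqrtr ?mulr_ge0 ?time_form_ge0// real_normK ?num_real//.
have [B1 B2] := time_form_bilin Sl Sl bb q q t1 t2.
apply: (@psd_cauchy_schwarz _ _ (time_poly q S)) => //.
- exact: (time_poly_closed q Sl).2.
- by move=> a x y w hx hy hw; exact: B1.
- exact: time_form_sym.
- exact: time_form_ge0.
Qed.

Lemma time_form_eq0 u : t1 < t2 -> (forall w, S w -> b w w = 0 -> w = 0) ->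
  time_poly q S u -> time_form b t1 t2 u u = 0 -> u = 0.
Proof.
move=> t12 bp hu; have [P PE] := time_bilinear_poly Sl Sl bb hu hu.
rewrite /time_form; under eq_Rintegral do rewrite PE.
move=> /(poly_int_eq0 t12) P0; apply/funext => t; apply: bp; first exact: time_poly_eval hu.
rewrite PE P0 ?horner0// => s _; rewrite -PE; apply: b0; exact: time_poly_eval hu.
Qed.

Lemma time_form_subset u (s1 s2 : R) : t1 <= s1 -> s2 <= t2 -> time_poly q S u ->
  time_form b s1 s2 u u <= time_form b t1 t2 u u.
Proof.
move=> ts st hu; rewrite /time_form /Rintegral.
have sub : `]s1, s2[%classic `<=` I.
  by move=> x /=; rewrite !in_itv/= => /andP[h1 h2]; rewrite (le_lt_trans ts h1) (lt_le_trans h2 st).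
have i1 := integrable_time_form Sl Sl bb t1 t2 hu hu.
have i2 := integrable_time_form Sl Sl bb s1 s2 hu hu.
apply: fine_le; [exact: (integrable_fin_num _ i2)|exact: (integrable_fin_num _ i1)|].
apply: ge0_subset_integral => //; first by case/integrableP: i1.
by move=> t _; rewrite lee_fin; apply: b0; exact: time_poly_eval hu.
Qed.

End psd_forms.

End time_poly.

Lemma lin_on_sum2 (R : realType) (V : lmodType R) (S : set V) (F : V -> R)
    (I J : finType) (c : I -> J -> R) (e : I -> J -> V) :
  lin_closed S -> lin_on S F -> (forall i j, S (e i j)) ->
  F (\sum_i \sum_j c i j *: e i j) = \sum_i \sum_j c i j * F (e i j).
Proof.
move=> Sl Fl Se; rewrite pair_bigA (pair_bigA _ (fun i j => c i j * F (e i j)))/=.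
exact: (lin_on_sum _ (fun p => c p.1 p.2) Sl Fl (fun p => Se p.1 p.2)).
Qed.

(** * Powers of the relative time on a substep *)

Section time_monomials.
Context {R : realType}.
Local Notation leb := (@lebesgue_measure R).
Context (t0 c : R) (c0 : 0 < c).

Definition time_mono (j : nat) : {poly R} := (c^-1 *: ('X - t0%:P)) ^+ j.

Lemma time_monoE j t : (time_mono j).[t] = ((t - t0) / c) ^+ j.
Proof. by rewrite /time_mono horner_exp hornerZ !hornerE mulrC. Qed.

Lemma size_time_mono j : (size (time_mono j) <= j.+1)%N.
Proof.
apply: leq_trans (size_poly_exp_leq _ _) _; rewrite ltnS -{2}[j]mul1n leq_mul2r.
apply/orP; right.
have : (size (c^-1 *: ('X - t0%:P)) <= 2)%N.
  by apply: leq_trans (size_scale_leq _ _) _; rewrite size_XsubC.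
by case: (size _) => [|[|[|]]].
Qed.

Lemma time_mono_start j : (time_mono j).[t0] = (j == 0%N)%:R.
Proof. by rewrite time_monoE subrr mul0r expr0n. Qed.

Lemma time_mono_end j : (time_mono j).[t0 + c] = 1.
Proof. by rewrite time_monoE addrC addKr divff ?gt_eqF// expr1n. Qed.

Lemma time_mono_expand q (p : {poly R}) : (size p <= q.+1)%N ->
  exists a : nat -> R, p = \sum_(j < q.+1) a j *: time_mono j.
Proof.
move=> sp; pose r := p \Po (c *: 'X + t0%:P); exists (fun j => r`_j).
have sr : (size r <= q.+1)%N.
  rewrite /r; have [->|p0] := eqVneq p 0; first by rewrite comp_poly0 size_poly0.
  apply: leq_trans (size_comp_poly_leq _ _) _.
  rewrite ltnS -ltnS; have sl : (size (c *: 'X + t0%:P)).-1 = 1%N.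
    by rewrite size_polyDl ?size_scale ?gt_eqF// size_polyX// size_polyC; case: (_ != _).
  by rewrite sl muln1 prednK// lt0n size_poly_eq0.
have -> : p = r \Po (c^-1 *: ('X - t0%:P)).
  rewrite /r -comp_polyA comp_polyD comp_polyZ comp_polyX comp_polyC.
  by rewrite scalerA divff ?gt_eqF// scale1r subrK comp_polyXr.
rewrite {1}(_ : r = \poly_(j < q.+1) r`_j); last first.
  apply/polyP => j; rewrite coef_poly; case: ltnP => // qj.
  by rewrite nth_default//; exact: leq_trans sr qj.
rewrite poly_def raddf_sum/=; apply: eq_bigr => j _.
by rewrite comp_polyZ comp_Xn_poly.
Qed.

Lemma Rintegral_time_mono k :
  \int[leb]_(t in `]t0, t0 + c[) (time_mono k).[t] = c * k.+1%:R^-1.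
Proof.
rewrite -Rintegral_Xn; have := Rintegral_affine ('X^k) t0 c0.
under eq_Rintegral do rewrite hornerXn -time_monoE.
by under [X in _ = c * X -> _]eq_Rintegral do rewrite hornerXn.
Qed.

Lemma time_monoM j k t : (time_mono j).[t] * (time_mono k).[t] = (time_mono (j + k)).[t].
Proof. by rewrite !time_monoE exprD. Qed.

Section basis.
Context {d D : nat} (S : set ('rV[R]_d -> R)) (phi : 'I_D -> 'rV[R]_d -> R)
  (co : ('rV[R]_d -> R) -> 'I_D -> R).
Context (Sl : lin_closed S) (Sphi : forall m, S (phi m))
  (exp : forall v, S v -> v = \sum_m co v m *: phi m).

Definition tensor j m : R -> 'rV[R]_d -> R := fun t => (time_mono j).[t] *: phi m.

Lemma time_poly_tensor q j m : (j <= q)%N -> time_poly q S (tensor j m).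
Proof.
move=> jq; apply: time_poly_monomial => //; exact: leq_trans (size_time_mono j) _.
Qed.

Lemma time_poly_coords q u : time_poly q S u ->
  exists a : nat -> 'I_D -> R, u = \sum_(j < q.+1) \sum_m a j m *: tensor j m.
Proof.
move=> /time_polyE[N [p [psi [h uE]]]].
have /choice[al alP] : forall l, exists a : nat -> R, p l = \sum_(j < q.+1) a j *: time_mono j.
  by move=> l; apply: time_mono_expand; have [] := h l.
exists (fun j m => \sum_l al l j * co (psi l) m).
apply/funext => t; rewrite uE.
transitivity (\sum_l \sum_(j < q.+1) \sum_m (al l j * co (psi l) m) *: tensor j m t).
  apply: eq_bigr => l _; rewrite {1}(exp (h l).2) alP horner_sum scaler_suml.
  apply: eq_bigr => j _; rewrite scaler_sumr; apply: eq_bigr => m _.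
  by rewrite hornerZ /tensor !scalerA; congr (_ *: _); ring.
rewrite exchange_big [in RHS]fct_sumE; apply: eq_bigr => j _.
rewrite exchange_big [in RHS]fct_sumE; apply: eq_bigr => m _.
by rewrite -scaler_suml.
Qed.

Lemma time_poly_of_coords q (a : nat -> 'I_D -> R) :
  time_poly q S (\sum_(j < q.+1) \sum_m a j m *: tensor j m).
Proof.
have TPl := time_poly_closed q Sl.
suff : time_poly q S (\sum_(j < q.+1) 1 *: (\sum_m a j m *: tensor j m)).
  by under eq_bigr do rewrite scale1r.
apply: lin_closed_sum => // j; apply: lin_closed_sum => // m.
by apply: time_poly_tensor; rewrite -ltnS.
Qed.

Lemma tensor_sum_eval q (a : nat -> 'I_D -> R) t :
  (\sum_(j < q.+1) \sum_m a j m *: tensor j m) t =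
  \sum_m (\sum_(j < q.+1) a j m * ((t - t0) / c) ^+ j) *: phi m.
Proof.
under [RHS]eq_bigr do rewrite scaler_suml.
rewrite exchange_big fct_sumE; apply: eq_bigr => j _.
rewrite fct_sumE; apply: eq_bigr => m _.
by rewrite -scalerA -time_monoE.
Qed.

Lemma time_deriv_tensor r m t : time_deriv (tensor r m) t =
  (r%:R / c * (time_mono r.-1).[t]) *: phi m.
Proof.
have E : forall t, tensor r m t = \sum_(l < 1) (time_mono r).[t] *: phi m.
  by move=> s; rewrite big_ord1.
rewrite (time_deriv_sum E) big_ord1; congr (_ *: _).
rewrite /time_mono deriv_exp derivZ derivB derivX derivC subr0.
rewrite hornerMn hornerM !(hornerZ, horner_exp) !hornerE -mulr_natr; ring.
Qed.

End basis.

End time_monomials.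

Section tensor_forms.
Context {R : realType} {d d' D D' : nat} (t0 c : R) (c0 : 0 < c).
Context (S : set ('rV[R]_d -> R)) (S' : set ('rV[R]_d' -> R)).
Context (b : ('rV[R]_d -> R) -> ('rV[R]_d' -> R) -> R).
Context (Sl : lin_closed S) (Sl' : lin_closed S') (bb : bilin_on S S' b).
Context (phi : 'I_D -> 'rV[R]_d -> R) (phi' : 'I_D' -> 'rV[R]_d' -> R).
Context (Sphi : forall m, S (phi m)) (Sphi' : forall m, S' (phi' m)).

Lemma bilin_onZ x y u v : S u -> S' v -> b (x *: u) (y *: v) = x * y * b u v.
Proof.
move=> Su Sv; have [b1 b2] := bb.
have Z1 w : S' w -> b (x *: u) w = x * b u w.
  move=> Sw; have := b1 w Sw x u 0 Su Sl.1.
  by rewrite addr0 (lin_on0 Sl (b1 w Sw)) addr0.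
have yv : S' (y *: v) by rewrite -[_ *: _]addr0; exact: Sl'.2 Sv Sl'.1.
rewrite Z1//; have := b2 u Su y v 0 Sv Sl'.1.
by rewrite addr0 (lin_on0 Sl' (b2 u Su)) addr0 => ->; rewrite mulrA.
Qed.

Lemma time_form_tensor j r m m' :
  time_form b t0 (t0 + c) (tensor t0 c phi j m) (tensor t0 c phi' r m') =
  c * (j + r).+1%:R^-1 * b (phi m) (phi' m').
Proof.
rewrite /time_form -(Rintegral_time_mono t0 c0) -RintegralZr//; last exact: integrable_horner_oo.
by apply: eq_Rintegral => t _; rewrite bilin_onZ// time_monoM.
Qed.

(** The factor [1/c] of the derivative cancels the length [c] of the substep, so that this matrix,
    unlike that of [time_form_tensor], is free of the time step. *)
Lemma time_form_tensor_deriv j r m m' :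
  time_form b t0 (t0 + c) (tensor t0 c phi j m) (time_deriv (tensor t0 c phi' r m')) =
  r%:R / (j + r)%:R * b (phi m) (phi' m').
Proof.
transitivity (\int[@lebesgue_measure R]_(t in `]t0, t0 + c[)
   (r%:R / c * (time_mono t0 c (j + r.-1)).[t] * b (phi m) (phi' m'))).
  apply: eq_Rintegral => t _; rewrite time_deriv_tensor// bilin_onZ// -time_monoM; ring.
(* For [r = 0] the denominator [j + r] may be 0, but then the numerator vanishes too. *)
case: r => [|r].
  by under eq_Rintegral do rewrite !mul0r; rewrite Rintegral_cst// !mul0r.
under eq_Rintegral do rewrite mulrAC mulrC.
rewrite RintegralZr//; last exact: integrable_horner_oo.
have n0 : (j + r.+1)%:R != 0 :> R by rewrite addnS pnatr_eq0.
rewrite Rintegral_time_mono// -addnS/=; move: (j + r.+1)%:R n0 => X X0; field.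
by rewrite X0 gt_eqF.
Qed.

End tensor_forms.

(** * Orthonormal bases of polynomials in time with values in a discrete space *)

Section time_basis.
Context {R : realType} {d : nat} (S : set ('rV[R]_d -> R)).
Context (b : ('rV[R]_d -> R) -> ('rV[R]_d -> R) -> R).
Context (Sl : lin_closed S) (bb : bilin_on S S b) (b0 : forall u, S u -> 0 <= b u u).
Context (bs : forall u v, S u -> S v -> b u v = b v u).
Context (bp : forall w, S w -> b w w = 0 -> w = 0).
Context (N : nat) (ev : ('rV[R]_d -> R) -> 'I_N -> R).
Context (evl : forall k, lin_on S (ev ^~ k))
  (ev0 : forall u, S u -> (forall k, ev u k = 0) -> u = 0).
Context (q : nat) (t1 t2 : R) (t12 : t1 < t2).

(** A polynomial of degree at most [q] is determined at the [q + 1] times 0, ..., q; together with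
    [ev] this gives the finitely many functionals required by [orthonormal_basis]. *)
Lemma time_poly_values_eq0 u : time_poly q S u ->
  (forall (a : 'I_q.+1) k, ev (u a%:R) k = 0) -> u = 0.
Proof.
move=> hu u0; have [M [p [psi [h uE]]]] := (time_polyE _ _ _).1 hu.
apply/funext => t; apply: ev0; first exact: time_poly_eval hu.
move=> k; pose P : {poly R} := \sum_l ev (psi l) k *: p l.
have PE s : ev (u s) k = P.[s].
  rewrite uE (lin_on_sum _ (fun l => (p l).[s]) Sl (evl k)); last by move=> l; have [] := h l.
  by rewrite horner_sum; apply: eq_bigr => l _; rewrite hornerZ mulrC.
rewrite PE (_ : P = 0) ?horner0//.
pose rs : seq R := [seq (nat_of_ord a)%:R | a <- enum 'I_q.+1].
apply/eqP; apply: contraT => P0; have : (size rs < size P)%N.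
  apply: max_poly_roots => //; first by apply/allP => _ /mapP[a _ ->]; rewrite /root -PE u0.
  by rewrite map_inj_uniq ?enum_uniq// => x y /eqP; rewrite eqr_nat => /eqP/ord_inj.
rewrite size_map size_enum_ord ltnNge => /negP[]; apply: leq_trans (size_sum _ _ _) _.
apply/bigmax_leqP => l _; apply: leq_trans (size_scale_leq _ _) _.
by have [] := h l.
Qed.

Lemma time_poly_basis : exists G (e : 'I_G -> R -> 'rV[R]_d -> R),
  [/\ forall g, time_poly q S (e g),
      forall g g', time_form b t1 t2 (e g) (e g') = (g == g')%:R &
      forall v, time_poly q S v -> v = \sum_g time_form b t1 t2 v (e g) *: e g].
Proof.
have TPl := time_poly_closed q Sl.
have [B1 B2] := time_form_bilin Sl Sl bb q q t1 t2.
pose evT (u : R -> 'rV[R]_d -> R) (i : 'I_#|{: 'I_q.+1 * 'I_N}|) :=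
  ev (u ((enum_val i).1 : nat)%:R) (enum_val i).2.
apply: (@orthonormal_basis _ _ (time_poly q S) (time_form b t1 t2) _ evT).
- exact: TPl.1.
- exact: TPl.2.
- by move=> a x y w hx hy hw; exact: B1.
- by move=> x y hx hy; exact: (time_form_sym Sl bs _ _ hx hy).
- move=> x hx x0; rewrite lt_def (time_form_ge0 Sl b0 t1 t2 hx) andbT.
  by apply: contraNneq x0 => /(time_form_eq0 Sl bb b0 t12 bp hx) ->.
- by move=> a x y k hx hy; apply: evl; [exact: time_poly_eval hx|exact: time_poly_eval hy].
- move=> x hx x0; apply: (time_poly_values_eq0 hx) => a k.
  by have := x0 (enum_rank (a, k)); rewrite /evT enum_rankK.
Qed.

End time_basis.

(** * Space-time integrals of the data *)

Section data.
Context {R : realType} {d : nat} (A : set 'rV[R]_d) (tf : R)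
  (S : set ('rV[R]_d -> R)) (f : R -> 'rV[R]_d -> R).
Local Notation leb := (@lebesgue_measure R).
Context (mA : measurable A).
Context (adm : admissible_data A tf S f).

(* The integrability in space holds for almost all times only, and measurability
   in time is only known for the functions in [S]. *)
Lemma data_rep q v : time_poly q S v -> exists (g : R -> R) N,
  [/\ leb.-integrable `]0, tf] (EFin \o g), measurable N, leb N = 0%E &
   forall t, 0 < t <= tf -> ~ N t -> inner A (f t) (v t) = g t /\
     (lebesgue_rV d).-integrable A (fun x => (f t x * v t x)%:E)].
Proof.
move=> /time_polyE[M [p [psi [h vE]]]].
have NP l : exists N, [/\ measurable N, leb N = 0%E & forall t, 0 < t <= tf -> ~ N t ->
    (lebesgue_rV d).-integrable A (fun x => (f t x * psi l x)%:E)].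
  have [[N [mN N0 NN]] _] := adm (h l).2; exists N; split => // t tt nN.
  apply: contrapT => nt; apply: nN; apply: NN => /= ht; exact: nt (ht tt).
have {NP}/choice[N NP] := NP.
exists (fun t => \sum_l (p l).[t] * inner A (f t) (psi l)), (\big[setU/set0]_l N l); split.
- have mI : measurable (`]0, tf]%classic : set (measurableTypeR R)) by exact: measurable_itv.
  have int1 l : leb.-integrable `]0, tf] (EFin \o (fun t => (p l).[t] * inner A (f t) (psi l))).
    have [_ il] := adm (h l).2.
    have := integrableMr mI _ _ il (h := horner (p l)); apply.
      by apply: measurable_funTS; apply: continuous_measurable_fun; exact: continuous_horner.
    have cp : compact (horner (p l) @` `[0, tf]%classic).
      apply: continuous_compact; last exact: segment_compact.
      by apply: continuous_subspaceT; exact: continuous_horner.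
    have [B [Br BP]] := compact_bounded cp; exists B; split => // B' BB' x /= xI.
    apply: BP => //; exists x => //=; move: xI; rewrite /= !in_itv/= => /andP[x0 ->].
    by rewrite ltW.
  have : leb.-integrable `]0, tf] (fun t => \sum_l ((p l).[t] * inner A (f t) (psi l))%:E).
    by apply: integrable_sum => // l _; exact: int1.
  by apply: eq_integrable => // t _ /=; rewrite sumEFin.
- by apply: bigsetU_measurable => l _; case: (NP l).
- apply/le_anti; rewrite measure_ge0 andbT.
  apply: le_trans (measure_bigsetU_le _ _ _) _; first by move=> l; case: (NP l).
  by rewrite big1// => l _; case: (NP l).
move=> t tt nN.
have il l : (lebesgue_rV d).-integrable A (fun x => (f t x * psi l x)%:E).
  have [_ _] := NP l; apply => // Nl; apply: nN; rewrite -bigcup_seq; exists l => //=.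
  by rewrite mem_index_enum.
have il' l : (lebesgue_rV d).-integrable A (EFin \o (fun x => (p l).[t] * (f t x * psi l x))).
  by have := integrableZl mA (p l).[t] (il l); exact: eq_integrable.
have fv x : f t x * v t x = \sum_l (p l).[t] * (f t x * psi l x).
  by rewrite vE fct_sumE mulr_sumr; apply: eq_bigr => l _; rewrite /= mulrCA.
split.
  rewrite /inner; under eq_Rintegral do rewrite fv.
  rewrite Rintegral_sum//; apply: eq_bigr => l _.
  by rewrite RintegralZl//; exact: il.
have : (lebesgue_rV d).-integrable A (fun x => \sum_l ((p l).[t] * (f t x * psi l x))%:E).
  by apply: integrable_sum => // l _; exact: il'.
by apply: eq_integrable => // x _ /=; rewrite fv sumEFin.
Qed.

Definition data_form (t1 t2 : R) (v : R -> 'rV[R]_d -> R) : R :=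
  \int[leb]_(t in `]t1, t2[) inner A (f t) (v t).

Context (t1 t2 : R) (t1_ge0 : 0 <= t1) (t2_le : t2 <= tf).
Local Notation I := `]t1, t2[%classic.

Let I_sub t : I t -> 0 < t <= tf.
Proof.
rewrite /= in_itv/= => /andP[h1 h2].
by rewrite (le_lt_trans t1_ge0 h1) (le_trans (ltW h2) t2_le).
Qed.

Let mI : measurable (I : set (measurableTypeR R)). Proof. exact: measurable_itv. Qed.

Let integrable_I (g : R -> R) : leb.-integrable `]0, tf] (EFin \o g) ->
  leb.-integrable I (EFin \o g).
Proof.
apply: integrableS => // t /I_sub; by rewrite /= in_itv.
Qed.

Lemma data_form_lin q : lin_on (time_poly q S) (data_form t1 t2).
Proof.
move=> a u v hu hv.
have [gu [Nu [iu mu Nu0 uP]]] := data_rep hu.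
have [gv [Nv [iv mv Nv0 vP]]] := data_rep hv.
have nulU : leb (Nu `|` Nv) = 0%E.
  by rewrite -Nu0; exact: measureU0.
have mU := measurableU _ _ mu mv.
have -> : data_form t1 t2 u = \int[leb]_(t in I) gu t.
  by apply: (Rintegral_null mu Nu0) => t It nN; have [] := uP t (I_sub It) nN.
have -> : data_form t1 t2 v = \int[leb]_(t in I) gv t.
  by apply: (Rintegral_null mv Nv0) => t It nN; have [] := vP t (I_sub It) nN.
rewrite -RintegralZl//; last exact: integrable_I.
rewrite -RintegralD//; last 2 first.
- by have := integrableZl mI a (integrable_I iu); exact: eq_integrable.
- exact: integrable_I.
apply: (Rintegral_null mU nulU) => t It nN.
have [e1 i1] := uP t (I_sub It) (fun h => nN (or_introl h)).
have [e2 i2] := vP t (I_sub It) (fun h => nN (or_intror h)).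
rewrite -e1 -e2 /inner -RintegralZl// -RintegralD//; last first.
  by have := integrableZl mA a i1; exact: eq_integrable.
apply: eq_Rintegral => x _; rewrite (_ : (a *: u + v) t = a *: u t + v t)//.
by rewrite (_ : (a *: u t + v t) x = a * u t x + v t x)//; ring.
Qed.

Lemma Rintegral_sub_data q (P : {poly R}) v : time_poly q S v ->
  \int[leb]_(t in I) (P.[t] - inner A (f t) (v t)) =
  \int[leb]_(t in I) P.[t] - data_form t1 t2 v.
Proof.
move=> hv; have [gv [Nv [iv mv Nv0 vP]]] := data_rep hv.
have -> : data_form t1 t2 v = \int[leb]_(t in I) gv t.
  by apply: (Rintegral_null mv Nv0) => t It nN; have [] := vP t (I_sub It) nN.
rewrite -RintegralB//; last 2 first.
- exact: integrable_horner_oo.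
- exact: integrable_I.
by apply: (Rintegral_null mv Nv0) => t It nN; have [-> _] := vP t (I_sub It) nN.
Qed.

Lemma Rintegral_inner_sub_data q (w v : R -> 'rV[R]_d -> R) (P : {poly R}) :
  time_poly q S v -> (forall t, bounded_meas A (w t)) -> (forall t, bounded_meas A (v t)) ->
  (lebesgue_rV d A < +oo)%E ->
  (forall t, inner A (w t) (v t) = P.[t]) ->
  \int[leb]_(t in I) inner A (fun x => w t x - f t x) (v t) =
  \int[leb]_(t in I) inner A (w t) (v t) - data_form t1 t2 v.
Proof.
move=> hv bw bv Aoo PE; under [X in _ = X - _]eq_Rintegral do rewrite PE.
rewrite -(Rintegral_sub_data _ hv).
have [gv [Nv [iv mv Nv0 vP]]] := data_rep hv.
apply: (Rintegral_null mv Nv0) => t It nN; have [_ ii] := vP t (I_sub It) nN.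
rewrite -PE /inner -RintegralB//.
  by apply: eq_Rintegral => x _; rewrite mulrBl.
by apply: bounded_meas_integrable => //; exact: bounded_measM.
Qed.

End data.

(** * The advection-diffusion form *)

(** Truncation at the essential bound makes the function bounded everywhere and changes it only on a
    null set. *)
Lemma Linf_bounded_version (R : realType) d (A : set 'rV[R]_d) f : measurable A ->
  Linf A f -> exists f' N B, [/\ bounded_meas A f', measurable N, lebesgue_rV d N = 0%E,
    0 <= B & (forall x, A x -> `|f' x| <= B) /\ forall x, A x -> ~ N x -> f x = f' x].
Proof.
move=> mA [mf [B [N [mN N0 NP]]]].
have [m m0 Bm] : exists2 m, 0 <= m & B <= m.
  by exists (Num.max B 0); rewrite le_max lexx// orbT.
exists (fun x => Num.min m (Num.max (- m) (f x))), N, m.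
have fb x : `|Num.min m (Num.max (- m) (f x))| <= m.
  rewrite ler_norml; apply/andP; split; last by rewrite ge_min lexx.
  by rewrite le_min le_max lexx /= andbT; lra.
split => //; last first.
  split => // x Ax nN.
  have fB : `|f x| <= B by apply: contrapT => h; apply: nN; apply: NP => /= /(_ Ax).
  have := le_trans fB Bm; rewrite ler_norml => /andP[h1 h2].
  by rewrite (max_idPr h1) (min_idPr h2).
split; last by exists m.
apply: measurable_minr; first exact: measurable_cst.
by apply: measurable_maxr => //; exact: measurable_cst.
Qed.

Lemma ip_bilin d (T : measurableType d) (R : realType) (mu : {measure set T -> \bar R})
    (A : set T) : measurable A -> (mu A < +oo)%E ->
  bilin_on (bounded_meas A : set (T -> R)) (bounded_meas A) (ip mu A).
Proof.
move=> mA Aoo; split => [v hv a u w hu hw|u hu a v w hv hw]; first exact: ip_lin.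
by rewrite ip_sym ip_lin// !(ip_sym _ _ u).
Qed.

Lemma bounded_meas_closed d (T : measurableType d) (R : realType) (A : set T) :
  measurable A -> lin_closed (bounded_meas A : set (T -> R)).
Proof.
move=> mA; split; first exact: bounded_meas_cst.
by move=> a u v hu hv; exact: bounded_meas_lin.
Qed.

Section L2_norm.
Context d (T : measurableType d) (R : realType) (mu : {measure set T -> \bar R}).
Context (A : set T) (mA : measurable A) (Aoo : (mu A < +oo)%E).
Local Notation ip := (ip mu A).

Definition L2norm (f : T -> R) : R := Num.sqrt (ip f f).

Lemma L2_ge0 f : 0 <= L2norm f. Proof. exact: sqrtr_ge0. Qed.

Lemma L2_mul_le f g B : bounded_meas A f -> bounded_meas A g -> 0 <= B ->
  (forall x, A x -> `|g x| <= B) -> L2norm (g \* f) <= B * L2norm f.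
Proof.
move=> bf bg B0 gB; rewrite -[X in X * _](ger0_norm B0) -sqrtr_sqr /L2norm -sqrtrM ?sqr_ge0//.
rewrite ler_wsqrtr//.
have -> : B ^+ 2 * ip f f = ip (fun x => B * f x) (fun x => B * f x).
  rewrite /ip -RintegralZl//; last exact/bounded_meas_integrable/bounded_measM.
  by apply: eq_Rintegral => x _; ring.
apply: ip_le => //; first exact: bounded_measM.
  by apply: bounded_measM => //; exact: bounded_meas_cst.
by move=> x Ax; rewrite !normrM (ger0_norm B0); apply: ler_wpM2r => //; exact: gB.
Qed.

End L2_norm.

Section advection_diffusion.
Context {R : realType} {n : nat} (hd : (n.+1 == 2) || (n.+1 == 3)).
Local Notation pt := 'rV[R]_n.+1.
Context (k : nat) (tau : @mesh R n.+1) (Z : set pt) (sigma : R) (O : set pt).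
Local Notation D := (\bigcup_K carrier (tau K)).
Local Notation mu := (@lebesgue_rV R n.+1).
Context (conf : conforming_mesh D tau) (reg : regular_mesh sigma tau).
Context (cD : closed D) (Kn : exists K : 'I_(ncells tau), True).
Context (mO : measurable O) (Ofin : (mu O < +oo)%E) (OD : O `<=` D).
Context (Oball : forall (x : pt) (r : R), 0 < r -> ball x r `<=` D -> ball x r `<=` O).
Local Notation h := (meshsize tau).
Local Notation S := (fe_space k tau Z).
Local Notation L2 := (L2norm mu O).

Context (nu0 : R) (s : pt -> pt) (gs ss : 'I_n.+1 -> pt -> R) (B : R).
Context (bg : forall j, bounded_meas O (gs j)) (bs : forall j, bounded_meas O (ss j)).
Context (B0 : 0 <= B) (gB : forall j x, O x -> `|gs j x| <= B)
  (sB : forall j x, O x -> `|ss j x| <= B).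
Context (gE : forall j, exists N, [/\ measurable N, mu N = 0%E &
  forall x, O x -> ~ N x -> wpd O j (fun y => s y ord0 j) x = gs j x]).
Context (sE : forall j, exists N, [/\ measurable N, mu N = 0%E &
  forall x, O x -> ~ N x -> s x ord0 j = ss j x]).

Lemma fe_closed : lin_closed S.
Proof. by split; [exact: fe_space0|move=> a u v hu hv; exact: fe_space_lin]. Qed.

(** [Lform] with cut-off derivatives and with bounded versions of the coefficients. All its
    integrands are bounded and measurable, so bilinearity and Cauchy-Schwarz apply term by term. *)
Definition Bform (v w : pt -> R) : R :=
  nu0 * \sum_j ip mu O (cell_pd tau j v) (cell_pd tau j w) +
  \sum_j (ip mu O (gs j \* v) w + ip mu O (ss j \* cell_pd tau j v) w).

Let bv v : S v -> bounded_meas O v. Proof. exact: fe_bounded_meas. Qed.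

Let bp j v : S v -> bounded_meas O (cell_pd tau j v).
Proof. by move=> hv; exact: (cell_pd_bounded_meas hd O conf reg cD Kn j hv). Qed.

Let bgv j v : S v -> bounded_meas O (gs j \* v).
Proof. by move=> hv; apply: bounded_measM => //; exact: bv. Qed.

Let bsv j v : S v -> bounded_meas O (ss j \* cell_pd tau j v).
Proof. by move=> hv; apply: bounded_measM => //; exact: bp. Qed.

Lemma LformE v w : S v -> S w -> Lform nu0 O s v w = Bform v w.
Proof.
move=> hv hw; rewrite /Lform /Bform.
have [N [mN N0 NG]] := mesh_interior_ae hd conf reg Kn.
have [Ng NgP] := choice gE; have [Ns NsP] := choice sE.
congr (_ * _ + _).
  transitivity (\int[mu]_(x in O) \sum_j (cell_pd tau j v x * cell_pd tau j w x)).
    apply: (Rintegral_null mN N0) => x Ox nN; have Gx := NG x (OD Ox) nN.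
    by apply: eq_bigr => j _; rewrite !cell_pdE.
  rewrite Rintegral_sum// => j.
  by apply: bounded_meas_integrable => //; apply: bounded_measM; exact: bp.
pose NN := N `|` \big[setU/set0]_j (Ng j `|` Ns j).
have mgs j : measurable (Ng j `|` Ns j).
  by apply: measurableU; [case: (NgP j)|case: (NsP j)].
have mU : measurable (\big[setU/set0]_j (Ng j `|` Ns j)) by exact: bigsetU_measurable.
have mNN : measurable NN by exact: measurableU.
have NN0 : mu NN = 0%E.
  have U0 : mu (\big[setU/set0]_j (Ng j `|` Ns j)) = 0%E.
    apply/le_anti; rewrite measure_ge0 andbT.
    apply: le_trans (measure_bigsetU_le _ _ _) _ => //.
    rewrite big1// => j _; have [m1 z1 _] := NgP j; have [m2 z2 _] := NsP j.
    by rewrite -[RHS]z1; exact: measureU0.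
  by rewrite -N0; exact: measureU0.
transitivity (\int[mu]_(x in O) \sum_j ((gs j x * v x) * w x + (ss j x * cell_pd tau j v x) * w x)).
  apply: (Rintegral_null mNN NN0) => x Ox nNN.
  have Gx : mesh_interior tau x by apply: NG (OD Ox) _ => nN; apply: nNN; left.
  have nj j : ~ (Ng j `|` Ns j) x.
    move=> nj; apply: nNN; right; rewrite -bigcup_seq; exists j => //=.
    by rewrite mem_index_enum.
  rewrite /div_mul mulr_suml; apply: eq_bigr => j _.
  have [_ _ g1] := NgP j; have [_ _ s1] := NsP j.
  rewrite g1//; last by move=> h1; apply: (nj j); left.
  rewrite s1//; last by move=> h1; apply: (nj j); right.
  by rewrite cell_pdE// mulrDl.
have i1 j : bounded_meas O (fun x => gs j x * v x * w x).
  by apply: bounded_measM; [exact: bgv|exact: bv].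
have i2 j : bounded_meas O (fun x => ss j x * cell_pd tau j v x * w x).
  by apply: bounded_measM; [exact: bsv|exact: bv].
rewrite Rintegral_sum//; last first.
  by move=> j; apply: bounded_meas_integrable => //; exact: bounded_measD.
by apply: eq_bigr => j _; rewrite RintegralD//; exact: bounded_meas_integrable.
Qed.

Let mul_lin (g : pt -> R) a (u v : pt -> R) : g \* (a *: u + v) = a *: (g \* u) + (g \* v).
Proof.
by apply/funext => x; rewrite !fctE /= mulrDr; congr (_ + _); rewrite /GRing.scale/=; ring.
Qed.

Let pd_lin j a u v : S u -> S v ->
  cell_pd tau j (a *: u + v) = a *: cell_pd tau j u + cell_pd tau j v.
Proof. exact: (cell_pd_lin hd conf reg Kn). Qed.

Lemma Bform_bilin : bilin_on S S Bform.
Proof.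
have [ip1 ip2] := ip_bilin mO Ofin; split => [v hv|u hu].
  apply: lin_onD; first apply: lin_onZ; apply: lin_on_bigsum => j.
    by move=> a u w hu hw; rewrite pd_lin// ip1//; exact: bp.
  apply: lin_onD => a u w hu hw.
    by rewrite mul_lin ip1//; [exact: bv|exact: bgv|exact: bgv].
  by rewrite pd_lin// mul_lin ip1//; [exact: bv|exact: bsv|exact: bsv].
apply: lin_onD; first apply: lin_onZ; apply: lin_on_bigsum => j.
  by move=> a v w hv hw; rewrite pd_lin// ip2//; exact: bp.
apply: lin_onD => a v w hv hw; rewrite ip2//; try exact: bv.
  exact: bgv.
exact: bsv.
Qed.

Lemma Lform_bilin : bilin_on S S (Lform nu0 O s).
Proof.
have [b1 b2] := Bform_bilin; have [S0 Sl] := fe_closed.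
split => [v hv a u w hu hw|u hu a v w hv hw]; rewrite !LformE//; try exact: Sl.
  exact: b1.
exact: b2.
Qed.

(** One term each for diffusion, of order [h^-2], the derivative of [s], of order 1, and advection,
    of order [h^-1]. The factors [H^2] and [H] raise the last two to order [h^-2], as [h <= H]. *)
Definition Lform_const (H : R) : R :=
  n.+1%:R * (`|nu0| * @grad_const R n k sigma + B * H ^+ 2 +
             B * Num.sqrt (@grad_const R n k sigma) * H).

Lemma Lform_le H v w : h <= H -> S v -> S w ->
  `|Lform nu0 O s v w| <= Lform_const H * h ^- 2 * L2 v * L2 w.
Proof.
move=> hH hv hw; rewrite LformE//.
have h0 := meshsize_gt0 conf Kn.
pose Cg : R := @grad_const R n k sigma.
have pdL j u : S u -> L2 (cell_pd tau j u) <= Num.sqrt Cg * h^-1 * L2 u.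
  move=> hu; have := cell_pd_inverse hd conf reg cD Kn mO Ofin Oball j hu.
  have Cg0 : 0 <= Cg.
    rewrite /Cg /grad_const divr_ge0//; last first.
      by rewrite ltW//; exact: (mass_const_gt0 hd k conf reg Kn).
    by apply: mulr_ge0; [exact: exprn_ge0|exact: sqr_ge0].
  rewrite /L2norm => /ler_wsqrtr/le_trans; apply.
  have c1 : 0 <= Cg / h ^+ 2 by rewrite divr_ge0// exprn_ge0// ltW.
  rewrite -/Cg (sqrtrM _ c1) (sqrtrM _ Cg0).
  by rewrite -exprVn sqrtr_sqr ger0_norm ?invr_ge0 ?(ltW h0).
have CSip u1 u2 : bounded_meas O u1 -> bounded_meas O u2 ->
    `|ip mu O u1 u2| <= L2 u1 * L2 u2 by exact: ip_cauchy_schwarz.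
have Lv := L2_ge0 mu O v; have Lw := L2_ge0 mu O w.
set sC := Num.sqrt Cg in pdL *.
have sC0 : 0 <= sC by exact: sqrtr_ge0.
have hV : 0 < h^-1 by rewrite invr_gt0.
have Hh : 1 <= H * h^-1 by rewrite ler_pdivlMr// mul1r.
have t1 : `|nu0 * \sum_j ip mu O (cell_pd tau j v) (cell_pd tau j w)| <=
    n.+1%:R * (`|nu0| * Cg * h^-1 ^+ 2 * L2 v * L2 w).
  rewrite normrM; have -> : n.+1%:R * (`|nu0| * Cg * h^-1 ^+ 2 * L2 v * L2 w) =
      `|nu0| * \sum_(j < n.+1) (Cg * h^-1 ^+ 2 * L2 v * L2 w).
    by rewrite sumr_const card_ord -mulr_natl; ring.
  apply: ler_wpM2l => //; apply: le_trans (ler_norm_sum _ _ _) _; apply: ler_sum => j _.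
  apply: le_trans (CSip _ _ (bp j hv) (bp j hw)) _.
  apply: le_trans (ler_pM (L2_ge0 _ _ _) (L2_ge0 _ _ _) (pdL j v hv) (pdL j w hw)) _.
  have : sC * sC = Cg.
    rewrite -expr2 sqr_sqrtr// /Cg /grad_const divr_ge0//; last first.
      by rewrite ltW//; exact: (mass_const_gt0 hd k conf reg Kn).
    by apply: mulr_ge0; [exact: exprn_ge0|exact: sqr_ge0].
  by move=> <-; rewrite le_eqVlt; apply/orP; left; apply/eqP; ring.
have t2 : `|\sum_j (ip mu O (gs j \* v) w + ip mu O (ss j \* cell_pd tau j v) w)| <=
    n.+1%:R * ((B + B * sC * h^-1) * L2 v * L2 w).
  have -> : n.+1%:R * ((B + B * sC * h^-1) * L2 v * L2 w) =
      \sum_(j < n.+1) ((B + B * sC * h^-1) * L2 v * L2 w).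
    by rewrite sumr_const card_ord -[RHS]mulr_natl.
  apply: le_trans (ler_norm_sum _ _ _) _; apply: ler_sum => j _.
  apply: le_trans (ler_normD _ _) _; rewrite !mulrDl; apply: lerD.
    apply: le_trans (CSip _ _ (bgv j hv) (bv hw)) _; apply: ler_wpM2r => //.
    by apply: L2_mul_le => //; [exact: bv|exact: gB].
  apply: le_trans (CSip _ _ (bsv j hv) (bv hw)) _; apply: ler_wpM2r => //.
  apply: (@le_trans _ _ (B * L2 (cell_pd tau j v))).
    by apply: L2_mul_le => //; [exact: bp|exact: sB].
  by rewrite -!mulrA; apply: ler_wpM2l => //; rewrite mulrA; exact: pdL.
rewrite /Bform; apply: le_trans (ler_normD _ _) _.
apply: le_trans (lerD t1 t2) _.
rewrite -exprVn /Lform_const -/Cg -/sC.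
have x0 : 0 <= h^-1 by exact: ltW.
have LL : 0 <= n.+1%:R * (L2 v * L2 w) by rewrite !mulr_ge0.
have e1 : B <= B * H ^+ 2 * h^-1 ^+ 2.
  by rewrite -mulrA -exprMn ler_peMr// expr_ge1// (le_trans ler01 Hh).
have e2 : B * sC * h^-1 <= B * sC * H * h^-1 ^+ 2.
  have -> : B * sC * H * h^-1 ^+ 2 = B * sC * h^-1 * (H * h^-1) by ring.
  by rewrite ler_peMr// !mulr_ge0.
have := ler_wpM2l LL (lerD e1 e2).
set X := L2 v; set Y := L2 w; lra.
Qed.

End advection_diffusion.

(** * The coupled problem *)

Section coupled.
Context {R : realType} {n : nat} (P : dgit_params R n).
Context (tau : 'I_2 -> @mesh R n.+1) (tauG : @mesh R n).
Context (dt tf : R) (dt0 : 0 < dt) (hM : forall i, (0 < Msub P i)%N).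
Context (f : 'I_2 -> R -> 'rV[R]_n.+1 -> R) (g : 'I_2 -> R -> 'rV[R]_n -> R).
Local Notation leb := (@lebesgue_measure R).
Local Notation S i := (U_space (kdeg P) (tau i) i).
Local Notation SG := (UG_space (kdeg P) tauG).
Local Notation L i := (Lform (nu P i) (Omega i) (adv P i)).
Local Notation O i := (@Omega R n i).
Local Notation G := (@Gam R n).

Context (Sl : forall i, lin_closed (S i)) (SGl : lin_closed SG).
Context (Sb : forall i, S i `<=` bounded_meas (O i)) (SGb : SG `<=` bounded_meas G).
Context (Tb : forall i v, S i v -> bounded_meas G (trace v)).
Context (Lb : forall i, bilin_on (S i) (S i) (L i)).
Context (af : forall i, admissible_data (O i) tf (S i) (f i))
  (ag : forall i, admissible_data G tf SG (g i)).

Context (D : 'I_2 -> nat) (phi : forall i, 'I_(D i) -> 'rV[R]_n.+1 -> R).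
Context (Sphi : forall i m, S i (@phi i m))
  (phi_on : forall i m m', inner (O i) (@phi i m) (@phi i m') = (m == m')%:R)
  (phi_exp : forall i v, S i v -> v = \sum_m inner (O i) v (@phi i m) *: @phi i m).

Definition flux_form (F : 'rV[R]_n -> R) (v : 'rV[R]_n.+1 -> R) : R := inner G F (trace v).
Definition trace_form (v : 'rV[R]_n.+1 -> R) (F : 'rV[R]_n -> R) : R := inner G (trace v) F.

Lemma inner_bilin i : bilin_on (S i) (S i) (inner (O i)).
Proof.
have [b1 b2] := ip_bilin (@measurable_Omega R n i) (@Omega_finite R n i).
split => [v hv|u hu]; first by apply: (lin_on_sub (@Sb i)); apply: b1; exact: Sb.
by apply: (lin_on_sub (@Sb i)); apply: b2; exact: Sb.
Qed.

Lemma innerG_bilin : bilin_on (bounded_meas G) (bounded_meas G) (inner G).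
Proof. exact: ip_bilin (@measurable_Gam R n) (@Gam_finite R n). Qed.

Lemma innerSG_bilin : bilin_on SG SG (inner G).
Proof.
have [b1 b2] := innerG_bilin.
split => [v hv|u hu]; first by apply: (lin_on_sub SGb); apply: b1; exact: SGb.
by apply: (lin_on_sub SGb); apply: b2; exact: SGb.
Qed.

Lemma innerG_sym u v : inner G u v = inner G v u.
Proof. exact: ip_sym. Qed.

Lemma flux_bilin i : bilin_on SG (S i) flux_form.
Proof.
have [b1 b2] := innerG_bilin.
split => [v hv|u hu]; first by apply: (lin_on_sub SGb); apply: b1; exact: Tb hv.
by move=> a v w hv hw; apply: b2; [exact: SGb|exact: Tb hv|exact: Tb hw].
Qed.

Lemma trace_bilin i : bilin_on (S i) SG trace_form.
Proof.
have [b1 b2] := innerG_bilin.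
split => [v hv|u hu].
  by move=> a u w hu hw; apply: b1; [exact: SGb|exact: Tb hu|exact: Tb hw].
by apply: (lin_on_sub SGb); apply: b2; exact: Tb hu.
Qed.

Lemma inner_phi i (x : 'I_(D i) -> R) m :
  inner (O i) (\sum_m' x m' *: @phi i m') (@phi i m) = x m.
Proof.
have [b1 _] := inner_bilin i.
rewrite (lin_on_sum _ _ (@Sl i) (b1 _ (Sphi m)) (@Sphi i)).
rewrite (bigD1 m)//= phi_on eqxx mulr1 big1 ?addr0// => m' m'm.
by rewrite phi_on (negbTE m'm) mulr0.
Qed.

Definition window_ok (z : dgit_fun R n) (w : nat) := forall i,
  [/\ time_poly (rdeg P i) SG (sol_uG z i w), time_poly (rdeg P i) SG (sol_F z i w),
      eq_T P tauG dt z i w, eq_F P tauG dt g z i w &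
      forall l, (1 <= l <= Msub P i)%N ->
        [/\ time_poly (qdeg P) (S i) (sol_u z i w l), S i (sol_U z i (gidx P i w l)),
            eq_S P dt z i w l & eq_V P tau dt f z i w l]].

Definition thk (k : nat) : R := if insub k is Some k' then theta P k' else 0.

Definition Dk (k c : nat) : R := if insub k is Some k' then Dmat P k' (inord c) else 0.

Context (hns : (ns P <= (qdeg P).+1)%N) (W W' : nat -> nat -> R).
Context (HW : forall (a : nat -> R) j, (j <= qdeg P)%N ->
  a j = \sum_(r < (qdeg P).+1 - ns P) W j r * (\sum_(j' < (qdeg P).+1) (j' + r).+1%:R^-1 * a j')
      + \sum_(k < ns P) W' j k * (\sum_(j' < (qdeg P).+1) thk k ^+ j' * a j')).
Context (Lam Ct : R) (Lam0 : 0 <= Lam) (Ct0 : 0 <= Ct).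
Context (LB : forall i v v', S i v -> S i v' ->
  `|L i v v'| <= Lam * L2norm (@lebesgue_rV R n.+1) (O i) v * L2norm (@lebesgue_rV R n.+1) (O i) v').
Context (trB : forall i v, S i v -> inner G (trace v) (trace v) <= Ct * inner (O i) v v).
Context (small : window_const (Msub P) (qdeg P) ((qdeg P).+1 - ns P) (ns P) (ks P) Dk (bcoef P) W W'
  * (dt * (Lam + Ct)) < 1).

(** * One coupling window and its coordinate system *)

Section one_window.
Context (w : nat) (w0 : (0 < w)%N) (wtf : wtime dt w <= tf).
Context (Gd : 'I_2 -> nat) (Mb : forall i, 'I_(Gd i) -> R -> 'rV[R]_n -> R).
Local Notation TG i := (time_poly (rdeg P i) SG).
Local Notation wform := (time_form (inner G) (wtime dt w.-1) (wtime dt w)).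
Context (MbT : forall i g, TG i (@Mb i g))
  (Mb_on : forall i g g', wform (@Mb i g) (@Mb i g') = (g == g')%:R)
  (Mb_exp : forall i v, TG i v -> v = \sum_g wform v (@Mb i g) *: @Mb i g).

Local Notation st i l := (stime P dt i w l).
Local Notation q := (qdeg P).
Local Notation nv := (q.+1 - ns P)%N.
Local Notation T i := (time_poly q (S i)).
Local Notation TV i := (time_poly nv (S i)).

Lemma dti_gt0 i : 0 < dti P dt i.
Proof. by rewrite divr_gt0// ltr0n. Qed.

Lemma stimeS i l : st i l.+1 = st i l + dti P dt i.
Proof. by rewrite /stime -addrA -[l.+1]addn1 natrD mulrDl mul1r. Qed.

Lemma wtime_pred : wtime dt w = wtime dt w.-1 + dt.
Proof. by rewrite /wtime -{1}(prednK w0) -natr1 mulrDl mul1r. Qed.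

Lemma wtime_ge0 : 0 <= wtime dt w.-1.
Proof. by rewrite mulr_ge0// ltW. Qed.

Lemma stime_le i l : (l <= Msub P i)%N -> st i l <= wtime dt w.
Proof.
move=> lM; rewrite wtime_pred lerD2l -[leRHS](divfK (x := (Msub P i)%:R)); last first.
  by rewrite pnatr_eq0 -lt0n.
by rewrite mulrC ler_wpM2l ?ler_nat// ltW// dti_gt0.
Qed.

Lemma stime_ge i l : wtime dt w.-1 <= st i l.
Proof. by rewrite lerDl mulr_ge0// ltW// dti_gt0. Qed.

Lemma stime_ge0 i l : 0 <= st i l.
Proof. exact: le_trans wtime_ge0 (stime_ge i l). Qed.

Lemma stime_tf i l : (l < Msub P i)%N -> st i l.+1 <= tf.
Proof. by move=> lM; exact: le_trans (stime_le lM) wtf. Qed.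

Definition basis_u i l j m := tensor (st i l) (dti P dt i) (@phi i) j m.

Definition stiff i m' m : R := L i (@phi i m') (@phi i m).

Definition flux_mx i l r m h : R :=
  time_form flux_form (st i l) (st i l.+1) (@Mb i h) (@basis_u i l r m).

Definition exchange i j h' h : R := wform (@Mb j h') (@Mb i h).

Definition load i l r m : R :=
  data_form (O i) (f i) (st i l) (st i l.+1) (@basis_u i l r m).

Definition flux_load i h : R := - data_form G (g i) (wtime dt w.-1) (wtime dt w) (@Mb i h).

Definition V_residual i l (U1 U0 : 'rV[R]_n.+1 -> R) u F v : R :=
  inner (O i) U1 (v (st i l.+1))
  - time_form (inner (O i)) (st i l) (st i l.+1) u (time_deriv v)
  - inner (O i) U0 (v (st i l))
  + time_form (L i) (st i l) (st i l.+1) u v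
  + time_form flux_form (st i l) (st i l.+1) F v
  - data_form (O i) (f i) (st i l) (st i l.+1) v.

Lemma V_residualE i l U1 U0 u F v : (l < Msub P i)%N -> T i u -> TG i F -> TV i v ->
  (inner (O i) U1 (v (st i l.+1))
    - \int[leb]_(t in `]st i l, st i l.+1[)
        inner (O i) (u t) (fun x => derive1 (v ^~ x) t)
    = inner (O i) U0 (v (st i l))
    - \int[leb]_(t in `]st i l, st i l.+1[)
        (L i (u t) (v t) + inner G (F t) (trace (v t)) - inner (O i) (f i t) (v t)))
  <-> V_residual i l U1 U0 u F v = 0.
Proof.
move=> lM hu hF hv.
have [PL PLE] := time_bilinear_poly (Sl i) (Sl i) (Lb i) hu hv.
have [PF PFE] := time_bilinear_poly SGl (Sl i) (flux_bilin i) hF hv.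
have -> : \int[leb]_(t in `]st i l, st i l.+1[)
    (L i (u t) (v t) + inner G (F t) (trace (v t)) - inner (O i) (f i t) (v t)) =
    time_form (L i) (st i l) (st i l.+1) u v + time_form flux_form (st i l) (st i l.+1) F v
    - data_form (O i) (f i) (st i l) (st i l.+1) v.
  have E t : L i (u t) (v t) + inner G (F t) (trace (v t)) = (PL + PF).[t].
    by rewrite hornerD -PLE -PFE.
  under eq_Rintegral do rewrite E.
  rewrite (Rintegral_sub_data (measurable_Omega i) (@af i) (stime_ge0 i l) (stime_tf lM) (PL + PF) hv).
  congr (_ - _); under eq_Rintegral do rewrite hornerD.
  rewrite RintegralD//; try exact: integrable_horner_oo.
  by congr (_ + _); apply: eq_Rintegral => t _; rewrite -?PLE -?PFE.
rewrite /V_residual /time_form /time_deriv.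
split=> [->|/eqP]; first by ring.
by move=> h; apply/eqP; rewrite -subr_eq0; move: h; congr (_ == _); ring.
Qed.

(** Linearity in the test function reduces (V) to the basis of test functions. *)
Lemma V_residual_lin i l U1 U0 u F : (l < Msub P i)%N -> S i U1 -> S i U0 -> T i u -> TG i F ->
  lin_on (TV i) (V_residual i l U1 U0 u F).
Proof.
move=> lM h1 h0 hu hF.
have ev U t : S i U -> lin_on (TV i) (fun v => inner (O i) U (v t)).
  move=> hU a v v' hv hv'; apply: (inner_bilin i).2 => //;
    [exact: time_poly_eval (Sl i) hv|exact: time_poly_eval (Sl i) hv'].
have [_ B2] := time_form_bilin (Sl i) (Sl i) (inner_bilin i) q nv (st i l) (st i l.+1).
have [_ L2] := time_form_bilin (Sl i) (Sl i) (Lb i) q nv (st i l) (st i l.+1).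
have [_ F2] := time_form_bilin SGl (Sl i) (flux_bilin i) (rdeg P i) nv (st i l) (st i l.+1).
apply: lin_onB; last exact: (data_form_lin (measurable_Omega i) (@af i) (stime_ge0 i l) (stime_tf lM)).
apply: lin_onD; last exact: F2.
apply: lin_onD; last exact: L2.
apply: lin_onB; last exact: ev.
apply: lin_onB; first exact: ev.
move=> a v v' hv hv'; rewrite (time_deriv_lin a hv hv').
by apply: B2 => //; exact: time_poly_deriv.
Qed.

Lemma basis_uT i l j m : (j <= q)%N -> T i (@basis_u i l j m).
Proof. by move=> jq; apply: time_poly_tensor => //; exact: dti_gt0. Qed.

Lemma basis_uTV i l r m : (r <= nv)%N -> TV i (@basis_u i l r m).
Proof. by move=> rq; apply: time_poly_tensor => //; exact: dti_gt0. Qed.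

Lemma lin_on_basis_u i l (Fn : (R -> 'rV[R]_n.+1 -> R) -> R) (a : nat -> 'I_(D i) -> R) :
  lin_on (T i) Fn -> Fn (\sum_(j < q.+1) \sum_m a j m *: @basis_u i l j m) =
    \sum_(j < q.+1) \sum_m a j m * Fn (@basis_u i l j m).
Proof.
move=> Fl; apply: (lin_on_sum2 (fun (j : 'I_q.+1) m => a j m) (time_poly_closed q (Sl i)) Fl).
by move=> j m; apply: basis_uT; rewrite -ltnS.
Qed.

Lemma lin_on_basisG i (Fn : (R -> 'rV[R]_n -> R) -> R) (y : 'I_(Gd i) -> R) :
  lin_on (TG i) Fn -> Fn (\sum_h y h *: @Mb i h) = \sum_h y h * Fn (@Mb i h).
Proof. by move=> Fl; exact: (lin_on_sum _ y (time_poly_closed _ SGl) Fl (@MbT i)). Qed.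

(* The residual of (V) against [s^r phi_m], with [s] the time relative to the
   substep. *)
Lemma V_residual_basis i l r m U1 U0 (a : nat -> 'I_(D i) -> R) (y : 'I_(Gd i) -> R) :
  (r <= nv)%N -> S i U0 ->
  V_residual i l U1 U0 (\sum_(j < q.+1) \sum_m' a j m' *: @basis_u i l j m')
    (\sum_h y h *: @Mb i h) (@basis_u i l r m) =
  inner (O i) U1 (@phi i m)
  - \sum_(j < q.+1) r%:R / (j + r)%:R * a j m
  - (r == 0%N)%:R * inner (O i) U0 (@phi i m)
  + (dti P dt i * \sum_(j < q.+1) \sum_m' (j + r).+1%:R^-1 * @stiff i m' m * a j m'
     + \sum_h @flux_mx i l r m h * y h)
  - @load i l r m.
Proof.
move=> rnv h0; have hv := @basis_uTV i l r m rnv; have c0 := dti_gt0 i.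
rewrite /V_residual.
have [B1 _] := time_form_bilin (Sl i) (Sl i) (inner_bilin i) q nv (st i l) (st i l.+1).
have [L1 _] := time_form_bilin (Sl i) (Sl i) (Lb i) q nv (st i l) (st i l.+1).
have [F1 _] := time_form_bilin SGl (Sl i) (flux_bilin i) (rdeg P i) nv (st i l) (st i l.+1).
rewrite (lin_on_basis_u _ _ (B1 _ (time_poly_deriv hv))).
rewrite (lin_on_basis_u _ _ (L1 _ hv)) (lin_on_basisG _ (F1 _ hv)).
have -> : inner (O i) U1 (basis_u l r m (st i l.+1)) = inner (O i) U1 (@phi i m).
  by rewrite /basis_u /tensor stimeS time_mono_end// scale1r.
have -> : inner (O i) U0 (basis_u l r m (st i l)) = (r == 0%N)%:R * inner (O i) U0 (@phi i m).
  rewrite /basis_u /tensor time_mono_start -[X in inner _ X _]scale1r.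
  by rewrite (bilin_onZ (Sl i) (Sl i) (inner_bilin i))// mul1r.
have -> : \sum_(j < q.+1) \sum_m' a j m' * time_form (inner (O i)) (st i l) (st i l.+1)
    (@basis_u i l j m') (time_deriv (@basis_u i l r m)) =
    \sum_(j < q.+1) r%:R / (j + r)%:R * a j m.
  apply: eq_bigr => j _; rewrite (bigD1 m)//= big1 => [|m' m'm].
    rewrite addr0 stimeS (time_form_tensor_deriv _ c0 (Sl i) (Sl i) (inner_bilin i))//.
    by rewrite phi_on eqxx mulr1 mulrC.
  rewrite stimeS (time_form_tensor_deriv _ c0 (Sl i) (Sl i) (inner_bilin i))//.
  by rewrite phi_on (negbTE m'm) !mulr0.
have -> : \sum_(j < q.+1) \sum_m' a j m' * time_form (L i) (st i l) (st i l.+1)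
    (@basis_u i l j m') (@basis_u i l r m) =
    dti P dt i * \sum_(j < q.+1) \sum_m' (j + r).+1%:R^-1 * @stiff i m' m * a j m'.
  rewrite mulr_sumr; apply: eq_bigr => j _; rewrite mulr_sumr; apply: eq_bigr => m' _.
  rewrite stimeS (time_form_tensor _ c0 (Sl i) (Sl i) (Lb i))// /stiff; ring.
have -> : \sum_h y h * time_form flux_form (st i l) (st i l.+1) (@Mb i h) (@basis_u i l r m) =
    \sum_h @flux_mx i l r m h * y h.
  by apply: eq_bigr => h _; rewrite mulrC.
by rewrite /load !addrA.
Qed.

Lemma eq_bigZ0 i (x y : 'I_(D i) -> R) :
  \sum_m x m *: @phi i m = \sum_m y m *: @phi i m <-> x = y.
Proof.
split=> [xy|->//]; apply/funext => m.
by rewrite -(inner_phi x) xy inner_phi.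
Qed.

Section fixed_candidate.
Context (z : dgit_fun R n).
Context (a : forall i, nat -> nat -> 'I_(D i) -> R).
Context (zU : forall i j, (j <= w * Msub P i)%N -> S i (sol_U z i j)).
Context (zG : forall i, TG i (sol_uG z i w)) (zF : forall i, TG i (sol_F z i w)).
Context (zu : forall i l, (l < Msub P i)%N ->
  sol_u z i w l.+1 = \sum_(j < q.+1) \sum_m @a i l j m *: @basis_u i l j m).

Definition coordU i j m : R := inner (O i) (sol_U z i j) (@phi i m).
Definition coordG i h : R := wform (sol_uG z i w) (@Mb i h).
Definition coordF i h : R := wform (sol_F z i w) (@Mb i h).

Local Notation g0 := (fun i => (w.-1 * Msub P i)%N).

Lemma gidx_le i l : (l <= Msub P i)%N -> (gidx P i w l <= w * Msub P i)%N.
Proof.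
by move=> lM; rewrite /gidx -{2}(prednK w0) mulSn addnC leq_add2r.
Qed.

Lemma sol_uT i l : (l < Msub P i)%N -> T i (sol_u z i w l.+1).
Proof. by move=> lM; rewrite zu//; apply: time_poly_of_coords => //; exact: dti_gt0. Qed.

Lemma eq_V_coords i l : (l < Msub P i)%N ->
  eq_V P tau dt f z i w l.+1 <-> forall (r : nat) (m : 'I_(D i)), (r <= nv)%N ->
    Vres q g0 (dti P dt) stiff flux_mx a coordU coordF l r m = @load i l r m.
Proof.
move=> lM.
have U1 : S i (sol_U z i (gidx P i w l.+1)) by apply: zU; exact: gidx_le.
have U0 : S i (sol_U z i (gidx P i w l)) by apply: zU; apply: gidx_le; exact: ltnW.
have E r m : (r <= nv)%N -> V_residual i l (sol_U z i (gidx P i w l.+1))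
    (sol_U z i (gidx P i w l)) (sol_u z i w l.+1) (sol_F z i w) (@basis_u i l r m) =
    Vres q g0 (dti P dt) stiff flux_mx a coordU coordF l r m - @load i l r m.
  move=> rnv; rewrite zu// {1}(Mb_exp (zF i)) V_residual_basis//.
  by rewrite /Vres /coordU /gidx addnS.
have hu := sol_uT lM.
have lin := V_residual_lin lM U1 U0 hu (zF i).
split=> [eqV r m rnv|eqV v hv].
  have hv := @basis_uTV i l r m rnv.
  apply/eqP; rewrite -subr_eq0 -E//; apply/eqP.
  by apply/(V_residualE _ _ lM hu (zF i) hv); exact: eqV.
apply/(V_residualE _ _ lM hu (zF i) hv).
have [c ->] := time_poly_coords (st i l) (dti_gt0 i) (@phi_exp i) hv.
rewrite (lin_on_sum2 (fun (j : 'I_nv.+1) m => c j m) (time_poly_closed nv (Sl i)) lin).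
  rewrite big1// => j _; rewrite big1// => m _.
  have jn : (j <= nv)%N by rewrite -ltnS.
  by rewrite -/(@basis_u i l j m) E// eqV// subrr mulr0.
by move=> j m; apply: basis_uTV; rewrite -ltnS.
Qed.

Lemma eq_S_coords i l : (l < Msub P i)%N ->
  eq_S P dt z i w l.+1 <-> forall (k : nat) (m : 'I_(D i)), (k < ns P)%N ->
    Sres q (ks P) g0 thk Dk a coordU l k m = 0 :> R.
Proof.
move=> lM; have c0 := dti_gt0 i.
have zUc j : (j <= gidx P i w l.+1)%N ->
    sol_U z i j = \sum_m coordU j m *: @phi i m.
  by move=> jl; apply: phi_exp; apply: zU; exact: leq_trans jl (gidx_le _).
have lhs k : sol_u z i w l.+1 (st i l + theta P k * dti P dt i) =
    \sum_m (\sum_(j < q.+1) theta P k ^+ j * @a i l j m) *: @phi i m.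
  rewrite zu// (tensor_sum_eval (st i l) (dti P dt i) (@phi i)).
  apply: eq_bigr => m _; congr (_ *: _); apply: eq_bigr => j _.
  by rewrite [_ + _ - _]addrC addKr mulfK ?gt_eqF// mulrC.
have rhs k : (fun x => \sum_(c < (ks P).+1) Dmat P k c * sol_U z i (gidx P i w l.+1 - c) x) =
    \sum_m (\sum_(c < (ks P).+1) Dmat P k c * coordU (gidx P i w l.+1 - c) m) *: @phi i m.
  rewrite (eq_bigr (fun m => \sum_(c < (ks P).+1)
      (Dmat P k c * coordU (gidx P i w l.+1 - c) m) *: @phi i m)); last first.
    by move=> m _; rewrite scaler_suml.
  rewrite exchange_big fct_sumE; apply/funext => x; apply: eq_bigr => c _.
  rewrite (zUc _ (leq_subr _ _)).
  rewrite -[X in X = _]/((Dmat P k c *: \sum_m coordU (gidx P i w l.+1 - c) m *: @phi i m) x).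
  by rewrite scaler_sumr; congr (_ x); apply: eq_bigr => m _; rewrite scalerA.
have E (k : 'I_(ns P)) m : Sres q (ks P) g0 thk Dk a coordU l k m =
    (\sum_(j < q.+1) theta P k ^+ j * @a i l j m) -
    (\sum_(c < (ks P).+1) Dmat P k c * coordU (gidx P i w l.+1 - c) m).
  rewrite /Sres /thk /Dk valK; congr (_ - _); apply: eq_bigr => c _.
  by rewrite inord_val /gidx addnS.
split=> [eqS k m kn|eqS k].
  rewrite -[k]/(nat_of_ord (Ordinal kn)) E.
  have := eqS (Ordinal kn); rewrite [(l.+1).-1]/= => /funext.
  rewrite lhs rhs => /eq_bigZ0/(congr1 (fun F => F m)) ->.
  by rewrite subrr.
suff : sol_u z i w l.+1 (st i l + theta P k * dti P dt i) =
    (fun x => \sum_(c < (ks P).+1) Dmat P k c * sol_U z i (gidx P i w l.+1 - c) x).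
  by move=> h x; rewrite [(l.+1).-1]/= h.
rewrite lhs rhs; apply/eq_bigZ0/funext => m.
by apply/eqP; rewrite -subr_eq0 -E eqS.
Qed.

Lemma eq_T_coords i :
  eq_T P tauG dt z i w <-> forall h : 'I_(Gd i), Tres (Msub P) q flux_mx a coordG h = 0 :> R.
Proof.
pose TE lam := wform (sol_uG z i w) lam - \sum_(l < Msub P i)
  time_form trace_form (st i l) (st i l.+1) (sol_u z i w l.+1) lam.
have TP lam : (\int[leb]_(t in Iwin dt w) inner Gam (sol_uG z i w t) (lam t)
    = \sum_(1 <= l < (Msub P i).+1)
        \int[leb]_(t in Isub P dt i w l) inner Gam (trace (sol_u z i w l t)) (lam t))
   <-> TE lam = 0.
  rewrite big_add1 big_mkord /TE; split=> [h|/eqP].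
    by apply/eqP; rewrite subr_eq0; apply/eqP; exact: h.
  by rewrite subr_eq0 => /eqP.
have [W1 W2] := time_form_bilin SGl SGl innerSG_bilin (rdeg P i) (rdeg P i) (wtime dt w.-1) (wtime dt w).
have TEl : lin_on (TG i) TE.
  apply: lin_onB; first exact: W2.
  move=> c u v hu hv; rewrite mulr_sumr -big_split/=; apply: eq_bigr => l _.
  have [_ T2] := time_form_bilin (Sl i) SGl (trace_bilin i) q (rdeg P i) (st i l) (st i l.+1).
  by apply: T2 => //; exact: sol_uT.
have E h : TE (@Mb i h) = Tres (Msub P) q flux_mx a coordG h.
  rewrite /TE /Tres; congr (_ - _); apply: eq_bigr => l _.
  have [T1 _] := time_form_bilin (Sl i) SGl (trace_bilin i) q (rdeg P i) (st i l) (st i l.+1).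
  have tauE j m : time_form trace_form (st i l) (st i l.+1) (@basis_u i l j m) (@Mb i h) =
      @flux_mx i l j m h by apply: eq_Rintegral => t _; exact: innerG_sym.
  rewrite zu// (lin_on_basis_u _ _ (T1 _ (MbT h))); apply: eq_bigr => j _.
  by apply: eq_bigr => m _; rewrite tauE mulrC.
split=> [eqT h|eqT lam hl].
  by rewrite -E; apply/TP; apply: eqT; exact: MbT.
apply/TP; rewrite (Mb_exp hl) (lin_on_basisG _ TEl) big1// => h _.
by rewrite E eqT mulr0.
Qed.

Lemma eq_F_coords i :
  eq_F P tauG dt g z i w <-> forall h : 'I_(Gd i), Fres (bcoef P) exchange coordG coordF h = @flux_load i h.
Proof.
(* The two interface traces may have different degrees in time; a common degree puts their
   combination into one space. *)
pose rm := (\max_(j : 'I_2) rdeg P j)%N.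
have rall j : time_poly rm SG (sol_uG z j w).
  by apply: time_poly_mono (zG j) => //; exact: (leq_bigmax (F := rdeg P) j).
pose FE lam := wform (sol_F z i w) lam - (\sum_j bcoef P i j * wform (sol_uG z j w) lam
  - data_form G (g i) (wtime dt w.-1) (wtime dt w) lam).
have [W1 W2] := time_form_bilin SGl SGl innerSG_bilin (rdeg P i) (rdeg P i) (wtime dt w.-1) (wtime dt w).
have Wj j := (time_form_bilin SGl SGl innerSG_bilin rm (rdeg P i) (wtime dt w.-1) (wtime dt w)).2 _ (rall j).
have sumE : (fun t y => \sum_j bcoef P i j * sol_uG z j w t y) =
    \sum_j bcoef P i j *: sol_uG z j w.
  apply/funext => t; apply/funext => y; rewrite !fct_sumE.
  by apply: eq_bigr => j _.
have sumT : time_poly rm SG (\sum_j bcoef P i j *: sol_uG z j w).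
  by apply: (lin_closed_sum _ _ (time_poly_closed rm SGl)) => j; exact: rall.
have FP lam : TG i lam -> (\int[leb]_(t in Iwin dt w) inner Gam (sol_F z i w t) (lam t)
    = \int[leb]_(t in Iwin dt w)
        inner Gam (fun y => \sum_j bcoef P i j * sol_uG z j w t y - g i t y)
          (lam t)) <-> FE lam = 0.
  move=> hl.
  have [Q QE] := time_bilinear_poly SGl SGl innerSG_bilin sumT hl.
  have Ed := Rintegral_inner_sub_data measurable_Gam (@ag i) wtime_ge0 wtf hl
    (fun t => SGb (time_poly_eval t SGl sumT)) (fun t => SGb (time_poly_eval t SGl hl)) Gam_finite QE.
  have -> : \int[leb]_(t in Iwin dt w) inner Gam (fun y => \sum_j bcoef P i j * sol_uG z j w t y - g i t y) (lam t) =
     \sum_j bcoef P i j * wform (sol_uG z j w) lam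
  - data_form G (g i) (wtime dt w.-1) (wtime dt w) lam.
    transitivity (\int[leb]_(t in Iwin dt w)
        inner Gam (fun x => (\sum_j bcoef P i j *: sol_uG z j w) t x - g i t x) (lam t)).
      apply: eq_Rintegral => t _; congr (inner _ _ _); apply/funext => y.
      by rewrite -sumE.
    rewrite /Iwin [LHS]Ed; congr (_ - _).
    have [V1 _] := time_form_bilin SGl SGl innerSG_bilin rm (rdeg P i) (wtime dt w.-1) (wtime dt w).
    exact: (lin_on_sum _ (bcoef P i) (time_poly_closed rm SGl) (V1 _ hl) rall).
  rewrite /FE; split=> [h|/eqP].
    by apply/eqP; rewrite subr_eq0; apply/eqP; exact: h.
  by rewrite subr_eq0 => /eqP.
have FEl : lin_on (TG i) FE.
  apply: lin_onB; first exact: W2.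
  apply: lin_onB; last exact: (data_form_lin measurable_Gam (@ag i) wtime_ge0 wtf).
  by apply: lin_on_bigsum => j; apply: lin_onZ; exact: Wj.
have E h : FE (@Mb i h) = Fres (bcoef P) exchange coordG coordF h - @flux_load i h.
  rewrite /FE /Fres /flux_load opprK opprB addrCA [RHS]addrC; congr (_ + (_ - _)).
  apply: eq_bigr => j _; congr (_ * _).
  rewrite {1}(Mb_exp (zG j)).
  have [V1 _] := time_form_bilin SGl SGl innerSG_bilin (rdeg P j) (rdeg P i) (wtime dt w.-1) (wtime dt w).
  rewrite (lin_on_basisG _ (V1 _ (MbT h))); apply: eq_bigr => h' _.
  by rewrite mulrC.
split=> [eqF h|eqF lam hl].
  apply/eqP; rewrite -subr_eq0 -E; apply/eqP; apply/FP; first exact: MbT.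
  by apply: eqF; exact: MbT.
apply/FP => //; rewrite (Mb_exp hl) (lin_on_basisG _ FEl) big1// => h _.
by rewrite E eqF subrr mulr0.
Qed.

Lemma window_coords :
  (forall i, [/\ eq_T P tauG dt z i w, eq_F P tauG dt g z i w &
     forall l, (1 <= l <= Msub P i)%N -> eq_S P dt z i w l /\ eq_V P tau dt f z i w l]) <->
  window_eqs (Msub P) q nv (ns P) (ks P) g0 thk Dk (dti P dt) stiff flux_mx (bcoef P) exchange
    a coordU coordG coordF load flux_load.
Proof.
split=> [H i|H i].
  have [hT hF hl] := H i; split.
  - by move=> l r m lM rnv; apply: (eq_V_coords lM).1 => //; have [] := hl l.+1 lM.
  - by move=> l k m lM kn; apply: (eq_S_coords lM).1 => //; have [] := hl l.+1 lM.
  - exact: (eq_T_coords i).1.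
  - exact: (eq_F_coords i).1.
have [hV hS hT hF] := H i; split.
- exact: (eq_T_coords i).2.
- exact: (eq_F_coords i).2.
- move=> [|l]// /andP[_ lM]; split.
    by apply: (eq_S_coords lM).2 => k m kn; exact: hS.
  by apply: (eq_V_coords lM).2 => r m rn; exact: hV.
Qed.

End fixed_candidate.

Lemma inner_phi_dot i (x : 'I_(D i) -> R) :
  inner (O i) (\sum_m x m *: @phi i m) (\sum_m x m *: @phi i m) = dotf x x.
Proof.
have [_ b2] := inner_bilin i.
have hS : S i (\sum_m x m *: @phi i m) by exact: lin_closed_sum.
rewrite {1}(lin_on_sum _ x (Sl i) (b2 _ hS) (@Sphi i)); apply: eq_bigr => m _.
by rewrite inner_phi.
Qed.

Lemma wform_Mb i (y : 'I_(Gd i) -> R) h : wform (\sum_h' y h' *: @Mb i h') (@Mb i h) = y h.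
Proof.
have [W1 _] := time_form_bilin SGl SGl innerSG_bilin (rdeg P i) (rdeg P i) (wtime dt w.-1) (wtime dt w).
rewrite (lin_on_basisG _ (W1 _ (MbT h))) (bigD1 h)//= Mb_on eqxx mulr1 big1 ?addr0// => h' hh.
by rewrite Mb_on (negbTE hh) mulr0.
Qed.

Lemma sum_MbT i (y : 'I_(Gd i) -> R) : TG i (\sum_h y h *: @Mb i h).
Proof. by apply: lin_closed_sum => //; exact: time_poly_closed. Qed.

Lemma wform_Mb_dot i (y : 'I_(Gd i) -> R) :
  wform (\sum_h y h *: @Mb i h) (\sum_h y h *: @Mb i h) = dotf y y.
Proof.
have [_ W2] := time_form_bilin SGl SGl innerSG_bilin (rdeg P i) (rdeg P i) (wtime dt w.-1) (wtime dt w).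
rewrite {1}(lin_on_basisG _ (W2 _ (sum_MbT y))); apply: eq_bigr => h _.
by rewrite wform_Mb.
Qed.

Lemma stiff_bound i (x y : 'I_(D i) -> R) :
  `|\sum_m \sum_m' @stiff i m' m * x m' * y m| <= Lam * nrm x * nrm y.
Proof.
have hS (c : 'I_(D i) -> R) : S i (\sum_m c m *: @phi i m) by exact: lin_closed_sum.
have := LB (hS x) (hS y).
have nE (c : 'I_(D i) -> R) :
    L2norm (@lebesgue_rV R n.+1) (O i) (\sum_m c m *: @phi i m) = nrm c.
  by rewrite /nrm -inner_phi_dot.
rewrite !nE (bilin_on_sum _ _ _ _ (Sl i) (Sl i) (Lb i) (@Sphi i) (@Sphi i)) exchange_big.
rewrite (eq_bigr (fun m => \sum_m' @stiff i m' m * x m' * y m))// => m _.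
by apply: eq_bigr => m' _; rewrite /stiff; ring.
Qed.

Let bGb := innerG_bilin.
Let bGl : lin_closed (bounded_meas G : set ('rV[R]_n -> R)).
Proof. by apply: bounded_meas_closed; exact: measurable_Gam. Qed.
Let bG0 (u : 'rV[R]_n -> R) : bounded_meas G u -> 0 <= inner G u u.
Proof. by move=> _; exact: ip_ge0. Qed.
Let bGs (u v : 'rV[R]_n -> R) : bounded_meas G u -> bounded_meas G v -> inner G u v = inner G v u.
Proof. by move=> _ _; exact: innerG_sym. Qed.

(** The origin of [del = sqrt (dt Ct)]. By Cauchy-Schwarz in space and time, the flux costs at most
    its norm over the window, and the test function [s^r v0] costs the integral of [s^(2 r)], at
    most [dt], times the squared trace norm of [v0]. *)
Lemma flux_mx_bound i l r (x : 'I_(D i) -> R) (y : 'I_(Gd i) -> R) : (l < Msub P i)%N -> (r <= q.+1)%N ->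
  `|\sum_h \sum_m @flux_mx i l r m h * x m * y h| <= Num.sqrt (dt * Ct) * nrm x * nrm y.
Proof.
move=> lM rq.
pose F : R -> 'rV[R]_n -> R := \sum_h y h *: @Mb i h.
pose v0 : 'rV[R]_n.+1 -> R := \sum_m x m *: @phi i m.
have hv0 : S i v0 by exact: lin_closed_sum.
have hF : TG i F by exact: sum_MbT.
have hv : time_poly r (S i) (\sum_m x m *: @basis_u i l r m).
  apply: lin_closed_sum; first exact: time_poly_closed.
  by move=> m; apply: time_poly_tensor => //; exact: dti_gt0.
have c0 := dti_gt0 i.
have hbu m : time_poly r (S i) (@basis_u i l r m) by exact: time_poly_tensor.
have -> : \sum_h \sum_m @flux_mx i l r m h * x m * y h =
    time_form flux_form (st i l) (st i l.+1) F (\sum_m x m *: @basis_u i l r m).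
  rewrite (bilin_on_sum _ _ _ _ (time_poly_closed (rdeg P i) SGl) (time_poly_closed r (Sl i))
    (time_form_bilin SGl (Sl i) (flux_bilin i) _ _ _ _) (@MbT i) hbu).
  by apply: eq_bigr => h _; apply: eq_bigr => m _; rewrite /flux_mx; ring.
(* The trace of the test function as a tensor over a one-element family, so that [time_form_tensor]
   computes its norm. *)
pose Wt := tensor (st i l) (dti P dt i) (fun _ : 'I_1 => trace v0) r ord0.
pose Q := maxn (rdeg P i) r.
have FQ : time_poly Q (bounded_meas G) F by apply: time_poly_mono hF => //; exact: leq_maxl.
have WQ : time_poly Q (bounded_meas G) Wt.
  by apply: time_poly_tensor => // [_|]; [exact: Tb hv0|exact: leq_maxr].
have -> : time_form flux_form (st i l) (st i l.+1) F (\sum_m x m *: @basis_u i l r m) =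
    time_form (inner G) (st i l) (st i l.+1) F Wt.
  apply: eq_Rintegral => t _; rewrite /flux_form; congr (inner _ _ _).
  rewrite fct_sumE /Wt /tensor; apply/funext => s.
  rewrite /trace/= fct_sumE.
  rewrite -[RHS]/((time_mono (st i l) (dti P dt i) r).[t] * v0 (on_interface s)).
  rewrite /v0 fct_sumE mulr_sumr; apply: eq_bigr => m _.
  by rewrite -[LHS]/(x m * ((time_mono (st i l) (dti P dt i) r).[t] * phi m (on_interface s))) mulrCA.
apply: le_trans (time_form_cauchy_schwarz bGl bGb bG0 bGs _ _ FQ WQ) _.
rewrite [leRHS]mulrC; apply: ler_pM; rewrite ?sqrtr_ge0//.
  rewrite /nrm -wform_Mb_dot ler_wsqrtr//.
  exact: (time_form_subset bGl bGb bG0 (stime_ge i l) (stime_le lM) FQ).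
rewrite /nrm -sqrtrM; last by rewrite mulr_ge0// ltW.
rewrite ler_wsqrtr// -inner_phi_dot -/v0.
have -> : time_form (inner G) (st i l) (st i l.+1) Wt Wt =
    dti P dt i * (r + r).+1%:R^-1 * inner G (trace v0) (trace v0).
  rewrite stimeS (time_form_tensor _ c0 bGl bGl bGb)// => _; exact: Tb hv0.
apply: (@le_trans _ _ (dt * inner G (trace v0) (trace v0))).
  apply: ler_wpM2r; first by apply: bG0; exact: Tb hv0.
  apply: (@le_trans _ _ (dti P dt i)).
    by rewrite ler_piMr ?(ltW c0)// invf_le1 ?ltr0n// ler1n.
  by rewrite ler_pdivrMr ?ltr0n// ler_peMr ?(ltW dt0)// ler1n.
by rewrite -mulrA; apply: ler_wpM2l; [exact: ltW|exact: trB].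
Qed.

(** A Gram matrix of two orthonormal families is a contraction. It need not be the identity, since
    the degrees [rdeg] of the two sides may differ. *)
Lemma exchange_bound i j (x : 'I_(Gd j) -> R) (y : 'I_(Gd i) -> R) :
  `|\sum_h \sum_h' @exchange i j h' h * x h' * y h| <= nrm x * nrm y.
Proof.
pose rm := (\max_(j : 'I_2) rdeg P j)%N.
have rT j' (c : 'I_(Gd j') -> R) : time_poly rm (bounded_meas G) (\sum_h c h *: @Mb j' h).
  apply: time_poly_mono (sum_MbT c); last exact: SGb.
  exact: (leq_bigmax (F := rdeg P) j').
have := time_form_cauchy_schwarz bGl bGb bG0 bGs (wtime dt w.-1) (wtime dt w) (rT j x) (rT i y).
rewrite !wform_Mb_dot.
suff -> : \sum_h \sum_h' @exchange i j h' h * x h' * y h =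
    wform (\sum_h x h *: @Mb j h) (\sum_h y h *: @Mb i h) by [].
rewrite (bilin_on_sum _ _ _ _ (time_poly_closed (rdeg P j) SGl) (time_poly_closed (rdeg P i) SGl)
    (time_form_bilin SGl SGl innerSG_bilin _ _ _ _) (@MbT j) (@MbT i)) [RHS]exchange_big/=.
by apply: eq_bigr => h _; apply: eq_bigr => h' _; rewrite /exchange; ring.
Qed.

Local Notation g0 := (fun i => (w.-1 * Msub P i)%N).

Lemma small_window i : window_const (Msub P) q nv (ns P) (ks P) Dk (bcoef P) W W'
  * (dti P dt i * Lam + Num.sqrt (dt * Ct) ^+ 2) < 1.
Proof.
have wc0 : 0 <= window_const (Msub P) q nv (ns P) (ks P) Dk (bcoef P) W W'.
  rewrite /window_const addr_ge0// !mulr_ge0// ?addr_ge0//.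
  - by apply: mulr_ge0; [do 2 (apply: sumr_ge0 => ? _)|exact: addr_ge0].
  - by rewrite !mulr_ge0//; do 2 (apply: sumr_ge0 => ? _).
  - by do 2 (apply: sumr_ge0 => ? _).
apply: le_lt_trans small; apply: ler_wpM2l => //.
rewrite sqr_sqrtr ?mulr_ge0 ?(ltW dt0)// mulrDr lerD2r; apply: ler_wpM2r => //.
by rewrite ler_pdivrMr ?ltr0n// ler_peMr ?(ltW dt0)// ler1n.
Qed.

Lemma nv_le : (nv <= q.+1)%N. Proof. exact: leq_subr. Qed.

Lemma dti_ge0 i : 0 <= dti P dt i. Proof. exact: ltW (dti_gt0 i). Qed.

Lemma window_unique z z' : window_ok z w -> window_ok z' w ->
  (forall i j, (j <= w * Msub P i)%N -> S i (sol_U z i j)) ->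
  (forall i j, (j <= w * Msub P i)%N -> S i (sol_U z' i j)) ->
  (forall i j, (j <= g0 i)%N -> sol_U z i j = sol_U z' i j) ->
  forall i, [/\ sol_uG z i w = sol_uG z' i w, sol_F z i w = sol_F z' i w,
    forall l, (1 <= l <= Msub P i)%N -> sol_u z i w l = sol_u z' i w l &
    forall j, (j <= w * Msub P i)%N -> sol_U z i j = sol_U z' i j].
Proof.
move=> ok ok' zU zU' UU.
have coords (y : dgit_fun R n) : window_ok y w -> exists a : forall i, nat -> nat -> 'I_(D i) -> R,
    forall i l, (l < Msub P i)%N ->
      sol_u y i w l.+1 = \sum_(j < q.+1) \sum_m @a i l j m *: @basis_u i l j m.
  move=> oky.
  have : forall i, exists a : nat -> nat -> 'I_(D i) -> R, forall l, (l < Msub P i)%N ->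
      sol_u y i w l.+1 = \sum_(j < q.+1) \sum_m a l j m *: @basis_u i l j m.
    move=> i; have [_ _ _ _ hl] := oky i.
    have : forall l, exists a : nat -> 'I_(D i) -> R, (l < Msub P i)%N ->
        sol_u y i w l.+1 = \sum_(j < q.+1) \sum_m a j m *: @basis_u i l j m.
      move=> l; have [lM|lM] := ltnP l (Msub P i); last by exists (fun _ _ => 0).
      have [hu _ _ _] := hl l.+1 lM.
      have [a aE] := time_poly_coords (st i l) (dti_gt0 i) (@phi_exp i) hu.
      by exists a.
    by move=> /choice[a aP]; exists a => l lM; exact: aP.
  move=> aP; exists (fun i => sval (cid (aP i))) => i.
  exact: svalP (cid (aP i)).
have [a aE] := coords z ok; have [a' aE'] := coords z' ok'.
have zG y i : window_ok y w -> TG i (sol_uG y i w) by move=> /(_ i)[].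
have zF y i : window_ok y w -> TG i (sol_F y i w) by move=> /(_ i)[].
have eqs y : window_ok y w -> forall i, [/\ eq_T P tauG dt y i w, eq_F P tauG dt g y i w &
     forall l, (1 <= l <= Msub P i)%N -> eq_S P dt y i w l /\ eq_V P tau dt f y i w l].
  by move=> oky i; have [_ _ hT hF hl] := oky i; split => // l /hl[].
have E := (window_coords zU (fun i => zG z i ok) (fun i => zF z i ok) aE).1 (eqs z ok).
have E' := (window_coords zU' (fun i => zG z' i ok') (fun i => zF z' i ok') aE').1 (eqs z' ok').
have := window_homogeneous HW stiff_bound flux_mx_bound exchange_bound nv_le dti_ge0 Lam0
  (sqrtr_ge0 _) small_window (window_eqs_sub E E').
case; first by move=> i j m jg; rewrite /coordU UU// subrr.
move=> hu hU hp hF i; split.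
- rewrite (Mb_exp (zG z i ok)) (Mb_exp (zG z' i ok')); apply: eq_bigr => h _.
  exact: (congr1 (fun c => c *: @Mb i h) (subr0_eq (hp i h))).
- rewrite (Mb_exp (zF z i ok)) (Mb_exp (zF z' i ok')); apply: eq_bigr => h _.
  exact: (congr1 (fun c => c *: @Mb i h) (subr0_eq (hF i h))).
- move=> [|l]// /andP[_ lM]; rewrite aE// aE'//; apply: eq_bigr => j _.
  apply: eq_bigr => m _; congr (_ *: _); apply/eqP; rewrite -subr_eq0; apply/eqP.
  by apply: hu => //; rewrite -ltnS.
- move=> j jw; rewrite (phi_exp (zU i j jw)) (phi_exp (zU' i j jw)).
  apply: eq_bigr => m _; congr (_ *: _); apply/eqP; rewrite -subr_eq0; apply/eqP.
  by apply: hU; rewrite addnC -mulSn prednK.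
Qed.

(** Only window [w] of the result is meaningful, together with the side values up to its end. *)
Lemma window_extend z : (forall i j, (j <= g0 i)%N -> S i (sol_U z i j)) ->
  exists z', [/\ window_ok z' w, forall i j, (j <= g0 i)%N -> sol_U z' i j = sol_U z i j &
    forall i j, S i (sol_U z' i j)].
Proof.
move=> zU.
have [u [U [p [F [E HU]]]]] := window_exists g0 HW stiff_bound flux_mx_bound exchange_bound
  nv_le dti_ge0 Lam0 (sqrtr_ge0 _) small_window (subnK hns)
  (fun i j m => inner (O i) (sol_U z i j) (@phi i m)) load flux_load.
(* Substeps are numbered from 1 here and from 0 in [window_eqs], whence [l.-1]. The window index is
   ignored; the windows are glued in [existence]. *)
pose z' := DGiTFun (fun i w' l => \sum_(j < q.+1) \sum_m @u i l.-1 j m *: @basis_u i l.-1 j m)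
  (fun i j => \sum_m @U i j m *: @phi i m)
  (fun i w' => \sum_h @p i h *: @Mb i h) (fun i w' => \sum_h @F i h *: @Mb i h).
have zU' i j : S i (sol_U z' i j) by exact: lin_closed_sum.
have zG' i : TG i (sol_uG z' i w) by exact: sum_MbT.
have zF' i : TG i (sol_F z' i w) by exact: sum_MbT.
have zu' i l : (l < Msub P i)%N -> sol_u z' i w l.+1 = \sum_(j < q.+1) \sum_m @u i l j m *: @basis_u i l j m.
  by [].
have cU : coordU z' = U.
  by apply/functional_extensionality_dep => i; apply/funext => j; apply/funext => m; exact: inner_phi.
have cG : coordG z' = p.
  by apply/functional_extensionality_dep => i; apply/funext => h; exact: wform_Mb.
have cF : coordF z' = F.
  by apply/functional_extensionality_dep => i; apply/funext => h; exact: wform_Mb.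
have := (window_coords (fun i j _ => zU' i j) zG' zF' zu').2; rewrite cU cG cF => /(_ E) hE.
exists z'; split; last exact: zU'.
- move=> i; have [hT hF hl] := hE i.
  split; [exact: zG'|exact: zF'|exact: hT|exact: hF|move=> l lM].
  have [hS hV] := hl l lM; split; [|exact: zU'|exact: hS|exact: hV].
  by apply: time_poly_of_coords; [exact: Sl|exact: Sphi].
- move=> i j jg; rewrite (phi_exp (zU i j jg)); apply: eq_bigr => m _.
  by rewrite HU.
Qed.

End one_window.

(** * Induction over the coupling windows *)

Context (NG : nat) (evG : ('rV[R]_n -> R) -> 'I_NG -> R)
  (evGl : forall k, lin_on SG (evG ^~ k))
  (evG0 : forall u, SG u -> (forall k, evG u k = 0) -> u = 0)
  (pdG : forall u, SG u -> inner G u u = 0 -> u = 0).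

Lemma window_basis w : (0 < w)%N -> exists (Gd : 'I_2 -> nat)
    (Mb : forall i, 'I_(Gd i) -> R -> 'rV[R]_n -> R),
  [/\ forall i g, time_poly (rdeg P i) SG (@Mb i g),
      forall i g g', time_form (inner G) (wtime dt w.-1) (wtime dt w) (@Mb i g) (@Mb i g') = (g == g')%:R &
      forall i v, time_poly (rdeg P i) SG v ->
        v = \sum_g time_form (inner G) (wtime dt w.-1) (wtime dt w) v (@Mb i g) *: @Mb i g].
Proof.
move=> w0.
have wlt : wtime dt w.-1 < wtime dt w by rewrite (wtime_pred w0) ltrDl.
have H i := time_poly_basis SGl innerSG_bilin (fun u hu => ip_ge0 _ _ u)
  (fun u v _ _ => innerG_sym u v) pdG evGl evG0 (rdeg P i) wlt.
exists (fun i => sval (cid (H i))), (fun i => sval (cid (svalP (cid (H i))))).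
by split=> i; case: (svalP (cid (svalP (cid (H i))))).
Qed.

Lemma step_unique w z z' : (0 < w)%N -> wtime dt w <= tf ->
  window_ok z w -> window_ok z' w ->
  (forall i j, (j <= w * Msub P i)%N -> S i (sol_U z i j)) ->
  (forall i j, (j <= w * Msub P i)%N -> S i (sol_U z' i j)) ->
  (forall i j, (j <= w.-1 * Msub P i)%N -> sol_U z i j = sol_U z' i j) ->
  forall i, [/\ sol_uG z i w = sol_uG z' i w, sol_F z i w = sol_F z' i w,
    forall l, (1 <= l <= Msub P i)%N -> sol_u z i w l = sol_u z' i w l &
    forall j, (j <= w * Msub P i)%N -> sol_U z i j = sol_U z' i j].
Proof.
move=> w0 wtf; have [Gd [Mb [MbT Mb_on Mb_exp]]] := window_basis w0.
exact: (window_unique w0 wtf MbT Mb_on Mb_exp).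
Qed.

Lemma step_extend w z : (0 < w)%N -> wtime dt w <= tf ->
  (forall i j, (j <= w.-1 * Msub P i)%N -> S i (sol_U z i j)) ->
  exists z', [/\ window_ok z' w,
    forall i j, (j <= w.-1 * Msub P i)%N -> sol_U z' i j = sol_U z i j &
    forall i j, S i (sol_U z' i j)].
Proof.
move=> w0 wtf; have [Gd [Mb [MbT Mb_on Mb_exp]]] := window_basis w0.
exact: (window_extend w0 wtf MbT Mb_on Mb_exp).
Qed.

(** The equations of a window see only its own unknowns and the side values up to its end, so that
    solutions of different windows can be glued. *)
Lemma window_ok_congr z z' w : (0 < w)%N ->
  (forall i, sol_uG z i w = sol_uG z' i w) -> (forall i, sol_F z i w = sol_F z' i w) ->
  (forall i l, (1 <= l <= Msub P i)%N -> sol_u z i w l = sol_u z' i w l) ->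
  (forall i j, (j <= w * Msub P i)%N -> sol_U z i j = sol_U z' i j) ->
  window_ok z w -> window_ok z' w.
Proof.
move=> w0 eG eF eu eU ok i; have [hG hF hT hFl hl] := ok i; split.
- by rewrite -eG.
- by rewrite -eF.
- move=> lam hlam; rewrite -eG (hT lam hlam); apply: eq_big_nat => l lM.
  by rewrite (eu i l lM).
- move=> lam hlam; rewrite -eF (hFl lam hlam).
  apply: eq_Rintegral => t _; congr (inner _ _ _); apply/funext => y.
  by congr (_ - _); apply: eq_bigr => j _; rewrite (eG j).
- move=> l lM; have [hu hU hS hV] := hl l lM.
  have /andP[l1 l2] := lM.
  have lg : (gidx P i w l <= w * Msub P i)%N by exact: gidx_le.
  have lg' : (gidx P i w l.-1 <= w * Msub P i)%N.
    by apply: gidx_le => //; exact: leq_trans (leq_pred _) l2.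
  split.
  + by rewrite -(eu i l lM).
  + by rewrite -(eU i _ lg).
  + move=> k x; rewrite -(eu i l lM) hS; apply: eq_bigr => c _.
    by rewrite (eU i _ (leq_trans (leq_subr _ _) lg)).
  + move=> v hv; have := hV v hv.
    by rewrite (eu i l lM) (eU i _ lg) (eU i _ lg') eF; exact.
Qed.

Context (N N0 : nat) (Uinit : 'I_2 -> nat -> 'rV[R]_n.+1 -> R) (N01 : (1 <= N0)%N).
Context (wN : forall w, (w <= N)%N -> wtime dt w <= tf).
Context (Ui : forall i j, (j <= N0.-1 * Msub P i)%N -> S i (Uinit i j)).

Lemma dgit_solutionE z : dgit_solution P tau tauG dt N0 N f g Uinit z <->
  (forall i j, (j <= N0.-1 * Msub P i)%N -> sol_U z i j = Uinit i j) /\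
  forall w, (N0 <= w <= N)%N -> window_ok z w.
Proof.
split=> -[h1 h2]; split; try exact: h1.
  by move=> w wN' i; exact: h2.
by move=> w i wN'; exact: h2.
Qed.

Lemma gidx_surj i w j : (0 < w)%N -> (w.-1 * Msub P i < j <= w * Msub P i)%N ->
  exists2 l, (1 <= l <= Msub P i)%N & j = gidx P i w l.
Proof.
move=> w0 /andP[h1 h2]; exists (j - w.-1 * Msub P i)%N; last by rewrite /gidx subnKC// ltnW.
by rewrite subn_gt0 h1/= leq_subLR addnC -mulSn prednK.
Qed.

Lemma solution_side_values z : dgit_solution P tau tauG dt N0 N f g Uinit z ->
  forall w, (N0.-1 <= w)%N -> (w <= N)%N -> forall i j, (j <= w * Msub P i)%N -> S i (sol_U z i j).
Proof.
move=> /dgit_solutionE[hi hw]; elim=> [|w IH] Nw wN' i j jw.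
  have N0E : N0.-1 = 0%N by apply/eqP; rewrite -leqn0.
  by rewrite hi ?N0E//; apply: Ui; rewrite N0E.
have [jw'|jw'] := leqP j (w * Msub P i).
  have [Nw'|Nw'] := leqP N0.-1 w; first by apply: IH => //; exact: ltnW.
  have E : N0.-1 = w.+1 by apply/eqP; rewrite eqn_leq Nw Nw'.
  by rewrite hi ?E//; apply: Ui; rewrite E.
have [Nw'|Nw'] := leqP N0 w.+1; last first.
  have E : N0.-1 = w.+1 by apply/eqP; rewrite eqn_leq Nw/= -ltnS prednK.
  by rewrite hi ?E//; apply: Ui; rewrite E.
have [|l lM ->] := @gidx_surj i w.+1 j isT; first by rewrite jw' jw.
have := hw w.+1; rewrite Nw' wN' => /(_ isT i)[_ _ _ _ /(_ l lM)].
by case.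
Qed.

Lemma uniqueness z z' : dgit_solution P tau tauG dt N0 N f g Uinit z ->
  dgit_solution P tau tauG dt N0 N f g Uinit z' -> same_solution P N0 N z z'.
Proof.
move=> hz hz'; have [hi hw] := (dgit_solutionE z).1 hz.
have [hi' hw'] := (dgit_solutionE z').1 hz'.
have main : forall w, (N0.-1 <= w)%N -> (w <= N)%N ->
    forall i j, (j <= w * Msub P i)%N -> sol_U z i j = sol_U z' i j.
  elim=> [|w IH] Nw wN' i j jw.
    have N0E : N0.-1 = 0%N by apply/eqP; rewrite -leqn0.
    by rewrite hi ?hi' ?N0E.
  have [Nw'|Nw'] := leqP N0 w.+1; last first.
    have E : N0.-1 = w.+1 by apply/eqP; rewrite eqn_leq Nw/= -ltnS prednK.
    by rewrite hi ?hi' ?E.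
  have Nw0 : (N0.-1 <= w)%N by rewrite -ltnS prednK.
  have ww : (N0 <= w.+1 <= N)%N by rewrite Nw' wN'.
  have [_ _ _] := @step_unique w.+1 z z' isT (wN wN') (hw _ ww) (hw' _ ww)
    (solution_side_values hz Nw wN') (solution_side_values hz' Nw wN') (IH Nw0 (ltnW wN')) i.
  exact.
move=> w i ww; have /andP[Nw wN'] := ww.
have w0 : (0 < w)%N by exact: leq_trans N01 Nw.
have Nw1 : (N0.-1 <= w)%N by exact: leq_trans (leq_pred _) Nw.
have Nw0 : (N0.-1 <= w.-1)%N by rewrite -ltnS !prednK.
have [e1 e2 e3 e4] := @step_unique w z z' w0 (wN wN') (hw _ ww) (hw' _ ww)
    (solution_side_values hz Nw1 wN') (solution_side_values hz' Nw1 wN')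
    (main _ Nw0 (leq_trans (leq_pred _) wN')) i.
split => // l lM; split; first exact: e3.
by apply: e4; apply: gidx_le => //; have /andP[] := lM.
Qed.

Lemma existence : exists z, dgit_solution P tau tauG dt N0 N f g Uinit z.
Proof.
(* The maximum covers the case [N < N0], where there is no window to solve. *)
suff main : forall k, (N0.-1 + k <= maxn N N0.-1)%N -> exists z : dgit_fun R n,
    [/\ forall i j, (j <= N0.-1 * Msub P i)%N -> sol_U z i j = Uinit i j,
        forall i j, (j <= (N0.-1 + k) * Msub P i)%N -> S i (sol_U z i j) &
        forall w, (N0 <= w <= N0.-1 + k)%N -> window_ok z w].
  have [|z [h1 h2 h3]] := main (maxn N N0.-1 - N0.-1)%N; first by rewrite subnKC// leq_maxr.
  exists z; apply/dgit_solutionE; split => // w /andP[Nw wN'].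
  by apply: h3; rewrite Nw subnKC ?leq_maxr//= leq_max wN'.
elim=> [|k IH] kN.
  exists (DGiTFun (fun _ _ _ _ _ => 0) Uinit (fun _ _ _ _ => 0) (fun _ _ _ _ => 0)).
  split=> //=; first by move=> i j; rewrite addn0; exact: Ui.
  by move=> w /andP[h1 h2]; have := leq_trans h1 h2; rewrite addn0 leqNgt prednK// leqnn.
have [|z [h1 h2 h3]] := IH; first by apply: leq_trans kN; rewrite leq_add2l.
pose w := (N0.-1 + k).+1.
have wE : (N0.-1 + k.+1)%N = w by rewrite addnS.
have wN' : (w <= N)%N.
  move: kN; rewrite wE leq_max => /orP[//|].
  by rewrite /w leqNgt ltnS leq_addr.
have [z1 [ok1 e1 s1]] := @step_extend w z isT (wN wN') h2.
(* The side values can be taken from [z1] throughout, as they agree with those of [z] up to the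
   start of window [w]. *)
pose z2 := DGiTFun (fun i w' => if (w' < w)%N then sol_u z i w' else sol_u z1 i w') (sol_U z1)
  (fun i w' => if (w' < w)%N then sol_uG z i w' else sol_uG z1 i w')
  (fun i w' => if (w' < w)%N then sol_F z i w' else sol_F z1 i w').
exists z2; split.
- move=> i j jN; rewrite -(h1 i j jN); apply: e1; apply: leq_trans jN _.
  by rewrite leq_mul2r leq_addr orbT.
- by move=> i j _; exact: s1.
- move=> w' /andP[Nw w'w]; have w'0 : (0 < w')%N by exact: leq_trans N01 Nw.
  move: w'w; rewrite wE leq_eqVlt => /orP[/eqP ->|w'w].
    apply: (@window_ok_congr z1 z2 w isT _ _ _ _ ok1);
      [move=> i|move=> i|move=> i l _|by []]; by rewrite /= ltnn.
  have okz : window_ok z w' by apply: h3; rewrite Nw -ltnS.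
  apply: (@window_ok_congr z z2 w' w'0 _ _ _ _ okz);
    [move=> i|move=> i|move=> i l _|move=> i j jw]; rewrite /= ?w'w//.
  apply/esym/e1; apply: leq_trans jw _; rewrite leq_mul2r; apply/orP; right.
  by rewrite -ltnS.
Qed.

Lemma well_posed : uniquely_solvable P tau tauG dt N0 N f g Uinit.
Proof.
have [z hz] := existence; exists z; split => // z' hz'; exact: uniqueness.
Qed.

End coupled.

(** * Bounded coefficients, spatial bases and the choice of the constant *)

Lemma W1inf_bounded_versions (R : realType) d (A : set 'rV[R]_d) (s : 'rV[R]_d -> 'rV[R]_d) :
  measurable A -> (forall j, W1inf A (fun x => s x ord0 j)) ->
  exists (gs ss : 'I_d -> 'rV[R]_d -> R) (B : R),
  [/\ forall j, bounded_meas A (gs j) /\ bounded_meas A (ss j), 0 <= B,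
    forall j x, A x -> `|gs j x| <= B /\ `|ss j x| <= B,
    forall j, exists N, [/\ measurable N, lebesgue_rV d N = 0%E &
      forall x, A x -> ~ N x -> wpd A j (fun y => s y ord0 j) x = gs j x] &
    forall j, exists N, [/\ measurable N, lebesgue_rV d N = 0%E &
      forall x, A x -> ~ N x -> s x ord0 j = ss j x]].
Proof.
move=> mA W.
have Lw j : Linf A (wpd A j (fun y => s y ord0 j)).
  have [_ /(_ j)[g0 g0P]] := W j.
  by have [] := @xgetPex _ (fun=> 0) [set g | Linf A g /\ weak_partial A j (fun y => s y ord0 j) g]
    (ex_intro _ g0 g0P).
have Ls j : Linf A (fun x => s x ord0 j) by case: (W j).
have /choice[gs] := fun j => Linf_bounded_version mA (Lw j).
move=> /choice[Ng] /choice[Bg] hg.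
have /choice[ss] := fun j => Linf_bounded_version mA (Ls j).
move=> /choice[Ns] /choice[Bs] hs.
exists gs, ss, (\sum_j (Bg j + Bs j)).
have Bg0 j : 0 <= Bg j by case: (hg j).
have Bs0 j : 0 <= Bs j by case: (hs j).
have B_ge j : Bg j + Bs j <= \sum_j (Bg j + Bs j).
  by rewrite [leRHS](bigD1 j)//= lerDl sumr_ge0// => l _; exact: addr_ge0.
split.
- by move=> j; have [] := hg j; have [] := hs j.
- by apply: sumr_ge0 => j _; exact: addr_ge0.
- move=> j x Ax; have [_ _ _ _ [g1 _]] := hg j; have [_ _ _ _ [s1 _]] := hs j.
  split; [apply: le_trans (g1 x Ax) _|apply: le_trans (s1 x Ax) _]; apply: le_trans (B_ge j);
    by rewrite ?lerDl ?lerDr.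
- by move=> j; exists (Ng j); have [_ mN N0 _ [_ gE]] := hg j.
- by move=> j; exists (Ns j); have [_ mN N0 _ [_ sE]] := hs j.
Qed.

Lemma fe_orthonormal_basis (R : realType) m (k : nat) (tau : @mesh R m) (Z : set 'rV[R]_m)
    (b : ('rV[R]_m -> R) -> ('rV[R]_m -> R) -> R) :
  lin_closed (fe_space k tau Z) -> bilin_on (fe_space k tau Z) (fe_space k tau Z) b ->
  (forall u v, b u v = b v u) -> (forall u, 0 <= b u u) ->
  (forall u, fe_space k tau Z u -> b u u = 0 -> u = 0) ->
  exists D (e : 'I_D -> 'rV[R]_m -> R), [/\ forall i, fe_space k tau Z (e i),
    forall i i', b (e i) (e i') = (i == i')%:R &
    forall v, fe_space k tau Z v -> v = \sum_i b v (e i) *: e i].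
Proof.
move=> [S0 Sl] [b1 b2] bs b0 bp.
apply: (@orthonormal_basis _ _ (fe_space k tau Z) b _ (@node_values R m k tau)) => //.
- by move=> a u v w hu hv hw; exact: b1.
- by move=> u hu un; rewrite lt_def b0 andbT; apply: contraNneq un => /(bp u hu) ->.
- exact: node_values_eq0.
Qed.

Theorem theorem3 (R : realType) (n : nat) (hd : (n.+1 = 2 \/ n.+1 = 3)%N)
    (P : dgit_params R n) (tf sigma : R) (L1 L2 : 'I_2 -> R)
    (psi : nat -> {poly R})
    (htf : 0 < tf)
    (hnu : forall i, 0 < nu P i)
    (hadv_cont : forall i, {within closure (Omega i), continuous (adv P i)})
    (hadv_normal : forall i x e, bdry (Omega i) x ->
       outward_normal (Omega i) x e -> dot e (adv P i x) = 0)
    (hadv_W1inf : forall i j, W1inf (Omega i) (fun x => adv P i x ord0 j))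
    (hk : (1 <= kdeg P)%N)
    (hns : (ns P <= (qdeg P).+1)%N)
    (htheta_lt : forall j k : 'I_(ns P), (j < k)%N -> theta P j < theta P k)
    (htheta_le1 : forall j, theta P j <= 1)
    (hM : forall i, (0 < Msub P i)%N)
    (hpsi : orthogonal_basis (qdeg P) psi)
    (hDt : (0 < ns P)%N -> Dtilde (qdeg P) psi (theta P) \in unitmx)
    (hL : forall i, 0 < L1 i /\ 0 < L2 i) :
  exists2 C : R, 0 < C &
  forall (tau : 'I_2 -> @mesh R n.+1) (tauG : @mesh R n),
    (forall i, conforming_mesh (closure (Omega i)) (tau i)) ->
    conforming_mesh (closure Gam) tauG ->
    (forall i, induces (tau i) tauG) ->
    (forall i, regular_mesh sigma (tau i)) ->
    (forall i v, U_space (kdeg P) (tau i) i v ->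
       L1 i * H1normsq (Omega i) v
         <= Lform (nu P i) (Omega i) (adv P i) v v
         <= L2 i * H1normsq (Omega i) v) ->
  forall (N N0 : nat) (f : 'I_2 -> R -> 'rV[R]_n.+1 -> R)
    (g : 'I_2 -> R -> 'rV[R]_n -> R) (Uinit : 'I_2 -> nat -> 'rV[R]_n.+1 -> R),
    (1 <= N)%N -> (1 <= N0)%N ->
    ((0 < ns P)%N -> forall i, (ks P <= N0.-1 * Msub P i + 1)%N) ->
    (forall i, admissible_data (Omega i) tf (U_space (kdeg P) (tau i) i) (f i)) ->
    (forall i, admissible_data Gam tf (UG_space (kdeg P) tauG) (g i)) ->
    (forall i j, (j <= N0.-1 * Msub P i)%N ->
       U_space (kdeg P) (tau i) i (Uinit i j)) ->
  let dt := tf / N%:R in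
  let h := Num.max (meshsize (tau ord0)) (meshsize (tau ord_max)) in
  dt * (h ^- 2 + h ^- 1) <= C ->
  uniquely_solvable P tau tauG dt N0 N f g Uinit.
Proof.
have hd' : (n.+1 == 2) || (n.+1 == 3) by case: hd => ->.
have [W [W' HW]] := time_inverse hns hpsi hDt.
have /choice[gs] := fun i => W1inf_bounded_versions (measurable_Omega i) (hadv_W1inf i).
move=> /choice[ss] /choice[B] hB.
pose e := @expansion R n sigma.
(* [n + 1] is the bound [meshsize_le]. The powers of [e] in [X] pay for replacing the mesh parameter
   of each side by [h], since [e h] is at most either of them. *)
pose LC := \sum_i `|@Lform_const R n (kdeg P) sigma (nu P i) (B i) n.+1%:R|.
pose TC := `|@trace_const R n (kdeg P) sigma|.
pose X := LC * e ^- 2 + TC * e^-1.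
pose wc := window_const (Msub P) (qdeg P) ((qdeg P).+1 - ns P) (ns P) (ks P) (Dk P) (bcoef P) W W'.
have den : 0 < 1 + `|wc| * `|X| by apply: ltr_pwDl => //; exact: mulr_ge0.
(* This makes [wc * dt * (Lam + Ct)] less than 1. Absolute values are taken because the constant is
   chosen before any mesh is given, and the sign of [sigma] is only known from a mesh. *)
exists (1 + `|wc| * `|X|)^-1; first by rewrite invr_gt0.
move=> tau tauG conf confG ind reg _ N N0 f g Uinit N1 N01 _ af ag Ui dt h dth.
have Kn i := @cell_exists R n tau conf i.
have e0 : 0 < e := expansion_gt0 hd' (conf_cover conf ord0) (@reg ord0) (Kn ord0).
have hi0 i : 0 < meshsize (tau i) := meshsize_gt0 (conf_cover conf i) (Kn i).
have eh i : e * h <= meshsize (tau i).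
  have c j : e * meshsize (tau j) <= meshsize (tau i).
    exact: (meshsize_comparable hd' conf confG ind reg).
  by rewrite /h; case: (leP (meshsize (tau ord0)) (meshsize (tau ord_max))) => _; exact: c.
have h0 : 0 < h by rewrite lt_max hi0.
have eh0 : 0 < e * h by exact: mulr_gt0.
have dt0 : 0 < dt by rewrite divr_gt0// ltr0n.
have cc i := @closed_cover R n tau conf i.
have OD i : Omega i `<=` \bigcup_K carrier (tau i K).
  by rewrite -(cover_Omega conf); exact: subset_closure.
have Ob i (x : 'rV[R]_n.+1) (r : R) := @ball_sub_cover R n tau conf i x r.
have Sl i : lin_closed (U_space (kdeg P) (tau i) i) by exact: fe_closed.
have SGl : lin_closed (UG_space (kdeg P) tauG).
  by split; [exact: fe_space0|move=> a u v hu hv; exact: fe_space_lin].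
have Sb i : U_space (kdeg P) (tau i) i `<=` bounded_meas (Omega i).
  by move=> v hv; exact: fe_bounded_meas (cc i) hv.
have SGb : UG_space (kdeg P) tauG `<=` bounded_meas Gam.
  by move=> v hv; exact: fe_bounded_meas (closed_cover_Gam confG) hv.
have Tb i v : U_space (kdeg P) (tau i) i v -> bounded_meas Gam (trace v).
  move=> hv; split.
    by apply: measurable_funTS; apply: measurable_trace; exact: fe_measurable (cc i) hv.
  by have [b vb] := fe_bounded hv; exists b => x _; exact: vb.
have Lb i : bilin_on (U_space (kdeg P) (tau i) i) (U_space (kdeg P) (tau i) i)
    (Lform (nu P i) (Omega i) (adv P i)).
  have [bb _ _ gE sE] := hB i.
  exact: (Lform_bilin hd' _ _ (conf_cover conf i) (@reg i) (cc i) (Kn i) (measurable_Omega i)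
    (Omega_finite i) (@OD i) _ (fun j => (bb j).1) (fun j => (bb j).2) gE sE).
have [b1 b2] : (forall i, bilin_on (U_space (kdeg P) (tau i) i) (U_space (kdeg P) (tau i) i)
    (inner (Omega i))) /\ True.
  by split => // i; exact: (inner_bilin Sb).
have /(_ _)/cid-/all_sig[D /(_ _)/cid-/all_sig[phi hphi]] : forall i, exists D
    (phi : 'I_D -> 'rV[R]_n.+1 -> R),
    [/\ forall m, U_space (kdeg P) (tau i) i (phi m),
     forall m m', inner (Omega i) (phi m) (phi m') = (m == m')%:R &
     forall v, U_space (kdeg P) (tau i) i v -> v = \sum_m inner (Omega i) v (phi m) *: phi m].
  move=> i; apply: (fe_orthonormal_basis (Sl i) (b1 i)).
  - by move=> u v; exact: ip_sym.
  - by move=> u; exact: ip_ge0.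
  - exact: (ip_eq0 hd' (conf_cover conf i) (@reg i) (cc i) (Kn i) (measurable_Omega i)
      (Omega_finite i) (@Ob i)).
pose Lam := LC * (e * h) ^- 2; pose Ct := TC * (e * h)^-1.
have LC0 : 0 <= LC by exact: sumr_ge0.
have Lam0 : 0 <= Lam by rewrite divr_ge0// exprn_ge0// ltW.
have Ct0 : 0 <= Ct by rewrite /Ct /TC divr_ge0// ltW.
have hinv i : (meshsize (tau i))^-1 <= (e * h)^-1 by rewrite lef_pV2 ?posrE.
apply: (well_posed dt0 hM Sl SGl Sb SGb Tb Lb af ag (D := D) (phi := phi) _ _ _ hns HW Lam0 Ct0
  _ _ _ (NG := _) (evG := @node_values R n (kdeg P) tauG) _ _ _ N01 _ Ui).
- by move=> i; case: (hphi i).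
- by move=> i; case: (hphi i).
- by move=> i; case: (hphi i).
- move=> i v v' hv hv'; have [bb B0 gsB gE sE] := hB i.
  have := Lform_le hd' (conf_cover conf i) (@reg i) (cc i) (Kn i) (measurable_Omega i)
    (Omega_finite i) (@OD i) (@Ob i) (nu P i) (fun j => (bb j).1) (fun j => (bb j).2) B0
    (fun j x Ax => (gsB j x Ax).1) (fun j x Ax => (gsB j x Ax).2) gE sE (meshsize_le conf i) hv hv'.
  move=> /le_trans; apply; apply: ler_wpM2r; first exact: L2_ge0.
  apply: ler_wpM2r; first exact: L2_ge0.
  rewrite /Lam -!exprVn; apply: (@le_trans _ _ (LC * (meshsize (tau i))^-1 ^+ 2)).
    apply: ler_wpM2r; first by rewrite exprn_ge0// invr_ge0 ltW.
    apply: le_trans (ler_norm _) _; rewrite /LC (bigD1 i)//= lerDl.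
    by apply: sumr_ge0 => ? _.
  apply: ler_wpM2l => //; apply: lerXn2r; rewrite ?nnegrE ?hinv//.
    by rewrite invr_ge0 ltW.
  by rewrite invr_ge0 ltW.
- move=> i v hv.
  have := trace_inverse hd' (conf_cover conf i) (@reg i) (cc i) (Kn i) (measurable_Omega i)
    (Omega_finite i) (@Ob i) measurable_Gam Gam_finite (Tb i v hv) hv.
  move=> /le_trans; apply; apply: ler_wpM2r; first exact: ip_ge0.
  rewrite /Ct expr1; apply: (@le_trans _ _ (TC * (meshsize (tau i))^-1)).
    by apply: ler_wpM2r; [rewrite invr_ge0 ltW|exact: ler_norm].
  by apply: ler_wpM2l; [exact: normr_ge0|exact: hinv].
- rewrite -/wc; have u0 : 0 <= h ^- 2 by rewrite invr_ge0 exprn_ge0// ltW.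
  have v0 : 0 <= h ^- 1 by rewrite invr_ge0 ltW.
  have a0 : 0 <= LC * e ^- 2 by rewrite mulr_ge0// invr_ge0 exprn_ge0// ltW.
  have c0 : 0 <= TC * e^-1 by rewrite mulr_ge0 ?normr_ge0// invr_ge0 ltW.
  have LCt : Lam + Ct <= `|X| * (h ^- 2 + h ^- 1).
    have -> : Lam + Ct = LC * e ^- 2 * h ^- 2 + TC * e^-1 * h ^- 1.
      by rewrite /Lam /Ct exprMn !invfM !mulrA.
    rewrite ger0_norm; last exact: addr_ge0.
    rewrite /X mulrDl; apply: lerD; apply: ler_wpM2l => //; by rewrite ?lerDl ?lerDr.
  apply: (@le_lt_trans _ _ (`|wc| * `|X| * (1 + `|wc| * `|X|)^-1)).
    apply: (@le_trans _ _ (`|wc| * (dt * (Lam + Ct)))).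
      by apply: ler_wpM2r; [rewrite mulr_ge0 ?addr_ge0// ltW|exact: ler_norm].
    rewrite -mulrA; apply: ler_wpM2l => //.
    apply: (@le_trans _ _ (`|X| * (dt * (h ^- 2 + h ^- 1)))).
      by rewrite mulrCA; apply: ler_wpM2l => //; exact: ltW.
    exact: ler_wpM2l.
  by rewrite ltr_pdivrMr// mul1r ltrDr.
- by move=> j a u v _ _.
- exact: node_values_eq0.
- by move=> u hu; apply: (UG_ip_eq0 (cover_Gam confG) hu).
- move=> w wN; rewrite /wtime /dt mulrA ler_pdivrMr ?ltr0n// mulrC.
  by rewrite ler_wpM2l ?ler_nat// ltW.
Qed.
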